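(* Let $n\ge3$. Suppose that $(M^n,g,V)$ is a static Einstein vacuum, that $(M^n,g)$ is a (conformally compact) asymptotically hyperbolic manifold with conformal infinity $(N^{n-1},[\hat g])$, and that $\tau$ is the special defining function associated with a metric $\hat g\in[\hat g]$. Assume also that $V$ is with the growth of $\frac1\tau$ near conformal infinity (that is, $\tau V|_{\tau=0}=1$), and that $g$ is sufficiently regular at infinity. If $g=\tau^{-2}(d\tau^2+g_\tau)$ near conformal infinity, then $$g_\tau=\hat g+g^{(2)}\tau^2+(\text{even powers of }\tau)+g^{(2l)}\tau^{2l}+\cdots,$$ $$V=\frac1\tau+V^{(1)}\tau+(\text{odd powers of }\tau)+V^{(2l-1)}\tau^{2l-1}+\cdots,$$ where $g^{(2l)}$ and $V^{(2l-1)}$ are uniquely determined by $\hat g$ for $2l\le n-1$. (The parity assertion concerns the terms of $g_\tau$ up to order $\tau^{n-1}$ and the terms of $V$ up to order $\tau^{n-2}$.)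
   Context: Static Einstein vacuum: a Riemannian manifold $(M^n,g)$ with a positive function $V$ satisfying $Ric(g)+ng=V^{-1}\nabla_g^2V$ and $\Delta_gV=nV$. Asymptotically hyperbolic: $(M,g)$ is complete noncompact with $\|Rm-\mathbf K\|_g\le Ce^{-b\rho}$ for some $b>0$, where $\mathbf K_{ijkl}=-(g_{ik}g_{jl}-g_{il}g_{jk})$ and $\rho$ is the distance to a fixed point. Conformally compact: $M$ is the interior of a compact manifold $\bar M$ with boundary $N^{n-1}$ and $\tau^2g$ extends to a Riemannian metric on $\bar M$ for a smooth defining function $\tau$ of $N$ ($\tau>0$ in $M$, $\tau=0$ and $d\tau\ne0$ on $N$). The conformal class of $\tau^2g|_{TN}$ is independent of $\tau$; $(N,[\tau^2g|_{TN}])$ is the conformal infinity. Special defining function associated with $\hat g\in[\hat g]$: the unique defining function $\tau$ such that in a neighbourhood $[0,\delta)\times N$ of the boundary $g=\tau^{-2}(d\tau^2+g_\tau)$, where $g_\tau$ is a 1-parameter family of metrics on $N$ with $g_\tau|_{\tau=0}=\hat g$. Standing regularity assumption: the metric $g$ is sufficiently regular at infinity, meaning that it has asymptotic expansions in $\tau$ as $\tau\to0$ to high enough order, in general involving log terms. *)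

(* Defs.v *)
From HB Require Import structures.
From mathcomp Require Import all_boot all_order all_algebra.
From mathcomp Require Import all_classical all_reals all_analysis.
Set Implicit Arguments.
Unset Strict Implicit.
Unset Printing Implicit Defensive.
Import Order.TTheory GRing.Theory Num.Theory numFieldNormedType.Exports.
Local Open Scope classical_set_scope.
Local Open Scope ring_scope.

(* Points of R^n are row vectors, and coordinate 0 is the one that is
   nonnegative on the half-space.  Tangent vectors are row vectors as well, so
   the differential of F acts as v |-> v *m jac F x, and a covariant 2-tensor t
   pulls back as J *m t *m J^T. *)

Definition partial (R : realType) (n : nat) (i : 'I_n) (f : 'rV[R]_n -> R)
  (x : 'rV[R]_n) : R := 'D_(delta_mx 0 i) f x.

Definition partials (R : realType) (n : nat) (s : seq 'I_n)
  (f : 'rV[R]_n -> R) : 'rV[R]_n -> R := foldr (@partial R n) f s.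

Definition jac (R : realType) (n m : nat) (F : 'rV[R]_n -> 'rV[R]_m)
  (x : 'rV[R]_n) : 'M[R]_(n, m) :=
  \matrix_(i, j) partial i (fun y => F y 0 j) x.

Fixpoint Ck (R : realType) (n k : nat) (U : set 'rV[R]_n)
  (f : 'rV[R]_n -> R) : Prop :=
  {in U, continuous f} /\
  if k is k'.+1 then
    forall i, (forall x, U x -> derivable f x (delta_mx 0 i)) /\
              Ck k' U (partial i f)
  else True.

Definition smooth_ext (R : realType) (n : nat) (A : set 'rV[R]_n)
  (f : 'rV[R]_n -> R) (x : 'rV[R]_n) (F : 'rV[R]_n -> R) : Prop :=
  exists U : set 'rV[R]_n,
    [/\ open U, U x, forall k, Ck k U F & forall y, A y -> U y -> F y = f y].

(* Smoothness on a set that need not be open: near each point of A, f is the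
   restriction of a function that is smooth on a neighbourhood of the point. *)
Definition smooth_on (R : realType) (n : nat) (A : set 'rV[R]_n)
  (f : 'rV[R]_n -> R) : Prop :=
  forall x, A x -> exists F, smooth_ext A f x F.

Definition half_space (R : realType) (n : nat) : set 'rV[R]_n.+1 :=
  [set x | 0 <= x 0 0].

Record chart (R : realType) (n : nat) (T : Type) := Chart {
  cdom : set T;
  cmap : T -> 'rV[R]_n;
  cinv : 'rV[R]_n -> T
}.

(* H is the model: the whole space, or the half-space for manifolds with
   boundary. *)
Definition is_chart (R : realType) (n : nat) (T : topologicalType)
  (H : set 'rV[R]_n) (c : chart R n T) : Prop :=
  [/\ open (cdom c),
      exists2 U : set 'rV[R]_n, open U & cmap c @` cdom c = U `&` H,
      forall p, cdom c p -> cinv c (cmap c p) = p,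
      {within cdom c, continuous (cmap c)} &
      {within cmap c @` cdom c, continuous (cinv c)}].

Definition transition (R : realType) (n : nat) (T : Type)
  (c d : chart R n T) (x : 'rV[R]_n) : 'rV[R]_n := cmap d (cinv c x).

Definition compatible (R : realType) (n : nat) (T : Type)
  (c d : chart R n T) : Prop :=
  let W := cdom c `&` cdom d in
  (forall i, smooth_on (cmap c @` W) (fun x => transition c d x 0 i)) /\
  (forall i, smooth_on (cmap d @` W) (fun x => transition d c x 0 i)).

Structure manifold (R : realType) (n : nat) (H : set 'rV[R]_n) := Manifold {
  carrier :> topologicalType;
  atlas : set (chart R n carrier);
  carrier_hausdorff : hausdorff_space carrier;
  carrier_countable : @second_countable carrier;
  atlas_chart : forall c, atlas c -> is_chart H c;
  atlas_cover : forall p, exists2 c, atlas c & cdom c p;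
  atlas_compatible : forall c d, atlas c -> atlas d -> compatible c d
}.
Arguments atlas {R n H} _.

Notation boundaryless R n := (@manifold R n [set: 'rV[R]_n]).
Notation with_boundary R n := (@manifold R n.+1 (@half_space R n)).

Definition minterior (R : realType) (n : nat) (X : with_boundary R n) : set X :=
  [set p | forall c, atlas X c -> cdom c p -> 0 < cmap c p 0 0].
Arguments minterior {R n} X.

Definition mboundary (R : realType) (n : nat) (X : with_boundary R n) : set X :=
  ~` minterior X.
Arguments mboundary {R n} X.

Definition image_of (R : realType) (n : nat) (T : Type) (S : set T)
  (c : chart R n T) : set 'rV[R]_n := cmap c @` (cdom c `&` S).

Definition smooth_fun (R : realType) (n : nat) (H : set 'rV[R]_n)
  (X : manifold H) (S : set X) (f : X -> R) : Prop :=
  forall c, atlas X c -> smooth_on (image_of S c) (fun x => f (cinv c x)).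

Definition smooth_map (R : realType) (n m : nat) (H : set 'rV[R]_n)
  (K : set 'rV[R]_m) (X : manifold H) (Y : manifold K) (f : X -> Y) : Prop :=
  continuous f /\
  forall c d, atlas X c -> atlas Y d -> forall i,
    smooth_on (image_of (f @^-1` cdom d) c)
              (fun x => cmap d (f (cinv c x)) 0 i).

(* A covariant 2-tensor is given by its components in the charts of the
   atlas. *)
Definition tensor2 (R : realType) (n : nat) (H : set 'rV[R]_n)
  (X : manifold H) : Type := chart R n X -> 'rV[R]_n -> 'M[R]_n.

Definition sym_tensor (R : realType) (n : nat) (H : set 'rV[R]_n)
  (X : manifold H) (S : set X) (t : tensor2 X) : Prop :=
  [/\ forall c, atlas X c -> forall x, image_of S c x -> (t c x)^T = t c x,
      forall c, atlas X c -> forall i j,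
        smooth_on (image_of S c) (fun x => t c x i j) &
      forall c d, atlas X c -> atlas X d ->
        forall p, S p -> cdom c p -> cdom d p ->
          let J := jac (transition c d) (cmap c p) in
          t c (cmap c p) = J *m t d (cmap d p) *m J^T].

Definition posdef (R : realType) (n : nat) (G : 'M[R]_n) : Prop :=
  G^T = G /\ forall v : 'rV[R]_n, v != 0 -> 0 < (v *m G *m v^T) 0 0.

Definition riemannian (R : realType) (n : nat) (H : set 'rV[R]_n)
  (X : manifold H) (S : set X) (g : tensor2 X) : Prop :=
  sym_tensor S g /\
  forall c, atlas X c -> forall x, image_of S c x -> posdef (g c x).

(* Curvature in coordinates; g is the matrix of components of a metric. *)

Definition christoffel (R : realType) (n : nat) (g : 'rV[R]_n -> 'M[R]_n)
  (k i j : 'I_n) (x : 'rV[R]_n) : R :=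
  2^-1 * \sum_l invmx (g x) k l *
    (partial i (fun y => g y j l) x + partial j (fun y => g y i l) x
     - partial l (fun y => g y i j) x).

(* R(d_k, d_l) d_j = \sum_i riem_up g i j k l d_i *)
Definition riem_up (R : realType) (n : nat) (g : 'rV[R]_n -> 'M[R]_n)
  (i j k l : 'I_n) (x : 'rV[R]_n) : R :=
  partial k (christoffel g i l j) x - partial l (christoffel g i k j) x
  + \sum_a (christoffel g i k a x * christoffel g a l j x
            - christoffel g i l a x * christoffel g a k j x).

(* With this sign R_ijij is positive on the round sphere. *)
Definition riem (R : realType) (n : nat) (g : 'rV[R]_n -> 'M[R]_n)
  (i j k l : 'I_n) (x : 'rV[R]_n) : R :=
  \sum_a g x i a * riem_up g a j k l x.

Definition ricci (R : realType) (n : nat) (g : 'rV[R]_n -> 'M[R]_n)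
  (j l : 'I_n) (x : 'rV[R]_n) : R := \sum_i riem_up g i j i l x.

Definition hessian (R : realType) (n : nat) (g : 'rV[R]_n -> 'M[R]_n)
  (f : 'rV[R]_n -> R) (i j : 'I_n) (x : 'rV[R]_n) : R :=
  partial i (partial j f) x - \sum_k christoffel g k i j x * partial k f x.

Definition laplacian (R : realType) (n : nat) (g : 'rV[R]_n -> 'M[R]_n)
  (f : 'rV[R]_n -> R) (x : 'rV[R]_n) : R :=
  \sum_i \sum_j invmx (g x) i j * hessian g f i j x.

Definition norm4 (R : realType) (n : nat) (G : 'M[R]_n)
  (T : 'I_n -> 'I_n -> 'I_n -> 'I_n -> R) : R :=
  let G' := invmx G in
  Num.sqrt (\sum_i \sum_j \sum_k \sum_l \sum_a \sum_b \sum_c \sum_d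
    G' i a * G' j b * G' k c * G' l d * T i j k l * T a b c d).

Definition hyp_curv (R : realType) (n : nat) (G : 'M[R]_n)
  (i j k l : 'I_n) : R := - (G i k * G j l - G i l * G j k).

Definition static_vacuum (R : realType) (n : nat) (H : set 'rV[R]_n)
  (X : manifold H) (S : set X) (g : tensor2 X) (V : X -> R) : Prop :=
  [/\ riemannian S g, smooth_fun S V, forall p, S p -> 0 < V p &
      forall c, atlas X c -> forall x, image_of S c x ->
        let v := fun y => V (cinv c y) in
        (forall i j, ricci (g c) i j x + n%:R * g c x i j
                     = (v x)^-1 * hessian (g c) v i j x) /\
        laplacian (g c) v x = n%:R * v x].

(* Piecewise C^1 curves inside S, as concatenations of C^1 arcs each lying in
   one chart, together with their length. *)

Definition velocity (R : realType) (n : nat) (x : R -> 'rV[R]_n) (t : R) :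
  'rV[R]_n := \row_i (fun s => x s 0 i)^`()%classic t.

Definition C1_curve (R : realType) (n : nat) (x : R -> 'rV[R]_n) : Prop :=
  forall i, (forall t, derivable (fun s => x s 0 i) t 1) /\
            continuous ((fun s => x s 0 i)^`()%classic).

Inductive joined (R : realType) (n : nat) (H : set 'rV[R]_n) (X : manifold H)
  (S : set X) (g : tensor2 X) : X -> X -> R -> Prop :=
| joined_arc (c : chart R n X) (x : R -> 'rV[R]_n) :
    atlas X c -> C1_curve x ->
    (forall t, 0 <= t <= 1 -> image_of S c (x t)) ->
    joined S g (cinv c (x 0)) (cinv c (x 1))
      (Rintegral (@lebesgue_measure R) `[0, 1]
         (fun t => Num.sqrt
            ((velocity x t *m g c (x t) *m (velocity x t)^T) 0 0)))
| joined_cat (p q r : X) (L L' : R) :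
    joined S g p q L -> joined S g q r L' -> joined S g p r (L + L').

Definition rdist (R : realType) (n : nat) (H : set 'rV[R]_n) (X : manifold H)
  (S : set X) (g : tensor2 X) (p q : X) : R := inf [set L | joined S g p q L].

Definition complete_metric (R : realType) (n : nat) (H : set 'rV[R]_n)
  (X : manifold H) (S : set X) (g : tensor2 X) : Prop :=
  forall u : nat -> X, (forall k, S (u k)) ->
    (forall e : R, 0 < e -> exists K : nat, forall i j : nat,
       (K <= i)%N -> (K <= j)%N -> rdist S g (u i) (u j) < e) ->
    exists2 p, S p & (fun k => rdist S g (u k) p) @ \oo --> (0 : R).

(* Connectedness makes the distance to a fixed point finite. *)
Definition asymptotically_hyperbolic (R : realType) (n : nat)
  (H : set 'rV[R]_n) (X : manifold H) (S : set X) (g : tensor2 X) : Prop :=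
  [/\ connected S, ~ compact S, complete_metric S g &
      exists o : X, S o /\ exists b : R, 0 < b /\ exists C : R,
        forall c, atlas X c -> forall x, image_of S c x ->
          norm4 (g c x)
            (fun i j k l => riem (g c) i j k l x - hyp_curv (g c x) i j k l)
          <= C * expR (- b * rdist S g o (cinv c x))].

(* The differential of r at a boundary point is read off from a smooth
   extension of r across the boundary in a chart. *)
Definition defining_function (R : realType) (n : nat) (X : with_boundary R n)
  (r : X -> R) : Prop :=
  [/\ smooth_fun setT r,
      forall p, minterior X p -> 0 < r p,
      forall p, mboundary X p -> r p = 0 &
      forall c, atlas X c -> forall p, cdom c p -> mboundary X p ->
        exists F, smooth_ext (image_of setT c) (fun x => r (cinv c x))
                    (cmap c p) F /\
                  exists i, partial i F (cmap c p) != 0].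

(* The log terms allowed at infinity rule out asking more than continuity of
   the extended metric up to the boundary. *)
Definition extends_compactified (R : realType) (n : nat)
  (X : with_boundary R n) (r : X -> R) (g G : tensor2 X) : Prop :=
  forall c, atlas X c ->
    [/\ {within image_of setT c, continuous (G c)},
        forall x, image_of setT c x -> posdef (G c x) &
        forall x, image_of (minterior X) c x ->
          G c x = r (cinv c x) ^+ 2 *: g c x].

Definition conformally_compact (R : realType) (n : nat)
  (X : with_boundary R n) (g : tensor2 X) : Prop :=
  compact [set: X] /\
  exists r G, defining_function r /\ extends_compactified r g G.

Definition boundary_embedding (R : realType) (n : nat) (N : boundaryless R n)
  (X : with_boundary R n) (iota : N -> X) : Prop :=
  [/\ smooth_map iota, injective iota, range iota = mboundary X &
      forall c d, atlas N c -> atlas X d -> forall y, cdom c y ->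
        cdom d (iota y) ->
        row_free (jac (fun x => cmap d (iota (cinv c x))) (cmap c y))].

(* The conformal infinity of (X, g) is (N, [ghat]), the boundary of X being
   identified with N by iota. *)
Definition conformal_infinity (R : realType) (n : nat) (N : boundaryless R n)
  (X : with_boundary R n) (g : tensor2 X) (iota : N -> X) (ghat : tensor2 N) :
  Prop :=
  boundary_embedding iota /\
  exists (r : X -> R) (G : tensor2 X) (phi : N -> R),
    [/\ defining_function r, extends_compactified r g G,
        forall y, 0 < phi y &
        forall c d, atlas N c -> atlas X d -> forall y, cdom c y ->
          cdom d (iota y) ->
          let J := jac (fun x => cmap d (iota (cinv c x))) (cmap c y) in
          J *m G d (cmap d (iota y)) *m J^T = phi y *: ghat c (cmap c y)].

(* The chart p |-> (tau p, c (pr p)) of X, where Phi identifies [0, delta) x N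
   with a neighbourhood of the boundary and (tau, pr) is inverse to Phi. *)
Definition collar_chart (R : realType) (n : nat) (N X : Type) (delta : R)
  (Phi : R -> N -> X) (tau : X -> R) (pr : X -> N) (c : chart R n N) :
  chart R n.+1 X :=
  @Chart R n.+1 X
    [set p | exists t y, [/\ 0 <= t < delta, cdom c y & p = Phi t y]]
    (fun p => row_mx (const_mx (tau p) : 'rV[R]_1) (cmap c (pr p)))
    (fun v => Phi (v 0 0) (cinv c (@rsubmx R 1 1 n v))).

Definition collar (R : realType) (n : nat) (N : boundaryless R n)
  (X : with_boundary R n) (iota : N -> X) (delta : R) (Phi : R -> N -> X)
  (tau : X -> R) (pr : X -> N) : Prop :=
  [/\ 0 < delta,
      forall y, Phi 0 y = iota y,
      forall t y, 0 <= t < delta -> tau (Phi t y) = t /\ pr (Phi t y) = y &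
      forall c, atlas N c ->
        let C := collar_chart delta Phi tau pr c in
        is_chart (@half_space R n) C /\
        forall d, atlas X d -> compatible C d].

(* tau is a defining function, g = tau^-2 (dtau^2 + h_tau) on the collar, and
   h is a family of metrics on N, continuous up to tau = 0, with h_0 = ghat. *)
Definition special_defining_function (R : realType) (n : nat)
  (N : boundaryless R n) (X : with_boundary R n) (g : tensor2 X)
  (iota : N -> X) (ghat : tensor2 N) (delta : R) (Phi : R -> N -> X)
  (tau : X -> R) (pr : X -> N) (h : R -> tensor2 N) : Prop :=
  [/\ defining_function tau,
      collar iota delta Phi tau pr,
      forall t, 0 <= t < delta -> riemannian setT (h t),
      forall c, atlas N c ->
        {within [set z : R * 'rV[R]_n | 0 <= z.1 < delta /\
                                        image_of setT c z.2],
           continuous (fun z => h z.1 c z.2)} /\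
        forall x, image_of setT c x -> h 0 c x = ghat c x &
      forall c d, atlas N c -> atlas X d ->
        forall t y, 0 < t < delta -> cdom c y -> cdom d (Phi t y) ->
          let C := collar_chart delta Phi tau pr c in
          let J := jac (transition C d) (cmap C (Phi t y)) in
          t ^- 2 *: (block_mx 1%:M 0 0 (h t c (cmap c y)) : 'M[R]_(1 + n))
          = J *m g d (cmap d (Phi t y)) *m J^T].

(* f = S + o(t^q) as t -> 0+, uniformly on compact subsets of U, and this may
   be differentiated up to r times in t and x, each derivative in t costing a
   factor t. *)
Definition asymp (R : realType) (n : nat) (q r : nat) (U : set 'rV[R]_n)
  (f S : R -> 'rV[R]_n -> R) : Prop :=
  forall (j : nat) (s : seq 'I_n), (j + size s <= r)%N ->
  forall D : set 'rV[R]_n, compact D -> D `<=` U ->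
  forall e : R, 0 < e -> exists2 eta : R, 0 < eta &
    forall t x, 0 < t < eta -> D x ->
      t ^+ j * `| derive1n j
                    (fun u => partials s (fun y => f u y - S u y) x) t |
      <= e * t ^+ q.

(* h has an expansion in powers of t and log t with smooth coefficients through
   order K, which may be differentiated K times. *)
Definition regular_at_infinity (R : realType) (n : nat) (N : boundaryless R n)
  (h : R -> tensor2 N) (K : nat) : Prop :=
  exists (P : nat) (a : nat -> nat -> tensor2 N),
    (forall k p, sym_tensor setT (a k p)) /\
    forall c, atlas N c -> forall i j,
      asymp K K (image_of setT c) (fun t x => h t c x i j)
        (fun t x => \sum_(k < K.+1) \sum_(p < P.+1)
                      t ^+ k * ln t ^+ p * a k p c x i j).

(* Main.v *)
Require Import Defs.
From HB Require Import structures.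
From mathcomp Require Import all_boot all_order all_algebra.
From mathcomp Require Import all_classical all_reals all_analysis.
From mathcomp Require Import ring lra zify.
Set Implicit Arguments.
Unset Strict Implicit.
Unset Printing Implicit Defensive.
Import Order.TTheory GRing.Theory Num.Theory numFieldNormedType.Exports.
Local Open Scope classical_set_scope.
Local Open Scope ring_scope.

(** Put [s = t^2], write [theta] for [s d/ds], [H(s, x)] for [h_t(x)] and [u] for [t V].
    In the coordinates [(s, x)] the metric is [ds^2/(4 s^2) + H/s] and [V] is [u/sqrt s],
    and the static equations become three equations whose only singular operator is
    [theta]; no odd power of [t] is left in them ([static_N0], [static_NS], [static_NE]).
    That is the reason for the parity: if the unknowns are determined through order
    [s^(m/2)] by equations with coefficients smooth in [s], then [h_t] is even in [t] and
    [V] is odd in [t] through the corresponding order.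

    Linearised at [s = 0], with [mu = (m+1)/2] and [Z = tr (ghat^-1 theta R)] for a
    perturbation [(R, v)] of [(H, u)], the scalar curvature equation [NS] reads
    [4 (theta - mu) Z = 0].  The trace of the tangential equation [NE] then determines
    [theta v], and what remains of it is [(theta - mu) theta R = 0].  The indicial
    exponents are therefore [0] and [mu].  None lies in the open interval [(0, mu)], so
    two solutions with the same boundary values agree up to [O(s^(m/2 + 1/4))]
    ([compare]), and the power series recursion is solvable through order [s^(m/2)]
    ([formal_residual]), with coefficients that are local expressions in [ghat].
    Comparison of an actual solution with the formal one is [static_expansion].

    To start the comparison the solution must be known to tend to its boundary values at
    some rate, together with its Euler derivatives.  For [H] this follows from the
    assumed expansion in powers of [t] and [ln t]: continuity at [t = 0] excludes
    logarithms at order [t^0] ([leading_coefficient], [regular_G]).  For [u] nothing of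
    the kind is assumed except the limit, and the [00] equation
    [theta^2 u - theta u = Phi u] with [Phi = O(s^(1/4))] gives it
    ([gronwall], [asymp_data_lapse]).

    All estimates are local near one boundary point, in the classes [G] of germs whose
    tangential derivatives up to a given order are [O(s^a)].  First order operators in
    [theta] are integrated along the lines [x = const] ([INTpos_bO0], [INT0_bO0]).
    The passage from the charts of [M] to the coordinates [(s, x)] rests on the
    invariance of the static equations ([static_gt]).  That the local coefficients
    transform as tensors on [N] is inherited from [h_t], because an even expansion with
    this error determines its coefficients ([expo_inj]). *)

(** * Calculus of several variables *)

Notation ee i := (delta_mx 0 i).

Section Lines.
Context {R : realType} {n : nat}.
Implicit Types (f g : 'rV[R]_n -> R) (x v : 'rV[R]_n) (U : set 'rV[R]_n).

(** Directional derivatives are taken along lines, which reduces calculus in several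
    variables to one real variable. *)
Lemma derive_line (W : normedModType R) (f : 'rV[R]_n -> W) x v :
  'D_v f x = 'D_1 (fun h : R => f (h *: v + x)) 0.
Proof.
rewrite /derive.
have -> // : (fun h : R => h^-1 *: ((f \o shift x) (h *: v) - f x)) =
  (fun h : R => h^-1 *: (((fun h : R => f (h *: v + x)) \o shift 0) (h *: 1) -
     f ((0:R) *: v + x))).
by rewrite funeqE => h /=; rewrite addr0 scale0r add0r [_%:A]mulr1.
Qed.

Lemma line_is_derive f x v t : derivable f (x + t *: v) v ->
  is_derive t 1 (fun t => f (x + t *: v)) ('D_v f (x + t *: v)).
Proof.
have E : (fun h => f (x + (h *: 1 + t) *: v)) = (fun h => f (h *: v + (x + t *: v))).
  by rewrite funeqE => h; congr f; rewrite [_%:A]mulr1 scalerDl addrCA.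
move=> df; split.
  by apply/derivable1P; move/derivable1P: df; rewrite -E.
rewrite [RHS]derive_line -E /derive.
have -> // : (fun h : R => h^-1 *: (((fun t => f (x + t *: v)) \o shift t) (h *: 1)
     - f (x + t *: v))) =
  (fun h : R => h^-1 *: (((fun h : R => f (x + (h *: 1 + t) *: v)) \o shift 0) (h *: 1)
     - f (x + ((0:R) *: 1 + t) *: v))).
by rewrite funeqE => h /=; rewrite addr0 scale0r add0r ![_%:A]mulr1.
Qed.

Lemma is_derive_translate f x v w (d : R) : is_derive (x + w) v f d ->
  is_derive x v (fun y => f (y + w)) d.
Proof.
have E : (fun z : R => f (z *: v + (x + w))) = (fun z : R => f (z *: v + x + w)).
  by apply/funext => z; rewrite addrA.
case=> [/derivable1P D V]; split; first by apply/derivable1P; rewrite -E.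
by rewrite -V (derive_line f) E derive_line.
Qed.

Lemma line_MVT f x v (h : R) :
  (forall t : R, 0 <= t <= 1 -> derivable f (x + (t * h) *: v) v) ->
  exists2 c : R, 0 <= c <= 1 & f (x + h *: v) - f x = h * 'D_v f (x + (c * h) *: v).
Proof.
move=> df.
have dm (t : R) : is_derive t (1 : R) (fun t : R => t * h) h.
  by split; [exact: derivableM|
    rewrite deriveM // derive_cst derive_id scaler0 add0r [_ *: _]mulr1].
have dG (t : R) : 0 <= t <= 1 ->
    is_derive t (1 : R) (fun t : R => f (x + (t * h) *: v)) ('D_v f (x + (t * h) *: v) * h).
  move=> /df /line_is_derive L.
  exact: (@is_derive1_comp R (fun t => f (x + t *: v)) (fun t => t * h) t _ _ L (dm t)).
have MV := @MVT_segment R (fun t : R => f (x + (t * h) *: v))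
  (fun t : R => 'D_v f (x + (t * h) *: v) * h) 0 1 ler01.
have [c c01 E] : exists2 c : R, c \in `[0, 1] &
    f (x + (1 * h) *: v) - f (x + (0 * h) *: v) = 'D_v f (x + (c * h) *: v) * h * (1 - 0).
  apply: MV => [t|].
    by rewrite in_itv /= => /andP[/ltW t0 /ltW t1]; apply: dG; rewrite t0.
  by apply: derivable_within_continuous => t; rewrite in_itv /= => /dG [].
exists c => //; move: E; rewrite /= mul1r mul0r scale0r addr0 => ->.
by rewrite subr0 mulr1 mulrC.
Qed.

End Lines.

Section Partial.
Context {R : realType} {n : nat}.
Implicit Types (f g : 'rV[R]_n -> R) (x v : 'rV[R]_n) (U : set 'rV[R]_n) (i : 'I_n).

Lemma partial_near i f g x : (\forall y \near x, f y = g y) ->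
  partial i f x = partial i g x.
Proof. exact: near_eq_derive. Qed.

Lemma open_eq_near U f g x : open U -> U x -> (forall y, U y -> f y = g y) ->
  \forall y \near x, f y = g y.
Proof. by move=> oU Ux fg; apply: filterS (open_nbhs_nbhs (conj oU Ux)). Qed.

Lemma cont_near f g x : (\forall y \near x, f y = g y) ->
  {for x, continuous f} -> {for x, continuous g}.
Proof.
move=> fg cf; rewrite /prop_for /continuous_at -(nbhs_singleton fg).
apply: (cvg_trans _ cf).
apply: (@near_eq_cvg _ _ (nbhs x)).
by apply: filterS fg => y ->.
Qed.

Lemma partialD i f g x : derivable f x (ee i) -> derivable g x (ee i) ->
  partial i (fun y => f y + g y) x = partial i f x + partial i g x.
Proof. exact: deriveD. Qed.

Lemma partialB i f g x : derivable f x (ee i) -> derivable g x (ee i) ->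
  partial i (fun y => f y - g y) x = partial i f x - partial i g x.
Proof. exact: deriveB. Qed.

Lemma partialM i f g x : derivable f x (ee i) -> derivable g x (ee i) ->
  partial i (fun y => f y * g y) x = partial i f x * g x + f x * partial i g x.
Proof.
move=> df dg; rewrite /partial; have -> := deriveM df dg.
by rewrite addrC; congr (_ + _); exact: mulrC.
Qed.

Lemma partial_cst i (c : R) x : partial i (fun=> c) x = 0.
Proof. exact: derive_cst. Qed.

Lemma partialV i f x : f x != 0 -> derivable f x (ee i) ->
  partial i (fun y => (f y)^-1) x = - (f x ^- 2) * partial i f x.
Proof. by move=> f0 df; rewrite /partial deriveV. Qed.

Lemma derivable_near i f g x : (\forall y \near x, f y = g y) ->
  derivable f x (ee i) -> derivable g x (ee i).
Proof. exact: near_eq_derivable. Qed.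

Lemma Ck_cont k U f x : Ck k U f -> U x -> {for x, continuous f}.
Proof. by case: k => [|k] [cf _] Ux; apply: cf; rewrite inE. Qed.

Lemma CkW k U f : Ck k.+1 U f -> Ck k U f.
Proof.
elim: k f => [|k IH] f [cf df]; first by [].
split=> // i; have [d1 d2] := df i; split=> //; exact: IH.
Qed.

Lemma Ck_le j k U f : (j <= k)%N -> Ck k U f -> Ck j U f.
Proof.
move=> /subnK <-; elim: (k - j)%N => [//|d IH]; rewrite addSn => /CkW; exact: IH.
Qed.

Lemma Ck_sub k U V f : V `<=` U -> Ck k U f -> Ck k V f.
Proof.
move=> VU; elim: k f => [|k IH] f [cf df].
  by split=> // x; rewrite inE => Vx; apply: cf; rewrite inE; apply: VU.
split; first by move=> x; rewrite inE => Vx; apply: cf; rewrite inE; apply: VU.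
by move=> i; have [d1 d2] := df i; split; [move=> x /VU /d1|apply: IH].
Qed.

Lemma Ck_ext k U f g : open U -> (forall x, U x -> f x = g x) -> Ck k U f ->
  Ck k U g.
Proof.
move=> oU; elim: k f g => [|k IH] f g fg [cf df].
  split=> // x; rewrite inE => Ux.
  by apply: cont_near (open_eq_near oU Ux fg) _; apply: cf; rewrite inE.
split.
  move=> x; rewrite inE => Ux.
  by apply: cont_near (open_eq_near oU Ux fg) _; apply: cf; rewrite inE.
move=> i; have [d1 d2] := df i; split.
  move=> x Ux; apply: derivable_near (d1 x Ux); exact: (open_eq_near oU Ux).
apply: (IH (partial i f)) => // x Ux; apply: partial_near.
exact: (open_eq_near oU Ux).
Qed.

Lemma Ck_derivable k U f i x : Ck k.+1 U f -> U x -> derivable f x (ee i).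
Proof. by move=> [_ /(_ i)[d _]] /d. Qed.

Lemma Ck_partial k U f i : Ck k.+1 U f -> Ck k U (partial i f).
Proof. by move=> [_ /(_ i)[]]. Qed.

Lemma CkD k U f g : open U -> Ck k U f -> Ck k U g -> Ck k U (fun x => f x + g x).
Proof.
move=> oU; elim: k f g => [|k IH] f g Cf Cg.
  split=> // x; rewrite inE => Ux.
  exact: (continuousD (Ck_cont Cf Ux) (Ck_cont Cg Ux)).
split.
  move=> x; rewrite inE => Ux.
  exact: (continuousD (Ck_cont Cf Ux) (Ck_cont Cg Ux)).
move=> i; split=> [x Ux|].
  by apply: derivableD; [apply: Ck_derivable Cf Ux|apply: Ck_derivable Cg Ux].
apply: Ck_ext (IH _ _ (Ck_partial i Cf) (Ck_partial i Cg)) => // x Ux.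
by rewrite partialD //; [apply: Ck_derivable Cf Ux|apply: Ck_derivable Cg Ux].
Qed.

Lemma Ck_cst k U (c : R) : open U -> Ck k U (fun=> c).
Proof.
move=> oU; elim: k c => [|k IH] c; first by split=> // x _; exact: cst_continuous.
split; first by move=> x _; exact: cst_continuous.
move=> i; split=> [x Ux|]; first exact: derivable_cst.
by apply: Ck_ext (IH 0) => // x Ux; rewrite partial_cst.
Qed.

Lemma CkM k U f g : open U -> Ck k U f -> Ck k U g -> Ck k U (fun x => f x * g x).
Proof.
move=> oU; elim: k f g => [|k IH] f g Cf Cg.
  split=> // x; rewrite inE => Ux.
  exact: (continuousM (Ck_cont Cf Ux) (Ck_cont Cg Ux)).
split.
  move=> x; rewrite inE => Ux.
  exact: (continuousM (Ck_cont Cf Ux) (Ck_cont Cg Ux)).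
move=> i; split=> [x Ux|].
  by apply: derivableM; [apply: Ck_derivable Cf Ux|apply: Ck_derivable Cg Ux].
apply: Ck_ext (CkD oU (IH _ _ (Ck_partial i Cf) (CkW Cg))
                      (IH _ _ (CkW Cf) (Ck_partial i Cg))) => // x Ux.
by rewrite partialM //; [apply: Ck_derivable Cf Ux|apply: Ck_derivable Cg Ux].
Qed.

Lemma CkV k U f : open U -> (forall x, U x -> f x != 0) -> Ck k U f ->
  Ck k U (fun x => (f x)^-1).
Proof.
move=> oU f0; elim: k => [|k IH] Cf.
  split=> // x; rewrite inE => Ux; exact: (continuousV (f0 _ Ux) (Ck_cont Cf Ux)).
split.
  move=> x; rewrite inE => Ux; exact: (continuousV (f0 _ Ux) (Ck_cont Cf Ux)).
move=> i; split=> [x Ux|].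
  by apply: derivableV; [exact: f0|apply: Ck_derivable Cf Ux].
have Ci := IH (CkW Cf).
apply: Ck_ext (CkM oU (CkM oU (Ck_cst k (-1) oU) (CkM oU Ci Ci)) (Ck_partial i Cf)) => //.
move=> x Ux; rewrite partialV ?f0 //; last by apply: Ck_derivable Cf Ux.
by rewrite mulN1r -invrM ?unitfE ?f0 // expr2.
Qed.

Lemma partial_coord i j x : partial i (fun y : 'rV[R]_n => y 0 j) x = (i == j)%:R.
Proof.
rewrite /partial deriveE; last exact: differentiable_coord.
have L : linear (fun y : 'rV[R]_n => y 0 j : R) by move=> a u v; rewrite !mxE.
pose lL : {linear 'rV[R]_n -> R} := HB.pack (fun y : 'rV[R]_n => y 0 j : R)
  (GRing.isLinear.Build _ _ _ _ _ L).
have cL : continuous lL by move=> y; exact: coord_continuous.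
have -> := diff_lin x cL.
by rewrite /= mxE eqxx eq_sym.
Qed.

Lemma Ck_coord k U j : open U -> Ck k U (fun y : 'rV[R]_n => y 0 j).
Proof.
move=> oU.
have C : {in U, continuous (fun y : 'rV[R]_n => y 0 j : R)}.
  by move=> x _; apply: coord_continuous.
case: k => [|k]; split=> // i; split=> [x Ux|].
  exact/diff_derivable/differentiable_coord.
by apply: Ck_ext (Ck_cst k (i == j)%:R oU) => // x _; rewrite partial_coord.
Qed.


Lemma Ck_sum k U (I : Type) (r : seq I) (P : pred I) (F : I -> 'rV[R]_n -> R) :
  open U -> (forall a, Ck k U (F a)) -> Ck k U (fun x => \sum_(a <- r | P a) F a x).
Proof.
move=> oU CF; elim: r => [|a r IH].
  by apply: Ck_ext (Ck_cst k 0 oU) => // x _; rewrite big_nil.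
case Pa : (P a).
  by apply: Ck_ext (CkD oU (CF a) IH) => // x _; rewrite big_cons Pa.
by apply: Ck_ext IH => // x _; rewrite big_cons Pa.
Qed.

Lemma derivable_sumf (I : Type) (r : seq I) (P : pred I) (F : I -> 'rV[R]_n -> R) x v :
  (forall a, derivable (F a) x v) ->
  derivable (fun x => \sum_(a <- r | P a) F a x) x v.
Proof.
move=> dF; elim: r => [|a r IH].
  by under eq_fun do rewrite big_nil; exact: derivable_cst.
case Pa : (P a).
  have -> : (fun x => \sum_(a <- a :: r | P a) F a x) =
      (fun x => F a x + \sum_(a <- r | P a) F a x).
    by apply/funext => y; rewrite big_cons Pa.
  exact: derivableD (dF a) IH.
have -> // : (fun x => \sum_(a <- a :: r | P a) F a x) =
    (fun x => \sum_(a <- r | P a) F a x).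
by apply/funext => y; rewrite big_cons Pa.
Qed.

Lemma partial_sum (I : Type) (r : seq I) (P : pred I) (F : I -> 'rV[R]_n -> R) i x :
  (forall a, derivable (F a) x (ee i)) ->
  partial i (fun x => \sum_(a <- r | P a) F a x) x = \sum_(a <- r | P a) partial i (F a) x.
Proof.
move=> dF; elim: r => [|a r IH].
  by rewrite big_nil; under eq_fun do rewrite big_nil; exact: partial_cst.
rewrite big_cons -IH; case Pa : (P a).
  have -> : (fun x => \sum_(a <- a :: r | P a) F a x) =
      (fun x => F a x + \sum_(a <- r | P a) F a x).
    by apply/funext => y; rewrite big_cons Pa.
  by apply: partialD (dF a) _; exact: derivable_sumf.
have -> // : (fun x => \sum_(a <- a :: r | P a) F a x) =
    (fun x => \sum_(a <- r | P a) F a x).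
by apply/funext => y; rewrite big_cons Pa.
Qed.

Lemma coord_le_norm (v : 'rV[R]_n) i : `|v 0 i| <= `|v|.
Proof.
rewrite [leRHS]/Num.Def.normr/= mx_normrE.
exact: (le_bigmax _ (fun ij : 'I_1 * 'I_n => `|v ij.1 ij.2|) (0, i)).
Qed.

Lemma ball_rVP x r y : ball x r y <-> 0 < r /\ forall j, `|x 0 j - y 0 j| < r.
Proof.
split=> [[r0 B]|[r0 B]]; split=> // j; first exact: B.
by move=> k; rewrite (ord1 j); exact: B.
Qed.

Definition trunc (k : nat) (v : 'rV[R]_n) : 'rV[R]_n :=
  \row_i (if (i < k)%N then v 0 i else 0).

(** A C^1 function is Frechet differentiable: move along one coordinate at a
    time and apply the mean value theorem to each step. *)
Lemma Ck1_expansion U f x (e : R) : open U -> Ck 1 U f -> U x -> 0 < e ->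
  exists2 r, 0 < r & forall v : 'rV[R]_n, `|v| < r ->
    `|f (x + v) - f x - \sum_i v 0 i * partial i f x| <= n%:R * e * `|v|.
Proof.
move=> oU Cf Ux e0.
have : \forall y \near x, U y /\ forall i, `|partial i f x - partial i f y| < e.
  have H : \forall y \near x, forall i, `|partial i f x - partial i f y| < e.
    apply: (@filter_forall _ _ (fun i y => `|partial i f x - partial i f y| < e) (nbhs x)) => i; have := Ck_cont (Ck_partial i Cf) Ux.
    by move/cvgrPdist_lt => /(_ e e0).
  by apply: filterS2 (open_nbhs_nbhs (conj oU Ux)) H => y H1 H2; split.
move=> /nbhs_ballP [r /= r0 B]; exists r => // v vr.
have step k : (k <= n)%N ->
  `|f (x + trunc k v) - f x - \sum_(i < n | (i < k)%N) v 0 i * partial i f x|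
    <= k%:R * e * `|v|.
  elim: k => [_|k IH kn].
    rewrite (_ : trunc 0 v = 0) ?addr0 ?subrr ?sub0r ?big_pred0 // ?oppr0 ?normr0 ?mul0r ?mul0r //.
    by apply/rowP => i; rewrite !mxE.
  pose ik := Ordinal kn.
  have tS : trunc k.+1 v = trunc k v + v 0 ik *: ee ik.
    apply/rowP => i; rewrite !mxE eqxx /= ltnS leq_eqVlt.
    case: (ltngtP i k) => [ik'|ik'|/eqP ik'].
    - by rewrite (_ : i == ik = false) ?mulr0 ?addr0 //; apply/eqP => E; move: ik'; rewrite E ltnn.
    - by rewrite (_ : i == ik = false) ?mulr0 ?addr0 //; apply/eqP => E; move: ik'; rewrite E ltnn.
    - have -> : i = ik by apply/val_inj/eqP.
      by rewrite eqxx mulr1 add0r.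
  have inB (t : R) : 0 <= t <= 1 -> ball x r (x + trunc k v + (t * v 0 ik) *: ee ik).
    move=> /andP[t0 t1]; apply/ball_rVP; split=> // j; rewrite !mxE eqxx /=.
    apply: le_lt_trans vr; apply: le_trans (coord_le_norm v j).
    rewrite -addrA opprD addrA subrr sub0r normrN.
    case: (ltngtP j k) => [jk|jk|/eqP jk].
    - rewrite (_ : j == ik = false) ?mulr0 ?addr0 //; apply/eqP => E; move: jk; by rewrite E ltnn.
    - rewrite (_ : j == ik = false) ?mulr0 ?addr0 ?normr0 //; apply/eqP => E; move: jk; by rewrite E ltnn.
    - have -> : j = ik by apply/val_inj/eqP.
      by rewrite eqxx mulr1 add0r normrM ger0_norm // ler_piMl.
  have [c c01 E] : exists2 c : R, 0 <= c <= 1 &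
      f (x + trunc k v + v 0 ik *: ee ik) - f (x + trunc k v) =
      v 0 ik * partial ik f (x + trunc k v + (c * v 0 ik) *: ee ik).
    apply: line_MVT => t /inB /B [Uy _]; exact: Ck_derivable Cf Uy.
  rewrite tS addrA (bigD1 ik) /=; last by rewrite ltnSn.
  rewrite (eq_bigl (fun i : 'I_n => (i < k)%N)); last first.
    move=> i; rewrite ltnS leq_eqVlt; case: (ltngtP i k) => [h|h|/eqP h].
    - by rewrite orbT /=; apply/eqP => E'; move: h; rewrite E' ltnn.
    - by [].
    - by rewrite /=; apply/negbTE; rewrite negbK; apply/eqP/val_inj/eqP.
  have [_ /(_ ik)] := B _ (inB _ c01).
  set y := x + trunc k v + _ => Hy.
  have split_step (a b c0 p q : R) : a - c0 - (p + q) = (b - c0 - q) + (a - b - p) by ring.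
  rewrite (split_step _ (f (x + trunc k v))).
  apply: le_trans (ler_normD _ _) _.
  rewrite -natr1 mulrDl mul1r mulrDl lerD //; first by apply: IH; exact: ltnW.
  rewrite E -mulrBr normrM mulrC distrC ler_pM //; [exact: ltW|exact: coord_le_norm].
have := step n (leqnn n).
have -> : trunc n v = v by apply/rowP => i; rewrite !mxE ltn_ord.
have -> // : \sum_(i < n | (i < n)%N) v 0 i * partial i f x = \sum_i v 0 i * partial i f x.
by apply: eq_bigl => i; exact: ltn_ord.
Qed.

Lemma Ck1_differentiable U f x : open U -> Ck 1 U f -> U x -> differentiable f x.
Proof.
move=> oU Cf Ux.
have L : linear (fun v : 'rV[R]_n => \sum_i v 0 i * partial i f x : R).
  move=> a u v; rewrite scaler_sumr -big_split; apply: eq_bigr => i _ /=.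
  by rewrite !mxE mulrDl -mulrA.
pose lL : {linear 'rV[R]_n -> R} := HB.pack (fun v : 'rV[R]_n => \sum_i v 0 i * partial i f x : R)
  (GRing.isLinear.Build _ _ _ _ _ L).
have cL : continuous lL.
  move=> y; have /Ck_cont := Ck_sum (k := 0) (index_enum 'I_n) xpredT
    (F := fun i (v : 'rV[R]_n) => v 0 i * partial i f x) openT
    (fun i => CkM openT (Ck_coord 0 i openT) (Ck_cst 0 (partial i f x) openT)).
  exact.
have E : f \o shift x = cst (f x) + lL +o_ (0 : 'rV[R]_n) id.
  apply/eqaddoP => e e0.
  have e1 : 0 < e / (n%:R + 1) by rewrite divr_gt0 // ltr_wpDl.
  have [r r0 H] := Ck1_expansion oU Cf Ux e1.
  apply/nbhs_ballP; exists r => //= v; rewrite -ball_normE /= sub0r normrN => vr.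
  have := H v vr; rewrite (addrC x v).
  have -> : (f \o shift x - (cst (f x) + lL)) v = f (v + x) - f x - \sum_i v 0 i * partial i f x.
    by rewrite /= !fctE /= opprD addrA.
  move/le_trans; apply; rewrite ler_wpM2r //.
  by rewrite mulrCA ler_piMr ?(ltW e0) // ler_pdivrMr ?ltr_wpDl // mul1r lerDl.
apply/diff_locallyP; have -> : 'd f x = lL :> (_ -> _) by apply: diff_unique.
by [].
Qed.

Lemma dist_half_le (a b c e : R) : `|a - c| < e / 2 -> `|b - c| < e / 2 -> `|a - b| <= e.
Proof.
move=> h1 h2; have -> : a - b = (a - c) - (b - c) by ring.
by apply: le_trans (ler_normB _ _) _; rewrite (splitr e) lerD // ltW.
Qed.

(** Mixed second partials commute: the second difference of [f] along [e_i] and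
    [e_j] is a value of either mixed derivative at a nearby point. *)
Lemma partialC U f i j x : open U -> Ck 2 U f -> U x ->
  partial i (partial j f) x = partial j (partial i f) x.
Proof.
move=> oU Cf Ux; apply/eqP; rewrite -subr_eq0 -normr_eq0 eq_le normr_ge0 andbT.
apply/ler_addgt0Pr => e e0; rewrite add0r.
have e2 : 0 < e / 2 by rewrite divr_gt0.
have [r r0 B] : exists2 r, 0 < r & forall y, ball x r y ->
   [/\ U y, `|partial i (partial j f) x - partial i (partial j f) y| < e / 2
     & `|partial j (partial i f) x - partial j (partial i f) y| < e / 2].
  have C1 := Ck_cont (Ck_partial i (Ck_partial j Cf)) Ux.
  have C2 := Ck_cont (Ck_partial j (Ck_partial i Cf)) Ux.
  move/cvgrPdist_lt : C1 => /(_ _ e2) C1; move/cvgrPdist_lt : C2 => /(_ _ e2) C2.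
  have : \forall y \near x, [/\ U y, `|partial i (partial j f) x - partial i (partial j f) y| < e / 2
     & `|partial j (partial i f) x - partial j (partial i f) y| < e / 2].
    by apply: filterS3 (open_nbhs_nbhs (conj oU Ux)) C1 C2 => y; exact: And3.
  by move=> /nbhs_ballP [r /= r0 B]; exists r.
pose h := r / 3.
have h0 : 0 < h by rewrite divr_gt0.
have inB (a b : 'I_n) (s t : R) : 0 <= s <= 1 -> 0 <= t <= 1 ->
    ball x r (x + (s * h) *: ee a + (t * h) *: ee b).
  move=> /andP[s0 s1] /andP[t0 t1]; apply/ball_rVP; split=> // l; rewrite !mxE eqxx /=.
  have D : `|(s * h) * (l == a)%:R| + `|(t * h) * (l == b)%:R| <= h + h.
    apply: lerD.
      case: (l == a); rewrite ?mulr1 ?mulr0 ?normr0 ?(ltW h0) //.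
      by rewrite normrM (ger0_norm s0) (gtr0_norm h0) ler_piMl // ltW.
    case: (l == b); rewrite ?mulr1 ?mulr0 ?normr0 ?(ltW h0) //.
    by rewrite normrM (ger0_norm t0) (gtr0_norm h0) ler_piMl // ltW.
  rewrite -addrA opprD addrA subrr sub0r normrN.
  apply: le_lt_trans (ler_normD _ _) _; apply: le_lt_trans D _.
  by rewrite /h -mulrDr; lra.
have key (a b : 'I_n) : exists2 y, ball x r y &
    f (x + h *: ee a + h *: ee b) - f (x + h *: ee a) - f (x + h *: ee b) + f x =
    h * h * partial b (partial a f) y.
  pose phi y := f (y + h *: ee b) - f y.
  have I01 (t : R) : 0 <= t <= 1 -> U (x + (t * h) *: ee a) /\ U (x + (t * h) *: ee a + h *: ee b).
    have i0 : 0 <= (0 : R) <= 1 by rewrite lexx ler01.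
    have i1 : 0 <= (1 : R) <= 1 by rewrite lexx ler01.
    move=> t01; have /B[] := inB a b t 0 t01 i0; rewrite mul0r scale0r addr0 => U1 _ _.
    by have /B[] := inB a b t 1 t01 i1; rewrite mul1r.
  have dsh (t : R) : 0 <= t <= 1 ->
     is_derive (x + (t * h) *: ee a) (ee a) (fun y => f (y + h *: ee b))
       (partial a f (x + (t * h) *: ee a + h *: ee b)).
    move=> /I01[U1 U2]; apply: is_derive_translate.
    by split=> //; exact: (Ck_derivable Cf U2).
  have [c c01 E] : exists2 c : R, 0 <= c <= 1 &
     phi (x + h *: ee a) - phi x = h * 'D_(ee a) phi (x + (c * h) *: ee a).
    apply: line_MVT => t t01; have [U1 U2] := I01 t t01.
    by apply: derivableB; [have [] := dsh t t01|exact: Ck_derivable Cf U1].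
  have [U1 U2] := I01 c c01.
  have E1 : 'D_(ee a) phi (x + (c * h) *: ee a) =
      partial a f (x + (c * h) *: ee a + h *: ee b) - partial a f (x + (c * h) *: ee a).
    rewrite deriveB; [|by have [] := dsh c c01|exact: Ck_derivable Cf U1].
    by have [_ ->] := dsh c c01.
  have [d d01 E2] : exists2 d : R, 0 <= d <= 1 &
     partial a f (x + (c * h) *: ee a + h *: ee b) - partial a f (x + (c * h) *: ee a)
     = h * partial b (partial a f) (x + (c * h) *: ee a + (d * h) *: ee b).
    apply: line_MVT => t t01; have /B[Uy _ _] := inB a b c t c01 t01.
    exact: Ck_derivable (Ck_partial a Cf) Uy.
  exists (x + (c * h) *: ee a + (d * h) *: ee b); first exact: inB.
  by move: E; rewrite E1 E2 /phi -mulrA => <-; rewrite opprB addrA addrAC.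
have [y1 /B[_ _ B1] E1] := key i j; have [y2 /B[_ B2 _] E2] := key j i.
have hh : h * h != 0 by rewrite mulf_neq0 ?gt_eqF.
have E3 : partial j (partial i f) y1 = partial i (partial j f) y2.
  apply: (mulfI hh); apply: etrans (esym E1) (etrans _ E2); rewrite (addrAC x).
  congr (_ + _); exact: addrAC.
rewrite -E3 in B2.
exact: dist_half_le B2 B1.
Qed.

End Partial.

Section Composition.
Context {R : realType}.

(** The topology of row vectors is the product topology. *)
Lemma rv_continuous (T : topologicalType) n (phi : T -> 'rV[R]_n) (x : T) :
  (forall j, {for x, continuous (fun y => phi y 0 j)}) -> {for x, continuous phi}.
Proof.
move=> H; apply/cvgrPdist_lt => e e0.
have H1 : \forall y \near x, forall j, `|phi x 0 j - phi y 0 j| < e.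
  apply: (@filter_forall _ _ (fun j y => `|phi x 0 j - phi y 0 j| < e) (nbhs x)) => j.
  by have /cvgrPdist_lt/(_ _ e0) := H j.
apply: filterS H1 => y H1.
suff : ball (phi x) e (phi y) by rewrite -ball_normE.
by apply/ball_rVP.
Qed.

(** The chain rule needs differentiability of the outer function, which
    [Ck1_differentiable] extracts from continuity of its partial derivatives. *)
Lemma chain n m (f : 'rV[R]_n -> R) (phi : 'rV[R]_m -> 'rV[R]_n) (U : set 'rV[R]_n) x i :
  open U -> Ck 1 U f -> U (phi x) ->
  (forall j, derivable (fun y => phi y 0 j) x (ee i)) ->
  is_derive x (ee i) (fun y => f (phi y))
   (\sum_j partial j f (phi x) * partial i (fun y => phi y 0 j) x).
Proof.
move=> oU Cf Ux dphi.
have dp : derivable phi x (ee i).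
  by apply/derivable_mxP => k j; rewrite (ord1 k).
have df : differentiable f (phi x) := Ck1_differentiable oU Cf Ux.
pose c (h : R) := phi (h *: ee i + x).
have c0 : c 0 = phi x by rewrite /c scale0r add0r.
have dc : derivable c 0 1 := (derivable1P phi x (ee i)).1 dp.
have dc' : differentiable c 0 := (derivable1_diffP c 0).1 dc.
have df' : differentiable f (c 0) by rewrite c0.
have dfc : differentiable (f \o c) 0 by exact: differentiable_comp.
split; first exact: ((derivable1P (fun y => f (phi y)) x (ee i)).2 ((derivable1_diffP (f \o c) 0).2 dfc)).
rewrite derive_line (_ : (fun _ => _) = f \o c) // deriveE // diff_comp //= c0.
have -> : 'd c 0 1 = 'D_(ee i) phi x by rewrite -deriveE //; exact/esym/derive_line.
have -> := derive_mx dp.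
rewrite [X in 'd f _ X]row_sum_delta linear_sum; apply: eq_bigr => j _.
rewrite linearZ /= -deriveE // !mxE; exact: mulrC.
Qed.

Lemma Ck_comp n m k (f : 'rV[R]_n -> R) (phi : 'rV[R]_m -> 'rV[R]_n)
    (U : set 'rV[R]_n) (V : set 'rV[R]_m) :
  open U -> open V -> (forall x, V x -> U (phi x)) -> Ck k U f ->
  (forall j, Ck k V (fun y => phi y 0 j)) -> Ck k V (fun y => f (phi y)).
Proof.
move=> oU oV VU Cf Cphi.
have cont l g x : Ck l U g -> V x -> {for x, continuous (fun y => g (phi y))}.
  move=> Cg Vx; apply: continuous_comp; last exact: Ck_cont Cg (VU _ Vx).
  by apply: rv_continuous => j; exact: Ck_cont (Cphi j) Vx.
elim: k f Cf Cphi => [|k IH] f Cf Cphi.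
  by split=> // x; rewrite inE; exact: cont Cf.
split; first by move=> x; rewrite inE; exact: cont Cf.
have ch i x (Vx : V x) := chain oU (Ck_le (ltn0Sn k) Cf) (VU _ Vx)
  (fun j => Ck_derivable (i := i) (Cphi j) Vx).
move=> i; split; first by move=> x Vx; have [] := ch i x Vx.
have S := Ck_sum (k := k) (index_enum 'I_n) xpredT oV (fun j => CkM oV
  (IH _ (Ck_partial j Cf) (fun l => CkW (Cphi l))) (Ck_partial i (Cphi j))).
by apply: Ck_ext oV _ S => x Vx; have [_] := ch i x Vx; rewrite /partial => ->.
Qed.

End Composition.

(** * Coordinate invariance of the static equations *)

Section ClosedClasses.
Context {R : comNzRingType} {T : Type} (P : (T -> R) -> Prop).
Hypothesis Pc : forall c, P (fun=> c).
Hypothesis PD : forall f g, P f -> P g -> P (fun x => f x + g x).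
Hypothesis PM : forall f g, P f -> P g -> P (fun x => f x * g x).

(** Determinants, adjugates and matrix products are polynomial in the entries, so
    any class of functions closed under sums and products contains them. The argument
    serves for C^k functions, for germs smooth at a point, and for pairs of germs
    (functions on [bool * T]). *)
Lemma closed_sum (I : Type) (r : seq I) (Q : pred I) (F : I -> T -> R) :
  (forall a, P (F a)) -> P (fun x => \sum_(a <- r | Q a) F a x).
Proof.
move=> PF; elim: r => [|a r IH].
  have -> : (fun x => \sum_(a <- [::] | Q a) F a x) = fun=> 0.
    by apply/funext => x; rewrite big_nil.
  exact: Pc.
case Qa : (Q a).
  have -> : (fun x => \sum_(a <- a :: r | Q a) F a x) =
      fun x => F a x + \sum_(b <- r | Q b) F b x.
    by apply/funext => x; rewrite big_cons Qa.
  exact: PD.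
have -> // : (fun x => \sum_(a <- a :: r | Q a) F a x) = fun x => \sum_(b <- r | Q b) F b x.
by apply/funext => x; rewrite big_cons Qa.
Qed.

Lemma closed_prod (I : Type) (r : seq I) (Q : pred I) (F : I -> T -> R) :
  (forall a, P (F a)) -> P (fun x => \prod_(a <- r | Q a) F a x).
Proof.
move=> PF; elim: r => [|a r IH].
  have -> : (fun x => \prod_(a <- [::] | Q a) F a x) = fun=> 1.
    by apply/funext => x; rewrite big_nil.
  exact: Pc.
case Qa : (Q a).
  have -> : (fun x => \prod_(a <- a :: r | Q a) F a x) =
      fun x => F a x * \prod_(b <- r | Q b) F b x.
    by apply/funext => x; rewrite big_cons Qa.
  exact: PM.
have -> // : (fun x => \prod_(a <- a :: r | Q a) F a x) = fun x => \prod_(b <- r | Q b) F b x.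
by apply/funext => x; rewrite big_cons Qa.
Qed.

Lemma closed_det n (M : T -> 'M[R]_n) :
  (forall i j, P (fun x => M x i j)) -> P (fun x => \det (M x)).
Proof.
move=> PMx; apply: closed_sum => s; apply: PM; first exact: Pc.
by apply: closed_prod => i.
Qed.

Lemma closed_adj n (M : T -> 'M[R]_n) i j :
  (forall i j, P (fun x => M x i j)) -> P (fun x => (\adj (M x)) i j).
Proof.
move=> PMx; under eq_fun do rewrite mxE /cofactor.
apply: PM; first exact: Pc.
by apply: closed_det => a b; under eq_fun do rewrite !mxE; exact: PMx.
Qed.

Lemma closed_mulmx m n p (M : T -> 'M[R]_(m, n)) (N : T -> 'M[R]_(n, p)) :
  (forall i j, P (fun x => M x i j)) -> (forall i j, P (fun x => N x i j)) ->
  forall i j, P (fun x => (M x *m N x) i j).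
Proof.
move=> PMx PNx i j; under eq_fun do rewrite mxE.
by apply: closed_sum => a; apply: PM.
Qed.
End ClosedClasses.

Lemma invmxE (R : comUnitRingType) n (A : 'M[R]_n) : A \in unitmx ->
  invmx A = (\det A)^-1 *: \adj A.
Proof. by move=> uA; rewrite /invmx uA. Qed.

Lemma partialE (R : realType) n (i : 'I_n) (f : 'rV[R]_n -> R) x : partial i f x = 'D_(ee i) f x.
Proof. by []. Qed.

(* unification must never unfold a derivative into a limit *)
Opaque partial.

Lemma addmxE (R : nmodType) m n (A B : 'M[R]_(m, n)) i j : (A + B) i j = A i j + B i j.
Proof. by rewrite mxE. Qed.

Lemma scalemxE (R : pzRingType) m n a (A : 'M[R]_(m, n)) i j : (a *: A) i j = a * A i j.
Proof. by rewrite mxE. Qed.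

Section MatrixCalculus.
Context {R : realType} {n : nat}.
Implicit Types (U : set 'rV[R]_n) (x : 'rV[R]_n).

Definition MC k a b U (M : 'rV[R]_n -> 'M[R]_(a, b)) :=
  forall i j, Ck k U (fun x => M x i j).

Definition Dm a b (k : 'I_n) (M : 'rV[R]_n -> 'M[R]_(a, b)) x : 'M[R]_(a, b) :=
  \matrix_(i, j) partial k (fun y => M y i j) x.

Lemma MC_W k a b U (M : 'rV[R]_n -> 'M[R]_(a, b)) : MC k.+1 U M -> MC k U M.
Proof. by move=> H i j; exact: CkW. Qed.

Lemma MC_ext k a b U (M N : 'rV[R]_n -> 'M[R]_(a, b)) : open U ->
  (forall x, U x -> M x = N x) -> MC k U M -> MC k U N.
Proof. by move=> oU MN H i j; apply: Ck_ext (H i j) => // x Ux; rewrite MN. Qed.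

Lemma MC_Z k a b U f (M : 'rV[R]_n -> 'M[R]_(a, b)) : open U ->
  Ck k U f -> MC k U M -> MC k U (fun x => f x *: M x).
Proof. by move=> oU Hf HM i j; apply: Ck_ext (CkM oU Hf (HM i j)) => // x _; rewrite mxE. Qed.

Lemma MC_sum k a b U (I : Type) (r : seq I) (Q : pred I) (M : I -> 'rV[R]_n -> 'M[R]_(a, b)) :
  open U -> (forall l, MC k U (M l)) -> MC k U (fun x => \sum_(l <- r | Q l) M l x).
Proof.
move=> oU HM i j; apply: Ck_ext (Ck_sum r Q oU (fun l => HM l i j)) => // x _.
by rewrite summxE.
Qed.

Lemma MC_M k a b c U (M : 'rV[R]_n -> 'M[R]_(a, b)) (N : 'rV[R]_n -> 'M[R]_(b, c)) : open U ->
  MC k U M -> MC k U N -> MC k U (fun x => M x *m N x).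
Proof.
move=> oU HM HN; apply: (@closed_mulmx _ _ (Ck k U)) => // [c0|f g|f g].
- exact: Ck_cst.
- exact: CkD.
- exact: CkM.
Qed.

Lemma MC_tr k a b U (M : 'rV[R]_n -> 'M[R]_(a, b)) :
  MC k U M -> MC k U (fun x => (M x)^T).
Proof. by move=> HM i j; have := HM j i; congr Ck; apply/funext => x; rewrite mxE. Qed.

Lemma Ck_det k a U (M : 'rV[R]_n -> 'M[R]_a) : open U -> MC k U M ->
  Ck k U (fun x => \det (M x)).
Proof.
move=> oU HM; apply: (@closed_det _ _ (Ck k U)) => // [c0|f g|f g].
- exact: Ck_cst.
- exact: CkD.
- exact: CkM.
Qed.

Lemma MC_inv k a U (M : 'rV[R]_n -> 'M[R]_a) : open U ->
  (forall x, U x -> M x \in unitmx) -> MC k U M -> MC k U (fun x => invmx (M x)).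
Proof.
move=> oU uM HM.
apply: (@MC_ext _ _ _ _ (fun x => (\det (M x))^-1 *: \adj (M x))) => // [x Ux|].
  by rewrite invmxE // uM.
apply: MC_Z => // [|i j].
  apply: CkV => // [x Ux|]; last exact: Ck_det.
  by have := uM x Ux; rewrite unitmxE unitfE.
apply: (@closed_adj _ _ (Ck k U)) => // [c0|f g|f g].
- exact: Ck_cst.
- exact: CkD.
- exact: CkM.
Qed.

Lemma MC_Dm k a b U i (M : 'rV[R]_n -> 'M[R]_(a, b)) : MC k.+1 U M -> MC k U (Dm i M).
Proof.
move=> HM p q; have := Ck_partial i (HM p q); congr Ck.
by apply/funext => x; rewrite mxE.
Qed.

Lemma Dm_ext a b k U (M N : 'rV[R]_n -> 'M[R]_(a, b)) x : open U -> U x ->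
  (forall y, U y -> M y = N y) -> Dm k M x = Dm k N x.
Proof.
move=> oU Ux MN; apply/matrixP => i j; rewrite !mxE; apply: partial_near.
by apply: (open_eq_near oU Ux) => y Uy; rewrite MN.
Qed.

Lemma DmM a b c k U (M : 'rV[R]_n -> 'M[R]_(a, b)) (N : 'rV[R]_n -> 'M[R]_(b, c)) x :
  MC 1 U M -> MC 1 U N -> U x ->
  Dm k (fun x => M x *m N x) x = Dm k M x *m N x + M x *m Dm k N x.
Proof.
move=> HM HN Ux; apply/matrixP => i j; rewrite !mxE -big_split /=.
have dM p q := Ck_derivable (i := k) (HM p q) Ux.
have dN p q := Ck_derivable (i := k) (HN p q) Ux.
under [X in partial k X]eq_fun do rewrite mxE.
rewrite partial_sum; last by move=> l; exact: derivableM.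
by apply: eq_bigr => l _; rewrite partialM // !mxE.
Qed.

Lemma DmD a b k U (M N : 'rV[R]_n -> 'M[R]_(a, b)) x :
  MC 1 U M -> MC 1 U N -> U x ->
  Dm k (fun x => M x + N x) x = Dm k M x + Dm k N x.
Proof.
move=> HM HN Ux; apply/matrixP => i j; rewrite !mxE.
have dM p q := Ck_derivable (i := k) (HM p q) Ux.
have dN p q := Ck_derivable (i := k) (HN p q) Ux.
by under [X in partial k X]eq_fun do rewrite mxE; rewrite partialD.
Qed.

Lemma DmZ a b k U f (M : 'rV[R]_n -> 'M[R]_(a, b)) x :
  Ck 1 U f -> MC 1 U M -> U x ->
  Dm k (fun x => f x *: M x) x = partial k f x *: M x + f x *: Dm k M x.
Proof.
move=> Hf HM Ux; apply/matrixP => i j; rewrite !mxE.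
have dM p q := Ck_derivable (i := k) (HM p q) Ux.
have df := Ck_derivable (i := k) Hf Ux.
by under [X in partial k X]eq_fun do rewrite mxE; rewrite partialM.
Qed.

Lemma Dm_sum a b k U (I : Type) (r : seq I) (Q : pred I) (M : I -> 'rV[R]_n -> 'M[R]_(a, b)) x :
  (forall l, MC 1 U (M l)) -> U x ->
  Dm k (fun x => \sum_(l <- r | Q l) M l x) x = \sum_(l <- r | Q l) Dm k (M l) x.
Proof.
move=> HM Ux; apply/matrixP => i j; rewrite summxE !mxE.
under [X in partial k X]eq_fun do rewrite summxE.
rewrite partial_sum; first by apply: eq_bigr => l _; rewrite mxE.
by move=> l; exact: Ck_derivable (HM l i j) Ux.
Qed.

Lemma Dm_tr a b k (M : 'rV[R]_n -> 'M[R]_(a, b)) x : Dm k (fun x => (M x)^T) x = (Dm k M x)^T.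
Proof. by apply/matrixP => i j; rewrite !mxE; under [X in partial k X]eq_fun do rewrite mxE. Qed.

Lemma DmC a b k l U (M : 'rV[R]_n -> 'M[R]_(a, b)) x : open U -> MC 2 U M -> U x ->
  Dm k (Dm l M) x = Dm l (Dm k M) x.
Proof.
move=> oU HM Ux; apply/matrixP => i j; rewrite [LHS]mxE [RHS]mxE.
have E q : (fun y => Dm q M y i j) = partial q (fun y => M y i j).
  by apply/funext => y; rewrite mxE.
rewrite !E; exact: (partialC k l oU (HM i j) Ux).
Qed.

Lemma Dm_comp a b k U V (M : 'rV[R]_n -> 'M[R]_(a, b)) (phi : 'rV[R]_n -> 'rV[R]_n) x :
  open U -> MC 1 U M -> U (phi x) ->
  (forall j, Ck 1 V (fun y => phi y 0 j)) -> V x ->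
  Dm k (fun y => M (phi y)) x = \sum_e jac phi x k e *: Dm e M (phi x).
Proof.
move=> oU HM Ux Hp Vx; apply/matrixP => i j; rewrite summxE [LHS]mxE partialE.
have [_ ->] := chain oU (HM i j) Ux (fun j => Ck_derivable (i := k) (Hp j) Vx).
by apply: eq_bigr => e _; rewrite !mxE mulrC.
Qed.

End MatrixCalculus.

Section Connection.
Context {R : realType} {n : nat}.
Implicit Types (g : 'rV[R]_n -> 'M[R]_n).

(** Connection matrices: row [j] of [conn g k x] lists the components of the
    covariant derivative of the j-th coordinate field along the k-th one. *)
Definition conn g (k : 'I_n) x : 'M[R]_n := \matrix_(j, i) christoffel g i k j x.

Lemma connE g k x j i : conn g k x j i = christoffel g i k j x.
Proof. by rewrite mxE. Qed.

(** Christoffel symbols of the first kind. *)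
Definition conn1 g (k : 'I_n) x : 'M[R]_n :=
  \matrix_(j, l) (2^-1 * (Dm k g x j l + Dm j g x k l - Dm l g x k j)).

Lemma conn_eq g k x : conn g k x = conn1 g k x *m (invmx (g x))^T.
Proof.
apply/matrixP => j i; rewrite !mxE /christoffel mulr_sumr; apply: eq_bigr => l _.
by rewrite !mxE mulrCA mulrC.
Qed.

Lemma conn_conn1 g k x : g x \in unitmx -> (g x)^T = g x -> conn g k x *m g x = conn1 g k x.
Proof.
move=> ug sg; rewrite conn_eq -mulmxA trmx_inv sg mulVmx ?mulmx1 //.
Qed.

Lemma riem_up_conn g i j k l x U : open U -> U x -> (forall k, MC 1 U (conn g k)) ->
  riem_up g i j k l x =
  (Dm k (conn g l) x - Dm l (conn g k) x
   + (conn g l x *m conn g k x - conn g k x *m conn g l x)) j i.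
Proof.
move=> oU Ux HC; rewrite !mxE /riem_up.
have E q p r : (fun y => conn g q y p r) = christoffel g r q p.
  by apply/funext => y; rewrite mxE.
rewrite !E; congr (_ + _); rewrite -sumrB; apply: eq_bigr => a _.
by rewrite !mxE [X in X - _]mulrC [X in _ - X]mulrC.
Qed.

(** The curvature of the connection matrices, as a commutator; row [j] and column
    [i] hold the components of [R(d_k, d_l) d_j]. *)
Definition curv g k l x : 'M[R]_n :=
  Dm k (conn g l) x - Dm l (conn g k) x
   + (conn g l x *m conn g k x - conn g k x *m conn g l x).

Lemma MC_conn1 U g k q : open U -> MC q.+1 U g -> MC q U (conn1 g k).
Proof.
move=> oU Hg i j.
have H a b c : Ck q U (fun y => Dm a g y b c) by exact: MC_Dm.
apply: (@Ck_ext _ _ _ _ (fun y => 2^-1 * ((Dm k g y i j + Dm i g y k j) + (-1) * Dm j g y k i))) => //.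
  by move=> x _; rewrite [RHS]mxE mulN1r.
apply: CkM => //; first exact: Ck_cst.
by apply: CkD => //; [exact: CkD|apply: CkM => //; exact: Ck_cst].
Qed.

Lemma MC_conn U g k q : open U -> (forall x, U x -> g x \in unitmx) ->
  MC q.+1 U g -> MC q U (conn g k).
Proof.
move=> oU ug Hg.
apply: (@MC_ext _ _ _ _ _ _ (fun x => conn1 g k x *m (invmx (g x))^T)) => //.
  by move=> x _; rewrite conn_eq.
apply: MC_M => //; first exact: MC_conn1.
by apply: MC_tr; apply: MC_inv => //; exact: MC_W.
Qed.

End Connection.

(** The transformation law of Christoffel symbols of the first kind, as an
    identity between matrices: [J] is a Jacobian, [DJ] its derivatives (symmetric
    by equality of mixed partials) and [Dg] the derivatives of the metric. *)
Lemma conn1_alg (R : fieldType) n (J g : 'M[R]_n) (DJ Dg : 'I_n -> 'M[R]_n) :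
  (2 : R) != 0 -> g^T = g -> (forall i j c, DJ i j c = DJ j i c) ->
  let Dgt k := DJ k *m g *m J^T + J *m (\sum_c J k c *: Dg c) *m J^T + J *m g *m (DJ k)^T in
  forall k j l, 2^-1 * (Dgt k j l + Dgt j k l - Dgt l k j) =
  (DJ k *m g *m J^T + J *m (\sum_c J k c *:
     \matrix_(a, b) (2^-1 * (Dg c a b + Dg a c b - Dg b c a))) *m J^T) j l.
Proof.
move=> two gs DJC /= k j l.
pose X k := DJ k *m g *m J^T.
have XT k' : J *m g *m (DJ k')^T = (X k')^T.
  by rewrite /X !trmx_mul trmxK gs // mulmxA.
have XC a b c : X a b c = X b a c.
  rewrite /X !mxE; apply: eq_bigr => l' _; congr (_ * _); rewrite !mxE.
  by apply: eq_bigr => l'' _; rewrite DJC.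
pose T (F : 'I_n -> 'I_n -> 'I_n -> R) k j l :=
  \sum_c \sum_a \sum_b J k c * J j a * J l b * F c a b.
have YE k' j' l' (F : 'I_n -> 'M[R]_n) : (J *m (\sum_c J k' c *: F c) *m J^T) j' l' =
    T (fun c a b => F c a b) k' j' l'.
  rewrite mulmx_sumr mulmx_suml summxE; apply: eq_bigr => c _.
  rewrite -scalemxAr -scalemxAl mxE mxE mulr_sumr [RHS]exchange_big /=.
  apply: eq_bigr => b _; rewrite !mxE mulrA mulrC mulr_sumr mulr_sumr.
  by apply: eq_bigr => a _; ring.
have addE (A B : 'M[R]_n) a b : (A + B) a b = A a b + B a b by rewrite mxE.
have trE (A : 'M[R]_n) a b : A^T a b = A b a by rewrite mxE.
rewrite !XT -!/(X _) !addE !trE !YE (XC k l j) (XC j l k) (XC j k l).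
have S2 : T (fun c a b => Dg c a b) j k l = T (fun c a b => Dg a c b) k j l.
  rewrite /T exchange_big; apply: eq_bigr => a _; apply: eq_bigr => c _.
  by apply: eq_bigr => b _; ring.
have S3 : T (fun c a b => Dg c a b) l k j = T (fun c a b => Dg b c a) k j l.
  rewrite /T exchange_big; apply: eq_bigr => c _; rewrite exchange_big.
  by apply: eq_bigr => a _; apply: eq_bigr => b _; ring.
have S4 : T (fun c a b => (\matrix_(a, b) (2^-1 * (Dg c a b + Dg a c b - Dg b c a))) a b) k j l
  = 2^-1 * (T (fun c a b => Dg c a b) k j l + T (fun c a b => Dg a c b) k j l
            - T (fun c a b => Dg b c a) k j l).
  rewrite /T -big_split -sumrB mulr_sumr; apply: eq_bigr => c _.
  rewrite -big_split -sumrB mulr_sumr; apply: eq_bigr => a _.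
  rewrite -big_split -sumrB mulr_sumr; apply: eq_bigr => b _.
  by rewrite mxE /=; ring.
rewrite S4 S2 S3.
set t1 := T _ _ _ _; set t2 := T _ _ _ _; set t3 := T _ _ _ _.
by field.
Qed.

Lemma curv_alg (R : comNzRingType) n (ck cl J Dkl Dlk DkJ DlJ S Bk Bl DkBl DlBk : 'M[R]_n) :
  Dkl *m J + cl *m DkJ = S + (DkJ *m Bl + J *m DkBl) ->
  Dlk *m J + ck *m DlJ = S + (DlJ *m Bk + J *m DlBk) ->
  DkJ = ck *m J - J *m Bk -> DlJ = cl *m J - J *m Bl ->
  (Dkl - Dlk + (cl *m ck - ck *m cl)) *m J = J *m (DkBl - DlBk + (Bl *m Bk - Bk *m Bl)).
Proof.
move=> /(canRL (addrK _)) h1 /(canRL (addrK _)) h2 h3 h4.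
rewrite !mulmxDl !mulNmx !mulmxDr !mulmxN h1 h2 h3 h4.
have alg (p1 p2 p4 q2 d1 d2 w1 w2 : 'M[R]_n) :
    S + (p1 - p2 + d1) - (w1 - p4) - (S + (p4 - q2 + d2) - (w2 - p1)) + (w1 - w2)
    = d1 - d2 + (q2 - p2).
  by apply/matrixP => a b; rewrite !mxE; ring.
rewrite !mulmxBl !mulmxBr !mulmxA; exact: alg.
Qed.

Lemma curv_alg2 (R : comNzRingType) n (a b w : 'I_n -> R) (C : 'I_n -> 'M[R]_n)
    (DC : 'I_n -> 'I_n -> 'M[R]_n) :
  \sum_c (w c *: C c + \sum_e (b c * a e) *: DC e c)
  - \sum_c (w c *: C c + \sum_e (a c * b e) *: DC e c)
  + ((\sum_c b c *: C c) *m (\sum_c a c *: C c) - (\sum_c a c *: C c) *m (\sum_c b c *: C c))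
  = \sum_c \sum_e (a c * b e) *: (DC c e - DC e c + (C e *m C c - C c *m C e)).
Proof.
rewrite !big_split /= opprD (addrACA (\sum_c w c *: C c)) subrr add0r.
have QE (p q : 'I_n -> R) : (\sum_c p c *: C c) *m (\sum_c q c *: C c) =
   \sum_c \sum_e (p c * q e) *: (C c *m C e).
  rewrite mulmx_suml; apply: eq_bigr => c _; rewrite mulmx_sumr; apply: eq_bigr => e _.
  by rewrite -scalemxAl -scalemxAr scalerA.
have sw (F : 'I_n -> 'I_n -> 'M[R]_n) : \sum_c \sum_e (b c * a e) *: F c e =
   \sum_c \sum_e (a c * b e) *: F e c.
  rewrite exchange_big; apply: eq_bigr => c _; apply: eq_bigr => e _.
  by rewrite (mulrC (b e)).
rewrite !QE (sw (fun c e => DC e c)) (sw (fun c e => C c *m C e)).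
rewrite -!sumrB -big_split; apply: eq_bigr => c _; rewrite -!sumrB -big_split.
by apply: eq_bigr => e _; rewrite /= -!scalerBr -scalerDr.
Qed.

Lemma ricci_alg (R : comUnitRingType) n (J : 'M[R]_n) (F Ft : 'I_n -> 'I_n -> 'M[R]_n) :
  J \in unitmx ->
  (forall k l, Ft k l *m J = J *m \sum_c \sum_e (J k c * J l e) *: F c e) ->
  forall j l, \sum_i Ft i l j i = \sum_a \sum_e J j a * J l e * \sum_c F c e a c.
Proof.
move=> uJ H j l.
transitivity (\sum_i \sum_b \sum_a \sum_c \sum_e
    J j a * J l e * F c e a b * (invmx J b i * J i c)).
  apply: eq_bigr => i _; rewrite (canRL (mulmxK uJ) (H i l)) mxE.
  apply: eq_bigr => b _; rewrite mxE mulr_suml; apply: eq_bigr => a _.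
  rewrite summxE mulr_sumr mulr_suml; apply: eq_bigr => c _.
  rewrite summxE mulr_sumr mulr_suml; apply: eq_bigr => e _.
  by rewrite mxE; ring.
rewrite exchange_big; under eq_bigr do rewrite exchange_big.
rewrite exchange_big; apply: eq_bigr => a _.
transitivity (\sum_b \sum_c \sum_e J j a * J l e * F c e a b * (b == c)%:R).
  apply: eq_bigr => b _; rewrite exchange_big; apply: eq_bigr => c _.
  rewrite exchange_big; apply: eq_bigr => e _; rewrite -mulr_sumr; congr (_ * _).
  by have := mulVmx uJ => /matrixP /(_ b c); rewrite !mxE.
transitivity (\sum_b \sum_e J j a * J l e * F b e a b).
  apply: eq_bigr => b _; rewrite (bigD1 b) //= [X in _ + X]big1 ?addr0.
    by apply: eq_bigr => e _; rewrite eqxx mulr1.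
  by move=> c cb; rewrite big1 // => e _; rewrite eq_sym (negbTE cb) mulr0.
rewrite exchange_big; apply: eq_bigr => e _; by rewrite -mulr_sumr.
Qed.

Definition static_at (R : realType) n (g : 'rV[R]_n -> 'M[R]_n) (v : 'rV[R]_n -> R) x :=
  (forall i j, ricci g i j x + n%:R * g x i j = (v x)^-1 * hessian g v i j x) /\
  laplacian g v x = n%:R * v x.

Lemma ricci_curv (R : realType) n (g : 'rV[R]_n -> 'M[R]_n) U j l x : open U -> U x ->
  (forall k, MC 1 U (conn g k)) -> ricci g j l x = \sum_i curv g i l x j i.
Proof. by move=> oU Ux HC; apply: eq_bigr => i _; rewrite (riem_up_conn _ _ _ _ oU Ux HC). Qed.

Section Covariance.
Context {R : realType} {n : nat}.
Variables (U V : set 'rV[R]_n) (phi : 'rV[R]_n -> 'rV[R]_n) (g gt : 'rV[R]_n -> 'M[R]_n).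
Hypotheses (oU : open U) (oV : open V) (VU : forall x, V x -> U (phi x)).
Hypothesis Cphi : forall k j, Ck k V (fun y => phi y 0 j).
Hypothesis Cg : forall k, MC k U g.
Hypothesis gs : forall x, U x -> (g x)^T = g x.
Hypothesis gu : forall x, U x -> g x \in unitmx.
Hypothesis Ju : forall x, V x -> jac phi x \in unitmx.
Hypothesis gtE : forall x, V x -> gt x = jac phi x *m g (phi x) *m (jac phi x)^T.

Local Notation J := (jac phi).
(* the connection of [g], pulled back to a matrix of one-forms on [V] *)
Let B k x : 'M[R]_n := \sum_c J x k c *: conn g c (phi x).

Lemma MC_jac k : MC k V J.
Proof.
move=> i j; have := Ck_partial i (Cphi k.+1 j); congr Ck.
by apply/funext => x; rewrite mxE.
Qed.

Lemma MC_comp k a b (M : 'rV[R]_n -> 'M[R]_(a, b)) : MC k U M -> MC k V (fun y => M (phi y)).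
Proof. by move=> HM i j; exact: (Ck_comp oU oV VU (HM i j) (Cphi k)). Qed.

Lemma jacC i j c x : V x -> Dm i J x j c = Dm j J x i c.
Proof.
move=> Vx; rewrite [LHS]mxE [RHS]mxE.
have E q : (fun y => J y q c) = partial q (fun y => phi y 0 c).
  by apply/funext => y; rewrite mxE.
by rewrite !E; exact: (partialC i j oV (Cphi 2 c) Vx).
Qed.

Lemma MC_gt k : MC k V gt.
Proof.
apply: (@MC_ext _ _ _ _ _ _ (fun x => J x *m g (phi x) *m (J x)^T)) => //.
  by move=> x Vx; rewrite gtE.
apply: MC_M => //; last by apply: MC_tr; exact: MC_jac.
by apply: MC_M => //; [exact: MC_jac|exact: MC_comp].
Qed.

Lemma gtu x : V x -> gt x \in unitmx.
Proof. by move=> Vx; rewrite gtE // !unitmx_mul unitmx_tr Ju // gu //; exact: VU. Qed.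

Lemma gts x : V x -> (gt x)^T = gt x.
Proof. by move=> Vx; rewrite gtE // !trmx_mul trmxK gs ?mulmxA //; exact: VU. Qed.

Lemma Dm_gt k x : V x -> Dm k gt x =
  Dm k J x *m g (phi x) *m (J x)^T
  + J x *m (\sum_c J x k c *: Dm c g (phi x)) *m (J x)^T
  + J x *m g (phi x) *m (Dm k J x)^T.
Proof.
move=> Vx.
rewrite (@Dm_ext _ _ _ _ k V gt (fun x => J x *m g (phi x) *m (J x)^T)) //.
have M0 : MC 1 V (fun x => g (phi x)) by exact: MC_comp.
have M1 : MC 1 V (fun x => J x *m g (phi x)) by apply: MC_M => //; exact: MC_jac.
have M2 : MC 1 V (fun x => (J x)^T) by apply: MC_tr; exact: MC_jac.
rewrite (DmM k M1 M2 Vx) (DmM k (MC_jac 1) M0 Vx).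
rewrite (Dm_comp k oU (Cg 1) (VU Vx) (Cphi 1) Vx).
by rewrite Dm_tr mulmxDl.
Qed.

Lemma conn1_gt k x : V x -> conn1 gt k x =
  (Dm k J x + J x *m B k x) *m g (phi x) *m (J x)^T.
Proof.
move=> Vx; have Ux := VU Vx.
have two : (2 : R) != 0 by rewrite pnatr_eq0.
have A := @conn1_alg R n (J x) (g (phi x)) (fun k => Dm k J x)
  (fun c => Dm c g (phi x)) two (gs Ux) (fun i j c => jacC i j c Vx).
apply/matrixP => j l; rewrite [LHS]mxE !Dm_gt // {}A.
congr (fun_of_matrix _ _ _); rewrite !mulmxDl; congr (_ + _).
rewrite -!mulmxA; congr (_ *m _); rewrite mulmxA; congr (_ *m _).
rewrite /B mulmx_suml; apply: eq_bigr => c _.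
rewrite -scalemxAl conn_conn1 ?gs ?gu //.
Qed.

(** The transformation law of the connection. *)
Lemma conn_gt k x : V x -> conn gt k x *m J x = Dm k J x + J x *m B k x.
Proof.
move=> Vx.
have uJ : g (phi x) *m (J x)^T \in unitmx by rewrite unitmx_mul unitmx_tr Ju // gu //; exact: VU.
apply: (can_inj (mulmxK uJ)).
have : conn gt k x *m gt x = conn1 gt k x by apply: conn_conn1; [exact: gtu|exact: gts].
by rewrite gtE // conn1_gt // -!mulmxA.
Qed.

Lemma MC_B k q : MC q V (B k).
Proof.
apply: MC_sum => // c; apply: MC_Z => //; first exact: MC_jac.
by apply: MC_comp; apply: MC_conn => //; exact: Cg.
Qed.

(** Differentiating the law for the connection and antisymmetrizing removes the
    second derivatives of the coordinate change: curvature is a tensor. *)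
Lemma curv_gt k l x : V x -> curv gt k l x *m J x =
  J x *m \sum_c \sum_e (J x k c * J x l e) *: curv g c e (phi x).
Proof.
move=> Vx; have Ux := VU Vx.
have Cgt a : MC 1 V (conn gt a).
  by apply: MC_conn => //; [exact: gtu|exact: MC_gt].
have CB a : MC 1 V (B a) by exact: MC_B.
have CJ : MC 1 V J by exact: MC_jac.
have D a b : Dm a (conn gt b) x *m J x + conn gt b x *m Dm a J x =
    Dm a (Dm b J) x + (Dm a J x *m B b x + J x *m Dm a (B b) x).
  rewrite -(DmM a (Cgt b) CJ Vx) -(DmM a CJ (CB b) Vx).
  rewrite -(DmD a (MC_Dm b (MC_jac 2)) (MC_M oV CJ (CB b)) Vx).
  by apply: (Dm_ext a oV Vx) => y Vy; exact: conn_gt.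
have DB a b : Dm a (B b) x = \sum_c (Dm a J x b c *: conn g c (phi x)
    + \sum_e (J x b c * J x a e) *: Dm e (conn g c) (phi x)).
  have Cc c : MC 1 V (fun x => conn g c (phi x)).
    by apply: MC_comp; apply: MC_conn => //; exact: Cg.
  rewrite (Dm_sum _ _ _ _ Vx); last by move=> c; apply: MC_Z => //; exact: CJ.
  apply: eq_bigr => c _; rewrite (DmZ a (CJ b c) (Cc c) Vx); congr (_ *: _ + _).
    by rewrite mxE.
  have Cc' : MC 1 U (conn g c) by apply: MC_conn => //; exact: Cg.
  rewrite (Dm_comp a oU Cc' Ux (Cphi 1) Vx) scaler_sumr.
  by apply: eq_bigr => e _; rewrite scalerA.
have N a : Dm a J x = conn gt a x *m J x - J x *m B a x by rewrite conn_gt // addrK.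
have E : curv gt k l x *m J x = J x *m (Dm k (B l) x - Dm l (B k) x
    + (B l x *m B k x - B k x *m B l x)).
  have h2 := D l k; rewrite (DmC l k oV (MC_jac 2) Vx) in h2.
  exact: (curv_alg (D k l) h2 (N k) (N l)).
rewrite E; congr (_ *m _).
rewrite !DB /B.
rewrite [in X in _ - X](eq_bigr (fun c => Dm k J x l c *: conn g c (phi x) +
  \sum_e (J x k c * J x l e) *: Dm e (conn g c) (phi x))); last first.
  by move=> c _; congr (_ *: _ + _); exact: jacC.
exact: (curv_alg2 (J x k) (J x l) (Dm k J x l) (fun c => conn g c (phi x))
  (fun e c => Dm e (conn g c) (phi x))).
Qed.

Lemma ricci_gt j l x : V x ->
  ricci gt j l x = \sum_a \sum_e J x j a * J x l e * ricci g a e (phi x).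
Proof.
move=> Vx; have Ux := VU Vx.
have Cgt a : MC 1 V (conn gt a).
  by apply: MC_conn => //; [exact: gtu|exact: MC_gt].
have Cgg a : MC 1 U (conn g a) by apply: MC_conn => //; exact: Cg.
rewrite (ricci_curv _ _ oV Vx Cgt).
rewrite (ricci_alg (F := fun c e => curv g c e (phi x)) (Ft := fun k l => curv gt k l x)
  (Ju Vx)); last by move=> k l'; exact: curv_gt.
apply: eq_bigr => a _; apply: eq_bigr => e _.
by rewrite (ricci_curv _ _ oU Ux Cgg).
Qed.

Variable v : 'rV[R]_n -> R.
Hypothesis Cv : forall k, Ck k U v.

Lemma partial_comp i x f : Ck 1 U f -> V x ->
  partial i (fun y => f (phi y)) x = \sum_c J x i c * partial c f (phi x).
Proof.
move=> Cf Vx; rewrite partialE.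
have [_ ->] := chain oU Cf (VU Vx) (fun j => Ck_derivable (i := i) (Cphi 1 j) Vx).
by apply: eq_bigr => c _; rewrite mxE mulrC.
Qed.

(** The inhomogeneous terms of the second derivative of a composite and of the
    transformed Christoffel symbols cancel. *)
Lemma hessian_gt i j x : V x ->
  hessian gt (fun y => v (phi y)) i j x =
  \sum_a \sum_b J x i a * J x j b * hessian g v a b (phi x).
Proof.
move=> Vx; have Ux := VU Vx; rewrite /hessian.
have -> : partial i (partial j (fun y => v (phi y))) x =
    \sum_c (Dm i J x j c * partial c v (phi x) +
            J x j c * \sum_a J x i a * partial a (partial c v) (phi x)).
  rewrite (@partial_near _ _ _ _ (fun y => \sum_c J y j c * partial c v (phi y))); last first.
    by apply: (open_eq_near oV Vx) => y Vy; rewrite partial_comp.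
  have dJ c : derivable (fun y => J y j c) x (ee i).
    by apply: (Ck_derivable (k := 0) (U := V) _ Vx); exact: MC_jac.
  have dv c : derivable (fun y => partial c v (phi y)) x (ee i).
    apply: (Ck_derivable (k := 0) (U := V) _ Vx).
    exact: (Ck_comp oU oV VU (Ck_partial c (Cv 2)) (Cphi 1)).
  rewrite partial_sum; last by move=> c; exact: derivableM.
  apply: eq_bigr => c _; rewrite (partialM (dJ c) (dv c)); congr (_ * _ + _ * _).
    by rewrite mxE.
  by apply: partial_comp => //; exact: Ck_partial.
have -> : \sum_k christoffel gt k i j x * partial k (fun y => v (phi y)) x =
   \sum_c (conn gt i x *m J x) j c * partial c v (phi x).
  under [RHS]eq_bigr do rewrite mxE mulr_suml.
  rewrite exchange_big; apply: eq_bigr => k _; rewrite partial_comp //.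
  by rewrite mulr_sumr; apply: eq_bigr => c _; rewrite connE mulrA.
rewrite conn_gt // -sumrB.
transitivity (\sum_c (J x j c * (\sum_a J x i a * partial a (partial c v) (phi x))
   - (J x *m B i x) j c * partial c v (phi x))).
  by apply: eq_bigr => c _; rewrite addmxE; ring.
rewrite sumrB.
transitivity (\sum_a \sum_b J x i a * J x j b * partial a (partial b v) (phi x)
   - \sum_a \sum_b J x i a * J x j b * \sum_c christoffel g c a b (phi x) * partial c v (phi x)).
  congr (_ - _).
    rewrite exchange_big; apply: eq_bigr => b _; rewrite mulr_sumr.
    by apply: eq_bigr => a _; ring.
  under eq_bigr do rewrite mxE mulr_suml.
  transitivity (\sum_c \sum_b \sum_a J x i a * J x j b * (christoffel g c a b (phi x) * partial c v (phi x))).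
    apply: eq_bigr => c _; apply: eq_bigr => b _.
    rewrite /B summxE mulr_sumr mulr_suml; apply: eq_bigr => a _.
    by rewrite -connE scalemxE; ring.
  rewrite exchange_big [RHS]exchange_big; apply: eq_bigr => b _.
  rewrite exchange_big; apply: eq_bigr => a _.
  by rewrite mulr_sumr.
rewrite -sumrB; apply: eq_bigr => a _; rewrite -sumrB; apply: eq_bigr => b _.
by rewrite mulrBr.
Qed.

(** Both equations are tensorial: [ricci_gt] and [hessian_gt] give the transformation of
    their terms. *)
Lemma static_gt x : V x -> static_at g v (phi x) -> static_at gt (fun y => v (phi y)) x.
Proof.
move=> Vx [E1 E2]; have Ux := VU Vx; split=> [i j|].
  rewrite ricci_gt // hessian_gt // gtE //.
  have -> : (J x *m g (phi x) *m (J x)^T) i j =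
      \sum_a \sum_b J x i a * J x j b * g (phi x) a b.
    rewrite mxE exchange_big; apply: eq_bigr => b _; rewrite !mxE mulr_suml.
    by apply: eq_bigr => a _; ring.
  rewrite !mulr_sumr -big_split; apply: eq_bigr => a _.
  rewrite !mulr_sumr -big_split; apply: eq_bigr => b _ /=.
  rewrite (mulrCA (v (phi x))^-1) -E1; ring.
rewrite -E2 /laplacian.
pose Hm : 'M[R]_n := \matrix_(a, b) hessian g v a b (phi x).
have HE i j : hessian gt (fun y => v (phi y)) i j x = (J x *m Hm *m (J x)^T) i j.
  rewrite hessian_gt // mxE exchange_big; apply: eq_bigr => b _; rewrite !mxE mulr_suml.
  by apply: eq_bigr => a _; rewrite !mxE; ring.
have trE (A C : 'M[R]_n) : \sum_i \sum_j A i j * C i j = \tr (A *m C^T).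
  apply: eq_bigr => i _; rewrite mxE; apply: eq_bigr => j _; by rewrite mxE.
transitivity (\tr (invmx (gt x) *m (J x *m Hm *m (J x)^T)^T)).
  rewrite -trE; apply: eq_bigr => i _; apply: eq_bigr => j _; by rewrite HE.
transitivity (\tr (invmx (g (phi x)) *m Hm^T)); last first.
  by rewrite -trE; apply: eq_bigr => i _; apply: eq_bigr => j _; rewrite mxE.
have uJ := Ju Vx; have ug := gu Ux.
have uJT : (J x)^T \in unitmx by rewrite unitmx_tr.
have -> : invmx (gt x) = invmx (J x)^T *m invmx (g (phi x)) *m invmx (J x).
  have EX : invmx (J x)^T *m invmx (g (phi x)) *m invmx (J x) *m gt x = 1%:M.
    by rewrite gtE // !mulmxA (mulmxKV uJ) (mulmxKV ug) mulVmx.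
  by rewrite -[LHS]mul1mx -EX mulmxK // gtu.
rewrite !trmx_mul trmxK -!mulmxA mulKmx // mxtrace_mulC -!mulmxA mulmxV // mulmx1.
by rewrite mxtrace_mulC.
Qed.

End Covariance.

(** * Reduction of the static equations in the variable s *)

Notation o0 := (@ord0 _ : 'I_(1 + _)).
Notation rr j := (@rshift 1 _ j).

Lemma lshift1 m (i : 'I_1) : lshift m i = o0 :> 'I_(1 + m).
Proof. by apply/val_inj; rewrite /= (ord1 i). Qed.

Lemma sum1m (V : nmodType) m (F : 'I_(1 + m) -> V) :
  \sum_i F i = F o0 + \sum_j F (rr j).
Proof. by rewrite big_split_ord big_ord1 lshift1. Qed.

Lemma partialZ (R : realType) n (i : 'I_n) (c : R) f x : derivable f x (ee i) ->
  partial i (fun y => c * f y) x = c * partial i f x.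
Proof. by move=> df; rewrite (partialM (derivable_cst c x _) df) partial_cst mul0r add0r. Qed.

Section Block.
Variables (R : nzRingType) (m : nat) (a : R) (D : 'M[R]_m).
Local Notation G := (block_mx a%:M 0 0 D : 'M[R]_(1 + m)).
Lemma blk00 : G o0 o0 = a.
Proof. by rewrite -(lshift1 m 0) block_mxEul mxE eqxx. Qed.
Lemma blk0r j : G o0 (rr j) = 0.
Proof. by rewrite -(lshift1 m 0) block_mxEur mxE. Qed.
Lemma blkr0 j : G (rr j) o0 = 0.
Proof. by rewrite -(lshift1 m 0) block_mxEdl mxE. Qed.
Lemma blkrr i j : G (rr i) (rr j) = D i j.
Proof. by rewrite block_mxEdr. Qed.
End Block.

Lemma oppmxE (V : zmodType) m n (A : 'M[V]_(m, n)) i j : (- A) i j = - A i j.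
Proof. by rewrite mxE. Qed.

Lemma sub1mxE (R : nzRingType) m (A : 'M[R]_m) i j : (A - 1%:M) i j = A i j - (i == j)%:R.
Proof. by rewrite !mxE. Qed.

Section ReducedOperators.
Context {R : realType} {m : nat}.
Local Notation pt := 'rV[R]_(1 + m).
Implicit Types (H : pt -> 'M[R]_m) (u f : pt -> R) (v : pt).

(** The Euler operator of [s]. Each [t d/dt] equals [2 theta], and all singular
    behaviour of the equations at [s = 0] is expressed by it. *)
Definition th f v : R := v 0 o0 * partial o0 f v.
Definition px (i : 'I_m) f := partial (rr i) f.
Definition Th a b (M : pt -> 'M[R]_(a, b)) v : 'M[R]_(a, b) := \matrix_(i, j) th (fun y => M y i j) v.

(** [chx], [ricx] and [hessx] are Christoffel symbols, Ricci tensor and Hessian of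
    the slices [s = const] with the metric [H]. *)
Definition chx H k i j v : R := 2^-1 * \sum_l invmx (H v) k l *
  (px i (fun y => H y j l) v + px j (fun y => H y i l) v - px l (fun y => H y i j) v).
Definition ricx H j l v : R := \sum_i
  (px i (chx H i l j) v - px l (chx H i i j) v
   + \sum_a (chx H i i a v * chx H a l j v - chx H i l a v * chx H a i j v)).
Definition hessx H f i j v : R := px i (px j f) v - \sum_k chx H k i j v * px k f v.
Definition Pm H v : 'M[R]_m := invmx (H v) *m Th H v.
Definition Ricx H v : 'M[R]_m := \matrix_(i, j) ricx H i j v.
Definition Hessx H f v : 'M[R]_m := \matrix_(i, j) hessx H f i j v.

(** The [00] component of [V Ric + n V g = Hess V], up to a nonzero factor; see
    [static_N0]. *)
Definition N0 H u v : R := th (th u) v - th u v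
  - u v * (2^-1 * \tr (Pm H v) + 4^-1 * \tr (Pm H v *m Pm H v)
           - 2^-1 * \tr (invmx (H v) *m Th (Th H) v)).
(** The scalar curvature equation [Scal g = n - n^2], which follows from the trace
    of the tensor equation and the equation for the Laplacian; unlike the components of
    the tensor equation it does not involve [u]. *)
Definition NS H v : R := 4 * \tr (invmx (H v) *m Th (Th H) v)
  - 3 * \tr (Pm H v *m Pm H v) - 2 * (m%:R + 1) * \tr (Pm H v)
  - v 0 o0 * \tr (invmx (H v) *m Ricx H v) + \tr (Pm H v) ^+ 2.
(** The tangential components of [V Ric + n V g = Hess V], up to a nonzero factor.
    *)
Definition NE H u v : 'M[R]_m :=
  u v *: ((-2) *: Th (Th H) v + (m%:R + 1) *: Th H v + 2 *: (Th H v *m Pm H v)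
     + \tr (Pm H v) *: H v - \tr (Pm H v) *: Th H v + v 0 o0 *: Ricx H v)
  + (2 * th u v) *: H v - (2 * th u v) *: Th H v - v 0 o0 *: Hessx H u v.
End ReducedOperators.

Section BlockMetric.
Context {R : realType} {m : nat}.
Local Notation pt := 'rV[R]_(1 + m).
Variables (V : set pt) (H : pt -> 'M[R]_m) (g : pt -> 'M[R]_(1 + m)).
Hypotheses (oV : open V) (Vpos : forall v, V v -> 0 < v 0 o0).
Hypothesis CH : forall k, MC k V H.
Hypothesis Hs : forall v, V v -> (H v)^T = H v.
Hypothesis Hu : forall v, V v -> H v \in unitmx.
Hypothesis gE : forall v, V v -> g v =
  block_mx ((4 * v 0 o0 ^+ 2)^-1)%:M 0 0 ((v 0 o0)^-1 *: H v).

Let s (v : pt) : R := v 0 o0.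

Lemma s_neq0 v : V v -> s v != 0. Proof. by move=> /Vpos; rewrite lt0r => /andP[]. Qed.

Lemma g00 v : V v -> g v o0 o0 = (4 * s v ^+ 2)^-1.
Proof. by move=> Vv; rewrite gE // blk00. Qed.
Lemma g0r v j : V v -> g v o0 (rr j) = 0.
Proof. by move=> Vv; rewrite gE // blk0r. Qed.
Lemma gr0 v j : V v -> g v (rr j) o0 = 0.
Proof. by move=> Vv; rewrite gE // blkr0. Qed.
Lemma grr v i j : V v -> g v (rr i) (rr j) = (s v)^-1 * H v i j.
Proof. by move=> Vv; rewrite gE // blkrr mxE. Qed.

Let gi v : 'M[R]_(1 + m) := block_mx (4 * s v ^+ 2)%:M 0 0 (s v *: invmx (H v)).

Lemma gu v : V v -> g v \in unitmx /\ invmx (g v) = gi v.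
Proof.
move=> Vv; have E : g v *m gi v = 1%:M.
  rewrite gE // mulmx_block !mulmx0 !mul0mx !addr0 !add0r -scalar_mxM mulVf; last first.
    by rewrite mulf_neq0 ?pnatr_eq0 ?expf_neq0 ?s_neq0.
  rewrite -scalemxAl -scalemxAr scalerA mulVf ?s_neq0 // scale1r mulmxV ?Hu //.
  by rewrite -scalar_mx_block.
have [ug _] := mulmx1_unit E; split=> //.
by rewrite -[LHS]mulmx1 -E mulKmx.
Qed.

Lemma gi00 v : V v -> invmx (g v) o0 o0 = 4 * s v ^+ 2.
Proof. by move=> /gu[_ ->]; rewrite /gi blk00. Qed.
Lemma gi0r v j : V v -> invmx (g v) o0 (rr j) = 0.
Proof. by move=> /gu[_ ->]; rewrite /gi blk0r. Qed.
Lemma gir0 v j : V v -> invmx (g v) (rr j) o0 = 0.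
Proof. by move=> /gu[_ ->]; rewrite /gi blkr0. Qed.
Lemma girr v i j : V v -> invmx (g v) (rr i) (rr j) = s v * invmx (H v) i j.
Proof. by move=> /gu[_ ->]; rewrite /gi blkrr mxE. Qed.

Lemma Cs k : Ck k V s. Proof. exact: Ck_coord. Qed.
Lemma CsV k : Ck k V (fun v => (s v)^-1).
Proof. by apply: CkV => //; [exact: s_neq0|exact: Cs]. Qed.

Lemma ps_0 v : partial o0 s v = 1. Proof. by rewrite partial_coord eqxx. Qed.
Lemma ps_r v i : partial (rr i) s v = 0.
Proof. by rewrite partial_coord. Qed.

Lemma psV_0 v : V v -> partial o0 (fun v => (s v)^-1) v = - (s v)^-2.
Proof.
move=> Vv; rewrite partialV ?s_neq0 ?ps_0 ?mulr1 //.
exact: (Ck_derivable (Cs 1) Vv).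
Qed.
Lemma psV_r v i : V v -> partial (rr i) (fun v => (s v)^-1) v = 0.
Proof.
move=> Vv; rewrite partialV ?s_neq0 ?ps_r ?mulr0 //.
exact: (Ck_derivable (Cs 1) Vv).
Qed.

Lemma eqV_partial k (f f' : pt -> R) v : V v -> (forall v, V v -> f v = f' v) ->
  partial k f v = partial k f' v.
Proof. by move=> Vv E; apply: partial_near; exact: (open_eq_near oV Vv). Qed.

Lemma dV (f : pt -> R) v k : V v -> Ck 1 V f -> derivable f v (ee k).
Proof. by move=> Vv Cf; exact: Ck_derivable Cf Vv. Qed.

Lemma pg00_0 v : V v -> partial o0 (fun y => g y o0 o0) v = - (2^-1 * (s v)^-1 ^+ 3).
Proof.
move=> Vv; rewrite (@eqV_partial _ _ (fun v => 4^-1 * ((s v)^-1 * (s v)^-1))) //; last first.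
  by move=> y Vy; rewrite g00 // invfM expr2 invfM.
have d := @dV _ _ o0 Vv (CsV 1).
have s0 := s_neq0 Vv.
rewrite (partialZ _ (derivableM d d)) (partialM d d) psV_0 //.
by field.
Qed.
Lemma pg00_r v i : V v -> partial (rr i) (fun y => g y o0 o0) v = 0.
Proof.
move=> Vv; rewrite (@eqV_partial _ _ (fun v => 4^-1 * ((s v)^-1 * (s v)^-1))) //; last first.
  by move=> y Vy; rewrite g00 // invfM expr2 invfM.
have d := @dV _ _ (rr i) Vv (CsV 1).
rewrite (partialZ _ (derivableM d d)) (partialM d d) psV_r //.
by rewrite !(mul0r, mulr0, addr0).
Qed.
Lemma pg0r v k j : V v -> partial k (fun y => g y o0 (rr j)) v = 0.
Proof.
move=> Vv; rewrite (@eqV_partial _ _ (fun=> 0)) ?partial_cst // => y Vy.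
by rewrite g0r.
Qed.
Lemma pgr0 v k j : V v -> partial k (fun y => g y (rr j) o0) v = 0.
Proof.
move=> Vv; rewrite (@eqV_partial _ _ (fun=> 0)) ?partial_cst // => y Vy.
by rewrite gr0.
Qed.
Lemma pgrr_0 v i j : V v -> partial o0 (fun y => g y (rr i) (rr j)) v =
  (s v)^-2 * (th (fun y => H y i j) v - H v i j).
Proof.
move=> Vv; rewrite (@eqV_partial _ _ (fun v => (s v)^-1 * H v i j)) //; last first.
  by move=> y Vy; rewrite grr.
rewrite partialM ?psV_0 //; [|exact: (dV Vv (CsV 1))|exact: (dV Vv (CH 1 i j))].
rewrite /th -/(s v); have := s_neq0 Vv => s0; by field.
Qed.
Lemma pgrr_r v k i j : V v -> partial (rr k) (fun y => g y (rr i) (rr j)) v =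
  (s v)^-1 * px k (fun y => H y i j) v.
Proof.
move=> Vv; rewrite (@eqV_partial _ _ (fun v => (s v)^-1 * H v i j)) //; last first.
  by move=> y Vy; rewrite grr.
rewrite partialM ?psV_r //; [|exact: (dV Vv (CsV 1))|exact: (dV Vv (CH 1 i j))].
by rewrite mul0r add0r.
Qed.

Local Notation Ga := (christoffel g).
Let Bm v i j : R := 2 * H v i j - 2 * th (fun y => H y i j) v.
Let Q v i j : R := 2^-1 * (s v)^-1 * (Pm H v i j - (i == j)%:R).

Lemma Ga_000 v : V v -> Ga o0 o0 o0 v = - (s v)^-1.
Proof.
move=> Vv; rewrite /christoffel sum1m big1 => [|l _]; last by rewrite gi0r // mul0r.
rewrite gi00 // !pg00_0 //; have := s_neq0 Vv => s0; by field.
Qed.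
Lemma Ga_00r v j : V v -> Ga o0 o0 (rr j) v = 0.
Proof.
move=> Vv; rewrite /christoffel sum1m big1 => [|l _]; last by rewrite gi0r // mul0r.
by rewrite pg00_r // pgr0 // pg0r //; ring.
Qed.
Lemma Ga_0r0 v j : V v -> Ga o0 (rr j) o0 v = 0.
Proof.
move=> Vv; rewrite /christoffel sum1m big1 => [|l _]; last by rewrite gi0r // mul0r.
by rewrite pg00_r // pgr0 //; ring.
Qed.
Lemma Ga_0rr v i j : V v -> Ga o0 (rr i) (rr j) v = Bm v i j.
Proof.
move=> Vv; rewrite /christoffel sum1m big1 => [|l _]; last by rewrite gi0r // mul0r.
rewrite gi00 // !pgr0 // pgrr_0 // /Bm; have := s_neq0 Vv => s0; by field.
Qed.
Lemma Ga_r00 v k : V v -> Ga (rr k) o0 o0 v = 0.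
Proof.
move=> Vv; rewrite /christoffel sum1m big1 => [|l _].
  by rewrite gir0 // mul0r addr0 mulr0.
by rewrite pg0r // pg00_r //; ring.
Qed.
Lemma Hsym v i j : V v -> H v i j = H v j i.
Proof. by move=> Vv; rewrite -{1}(Hs Vv) mxE. Qed.
Lemma PmE v k j : V v -> Pm H v k j = \sum_l invmx (H v) k l * th (fun y => H y j l) v.
Proof.
move=> Vv; rewrite mxE; apply: eq_bigr => l _; rewrite mxE /th; congr (_ * (_ * _)).
by apply: eqV_partial => // y Vy; exact: Hsym.
Qed.
Lemma delE v k j : V v -> (k == j)%:R = \sum_l invmx (H v) k l * H v j l.
Proof.
move=> Vv; have := mulVmx (Hu Vv) => /matrixP /(_ k j); rewrite !mxE => <-.
by apply: eq_bigr => l _; congr (_ * _); exact: Hsym.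
Qed.
Lemma Ga_r0r v k j : V v -> Ga (rr k) o0 (rr j) v = Q v k j.
Proof.
move=> Vv; rewrite /christoffel sum1m gir0 // mul0r add0r /Q (PmE _ _ Vv) (delE _ _ Vv).
rewrite -sumrB -mulrA [in RHS]mulr_sumr; congr (_ * _); apply: eq_bigr => l _.
rewrite girr // pgrr_0 // !pg0r //; have := s_neq0 Vv => s0; by field.
Qed.
Lemma Ga_rr0 v k j : V v -> Ga (rr k) (rr j) o0 v = Q v k j.
Proof.
move=> Vv; rewrite /christoffel sum1m gir0 // mul0r add0r /Q (PmE _ _ Vv) (delE _ _ Vv).
rewrite -sumrB -mulrA [in RHS]mulr_sumr; congr (_ * _); apply: eq_bigr => l _.
rewrite girr // pgrr_0 // pg0r // pgr0 //; have := s_neq0 Vv => s0; by field.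
Qed.
Lemma Ga_rrr v k i j : V v -> Ga (rr k) (rr i) (rr j) v = chx H k i j v.
Proof.
move=> Vv; rewrite /christoffel sum1m gir0 // mul0r add0r /chx; congr (_ * _).
apply: eq_bigr => l _; rewrite girr // !pgrr_r //; have := s_neq0 Vv => s0; by field.
Qed.


Lemma CPm k : MC k V (Pm H).
Proof.
apply: MC_M => //; first exact: MC_inv.
move=> i j; apply: (@Ck_ext _ _ _ _ (fun y => s y * partial o0 (fun z => H z i j) y)) => //.
  by move=> y _; rewrite mxE.
exact: (CkM oV (Cs k) (Ck_partial o0 (CH k.+1 i j))).
Qed.

Lemma QE v i j : Q v i j = 2^-1 * (s v)^-1 * (Pm H v - 1%:M) i j.
Proof. by rewrite /Q sub1mxE. Qed.

Lemma riem_up_kk i j k v : riem_up g i j k k v = 0.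
Proof. by rewrite /riem_up subrr add0r big1 // => a _; rewrite subrr. Qed.

Lemma pQ v k : V v -> partial o0 (fun v => Q v k k) v =
  - Q v k k / s v + 2^-1 * (s v)^-2 * th (fun y => Pm H y k k) v.
Proof.
move=> Vv; rewrite /Q.
have d1 := @dV _ _ o0 Vv (CsV 1).
have d2 : derivable (fun y => Pm H y k k - (k == k)%:R) v (ee o0).
  by apply: derivableB; [apply: dV Vv (CPm 1 k k)|exact: derivable_cst].
have -> : (fun v => 2^-1 / s v * (Pm H v k k - (k == k)%:R)) =
   (fun v => 2^-1 * ((s v)^-1 * (Pm H v k k - (k == k)%:R))).
  by apply/funext => y; rewrite mulrA.
rewrite (partialZ _ (derivableM d1 d2)) (partialM d1 d2) psV_0 //.
rewrite (partialB (dV (k := o0) Vv (CPm 1 k k)) (derivable_cst _ _ _)) partial_cst.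
rewrite /th -/(s v); have s0 := s_neq0 Vv; by field.
Qed.

(** With [P = H^-1 theta H] the normal connection coefficients of the slices are [(P
    - 1) / (2 s)], and this is the trace of their Riccati equation. *)
Lemma ricci_00 v : V v -> s v ^+ 2 * ricci g o0 o0 v =
  - (2^-1 * \sum_k th (fun y => Pm H y k k) v)
  - 4^-1 * \tr ((Pm H v - 1%:M) *m (Pm H v - 1%:M)).
Proof.
move=> Vv; rewrite /ricci sum1m riem_up_kk add0r mulr_sumr /mxtrace mulr_sumr -sumrN.
rewrite mulr_sumr -sumrB; apply: eq_bigr => k _.
rewrite /riem_up (@eqV_partial _ _ (fun=> 0) _ Vv) ?partial_cst; last by move=> y Vy; exact: Ga_r00.
rewrite (@eqV_partial _ _ (fun v => Q v k k) _ Vv); last by move=> y Vy; exact: Ga_rr0.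
rewrite pQ // sum1m Ga_r00 // Ga_rr0 // Ga_000 // mul0r subr0.
rewrite (eq_bigr (fun l => - (4^-1 * (s v)^-2 * ((Pm H v - 1%:M) k l * (Pm H v - 1%:M) l k)))); last first.
  move=> l _; rewrite Ga_r00 // mulr0 sub0r Ga_r0r // Ga_rr0 // !QE.
  by have s0 := s_neq0 Vv; field.
rewrite sumrN -mulr_sumr mxE; have s0 := s_neq0 Vv.
set S := \sum_(i < m) _; set t := th _ _; by field.
Qed.

(** The traced Gauss equation for the slices. *)
Lemma ricci_rr v i j : V v -> s v * ricci g (rr i) (rr j) v =
  s v * ricx H i j v + s v * partial o0 (fun y => Bm y i j) v - Bm v i j
  - 2^-1 * \sum_l Bm v j l * (Pm H v - 1%:M) l i
  + 2^-1 * \tr (Pm H v - 1%:M) * Bm v i j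
  - 2^-1 * \sum_l Bm v i l * (Pm H v - 1%:M) l j.
Proof.
move=> Vv; have s0 := s_neq0 Vv.
have Bsym y a b : V y -> Bm y a b = Bm y b a.
  move=> Vy; rewrite /Bm (Hsym a b Vy); congr (_ - _ * (_ * _)).
  by apply: eqV_partial => // z Vz; exact: Hsym.
have BE y a b : V y -> Ga o0 (rr a) (rr b) y = Bm y b a by move=> Vy; rewrite Ga_0rr // Bsym.
rewrite /ricci sum1m {1}/riem_up.
rewrite (@eqV_partial _ _ (fun v => Bm v i j) _ Vv); last by move=> y Vy; exact: BE.
rewrite (@eqV_partial (rr j) _ (fun=> 0) _ Vv) ?partial_cst; last by move=> y Vy; exact: Ga_00r.
rewrite sum1m Ga_000 // BE // Ga_0r0 // mul0r.
rewrite (eq_bigr (fun l => - (2^-1 * (s v)^-1 * (Bm v j l * (Pm H v - 1%:M) l i)))); last first.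
  by move=> l _; rewrite Ga_00r // Ga_0rr // Ga_r0r // QE; field.
rewrite sumrN -mulr_sumr.
have E k : riem_up g (rr k) (rr i) (rr k) (rr j) v =
   (px k (chx H k j i) v - px j (chx H k k i) v
   + \sum_a (chx H k k a v * chx H a j i v - chx H k j a v * chx H a k i v))
   + (2^-1 * (s v)^-1 * ((Pm H v - 1%:M) k k * Bm v i j))
   - (2^-1 * (s v)^-1 * (Bm v i k * (Pm H v - 1%:M) k j)).
  rewrite /riem_up.
  rewrite (@eqV_partial _ _ (chx H k j i) _ Vv); last by move=> y Vy; exact: Ga_rrr.
  rewrite (@eqV_partial (rr j) _ (chx H k k i) _ Vv); last by move=> y Vy; exact: Ga_rrr.
  rewrite sum1m Ga_rr0 // BE // Ga_rr0 // BE //.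
  rewrite (eq_bigr (fun a => chx H k k a v * chx H a j i v - chx H k j a v * chx H a k i v)); last first.
    by move=> a _; rewrite !Ga_rrr.
  rewrite !QE /px.
  have alg (p q S c a b d e : R) :
    p - q + (c * a * b - c * d * e + S) = p - q + S + c * (a * b) - c * (e * d) by ring.
  exact: alg.
rewrite (eq_bigr _ (fun k _ => E k)) sumrB big_split /= -!mulr_sumr -mulr_suml.
rewrite -/(ricx H i j v) -/(\tr (Pm H v - 1%:M)).
set S1 := \sum_(k < m) _; set S2 := \sum_(k < m) _; set r := ricx _ _ _ _; set T := \tr _.
set p := partial _ _ _; by field.
Qed.


Lemma ThE a b (M : pt -> 'M[R]_(a, b)) v : Th M v = s v *: Dm o0 M v.
Proof. by apply/matrixP => i j; rewrite !mxE. Qed.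

Lemma MC_Th k a b (M : pt -> 'M[R]_(a, b)) : MC k.+1 V M -> MC k V (Th M).
Proof.
move=> HM; apply: (@MC_ext _ _ _ _ _ _ (fun v => s v *: Dm o0 M v)) => //.
  by move=> v _; rewrite ThE.
by apply: MC_Z => //; [exact: Cs|exact: MC_Dm].
Qed.

Lemma HPm v : V v -> H v *m Pm H v = Th H v.
Proof. by move=> Vv; rewrite /Pm mulmxA mulmxV ?mul1mx // Hu. Qed.

Lemma ThPm v : V v -> Th (Pm H) v = invmx (H v) *m Th (Th H) v - Pm H v *m Pm H v.
Proof.
move=> Vv; have uH := Hu Vv.
have E : Th H v *m Pm H v + H v *m Th (Pm H) v = Th (Th H) v.
  rewrite [Th (Th H) v]ThE -(@Dm_ext _ _ _ _ o0 V (fun v => H v *m Pm H v)) //; last first.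
    exact: HPm.
  by rewrite (DmM o0 (CH 1) (CPm 1) Vv) scalerDr scalemxAl scalemxAr -!ThE.
by rewrite -E mulmxDr mulmxA -/(Pm H v) addrAC subrr add0r mulmxA mulVmx // mul1mx.
Qed.

Let B v : 'M[R]_m := 2 *: H v - 2 *: Th H v.

Lemma BmE v i j : Bm v i j = B v i j.
Proof. by rewrite /B !(addmxE, scalemxE, oppmxE) [Th H v i j]mxE. Qed.

Lemma BP v : V v -> B v *m (Pm H v - 1%:M) =
  4 *: Th H v - 2 *: H v - 2 *: (Th H v *m Pm H v).
Proof.
move=> Vv; rewrite mulmxBr mulmx1 mulmxBl -!scalemxAl HPm // /B.
by apply/matrixP => i j; rewrite !(addmxE, scalemxE, oppmxE); ring.
Qed.

Lemma ThHs v : V v -> (Th H v)^T = Th H v.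
Proof.
move=> Vv; apply/matrixP => i j; rewrite [LHS]mxE [LHS]mxE [RHS]mxE /th; congr (_ * _).
by apply: eqV_partial => // y Vy; exact: Hsym.
Qed.

Lemma BPs v : V v -> (B v *m (Pm H v - 1%:M))^T = B v *m (Pm H v - 1%:M).
Proof.
move=> Vv; rewrite BP // !linearB !linearZ /= trmx_mul /Pm trmx_mul ThHs // Hs //.
by rewrite trmx_inv Hs // mulmxA.
Qed.

Lemma trP1 v : \tr (Pm H v - 1%:M) = \tr (Pm H v) - m%:R.
Proof. by rewrite raddfB /= mxtrace1. Qed.

(** The spatial part of [s * (Ric + n g)]. *)
Let X v : 'M[R]_m := s v *: Ricx H v - 2 *: Th (Th H) v + 2 *: (Th H v *m Pm H v)
   + (\tr (Pm H v) - m%:R) *: (H v - Th H v) + (m%:R + 1) *: H v.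

Lemma ricci_X v i j : V v ->
  s v * (ricci g (rr i) (rr j) v + (1 + m)%:R * g v (rr i) (rr j)) = X v i j.
Proof.
move=> Vv; have s0 := s_neq0 Vv; rewrite mulrDr ricci_rr // grr //.
have E1 : \sum_l Bm v j l * (Pm H v - 1%:M) l i = (B v *m (Pm H v - 1%:M)) i j.
  rewrite -[in RHS](BPs Vv) [RHS]mxE [RHS]mxE; apply: eq_bigr => l _; by rewrite BmE.
have E2 : \sum_l Bm v i l * (Pm H v - 1%:M) l j = (B v *m (Pm H v - 1%:M)) i j.
  rewrite [RHS]mxE; apply: eq_bigr => l _; by rewrite BmE.
rewrite E1 E2 BP // trP1.
have -> : partial o0 (fun y => Bm y i j) v = 2 * partial o0 (fun y => H y i j) v
    - 2 * partial o0 (fun y => Th H y i j) v.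
  have d1 := @dV _ _ o0 Vv (CH 1 i j); have d2 := @dV _ _ o0 Vv (MC_Th (CH 2) i j).
  have dZ (f : pt -> R) : derivable f v (ee o0) -> derivable (fun y => 2 * f y) v (ee o0).
    by move=> df; exact: (derivableM (derivable_cst _ _ _) df).
  rewrite -(partialZ 2 d1) -(partialZ 2 d2) -(partialB (dZ _ d1) (dZ _ d2)).
  by apply: eqV_partial => // y _; rewrite /Bm [Th H y i j]mxE.
rewrite /Bm /X !(addmxE, scalemxE, oppmxE).
rewrite [Ricx H v i j]mxE [Th H v i j]mxE [Th (Th H) v i j]mxE natrD.
rewrite /th -/(s v) -/(th (fun y => H y i j)).
set a := ricx _ _ _ _; set b := partial _ _ _; set c := partial _ _ _.
set d := (_ *m _) i j; set T := \tr _; set h := H v i j.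
by field.
Qed.


Variables (u w : pt -> R).
Hypotheses (Cu : forall k, Ck k V u) (Cw : forall k, Ck k V w).
Hypotheses (u0 : forall v, V v -> u v != 0) (w0 : forall v, V v -> w v != 0).
Hypothesis w_0 : forall v, V v -> partial o0 w v = - (2^-1 * (s v)^-1 * w v).
Hypothesis w_r : forall v i, V v -> partial (rr i) w v = 0.

Let F v := w v * u v.

Lemma pF0 v : V v -> partial o0 F v = w v * ((s v)^-1 * (th u v - 2^-1 * u v)).
Proof.
move=> Vv; rewrite (partialM (dV (k := o0) Vv (Cw 1)) (dV (k := o0) Vv (Cu 1))) w_0 //.
rewrite /th -/(s v); have s0 := s_neq0 Vv; by field.
Qed.

Lemma pFr v i : V v -> partial (rr i) F v = w v * px i u v.
Proof.
move=> Vv; rewrite (partialM (dV (k := rr i) Vv (Cw 1)) (dV (k := rr i) Vv (Cu 1))) w_r //.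
by rewrite mul0r add0r.
Qed.

Lemma hess_00 v : V v -> hessian g F o0 o0 v =
  w v * ((s v)^-2 * (th (th u) v - th u v + 4^-1 * u v)).
Proof.
move=> Vv; have s0 := s_neq0 Vv; rewrite /hessian sum1m Ga_000 // pF0 // big1 ?addr0; last first.
  by move=> k _; rewrite Ga_r00 // mul0r.
have Ct : Ck 1 V (th u) := CkM oV (Cs 1) (Ck_partial o0 (Cu 2)).
have dt := @dV _ _ o0 Vv Ct; have du := @dV _ _ o0 Vv (Cu 1).
have dc : derivable (fun y => 2^-1 * u y) v (ee o0) := derivableM (derivable_cst _ _ _) du.
have d2 : derivable (fun y => th u y - 2^-1 * u y) v (ee o0) := derivableB dt dc.
have d1 := @dV _ _ o0 Vv (CsV 1).
rewrite (@eqV_partial _ _ (fun v => w v * ((s v)^-1 * (th u v - 2^-1 * u v))) _ Vv); last exact: pF0.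
have d12 : derivable (fun y => (s y)^-1 * (th u y - 2^-1 * u y)) v (ee o0) := derivableM d1 d2.
rewrite (partialM (dV (k := o0) Vv (Cw 1)) d12) (partialM d1 d2).
rewrite (partialB dt dc) (partialZ _ du) psV_0 // w_0 //.
have -> : partial o0 (th u) v = (s v)^-1 * th (th u) v.
  by rewrite {3}/th -/(s v) mulrA mulVf // mul1r.
have -> : partial o0 u v = (s v)^-1 * th u v.
  by rewrite /th -/(s v) mulrA mulVf // mul1r.
set a := th (th u) v; set b := th u v; by field.
Qed.

Lemma hess_rr v i j : V v -> hessian g F (rr i) (rr j) v =
  w v * (hessx H u i j v - Bm v i j * ((s v)^-1 * (th u v - 2^-1 * u v))).
Proof.
move=> Vv; rewrite /hessian sum1m Ga_0rr // pF0 //.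
rewrite (eq_bigr (fun k => w v * (chx H k i j v * px k u v))); last first.
  by move=> k _; rewrite Ga_rrr // pFr // mulrCA.
rewrite (@eqV_partial _ _ (fun v => w v * px j u v) _ Vv); last by move=> y Vy; exact: pFr.
rewrite (partialM (dV (k := rr i) Vv (Cw 1)) (dV (k := rr i) Vv (Ck_partial (rr j) (Cu 2)))) w_r //.
rewrite -mulr_sumr /hessx /px; set S := \sum_(k < m) _.
set p := partial _ (partial _ _) _; by ring.
Qed.

Lemma static_N0 v : V v -> static_at g F v -> N0 H u v = 0.
Proof.
move=> Vv [E _]; have s0 := s_neq0 Vv; have uv := u0 Vv; have wv := w0 Vv.
have := congr1 (fun z => s v ^+ 2 * z) (E o0 o0).
rewrite mulrDr ricci_00 // hess_00 // g00 // /F.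
have -> : \sum_k th (fun y => Pm H y k k) v =
    \tr (invmx (H v) *m Th (Th H) v) - \tr (Pm H v *m Pm H v).
  by rewrite -raddfB /= -ThPm //; apply: eq_bigr => k _; rewrite mxE.
have -> : \tr ((Pm H v - 1%:M) *m (Pm H v - 1%:M)) =
    \tr (Pm H v *m Pm H v) - 2 * \tr (Pm H v) + m%:R.
  rewrite mulmxBr mulmxBl !mulmx1 mul1mx !raddfB /= mxtrace1; ring.
rewrite /N0; set a := th (th u) v; set b := th u v.
set T2 := \tr (_ *m Th _ _); set T1 := \tr (Pm H v *m _); set T := \tr (Pm H v).
rewrite natrD => E'.
have : u v * (- (2^-1 * (T2 - T1)) - 4^-1 * (T1 - 2 * T + m%:R) + s v ^+ 2 * ((1 + m%:R) * (4 * s v ^+ 2)^-1))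
   = a - b + 4^-1 * u v by rewrite E'; field; rewrite s0 uv wv.
have -> : s v ^+ 2 * ((1 + m%:R) * (4 * s v ^+ 2)^-1) = (1 + m%:R) / 4 by field.
move=> E2; rewrite (_ : a - b = u v * (- (2^-1 * (T2 - T1)) - 4^-1 * (T1 - 2 * T + m%:R) + (1 + m%:R) / 4) - 4^-1 * u v).
  by field.
by rewrite E2 addrK.
Qed.

Lemma static_NE v : V v -> static_at g F v -> NE H u v = 0.
Proof.
move=> Vv [E _]; have s0 := s_neq0 Vv; have uv := u0 Vv; have wv := w0 Vv.
apply/matrixP => i j; rewrite [RHS]mxE.
have := congr1 (fun z => u v * (s v * z)) (E (rr i) (rr j)).
rewrite ricci_X // hess_rr // /F.
have -> : u v * (s v * ((w v * u v)^-1 * (w v * (hessx H u i j v -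
    Bm v i j * ((s v)^-1 * (th u v - 2^-1 * u v)))))) =
    s v * hessx H u i j v - Bm v i j * (th u v - 2^-1 * u v).
  by field; rewrite s0 uv wv.
rewrite BmE /B /X /NE !(addmxE, scalemxE, oppmxE) [Hessx H u v i j]mxE -/(s v).
set a := hessx _ _ _ _ _; set b := th u v; set T := \tr _.
set c := (_ *m _) i j; set d := Ricx _ _ _ _; set e := Th (Th H) v i j.
set f := Th H v i j; set h := H v i j; set x := u v => E'.
transitivity (x * (s v * d - 2 * e + 2 * c + (T - m%:R) * (h - f) + (m%:R + 1) * h)
  - (s v * a - (2 * h - 2 * f) * (b - 2^-1 * x))); last by rewrite E' subrr.
by field.
Qed.

Lemma static_NS v : V v -> static_at g F v -> NS H v = 0.
Proof.
move=> Vv SA; have [E L] := SA; have s0 := s_neq0 Vv; have uv := u0 Vv; have wv := w0 Vv.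
have Fv : F v != 0 by rewrite mulf_neq0.
have HE i j : hessian g F i j v = F v * (ricci g i j v + (1 + m)%:R * g v i j).
  by rewrite E mulrA mulfV // mul1r.
move: L; rewrite /laplacian sum1m [X in X + _]sum1m [X in _ + X + _]big1 ?addr0; last first.
  by move=> j _; rewrite gi0r // mul0r.
rewrite (eq_bigr (fun i => F v * \sum_j invmx (H v) i j * X v i j)); last first.
  move=> i _; rewrite sum1m gir0 // mul0r add0r mulr_sumr; apply: eq_bigr => j _.
  by rewrite girr // HE -ricci_X //; ring.
rewrite -mulr_sumr gi00 //.
have trE (A C : 'M[R]_m) : A^T = A -> \sum_i \sum_j A i j * C i j = \tr (A *m C).
  move=> As; rewrite exchange_big; apply: eq_bigr => i _; rewrite mxE.
  by apply: eq_bigr => j _; rewrite -{1}As mxE.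
rewrite trE; last by rewrite trmx_inv Hs.
rewrite HE mulrCA -mulrDr (mulrC _ (F v)) => /(mulfI Fv).
have := HE o0 o0; rewrite hess_00 // /F => /(congr1 (fun z => 4 * s v ^+ 2 * (w v)^-1 * z)).
have -> : 4 * s v ^+ 2 / w v * (w v * (s v ^- 2 * (th (th u) v - th u v + 4^-1 * u v))) =
  4 * (th (th u) v - th u v + 4^-1 * u v) by field; rewrite s0 wv.
have := static_N0 Vv SA; rewrite /N0 => /(canRL (subrK _)); rewrite add0r => ->.
move=> E1.
have {}E1 : 4 * s v ^+ 2 * (ricci g o0 o0 v + (1 + m)%:R * g v o0 o0) =
    4 * (2^-1 * \tr (Pm H v) + 4^-1 * \tr (Pm H v *m Pm H v)
           - 2^-1 * \tr (invmx (H v) *m Th (Th H) v) + 4^-1).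
  apply: (mulfI uv); apply: etrans (_ : _ = 4 * s v ^+ 2 / w v *
     (w v * u v * (ricci g o0 o0 v + (1 + m)%:R * g v o0 o0))) _.
    by field.
  by rewrite -E1; ring.
have tD (A C : 'M[R]_m) : \tr (invmx (H v) *m (A + C)) = \tr (invmx (H v) *m A) + \tr (invmx (H v) *m C).
  by rewrite mulmxDr raddfD.
have tZ c (A : 'M[R]_m) : \tr (invmx (H v) *m (c *: A)) = c * \tr (invmx (H v) *m A).
  by rewrite -scalemxAr mxtraceZ.
have tN (A : 'M[R]_m) : \tr (invmx (H v) *m (- A)) = - \tr (invmx (H v) *m A).
  by rewrite mulmxN raddfN.
have tH : \tr (invmx (H v) *m H v) = m%:R by rewrite mulVmx ?Hu // mxtrace1.
have tP : \tr (invmx (H v) *m (Th H v *m Pm H v)) = \tr (Pm H v *m Pm H v) by rewrite mulmxA.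
have tQ : \tr (invmx (H v) *m Th H v) = \tr (Pm H v) by [].
rewrite E1 /X !(tD, tZ, tN) tH tP tQ /NS -/(s v) natrD.
set T2 := \tr (invmx _ *m Th _ _); set T1 := \tr (Pm H v *m _); set T := \tr (Pm H v).
set S := \tr (invmx _ *m _) => E2.
transitivity ((1 + m%:R) - (4 * (2^-1 * T + 4^-1 * T1 - 2^-1 * T2 + 4^-1) +
  (s v * S - 2 * T2 + 2 * T1 + (T - m%:R) * (m%:R - T) + (m%:R + 1) * m%:R))).
  by field.
by rewrite E2 subrr.
Qed.

End BlockMetric.

(** * Germs at the boundary and Euler operators *)

(** Smoothness across [s = 0] at boundary points, as opposed to [sm] below. *)
Definition smooth_at (R : realType) n (f : 'rV[R]_n -> R) (v : 'rV[R]_n) :=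
  exists U : set 'rV[R]_n, [/\ open U, U v & forall k, Ck k U f].

Lemma min_lel (R : realType) (x y : R) : Num.min x y <= x. Proof. by rewrite ge_min lexx. Qed.
Lemma min_ler (R : realType) (x y : R) : Num.min x y <= y. Proof. by rewrite ge_min lexx orbT. Qed.

Section Germ.
Context {R : realType} {m : nat}.
Local Notation pt := 'rV[R]_(1 + m).
Variable p : pt.
Implicit Types (v : pt) (f g : pt -> R).
Hypothesis p0 : p 0 o0 = 0.

(** Half-boxes around the boundary point [p]: the part [s > 0] of a ball. *)
Definition hb (r : R) : set pt := [set v | ball p r v /\ 0 < v 0 o0].
(** [ev P] is the filter of half-neighbourhoods of [p]. *)
Definition ev (P : pt -> Prop) := exists2 r, 0 < r & forall v, hb r v -> P v.
(** Smooth for [s > 0] near [p], with no control at [s = 0]. *)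
Definition sm (f : pt -> R) := exists2 r, 0 < r & forall k, Ck k (hb r) f.
Definition bO0 (a : R) (f : pt -> R) := exists C, ev (fun v : pt => `|f v| <= C * v 0 o0 `^ a).
Fixpoint bO (r : nat) (a : R) (f : pt -> R) : Prop :=
  bO0 a f /\ if r is r'.+1 then forall i, bO r' a (px i f) else True.
(** [bO r a f] asks for [O(s^a)] for all tangential derivatives of [f] up to order
    [r], uniformly in the tangential variables; transversal derivatives are controlled
    separately through [theta]. *)
Definition G r a f := sm f /\ bO r a f.

Lemma hb_open r : open (hb r).
Proof.
have -> : hb r = ball p r `&` [set v : pt | 0 < v 0 o0] by [].
have [r0|r0] := leP r 0.
  have -> : ball p r `&` [set v : pt | 0 < v 0 o0] = set0.
    apply/seteqP; split=> // v [/ball_rVP [r0' _] _].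
    by have := lt_le_trans r0' r0; rewrite ltxx.
  exact: open0.
apply: openI; first exact: ball_open.
apply: (@open_comp _ _ (fun v : pt => v 0 o0) [set x : R | 0 < x]); last exact: open_gt.
by move=> v _; exact: coord_continuous.
Qed.

Lemma hb_sub r r' : r <= r' -> hb r `<=` hb r'.
Proof. by move=> rle v [B v0]; split=> //; exact: le_ball B. Qed.

Lemma ev_mono (P Q : pt -> Prop) : (forall v : pt, 0 < v 0 o0 -> P v -> Q v) -> ev P -> ev Q.
Proof. by move=> PQ [r r0 H]; exists r => // v hv; apply: PQ; [case: hv|exact: H]. Qed.

Lemma ev_and (P Q : pt -> Prop) : ev P -> ev Q -> ev (fun v : pt => P v /\ Q v).
Proof.
move=> [r r0 H] [r' r0' H']; exists (Num.min r r'); first by rewrite lt_min r0.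
by move=> v hv; split; [apply: H|apply: H']; apply: hb_sub hv; rewrite ge_min lexx ?orbT.
Qed.

Lemma ev_app (P Q : pt -> Prop) : ev P -> ev (fun v : pt => P v -> Q v) -> ev Q.
Proof. by move=> h h'; apply: ev_mono (ev_and h h') => v _ [Pv]; apply. Qed.

Lemma ev_true (P : pt -> Prop) : (forall v : pt, 0 < v 0 o0 -> P v) -> ev P.
Proof. by move=> H; exists 1 => // v [_]; exact: H. Qed.

Lemma ev_all (I : finType) (P : I -> pt -> Prop) : (forall i, ev (P i)) -> ev (fun v : pt => forall i, P i v).
Proof.
move=> H.
have : ev (fun v : pt => forall i, i \in enum I -> P i v).
  elim: (enum I) => [|a l IH]; first exact: ev_true.
  apply: ev_mono (ev_and (H a) IH) => v _ [Pa Pl] i; rewrite inE => /orP[/eqP->//|].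
  exact: Pl.
by apply: ev_mono => v _ h i; apply: h; rewrite mem_enum.
Qed.

Lemma ev_lt1 : ev (fun v : pt => v 0 o0 < 1).
Proof.
exists 1 => // v [/ball_rVP[_ /(_ o0)] + v0]; rewrite p0 sub0r normrN.
exact: le_lt_trans (ler_norm _).
Qed.

Lemma sm2 f g : sm f -> sm g -> exists2 r, 0 < r & forall k, Ck k (hb r) f /\ Ck k (hb r) g.
Proof.
move=> [r r0 H] [r' r0' H']; exists (Num.min r r'); first by rewrite lt_min r0.
by move=> k; split; [apply: Ck_sub (H k)|apply: Ck_sub (H' k)]; apply: hb_sub;
  rewrite ge_min lexx ?orbT.
Qed.

Lemma sm_cst c : sm (fun=> c).
Proof. by exists 1 => // k; apply: Ck_cst; exact: hb_open. Qed.
Lemma smD f g : sm f -> sm g -> sm (fun v : pt => f v + g v).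
Proof. by move=> /sm2 h /h [r r0 H]; exists r => // k; have [? ?] := H k; apply: CkD => //; exact: hb_open. Qed.
Lemma smM f g : sm f -> sm g -> sm (fun v : pt => f v * g v).
Proof. by move=> /sm2 h /h [r r0 H]; exists r => // k; have [? ?] := H k; apply: CkM => //; exact: hb_open. Qed.
Lemma sm_partial f i : sm f -> sm (partial i f).
Proof. by move=> [r r0 H]; exists r => // k; apply: Ck_partial. Qed.
Lemma sm_s : sm (fun v : pt => v 0 o0).
Proof. by exists 1 => // k; apply: Ck_coord; exact: hb_open. Qed.
Lemma sm_px f i : sm f -> sm (px i f). Proof. exact: sm_partial. Qed.
Lemma sm_th f : sm f -> sm (th f).
Proof. by move=> Hf; apply: smM; [exact: sm_s|exact: sm_partial]. Qed.

Lemma sm_eq f g : ev (fun v : pt => f v = g v) -> sm f -> sm g.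
Proof.
move=> [r r0 H] [r' r0' H']; exists (Num.min r r'); first by rewrite lt_min r0.
move=> k; apply: (@Ck_ext _ _ _ _ f); first exact: hb_open.
  by move=> v hv; apply: H; apply: hb_sub hv; rewrite ge_min lexx.
by apply: Ck_sub (H' k); apply: hb_sub; rewrite ge_min lexx orbT.
Qed.

Lemma smV f : ev (fun v : pt => f v != 0) -> sm f -> sm (fun v : pt => (f v)^-1).
Proof.
move=> [r r0 H] [r' r0' H']; exists (Num.min r r'); first by rewrite lt_min r0.
move=> k; apply: CkV; first exact: hb_open.
  by move=> v hv; apply: H; apply: hb_sub hv; rewrite ge_min lexx.
by apply: Ck_sub (H' k); apply: hb_sub; rewrite ge_min lexx orbT.
Qed.

Lemma sm_deriv f i : sm f -> ev (fun v : pt => derivable f v (ee i)).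
Proof.
move=> [r r0 H]; exists r => // v hv; exact: Ck_derivable (H 1) hv.
Qed.

Lemma ev_partial f g i : ev (fun v : pt => f v = g v) -> ev (fun v : pt => partial i f v = partial i g v).
Proof.
move=> [r r0 H]; exists r => // v hv; apply: partial_near.
exact: (open_eq_near (@hb_open r) hv H).
Qed.

Lemma ev_px_th f i : sm f -> ev (fun v : pt => px i (th f) v = th (px i f) v).
Proof.
move=> [r r0 H]; exists r => // v hv.
have ds : derivable (fun v : pt => v 0 o0) v (ee (rr i)).
  exact: (Ck_derivable (Ck_coord 1 o0 (@hb_open r)) hv).
have df := Ck_derivable (i := rr i) (Ck_partial o0 (H 2)) hv.
rewrite /px /th (partialM ds df) partial_coord /= mul0r add0r.
by rewrite (partialC (rr i) o0 (@hb_open r) (H 2) hv).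
Qed.

Lemma bO0_eq a f g : ev (fun v : pt => f v = g v) -> bO0 a f -> bO0 a g.
Proof.
by move=> E [C H]; exists C; apply: ev_app E _; apply: ev_mono H => v _ ? <-.
Qed.

Lemma bO_eq r a f g : ev (fun v : pt => f v = g v) -> bO r a f -> bO r a g.
Proof.
elim: r f g => [|r IH] f g E [H0 H1]; split=> //; first exact: bO0_eq E H0.
  exact: bO0_eq E H0.
by move=> i; apply: IH (H1 i); exact: ev_partial.
Qed.

Lemma G_eq r a f g : ev (fun v : pt => f v = g v) -> G r a f -> G r a g.
Proof. by move=> E [H1 H2]; split; [exact: sm_eq E H1|exact: bO_eq E H2]. Qed.

Lemma bO0_C a f : bO0 a f -> exists2 C, 0 <= C & ev (fun v : pt => `|f v| <= C * v 0 o0 `^ a).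
Proof.
move=> [C H]; exists `|C| => //; apply: ev_mono H => v v0 /le_trans; apply.
by apply: ler_wpM2r; [exact: powR_ge0|exact: ler_norm].
Qed.

Lemma bO0_W a b f : a <= b -> bO0 b f -> bO0 a f.
Proof.
move=> ab /bO0_C [C C0 H]; exists C; apply: ev_app ev_lt1 _; apply: ev_mono H => v v0 H v1.
by apply: le_trans H _; apply: ler_wpM2l => //; apply: ger_powR => //; rewrite v0 ltW.
Qed.

Lemma bO_W r a b f : a <= b -> bO r b f -> bO r a f.
Proof.
move=> ab; elim: r f => [|r IH] f [H0 H1]; split=> //; [exact: bO0_W ab H0|exact: bO0_W ab H0|].
by move=> i; exact: IH (H1 i).
Qed.

Lemma bO_S r a f : bO r.+1 a f -> bO r a f.
Proof.
elim: r f => [|r IH] f [H0 H1]; first by split.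
by split=> // i; exact: IH (H1 i).
Qed.

Lemma bO_r r r' a f : (r' <= r)%N -> bO r a f -> bO r' a f.
Proof.
by move=> /subnK <-; elim: (r - r')%N => [//|d IH]; rewrite addSn => /bO_S; exact: IH.
Qed.

Lemma bO_0 r a f : bO r a f -> bO0 a f. Proof. by case: r => [|r] []. Qed.

Lemma G_W r r' a b f : (r' <= r)%N -> a <= b -> G r b f -> G r' a f.
Proof. by move=> rle ab [H1 H2]; split=> //; apply: (bO_W ab); exact: (bO_r rle). Qed.

Lemma G_px r a f i : G r.+1 a f -> G r a (px i f).
Proof. by move=> [H1 [_ H2]]; split; [exact: sm_px|exact: H2]. Qed.

Lemma bO0_D a f g : bO0 a f -> bO0 a g -> bO0 a (fun v : pt => f v + g v).
Proof.
move=> [C H] [C' H']; exists (C + C'); apply: ev_mono (ev_and H H') => v _ [h h'].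
by rewrite mulrDl; apply: le_trans (ler_normD _ _) _; exact: lerD.
Qed.

Lemma bO0_M a b f g : bO0 a f -> bO0 b g -> bO0 (a + b) (fun v : pt => f v * g v).
Proof.
move=> /bO0_C [C C0 H] /bO0_C [C' C0' H']; exists (C * C').
apply: ev_mono (ev_and H H') => v v0 [h h'].
rewrite normrM powRD ?(gt_eqF v0) ?implybT // mulrACA.
by apply: ler_pM.
Qed.

Lemma GD r a f g : G r a f -> G r a g -> G r a (fun v : pt => f v + g v).
Proof.
elim: r f g => [|r IH] f g [sf bf] [sg bg]; split; try exact: smD; split=> //.
- exact: (bO0_D (bO_0 bf) (bO_0 bg)).
- exact: (bO0_D (bO_0 bf) (bO_0 bg)).
move=> i; apply: (@bO_eq _ _ (fun v : pt => px i f v + px i g v)).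
  apply: ev_mono (ev_and (sm_deriv (rr i) sf) (sm_deriv (rr i) sg)) => v _ [d1 d2].
  by rewrite /px partialD.
by have [] := IH _ _ (G_px i (conj sf bf)) (G_px i (conj sg bg)).
Qed.

(** Leibniz: each tangential derivative of the product is a sum of products in the
    classes of one order less. *)
Lemma GM r a b f g : G r a f -> G r b g -> G r (a + b) (fun v : pt => f v * g v).
Proof.
elim: r f g => [|r IH] f g Gf Gg; have [sf bf] := Gf; have [sg bg] := Gg;
  split; try exact: smM; split=> //.
- exact: (bO0_M (bO_0 bf) (bO_0 bg)).
- exact: (bO0_M (bO_0 bf) (bO_0 bg)).
move=> i; apply: (@bO_eq _ _ (fun v : pt => px i f v * g v + f v * px i g v)).
  apply: ev_mono (ev_and (sm_deriv (rr i) sf) (sm_deriv (rr i) sg)) => v _ [d1 d2].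
  by rewrite /px partialM.
have h1 := IH _ _ (G_px i Gf) (G_W (leqnSn r) (lexx b) Gg).
have h2 := IH _ _ (G_W (leqnSn r) (lexx a) Gf) (G_px i Gg).
by have [] := GD h1 h2.
Qed.

Lemma G_cst0 r a : G r a (fun=> 0).
Proof.
split; first exact: sm_cst.
have b0 : bO0 a (fun=> 0) by exists 0; apply: ev_true => v _; rewrite normr0 mul0r.
elim: r => [|r IH]; split=> // i; apply: (@bO_eq _ _ (fun=> 0)) => //.
by apply: ev_true => v _; rewrite /px partial_cst.
Qed.

Lemma G_cst r c : G r 0 (fun=> c).
Proof.
split; first exact: sm_cst.
have b0 : bO0 0 (fun=> c) by exists `|c|; apply: ev_true => v _; rewrite powRr0 mulr1.
case: r => [|r]; split=> // i; apply: (@bO_eq _ _ (fun=> 0)).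
  by apply: ev_true => v _; rewrite /px partial_cst.
by have [] := G_cst0 r 0.
Qed.

Lemma GZ r a c f : G r a f -> G r a (fun v : pt => c * f v).
Proof. by move=> Gf; have := GM (G_cst r c) Gf; rewrite add0r. Qed.

Lemma GN r a f : G r a f -> G r a (fun v : pt => - f v).
Proof. by move=> /(GZ (-1)); apply: G_eq; apply: ev_true => v _; rewrite mulN1r. Qed.

Lemma GB r a f g : G r a f -> G r a g -> G r a (fun v : pt => f v - g v).
Proof. by move=> Gf /GN; exact: GD. Qed.

Lemma G_s r : G r 1 (fun v : pt => v 0 o0).
Proof.
split; first exact: sm_s.
have b0 : bO0 1 (fun v : pt => v 0 o0).
  by exists 1; apply: ev_true => v v0; rewrite (powRr1 (ltW v0)) mul1r gtr0_norm.
case: r => [|r]; split=> // i; apply: (@bO_eq _ _ (fun=> 0)).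
  by apply: ev_true => v _; rewrite /px partial_coord.
by have [] := G_cst0 r 1.
Qed.

Lemma G_sum r a (I : Type) (l : seq I) (Q : pred I) (F : I -> pt -> R) :
  (forall i, G r a (F i)) -> G r a (fun v : pt => \sum_(i <- l | Q i) F i v).
Proof.
move=> GF; elim: l => [|i l IH].
  by apply: G_eq (G_cst0 r a); apply: ev_true => v _; rewrite big_nil.
case Qi : (Q i).
  by apply: G_eq (GD (GF i) IH); apply: ev_true => v _; rewrite big_cons Qi.
by apply: G_eq IH; apply: ev_true => v _; rewrite big_cons Qi.
Qed.

Lemma GV r f (c : R) : 0 < c -> ev (fun v : pt => c <= `|f v|) -> G r 0 f -> G r 0 (fun v : pt => (f v)^-1).
Proof.
move=> c0 cf.
have f0 : ev (fun v : pt => f v != 0).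
  by apply: ev_mono cf => v _ h; rewrite -normr_gt0; exact: lt_le_trans h.
have b0 : bO0 0 (fun v : pt => (f v)^-1).
  exists c^-1; apply: ev_mono cf => v _ h; rewrite powRr0 mulr1 normfV lef_pV2 ?posrE //.
  exact: lt_le_trans h.
elim: r => [|r IH] Gf; have [sf bf] := Gf; split; try exact: smV; split=> //.
move=> i; apply: (@bO_eq _ _ (fun v : pt => (-1) * ((f v)^-1 * (f v)^-1) * px i f v)).
  apply: ev_mono (ev_and f0 (sm_deriv (rr i) sf)) => v _ [fv d].
  by rewrite /px partialV // mulN1r expr2 invfM.
have Gi := IH (G_W (leqnSn r) (lexx _) Gf).
have := GM (GZ (-1) (GM Gi Gi)) (G_px i Gf).
by rewrite !addr0 => -[].
Qed.

Lemma sm_sum (I : Type) (l : seq I) (Q : pred I) (F : I -> pt -> R) :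
  (forall i, sm (F i)) -> sm (fun v : pt => \sum_(i <- l | Q i) F i v).
Proof.
move=> GF; elim: l => [|i l IH].
  by apply: sm_eq (sm_cst 0); apply: ev_true => v _; rewrite big_nil.
case Qi : (Q i).
  by apply: sm_eq (smD (GF i) IH); apply: ev_true => v _; rewrite big_cons Qi.
by apply: sm_eq IH; apply: ev_true => v _; rewrite big_cons Qi.
Qed.

Lemma smooth_at_sm f : smooth_at f p -> sm f.
Proof.
move=> [U [oU Up CU]]; have /nbhs_ballP [r /= r0 B] := open_nbhs_nbhs (conj oU Up).
by exists r => // k; apply: Ck_sub (CU k) => v [/B].
Qed.

Lemma smooth_at_partial f i v : smooth_at f v -> smooth_at (partial i f) v.
Proof. by move=> [U [oU Up CU]]; exists U; split=> // k; exact: Ck_partial. Qed.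

Lemma smooth_at_bO0 f : smooth_at f p -> bO0 0 f.
Proof.
move=> [U [oU Up CU]]; exists (`|f p| + 1).
have := Ck_cont (CU 0) Up; move/cvgrPdist_lt => /(_ 1 ltr01) /nbhs_ballP [r /= r0 B].
exists r => // v [/B /= h v0]; rewrite powRr0 mulr1.
have -> : f v = f p - (f p - f v) by ring.
by apply: le_trans (ler_normB _ _) _; rewrite lerD2l ltW.
Qed.

Lemma G_smooth r f : smooth_at f p -> G r 0 f.
Proof.
move=> Sf; split; first exact: smooth_at_sm.
elim: r f Sf => [|r IH] f Sf; split=> //; try exact: smooth_at_bO0.
by move=> i; apply: IH; exact: smooth_at_partial.
Qed.


Definition upd v (t : R) : pt := (v - v 0 o0 *: ee o0) + t *: ee o0.

Lemma upd0 v t : upd v t 0 o0 = t.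
Proof. by rewrite !mxE !eqxx mulr1 subrr add0r mulr1. Qed.

Lemma updr v t i : upd v t 0 (rr i) = v 0 (rr i).
Proof. by rewrite !mxE /= !mulr0 subr0 addr0. Qed.

Lemma upd_id v : upd v (v 0 o0) = v. Proof. by rewrite /upd subrK. Qed.

Lemma ball_hb r v : (forall i, `|p 0 (rr i) - v 0 (rr i)| < r) -> 0 < v 0 o0 < r -> hb r v.
Proof.
move=> H /andP[v0 vr]; split=> //; apply/ball_rVP; split; first exact: lt_trans vr.
move=> j; case: (@split_ordP 1 m j) => k -> //.
by rewrite lshift1 p0 sub0r normrN gtr0_norm.
Qed.

Lemma hb_s r v : hb r v -> 0 < v 0 o0 < r.
Proof.
move=> [/ball_rVP [_ /(_ o0)] + v0]; rewrite p0 sub0r normrN (gtr0_norm v0) => ->.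
by rewrite v0.
Qed.

Lemma hb_upd r v t : hb r v -> 0 < t < r -> hb r (upd v t).
Proof.
move=> [/ball_rVP [r0 B] v0] t0; apply: ball_hb; last by rewrite upd0.
by move=> i; rewrite updr.
Qed.

Lemma is_derive_upd f v t : derivable f (upd v t) (ee o0) ->
  is_derive t 1 (fun t => f (upd v t)) (partial o0 f (upd v t)).
Proof. by move=> df; rewrite partialE; apply: line_is_derive. Qed.

(** Both [psi - z] and [psi + z] are nondecreasing. *)
Lemma deriv_compare (z psi z' psi' : R -> R) (r : R) :
  (forall t, 0 < t < r -> is_derive t (1 : R) z (z' t)) ->
  (forall t, 0 < t < r -> is_derive t (1 : R) psi (psi' t)) ->
  (forall t, 0 < t < r -> `|z' t| <= psi' t) ->
  forall a b, 0 < a -> a <= b -> b < r -> `|z b - z a| <= psi b - psi a.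
Proof.
move=> dz dpsi zpsi a b a0 ab br.
have I t : t \in `[a, b] -> 0 < t < r.
  by rewrite in_itv /= => /andP[at_ tb]; rewrite (lt_le_trans a0 at_) (le_lt_trans tb br).
have I' t : t \in `]a, b[ -> 0 < t < r.
  by move=> h; apply: I; exact: subset_itv_oo_cc h.
have mono (q q' : R -> R) : (forall t, 0 < t < r -> is_derive t (1 : R) q (q' t)) ->
    (forall t, 0 < t < r -> 0 <= q' t) -> q a <= q b.
  move=> dq q0; apply: (@ger0_derive1_ndecr _ q a b) => //.
  - by move=> t /I' /dq [].
  - by move=> t /I' h; have [_ E] := dq t h; rewrite derive1E E; exact: q0.
  - by apply: derivable_within_continuous => t /I /dq [].
have h1 : (psi - z) a <= (psi - z) b.
  apply: (mono _ (fun t => psi' t - z' t)) => t h.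
    by have d1 := dz t h; have d2 := dpsi t h; exact: is_deriveB.
  by rewrite subr_ge0; apply: le_trans (ler_norm _) (zpsi t h).
have h2 : (psi + z) a <= (psi + z) b.
  apply: (mono _ (fun t => psi' t + z' t)) => t h.
    by have d1 := dz t h; have d2 := dpsi t h; exact: is_deriveD.
  by have := ler_norm (- z' t); rewrite normrN; have := zpsi t h; lra.
by rewrite ler_norml; apply/andP; split; move: h1 h2; rewrite /= !fctE /=; lra.
Qed.

Lemma is_derive_powR a (t : R) : 0 < t -> is_derive t 1 (fun t => t `^ a) (a * t `^ (a - 1)).
Proof. exact: is_derive1_powR. Qed.

Lemma powR_pred (t a : R) : 0 < t -> t `^ (a - 1) = t `^ a / t.
Proof.
move=> t0; have h : (a == 1) ==> (t != 0) by rewrite (gt_eqF t0) implybT.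
by rewrite powRB // powRr1 // ltW.
Qed.

Lemma powR_add (t a b : R) : 0 < t -> t `^ (a + b) = t `^ a * t `^ b.
Proof. by move=> t0; rewrite powRD // (gt_eqF t0) implybT. Qed.

Lemma is_derive_scale (c : R) (q : R -> R) (t dq : R) :
  is_derive t (1 : R) q dq -> is_derive t (1 : R) (fun t => c * q t) (c * dq).
Proof. exact: is_deriveZ. Qed.

Lemma is_derive_mul (q q' : R -> R) (t dq dq' : R) :
  is_derive t (1 : R) q dq -> is_derive t (1 : R) q' dq' ->
  is_derive t (1 : R) (fun t => q t * q' t) (q t * dq' + q' t * dq).
Proof. exact: is_deriveM. Qed.

(** Integration from [s = 0]: no decay is lost when [f] vanishes there. *)
(** Convergence to [0] along each line [x = const], without any uniformity in [x].
    *)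
Definition vanish f := ev (fun v : pt => forall e : R, 0 < e ->
  exists2 d : R, 0 < d & forall t, 0 < t < d -> `|f (upd v t)| < e).

Lemma INT0_bO0 (a : R) f : 0 < a -> sm f -> vanish f -> bO0 a (th f) -> bO0 a f.
Proof.
move=> a0 [r r0 Cf] [r1 r10 Vf] [C [r2 r20 H]]; exists (C / a).
pose q := Num.min r (Num.min r1 r2).
have [qr q1 q2] : [/\ q <= r, q <= r1 & q <= r2].
  by rewrite /q; split; rewrite !ge_min lexx ?orbT.
have q0 : 0 < q by rewrite !lt_min r0 r10 r20.
exists q => // v hv.
have D t : 0 < t < q -> is_derive t (1 : R) (fun t => f (upd v t)) (partial o0 f (upd v t)).
  move=> t0; apply: is_derive_upd; apply: Ck_derivable (Cf 1) _.
  by apply: (hb_sub qr); exact: hb_upd.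
have D' (t : R) : 0 < t < q -> is_derive t (1 : R) (fun t => C / a * t `^ a) (C * t `^ (a - 1)).
  move=> /andP[t0 _]; have d := is_derive_powR a t0.
  have := is_derive_scale (C / a) d; congr is_derive.
  have an : a != 0 by rewrite gt_eqF.
  by field.
have B t : 0 < t < q -> `|partial o0 f (upd v t)| <= C * t `^ (a - 1).
  move=> t0; have := H (upd v t) (hb_sub q2 (hb_upd hv t0)).
  have /andP[tp _] := t0.
  rewrite /th upd0 normrM (gtr0_norm tp) powR_pred //.
  by rewrite mulrA ler_pdivlMr // mulrC.
have K := deriv_compare D D' B.
have /andP[v0 vq] := hb_s hv.
apply/ler_addgt0Pr => e e0.
have [d d0 V] := Vf v (hb_sub q1 hv) e e0.
pose t := Num.min (v 0 o0) (d / 2).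
have t0 : 0 < t by rewrite lt_min v0 divr_gt0.
have td : 0 < t < d.
  by rewrite t0 /t gt_min; apply/orP; right; rewrite ltr_pdivrMr // ltr_pMr // ltr1n.
have := K t (v 0 o0) t0 (min_lel _ _) vq; rewrite upd_id => K1.
have C0 : 0 <= C / a * t `^ a.
  have : 0 <= C * t `^ (a - 1) by apply: le_trans (B t _) => //; rewrite t0 (le_lt_trans (min_lel _ _) vq).
  rewrite pmulr_lge0 ?powR_gt0 // => C0.
  by rewrite mulr_ge0 ?powR_ge0 // divr_ge0 // ltW.
have -> : f v = (f v - f (upd v t)) + f (upd v t) by rewrite subrK.
apply: le_trans (ler_normD _ _) _; apply: lerD; last exact/ltW/V.
by apply: le_trans K1 _; rewrite gerBl.
Qed.

(** Integration towards [s = 0] from a positive value of [s]: below the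
    indicial root [mu] any solution inherits the decay of the right-hand side. *)
Lemma INTpos_bO0 (a mu : R) f : a < mu -> sm f -> bO0 a (fun v : pt => th f v - mu * f v) -> bO0 a f.
Proof.
move=> amu [r r0 Cf] [C [r2 r20 H]].
pose q := Num.min 1 (Num.min r r2) / 2.
have m0 : 0 < Num.min 1 (Num.min r r2) by rewrite !lt_min ltr01 r0 r20.
have q0 : 0 < q by rewrite divr_gt0.
have q2m : q < Num.min 1 (Num.min r r2) by rewrite ltr_pdivrMr // ltr_pMr // ltr1n.
have [q1 qr q2] : [/\ q < 1, q < r & q < r2].
  by move: q2m; rewrite !lt_min => /and3P[].
pose v0 := upd p q.
have hv0 : hb r v0.
  by apply: ball_hb; [move=> i; rewrite updr subrr normr0|rewrite upd0 q0].
have /cvgrPdist_lt /(_ 1 ltr01) /nbhs_ballP [e /= e0 Be] := Ck_cont (Cf 0) hv0.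
pose w := Num.min q e.
have w0 : 0 < w by rewrite lt_min q0.
pose D0 := (`|f v0| + 1) * q `^ (- mu) + `|C| / (mu - a).
exists D0; exists w => // v hv.
have /andP[vp vw] := hb_s hv.
have vq : v 0 o0 < q by apply: lt_le_trans vw _; rewrite /w ge_min lexx.
have hu t : 0 < t < Num.min r r2 -> hb (Num.min r r2) (upd v t).
  move=> tt; apply: hb_upd => //; apply: hb_sub hv.
  by apply: le_trans (min_lel _ _) _; rewrite ltW // lt_min qr.
have mn : mu - a != 0 by rewrite gt_eqF // subr_gt0.
pose z t := t `^ (- mu) * f (upd v t).
have Dz (t : R) : 0 < t < Num.min r r2 -> is_derive t (1 : R) z
    (t `^ (- mu - 1) * (th f (upd v t) - mu * f (upd v t))).
  move=> tt; have /andP[t0 _] := tt.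
  have d1 := is_derive_powR (- mu) t0.
  have d2 : is_derive t (1 : R) (fun t => f (upd v t)) (partial o0 f (upd v t)).
    apply: is_derive_upd; apply: Ck_derivable (Cf 1) _.
    by apply: (hb_sub (min_lel r r2)); exact: hu.
  have := is_derive_mul d1 d2; congr is_derive.
  rewrite /th upd0.
  have -> : t `^ (- mu) = t * t `^ (- mu - 1).
    by rewrite powR_pred // mulrCA mulfV ?mulr1 // gt_eqF.
  ring.
have Dpsi (t : R) : 0 < t < Num.min r r2 -> is_derive t (1 : R)
    (fun t => - (`|C| / (mu - a)) * t `^ (a - mu)) (`|C| * t `^ (a - mu - 1)).
  move=> /andP[t0 _]; have d := is_derive_powR (a - mu) t0.
  have := is_derive_scale (- (`|C| / (mu - a))) d; congr is_derive.
  by field.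
have B (t : R) : 0 < t < Num.min r r2 ->
    `|t `^ (- mu - 1) * (th f (upd v t) - mu * f (upd v t))| <= `|C| * t `^ (a - mu - 1).
  move=> tt; have /andP[t0 _] := tt; have := H _ (hb_sub (min_ler r r2) (hu t tt)).
  rewrite upd0 normrM (ger0_norm (powR_ge0 _ _)) => h.
  have -> : t `^ (a - mu - 1) = t `^ (- mu - 1) * t `^ a.
    by rewrite -powR_add //; congr (_ `^ _); ring.
  rewrite mulrCA; apply: ler_wpM2l; first exact: powR_ge0.
  by apply: le_trans h _; apply: ler_wpM2r; [exact: powR_ge0|exact: ler_norm].
have qm : q < Num.min r r2 by rewrite lt_min qr.
have K := deriv_compare Dz Dpsi B vp (ltW vq) qm.
have fq : `|f (upd v q)| <= `|f v0| + 1.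
  have : ball v0 e (upd v q).
    apply/ball_rVP; split=> // j; case: (@split_ordP 1 m j) => k ->.
      by rewrite lshift1 /v0 !upd0 subrr normr0.
    rewrite /v0 !updr; have [/ball_rVP [_ /(_ (rr k)) h] _] := hv.
    by apply: lt_le_trans h _; rewrite /w ge_min lexx orbT.
  move=> /Be /= h; have -> : f (upd v q) = f v0 - (f v0 - f (upd v q)) by ring.
  by apply: le_trans (ler_normB _ _) _; rewrite lerD2l ltW.
have zv : z (v 0 o0) = (v 0 o0) `^ (- mu) * f v by rewrite /z upd_id.
have zq : `|z q| <= (`|f v0| + 1) * q `^ (- mu).
  by rewrite /z normrM (ger0_norm (powR_ge0 _ _)) mulrC ler_wpM2r ?powR_ge0.
have zb : `|z (v 0 o0)| <= (`|f v0| + 1) * q `^ (- mu) + `|C| / (mu - a) * (v 0 o0) `^ (a - mu).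
  have -> : z (v 0 o0) = z q - (z q - z (v 0 o0)) by ring.
  apply: le_trans (ler_normB _ _) _; apply: lerD => //.
  apply: le_trans K _; rewrite !mulNr opprK addrC lerBlDr lerDl.
  by rewrite mulr_ge0 ?powR_ge0 // divr_ge0 // subr_ge0 ltW.
have -> : `|f v| = v 0 o0 `^ mu * `|z (v 0 o0)|.
  rewrite zv normrM (ger0_norm (powR_ge0 _ _)) mulrA -powR_add //.
  by rewrite subrr powRr0 mul1r.
apply: le_trans (ler_wpM2l (powR_ge0 _ _) zb) _.
rewrite mulrDr /D0 [leRHS]mulrDl; apply: lerD.
  rewrite mulrC; apply: ler_wpM2l; first by rewrite mulr_ge0 ?powR_ge0 // addr_ge0.
  apply: ger_powR; last exact: ltW.
  by rewrite vp ltW // (lt_trans vq q1).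
rewrite mulrCA -powR_add //.
by rewrite (_ : mu + (a - mu) = a) //; ring.
Qed.

(** Tangential derivatives commute with [theta - mu], so the estimate of order zero
    applies to each of them. *)
Lemma INTpos r a mu f : a < mu -> sm f -> bO r a (fun v : pt => th f v - mu * f v) -> bO r a f.
Proof.
move=> amu; elim: r f => [|r IH] f sf [H0 H1].
  by split=> //; exact: INTpos_bO0 amu sf H0.
split; first exact: INTpos_bO0 amu sf H0.
move=> i; apply: IH; first exact: sm_px.
apply: bO_eq (H1 i).
apply: ev_mono (ev_and (ev_px_th i sf) (ev_and (sm_deriv (rr i) sf) (sm_deriv (rr i) (sm_th sf))))
  => v _ [E [d1 d2]].
rewrite -E /px.
have d3 : derivable (fun v : pt => mu * f v) v (ee (rr i)) := derivableM (derivable_cst mu _ _) d1.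
by rewrite (partialB d2 d3) (partialZ mu d1).
Qed.

Lemma bO0_vanish a f : 0 < a -> bO0 a f -> vanish f.
Proof.
move=> a0 /bO0_C [C C0 [r r0 H]]; exists r => // v hv e e0.
have e1 : 0 < e / (C + 1) by rewrite divr_gt0 // ltr_wpDl.
exists (Num.min r ((e / (C + 1)) `^ (a^-1))); first by rewrite lt_min r0 powR_gt0.
move=> t /andP[t0]; rewrite lt_min => /andP[tr te].
apply: le_lt_trans (H _ (hb_upd hv _)) _; first by rewrite t0.
rewrite upd0.
have : t `^ a < e / (C + 1).
  have -> : e / (C + 1) = ((e / (C + 1)) `^ (a^-1)) `^ a.
    by rewrite -powRrM mulVf ?gt_eqF // powRr1 // ltW.
  by apply: gt0_ltr_powR => //; rewrite nnegrE ?powR_ge0 // ltW.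
rewrite ltr_pdivlMr ?ltr_wpDl // => h; apply: le_lt_trans h.
by rewrite mulrC ler_wpM2l ?powR_ge0 // lerDl.
Qed.

(** As for [INTpos]; the decay [O(s^b)] gives the vanishing at [s = 0] that
    integration from [s = 0] needs. *)
Lemma INT0 r a b f : 0 < a -> 0 < b -> sm f -> bO r b f -> bO r a (th f) -> bO r a f.
Proof.
move=> a0 b0; elim: r f => [|r IH] f sf Hb [H0 H1].
  by split=> //; exact: INT0_bO0 a0 sf (bO0_vanish b0 (bO_0 Hb)) H0.
split; first exact: INT0_bO0 a0 sf (bO0_vanish b0 (bO_0 Hb)) H0.
move=> i; apply: IH; [exact: sm_px|by case: Hb => _ /(_ i)|].
by apply: bO_eq (H1 i); exact: ev_px_th.
Qed.

End Germ.

(** * Decay of the lapse, and Taylor expansion at the boundary *)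

Lemma le0_of_powR (R : realType) (x C b d : R) : 0 < b -> 0 < d ->
  (forall s : R, 0 < s < d -> x <= C * s `^ b) -> x <= 0.
Proof.
move=> b0 d0 H; apply/ler_addgt0Pr => e e0; rewrite add0r.
have e1 : 0 < e / (`|C| + 1) by rewrite divr_gt0 // ltr_wpDl.
pose s := Num.min (d / 2) ((e / (`|C| + 1)) `^ (b^-1)).
have s0 : 0 < s by rewrite lt_min powR_gt0 // divr_gt0.
have sd : s < d by apply: le_lt_trans (min_lel _ _) _; rewrite ltr_pdivrMr // ltr_pMr // ltr1n.
have sb : s `^ b <= e / (`|C| + 1).
  have -> : e / (`|C| + 1) = ((e / (`|C| + 1)) `^ (b^-1)) `^ b.
    by rewrite -powRrM mulVf ?gt_eqF // powRr1 // ltW.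
  by apply: ge0_ler_powR; rewrite ?nnegrE ?powR_ge0 ?(ltW b0) ?(ltW s0) //; exact: min_ler.
apply: (le_trans (H s _)); first by rewrite s0.
apply: (@le_trans _ _ (`|C| * s `^ b)); first by rewrite ler_wpM2r ?powR_ge0 // ler_norm.
apply: (@le_trans _ _ (`|C| * (e / (`|C| + 1)))); first by rewrite ler_wpM2l.
by rewrite mulrCA ler_piMr ?(ltW e0) // ler_pdivrMr ?ltr_wpDl // mul1r lerDl.
Qed.

(** By induction: the constant term is the limit at [s = 0], and the rest is divisible by [s]. *)
Lemma poly_vanish (R : realType) n (c : nat -> R) (C a d : R) : 0 < d -> n%:R - 1 < a ->
  (forall s : R, 0 < s < d -> `|\sum_(j < n) s ^+ j * c j| <= C * s `^ a) ->
  forall j, (j < n)%N -> c j = 0.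
Proof.
move=> d0; elim: n c a => [|n IH] c a // na H.
pose d' := Num.min d 1.
have d'0 : 0 < d' by rewrite lt_min d0 ltr01.
have C0 : 0 <= C.
  have h : 0 < d / 2 < d by rewrite divr_gt0 //= ltr_pdivrMr // ltr_pMr // ltr1n.
  have := le_trans (normr_ge0 _) (H _ h).
  by rewrite pmulr_lge0 // powR_gt0; case/andP: h.
have a0 : 0 < a.
  by apply: le_lt_trans na; rewrite -natr1 addrK ler0n.
pose b := Num.min a 1.
have b0 : 0 < b by rewrite lt_min a0 ltr01.
pose D := \sum_(j < n) `|c j.+1|.
have c0 : c 0%N = 0.
  apply/eqP; rewrite -normr_eq0 eq_le normr_ge0 andbT.
  apply: (@le0_of_powR _ _ (C + D) b d') => // s /andP[s0].
  rewrite lt_min => /andP[sd s1].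
  have := H s; rewrite s0 sd big_ord_recl expr0 mul1r => /(_ isT) h.
  have sb : s `^ a <= s `^ b by apply: ger_powR; rewrite ?s0 ?(ltW s1) //; exact: min_lel.
  have sb1 : s <= s `^ b.
    rewrite -[leLHS]powRr1 ?(ltW s0) //; apply: ger_powR; rewrite ?s0 ?(ltW s1) //; exact: min_ler.
  have -> : c 0%N = (c 0%N + \sum_(i < n) s ^+ lift ord0 i * c (lift ord0 i))
     - \sum_(i < n) s ^+ lift ord0 i * c (lift ord0 i) by rewrite addrK.
  apply: le_trans (ler_normB _ _) _; rewrite mulrDl; apply: lerD.
    by apply: le_trans h _; rewrite ler_wpM2l.
  apply: le_trans (ler_norm_sum _ _ _) _; rewrite /D mulr_suml; apply: ler_sum => i _.
  rewrite normrM mulrC lift0 ler_wpM2l // normrX (gtr0_norm s0) exprS.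
  apply: le_trans sb1; rewrite ler_piMr ?(ltW s0) // exprn_ile1 // ltW //.
move=> [_ //|j]; rewrite ltnS => jn.
apply: (IH (fun j => c j.+1) (a - 1)) => //; first by rewrite ltrBrDr subrK -natr1 in na *; lra.
move=> s /andP[s0 sd]; have := H s; rewrite s0 sd => /(_ isT).
rewrite big_ord_recl c0 mulr0 add0r powR_pred // mulrA ler_pdivlMr //.
have -> : \sum_(i < n) s ^+ lift ord0 i * c (lift ord0 i) = (\sum_(i < n) s ^+ i * c i.+1) * s.
  by rewrite mulr_suml; apply: eq_bigr => i _; rewrite lift0 exprS; ring.
by rewrite normrM (gtr0_norm s0).
Qed.

Lemma smooth_at_near (R : realType) n (f g : 'rV[R]_n -> R) x :
  (\forall y \near x, f y = g y) -> smooth_at f x -> smooth_at g x.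
Proof.
move=> fg [U [oU Ux CU]].
have : \forall y \near x, U y /\ f y = g y.
  by apply: filterS2 (open_nbhs_nbhs (conj oU Ux)) fg => y.
move=> /nbhs_ballP [r /= r0 B].
exists (ball x r); split; [exact: ball_open|exact: ballxx|move=> k].
apply: (@Ck_ext _ _ _ _ f); first exact: ball_open.
  by move=> y /B [].
by apply: Ck_sub (CU k) => y /B [].
Qed.

Lemma smooth_at_comp (R : realType) n k (f : 'rV[R]_n -> R) (phi : 'rV[R]_k -> 'rV[R]_n) x :
  smooth_at f (phi x) -> (forall j, smooth_at (fun y => phi y 0 j) x) ->
  smooth_at (fun y => f (phi y)) x.
Proof.
move=> [U [oU Ux CU]] Hp.
have cphi : {for x, continuous phi}.
  by apply: rv_continuous => j; have [W [oW Wx CW]] := Hp j; exact: Ck_cont (CW 0%N) Wx.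
have N1 : \forall y \near x, U (phi y) := cphi _ (open_nbhs_nbhs (conj oU Ux)).
have [W HW] := choice Hp.
have N2 : \forall y \near x, forall j, W j y.
  apply: (@filter_forall _ _ (fun j y => W j y) (nbhs x)) => j.
  by have [oW Wx _] := HW j; exact: (open_nbhs_nbhs (conj oW Wx)).
have : \forall y \near x, U (phi y) /\ forall j, W j y by apply: filterS2 N1 N2 => y.
move=> /nbhs_ballP [r /= r0 B].
exists (ball x r); split; [exact: ball_open|exact: ballxx|move=> l].
apply: (Ck_comp oU) (CU l) _ => [|y /B []//|j]; first exact: ball_open.
by have [_ _ CW] := HW j; apply: Ck_sub (CW l) => y /B [].
Qed.

Lemma smooth_at_ball (R : realType) n (f : 'rV[R]_n -> R) x : smooth_at f x ->
  exists2 r : R, 0 < r & forall k, Ck k (ball x r) f.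
Proof.
move=> [U [oU Ux CU]]; have /nbhs_ballP [r /= r0 B] := open_nbhs_nbhs (conj oU Ux).
by exists r => // k; exact: Ck_sub (CU k).
Qed.

Section SmoothAt.
Context {R : realType} {n : nat} (x : 'rV[R]_n).
Implicit Types f g : 'rV[R]_n -> R.

Lemma smooth_at_cst c : smooth_at (fun=> c) x.
Proof. by exists setT; split=> //; [exact: openT|move=> k; exact: Ck_cst openT]. Qed.

Lemma smooth_at_coord j : smooth_at (fun y : 'rV[R]_n => y 0 j) x.
Proof. by exists setT; split=> //; [exact: openT|move=> k; exact: Ck_coord openT]. Qed.

Lemma smooth_at2 f g : smooth_at f x -> smooth_at g x ->
  exists U, [/\ open U, U x, forall k, Ck k U f & forall k, Ck k U g].
Proof.
move=> [U [oU Ux CU]] [V [oV Vx CV]]; exists (U `&` V).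
by split; [exact: openI|split|move=> k; apply: Ck_sub (CU k) => ? []|move=> k; apply: Ck_sub (CV k) => ? []].
Qed.

Lemma smooth_atD f g : smooth_at f x -> smooth_at g x -> smooth_at (fun y => f y + g y) x.
Proof. by move=> /smooth_at2 h /h [U [oU Ux C1 C2]]; exists U; split=> // k; exact: CkD. Qed.

Lemma smooth_atM f g : smooth_at f x -> smooth_at g x -> smooth_at (fun y => f y * g y) x.
Proof. by move=> /smooth_at2 h /h [U [oU Ux C1 C2]]; exists U; split=> // k; exact: CkM. Qed.

Lemma smooth_at_cont f : smooth_at f x -> {for x, continuous f}.
Proof. by move=> [U [oU Ux CU]]; exact: Ck_cont (CU 0%N) Ux. Qed.

Lemma smooth_atV f : f x != 0 -> smooth_at f x -> smooth_at (fun y => (f y)^-1) x.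
Proof.
move=> fx Sf; have [U [oU Ux CU]] := Sf.
have N : \forall y \near x, f y != 0.
  have := smooth_at_cont Sf => /cvgrPdist_lt /(_ `|f x|); rewrite normr_gt0 => /(_ fx).
  apply: filterS => y h; apply/eqP => fy; move: h; rewrite fy subr0 ltxx //.
have : \forall y \near x, U y /\ f y != 0.
  by apply: filterS2 (open_nbhs_nbhs (conj oU Ux)) N => y.
move=> /nbhs_ballP [r /= r0 B].
exists (ball x r); split; [exact: ball_open|exact: ballxx|move=> k].
apply: CkV; first exact: ball_open.
  by move=> y /B [].
by apply: Ck_sub (CU k) => y /B [].
Qed.
End SmoothAt.

Lemma sqr_normr (R : realType) (x : R) : `|x| ^+ 2 = x ^+ 2.
Proof. by rewrite real_normK // num_real. Qed.

Lemma sq_le (R : realType) (a D : R) : 0 <= a -> 1 <= D -> a ^+ 2 <= D -> a <= D.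
Proof. by move=> a0 D1; have := sqr_ge0 (a - 1); nra. Qed.

Section Germ2.
Context {R : realType} {m : nat}.
Local Notation pt := 'rV[R]_(1 + m).
Variable p : pt.
Hypothesis p0 : p 0 o0 = 0.
Implicit Types (v : pt) (f g : pt -> R).

(** Here [om = s^(1/8)], [Y = y], [W = theta y] and [X = W / om]. Measuring [theta
    y] against [s^(1/8)] makes the terms of size [om^2 = s^(1/4)] an integrable multiple
    of the energy [1 + Y^2 + X^2]. *)
Lemma energy_ineq (Y X C om W G : R) : 0 <= om -> 0 <= C -> W = X * om ->
  `|G| <= C * om ^+ 2 * (`|Y| + 1) ->
  - ((1 + 2 * C) * om * (1 + Y ^+ 2 + X ^+ 2)) * om <= (2 * Y * W) * om + 7 / 4 * X ^+ 2 * om + 2 * X * G.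
Proof.
move=> om0 C0 -> hG.
have h1 : - (om ^+ 2 * (Y ^+ 2 + X ^+ 2)) <= 2 * Y * (X * om) * om.
  rewrite -subr_ge0; have -> : 2 * Y * (X * om) * om - - (om ^+ 2 * (Y ^+ 2 + X ^+ 2)) = om ^+ 2 * (Y + X) ^+ 2 by ring.
  by rewrite mulr_ge0 ?sqr_ge0.
have h2 : - (2 * C * om ^+ 2 * (1 + Y ^+ 2 + X ^+ 2)) <= 2 * X * G.
  have a1 : `|2 * X * G| <= 2 * `|X| * (C * om ^+ 2 * (`|Y| + 1)).
    by rewrite !normrM (ger0_norm (ler0n _ _)) ler_wpM2l ?mulr_ge0.
  have a2 : 2 * `|X| * (C * om ^+ 2 * (`|Y| + 1)) <= 2 * C * om ^+ 2 * (1 + Y ^+ 2 + X ^+ 2).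
    have -> : 2 * `|X| * (C * om ^+ 2 * (`|Y| + 1)) = C * om ^+ 2 * (2 * `|X| * (`|Y| + 1)) by ring.
    have -> : 2 * C * om ^+ 2 * (1 + Y ^+ 2 + X ^+ 2) = C * om ^+ 2 * (2 * (1 + Y ^+ 2 + X ^+ 2)) by ring.
    apply: ler_wpM2l; first by rewrite mulr_ge0 ?sqr_ge0.
    rewrite -(sqr_normr Y) -(sqr_normr X).
    by have := sqr_ge0 (`|X| - `|Y|); have := sqr_ge0 (`|X| - 1); nra.
  by have := ler_norm (- (2 * X * G)); rewrite normrN; move: a1 a2; lra.
have h3 : 0 <= 7 / 4 * X ^+ 2 * om.
  by have := sqr_ge0 X => x2; rewrite mulr_ge0 // mulr_ge0 // divr_ge0.
have h4 : 0 <= om ^+ 2 by rewrite sqr_ge0.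
have -> : - ((1 + 2 * C) * om * (1 + Y ^+ 2 + X ^+ 2)) * om =
  - (om ^+ 2 * (Y ^+ 2 + X ^+ 2)) - om ^+ 2 - 2 * C * om ^+ 2 * (1 + Y ^+ 2 + X ^+ 2) by ring.
lra.
Qed.

(** For [theta^2 y - theta y = Phi y + g] with [Phi] and [g] of size [s^(1/4)], the energy
    [1 + y^2 + (theta y)^2 s^(-1/4)] times [exp (K s^(1/8))] is nondecreasing in [s], so
    that it cannot grow as [s] tends to [0]. *)
Lemma gronwall0 y Phi : sm p y -> bO0 p 4^-1 Phi ->
  bO0 p 4^-1 (fun v : pt => th (th y) v - th y v - Phi v * y v) -> bO0 p 0 y.
Proof.
move=> [r r0 Cy] /bO0_C [C1 C10 [r1 r10 H1]] /bO0_C [C2 C20 [r2 r20 H2]].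
pose C := C1 + C2.
have C0 : 0 <= C by rewrite addr_ge0.
pose r3 := Num.min r (Num.min r1 r2).
have r30 : 0 < r3 by rewrite !lt_min r0 r10 r20.
have [h1 h2 h3] : [/\ r3 <= r, r3 <= r1 & r3 <= r2] by rewrite /r3; split; rewrite !ge_min lexx ?orbT.
pose q := r3 / 2.
have q0 : 0 < q by rewrite divr_gt0.
have qr : q < r3 by rewrite ltr_pdivrMr // ltr_pMr // ltr1n.
pose v0 := upd p q.
have hv0 : hb p r v0.
  apply: (hb_sub h1); apply: ball_hb => //; first by move=> i; rewrite updr subrr normr0.
  by rewrite upd0 q0.
have Ct : forall k, Ck k (hb p r) (th y).
  by move=> k; apply: CkM (Ck_coord k o0 (@hb_open _ _ p r)) (Ck_partial o0 (Cy k.+1)); exact: hb_open.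
have /cvgrPdist_lt /(_ 1 ltr01) /nbhs_ballP [e /= e0 Be] := Ck_cont (Cy 0) hv0.
have /cvgrPdist_lt /(_ 1 ltr01) /nbhs_ballP [e' /= e'0 Be'] := Ck_cont (Ct 0) hv0.
pose w := Num.min q (Num.min e e').
have w0 : 0 < w by rewrite !lt_min q0 e0 e'0.
pose K := 8 * (1 + 2 * C).
pose D := (1 + (`|y v0| + 1) ^+ 2 + (`|th y v0| + 1) ^+ 2 * q `^ (- 4^-1)) * expR (K * q `^ 8^-1).
exists D; exists w => // v hv; rewrite powRr0 mulr1.
have /andP[vp vw] := hb_s p0 hv.
have vq : v 0 o0 < q by apply: lt_le_trans vw _; rewrite /w ge_min lexx.
have hu t : 0 < t < r3 -> hb p r3 (upd v t).
  move=> tt; apply: hb_upd => //; apply: hb_sub hv.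
  by apply: le_trans (min_lel _ _) _; exact: ltW.
pose Y t := y (upd v t); pose W t := th y (upd v t).
have dY (t : R) : 0 < t < r3 -> is_derive t (1 : R) Y (t^-1 * W t).
  move=> tt; have /andP[t0 _] := tt.
  have -> : t^-1 * W t = partial o0 y (upd v t).
    by rewrite /W /th upd0 mulrA mulVf ?mul1r // gt_eqF.
  by apply: is_derive_upd; apply: Ck_derivable (Cy 1%N) _; apply: (hb_sub h1); exact: hu.
have dW (t : R) : 0 < t < r3 -> is_derive t (1 : R) W (t^-1 * th (th y) (upd v t)).
  move=> tt; have /andP[t0 _] := tt.
  have -> : t^-1 * th (th y) (upd v t) = partial o0 (th y) (upd v t).
    by rewrite {1}/th upd0 mulrA mulVf ?mul1r // gt_eqF.
  by apply: is_derive_upd; apply: Ck_derivable (Ct 1%N) _; apply: (hb_sub h1); exact: hu.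
pose en (t : R) := 1 + Y t * Y t + W t * W t * t `^ (- 4^-1).
pose E (t : R) := en t * expR (K * t `^ 8^-1).
have dE (t : R) : 0 < t < r3 -> is_derive t (1 : R) E
   (en t * (expR (K * t `^ 8^-1) * (K * (8^-1 * t `^ (8^-1 - 1)))) + expR (K * t `^ 8^-1) *
     (0 + (Y t * (t^-1 * W t) + Y t * (t^-1 * W t)) +
      (W t * W t * (- 4^-1 * t `^ (- 4^-1 - 1)) + t `^ (- 4^-1) *
       (W t * (t^-1 * th (th y) (upd v t)) + W t * (t^-1 * th (th y) (upd v t)))))).
  move=> tt; have /andP[t0 _] := tt; apply: is_derive_mul.
    apply: is_deriveD; first apply: is_deriveD.
    - exact: is_derive_mul (dY t tt) (dY t tt).
    - apply: is_derive_mul; first exact: is_derive_mul (dW t tt) (dW t tt).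
      exact: is_derive_powR.
  exact: (is_derive1_comp (is_derive_expR _) (is_derive_scale K (is_derive_powR 8^-1 t0))).
have pos (t : R) : 0 < t < r3 -> 0 <= en t * (expR (K * t `^ 8^-1) * (K * (8^-1 * t `^ (8^-1 - 1))))
   + expR (K * t `^ 8^-1) *
     (0 + (Y t * (t^-1 * W t) + Y t * (t^-1 * W t)) +
      (W t * W t * (- 4^-1 * t `^ (- 4^-1 - 1)) + t `^ (- 4^-1) *
       (W t * (t^-1 * th (th y) (upd v t)) + W t * (t^-1 * th (th y) (upd v t))))).
  move=> tt; have /andP[t0 _] := tt.
  set om := t `^ 8^-1.
  have om0 : 0 < om by rewrite powR_gt0.
  have om4 : t `^ (- 4^-1) = om ^- 2.
    by rewrite powRN /om -powR_mulrn ?powR_ge0 // -powRrM; congr (_ `^ _)^-1; field.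
  have om2 : t `^ 4^-1 = om ^+ 2.
    by rewrite /om -powR_mulrn ?powR_ge0 // -powRrM; congr (_ `^ _); field.
  set Z := th (th y) (upd v t); pose GG := Z - W t.
  have hG : `|GG| <= C * om ^+ 2 * (`|Y t| + 1).
    have b1 := H1 _ (hb_sub h2 (hu t tt)); have b2 := H2 _ (hb_sub h3 (hu t tt)).
    move: b1 b2; rewrite upd0 om2 -/Z -/(W t) -/(Y t) => b1 b2.
    have -> : GG = (Z - W t - Phi (upd v t) * Y t) + Phi (upd v t) * Y t by rewrite /GG; ring.
    apply: le_trans (ler_normD _ _) _; rewrite normrM.
    have b3 : `|Phi (upd v t)| * `|Y t| <= C1 * om ^+ 2 * `|Y t| by rewrite ler_wpM2r.
    have -> : C * om ^+ 2 * (`|Y t| + 1) = C1 * om ^+ 2 * `|Y t| + C2 * om ^+ 2 + (C1 * om ^+ 2 + C2 * om ^+ 2 * `|Y t|).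
      by rewrite /C; ring.
    have b4 : 0 <= C1 * om ^+ 2 + C2 * om ^+ 2 * `|Y t|.
      by have o2 := sqr_ge0 om; rewrite addr_ge0 // mulr_ge0 // mulr_ge0.
    lra.
  have en0 := energy_ineq (X := W t / om) (ltW om0) C0 (esym (divfK (lt0r_neq0 om0) _)) hG.
  rewrite !powR_pred // -/om om4.
  have -> : en t * (expR (K * om) * (K * (8^-1 * (om / t)))) + expR (K * om) *
     (0 + (Y t * (t^-1 * W t) + Y t * (t^-1 * W t)) +
      (W t * W t * (- 4^-1 * (om ^- 2 / t)) + om ^- 2 *
       (W t * (t^-1 * Z) + W t * (t^-1 * Z)))) =
    expR (K * om) / (t * om) * ((2 * Y t * W t) * om + 7 / 4 * (W t / om) ^+ 2 * om
      + 2 * (W t / om) * GG - - ((1 + 2 * C) * om * (1 + Y t ^+ 2 + (W t / om) ^+ 2)) * om).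
    rewrite /en om4 /K /GG.
    by field; rewrite !gt_eqF.
  apply: mulr_ge0; first by rewrite divr_ge0 ?expR_ge0 // mulr_ge0 ?ltW.
  by rewrite subr_ge0.
have Eq : E q <= D.
  have bq : ball v0 e (upd v q) /\ ball v0 e' (upd v q).
    split; apply/ball_rVP; split=> // j; case: (@split_ordP 1 m j) => k ->.
    - by rewrite lshift1 /v0 !upd0 subrr normr0.
    - rewrite /v0 !updr; have [/ball_rVP [_ /(_ (rr k)) h] _] := hv.
      by apply: lt_le_trans h _; rewrite /w !ge_min lexx ?orbT.
    - by rewrite lshift1 /v0 !upd0 subrr normr0.
    - rewrite /v0 !updr; have [/ball_rVP [_ /(_ (rr k)) h] _] := hv.
      by apply: lt_le_trans h _; rewrite /w !ge_min lexx ?orbT.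
  have near1 (a b : R) : `|a - b| < 1 -> b * b <= (`|a| + 1) ^+ 2.
    move=> h; rewrite -expr2 -(sqr_normr b); rewrite ler_sqr ?nnegrE ?addr_ge0 //.
    have -> : b = a - (a - b) by ring.
    by apply: le_trans (ler_normB _ _) _; rewrite lerD2l ltW.
  rewrite /E /D ler_wpM2r ?expR_ge0 // /en !lerD //; first exact: near1 (Be _ bq.1).
  by rewrite ler_wpM2r ?powR_ge0 //; exact: near1 (Be' _ bq.2).
have mono : E (v 0 o0) <= E q.
  have I t : t \in `[v 0 o0, q] -> 0 < t < r3.
    by rewrite in_itv /= => /andP[at_ tb]; rewrite (lt_le_trans vp at_) (le_lt_trans tb qr).
  have I' t : t \in `]v 0 o0, q[ -> 0 < t < r3.
    by move=> h; apply: I; exact: subset_itv_oo_cc h.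
  apply: (@ger0_derive1_ndecr _ E (v 0 o0) q) => //; last exact: ltW.
  - by move=> t /I' /dE [].
  - by move=> t /I' h; have [_ Ed] := dE t h; rewrite derive1E Ed; exact: pos.
  - by apply: derivable_within_continuous => t /I /dE [].
have D1 : 1 <= D.
  rewrite /D -[1]mulr1; apply: ler_pM => //.
    by rewrite mulr1 -addrA lerDl addr_ge0 ?sqr_ge0 // mulr_ge0 ?sqr_ge0 ?powR_ge0.
  rewrite -expR0 ler_expR mulr_ge0 ?powR_ge0 // /K mulr_ge0 // addr_ge0 // mulr_ge0 //.
have yD : `|y v| ^+ 2 <= D.
  apply: le_trans (le_trans mono Eq); rewrite /E /en /Y /W upd_id sqr_normr.
  rewrite -[leLHS]mulr1; apply: ler_pM => //; first exact: sqr_ge0.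
    rewrite -expr2; have : 0 <= th y v * th y v * v 0 o0 `^ (- 4^-1).
      by rewrite mulr_ge0 ?powR_ge0 // -expr2 sqr_ge0.
    by move=> z0; rewrite addrAC lerDr addr_ge0.
  rewrite -expR0 ler_expR mulr_ge0 ?powR_ge0 // /K mulr_ge0 // addr_ge0 // mulr_ge0 //.
exact: (sq_le (normr_ge0 _) D1 yD).
Qed.

Lemma gronwall r y Phi : sm p y -> G p r 4^-1 Phi ->
  bO p r 4^-1 (fun v : pt => th (th y) v - th y v - Phi v * y v) -> bO p r 0 y.
Proof.
elim: r y => [|r IH] y sy GP Hy.
  by split=> //; apply: gronwall0 sy (bO_0 GP.2) (bO_0 Hy).
split; first exact: gronwall0 sy (bO_0 GP.2) (bO_0 Hy).
have GPr : G p r 4^-1 Phi by apply: G_W GP.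
have Gy : G p r 0 y by split=> //; apply: IH => //; exact: bO_S Hy.
move=> i; apply: IH => //; first exact: sm_px.
have Gi := GM p0 (G_px i GP) Gy; rewrite addr0 in Gi.
have S1 : sm p (th (th y)) by apply: sm_th; exact: sm_th.
have S2 : sm p (th y) by exact: sm_th.
have S0 : sm p (fun v : pt => th (th y) v - th y v - Phi v * y v).
  apply: smD; first apply: smD => //.
    by apply: sm_eq (smM (sm_cst p (-1)) S2); apply: ev_true => v _; rewrite mulN1r.
  by apply: sm_eq (smM (sm_cst p (-1)) (smM GP.1 sy)); apply: ev_true => v _; rewrite mulN1r.
have := GD (conj (sm_px i S0) (Hy.2 i)) Gi.
move=> [_]; apply: bO_eq.
have E1 := ev_px_th i sy; have E2 := ev_px_th i S2; have E3 := ev_partial o0 E1.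
apply: ev_mono (ev_and E1 (ev_and E2 (ev_and E3 (ev_and (sm_deriv (rr i) S1) (ev_and (sm_deriv (rr i) S2)
  (ev_and (sm_deriv (rr i) GP.1) (sm_deriv (rr i) sy))))))) => v _ [e1 [e2 [e3 [d1 [d2 [d3 d4]]]]]].
have dM : derivable (fun v : pt => Phi v * y v) v (ee (rr i)) := derivableM d3 d4.
have dB : derivable (fun v : pt => th (th y) v - th y v) v (ee (rr i)) := derivableB d1 d2.
rewrite {1}/px (partialB dB dM) (partialB d1 d2) (partialM d3 d4).
rewrite -/(px i (th (th y)) v) -/(px i (th y) v) e1 e2.
have -> : th (px i (th y)) v = th (th (px i y)) v by rewrite {1}/th e3.
by rewrite /px; ring.
Qed.


(** Landau's interpolation: a difference quotient of [f] over a small fixed step tends to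
    [0] with [f], and the bound on the second derivative makes it close to [px i f]. *)
Lemma interpolate f i a : 0 < a -> sm p f -> bO0 p a f -> bO0 p 0 (px i (px i f)) ->
  vanish p (px i f).
Proof.
move=> a0 [r r0 Cf] /bO0_C [C C0 [r1 r10 H1]] /bO0_C [C' C'0 [r2 r20 H2]].
pose q := Num.min r (Num.min r1 r2) / 2.
have m0 : 0 < Num.min r (Num.min r1 r2) by rewrite !lt_min r0 r10 r20.
have q0 : 0 < q by rewrite divr_gt0.
exists q => // v hv e e0.
pose h := Num.min q (e / (2 * (C' + 1))).
have e1 : 0 < e / (2 * (C' + 1)) by rewrite divr_gt0 // mulr_gt0 // ltr_wpDl.
have h0 : 0 < h by rewrite lt_min q0.
have e2 : 0 < e * h / (4 * (C + 1)) by rewrite divr_gt0 ?mulr_gt0 // ltr_wpDl.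
pose d := Num.min q ((e * h / (4 * (C + 1))) `^ a^-1).
exists d; first by rewrite lt_min q0 powR_gt0.
move=> t /andP[t0 td].
have tq : t < q by apply: lt_le_trans td (min_lel _ _).
have ta : t `^ a < e * h / (4 * (C + 1)).
  have -> : e * h / (4 * (C + 1)) = ((e * h / (4 * (C + 1))) `^ (a^-1)) `^ a.
    by rewrite -powRrM mulVf ?gt_eqF // powRr1 // ltW.
  apply: gt0_ltr_powR => //; rewrite ?nnegrE ?powR_ge0 ?(ltW t0) //.
  by apply: lt_le_trans td (min_ler _ _).
set u := upd v t.
have hu : hb p q u by apply: hb_upd => //; rewrite t0.
have u0t : u 0 o0 = t by rewrite /u upd0.
clearbody u.
have IN (c : R) : 0 <= c <= 1 -> hb p (Num.min r (Num.min r1 r2)) (u + (c * h) *: ee (rr i)).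
  move=> /andP[c0 c1]; have ut := hb_s p0 hu; apply: (ball_hb p0); last first.
    rewrite !mxE /= mulr0 addr0; have /andP[-> /lt_trans] := ut; apply.
    by rewrite ltr_pdivrMr // ltr_pMr // ltr1n.
  move=> j; have [/ball_rVP [_ /(_ (rr j)) B] _] := hu.
  rewrite !mxE /= opprD addrA; apply: le_lt_trans (ler_normB _ _) _.
  have -> : Num.min r (Num.min r1 r2) = q + q by rewrite /q -splitr.
  apply: ltr_leD => //; rewrite normrM.
  apply: (@le_trans _ _ (h * 1)); last by rewrite mulr1; exact: min_lel.
  apply: ler_pM => //; first by rewrite normrM (ger0_norm c0) (gtr0_norm h0) ler_piMl // ltW.
  by case: (_ == _); rewrite ?normr1 ?normr0.
have [k1 k2 k3] : [/\ Num.min r (Num.min r1 r2) <= r, Num.min r (Num.min r1 r2) <= r1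
   & Num.min r (Num.min r1 r2) <= r2] by split; rewrite !ge_min lexx ?orbT.
have [c c01 E1] : exists2 c : R, 0 <= c <= 1 & f (u + h *: ee (rr i)) - f u =
    h * 'D_(ee (rr i)) f (u + (c * h) *: ee (rr i)).
  by apply: line_MVT => c c01; exact: Ck_derivable (Cf 1%N) (hb_sub k1 (IN c c01)).
have c0 : 0 <= c by case/andP: c01.
have [c' c'01 E2] : exists2 c' : R, 0 <= c' <= 1 &
    px i f (u + (c * h) *: ee (rr i)) - px i f u =
    (c * h) * 'D_(ee (rr i)) (px i f) (u + (c' * (c * h)) *: ee (rr i)).
  apply: line_MVT => c' /andP[c'0 c'1]; rewrite mulrA.
  apply: (Ck_derivable (Ck_partial (rr i) (Cf 2%N))); apply: (hb_sub k1); apply: IN.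
  by rewrite mulr_ge0 //= mulr_ile1 //; case/andP: c01.
have i1 : 0 <= (1 : R) <= 1 by rewrite ler01 lexx.
have i0 : 0 <= (0 : R) <= 1 by rewrite ler01 lexx.
have b1 : `|f (u + h *: ee (rr i)) - f u| <= 2 * C * t `^ a.
  have f1 := H1 _ (hb_sub k2 (IN 1 i1)); have f2 := H1 _ (hb_sub k2 (IN 0 i0)).
  rewrite mul0r scale0r addr0 u0t in f2; rewrite mul1r in f1.
  have E0 : (u + h *: ee (rr i)) 0 o0 = t by rewrite mxE u0t !mxE /= mulr0 addr0.
  rewrite E0 in f1.
  apply: le_trans (ler_normB _ _) _; have -> : 2 * C * t `^ a = C * t `^ a + C * t `^ a by ring.
  exact: lerD.
have b2 : `|'D_(ee (rr i)) (px i f) (u + (c' * (c * h)) *: ee (rr i))| <= C'.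
  have /andP[c'0 c'1] := c'01; have /andP[_ c1] := c01.
  have := H2 _ (hb_sub k3 (IN (c' * c) _)); rewrite mulr_ge0 //= mulr_ile1 // => /(_ isT).
  by rewrite powRr0 mulr1 mulrA /px partialE.
have E3 : px i f u = h^-1 * (f (u + h *: ee (rr i)) - f u)
   - c * h * 'D_(ee (rr i)) (px i f) (u + (c' * (c * h)) *: ee (rr i)).
  have ep : px i f (u + (c * h) *: ee (rr i)) = 'D_(ee (rr i)) f (u + (c * h) *: ee (rr i)).
    by rewrite /px partialE.
  by rewrite E1 mulKf ?gt_eqF // -ep -E2; ring.
rewrite E3; apply: le_lt_trans (ler_normB _ _) _.
rewrite [X in _ < X]splitr; apply: ltr_leD.
  rewrite normrM gtr0_norm ?invr_gt0 // ltr_pdivrMl //.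
  apply: le_lt_trans b1 _; rewrite ltr_pdivlMr ?mulr_gt0 ?ltr_wpDl // in ta.
  have : 0 <= t `^ a by exact: powR_ge0.
  by move: ta; rewrite mulrA; nra.
have hq : h * (2 * (C' + 1)) <= e.
  by rewrite -ler_pdivlMr; [exact: min_ler|rewrite mulr_gt0 // ltr_wpDl].
have /andP[_ c1] := c01.
rewrite !normrM (ger0_norm c0) (gtr0_norm h0).
have : c * h * `|'D_(ee (rr i)) (px i f) (u + (c' * (c * h)) *: ee (rr i))| <= 1 * h * C'.
  by apply: ler_pM => //; [rewrite mulr_ge0 // ltW|rewrite ler_wpM2r // ltW].
by move=> /le_trans; apply; rewrite mul1r; move: hq; nra.
Qed.

(** Pointwise decay of [f] is upgraded to its tangential derivatives one at a time:
    interpolation shows that each of them vanishes at [s = 0], and then integrating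
    [theta f] gives the rate. *)
Lemma bO_bootstrap r a f : 0 < a -> sm p f -> bO0 p a f -> bO p r.+1 0 f ->
  bO p r a (th f) -> bO p r a f.
Proof.
move=> a0; elim: r f => [|r IH] f sf b0 Hf Ht; first by split.
split=> // i; apply: IH; [exact: sm_px| |exact: Hf.2|].
  apply: (INT0_bO0 p0 a0); first exact: sm_px.
    apply: interpolate a0 sf b0 _; exact: bO_0 ((Hf.2 i).2 i).
  by apply: bO0_eq (bO_0 (Ht.2 i)); exact: ev_px_th.
by apply: bO_eq (Ht.2 i); exact: ev_px_th.
Qed.

Definition pi0 v : pt := upd v 0.

Lemma pi0p : pi0 p = p. Proof. by rewrite /pi0 -[in upd p _]p0 upd_id. Qed.

Lemma pi0_coord v j : pi0 v 0 j = v 0 j * (j != o0)%:R.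
Proof.
case: (@split_ordP 1 m j) => k ->; first by rewrite lshift1 upd0 eqxx mulr0.
by rewrite updr mulr1.
Qed.

Lemma smooth_pi0 f : smooth_at f p -> smooth_at (fun v => f (pi0 v)) p.
Proof.
move=> Sf; apply: smooth_at_comp; first by rewrite pi0p.
move=> j; have -> : (fun v => pi0 v 0 j) = (fun v => v 0 j * (j != o0)%:R).
  by apply/funext => v; exact: pi0_coord.
by apply: smooth_atM; [exact: smooth_at_coord|exact: smooth_at_cst].
Qed.

Lemma px_pi0 f i v : px i (fun v => f (pi0 v)) v = px i f (pi0 v).
Proof.
rewrite /px !partialE [LHS]derive_line [RHS]derive_line.
have -> // : (fun h : R => f (pi0 (h *: ee (rr i) + v))) = (fun h : R => f (h *: ee (rr i) + pi0 v)).
apply/funext => h; congr f; apply/rowP => j.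
rewrite pi0_coord [RHS]mxE pi0_coord !mxE; have [->|_] := eqVneq j o0.
  by rewrite /= !(mulr0, addr0).
by rewrite !mulr1.
Qed.

Lemma th_pi0 f v : th (fun v => f (pi0 v)) v = 0.
Proof.
rewrite /th partialE derive_line.
have -> : (fun h : R => f (pi0 (h *: ee o0 + v))) = (fun h : R => f (pi0 v)).
  apply/funext => h; congr f; apply/rowP => j; rewrite !pi0_coord !mxE.
  by have [->|_] := eqVneq j o0; rewrite /= !(mulr0, add0r).
by rewrite derive_cst mulr0.
Qed.

Lemma pi0_bO0 f : smooth_at f p -> bO0 p 1 (fun v => f v - f (pi0 v)).
Proof.
move=> Sf; have [r2 r20 C2] := smooth_at_ball Sf.
have := smooth_at_cont (smooth_at_partial o0 Sf) => /cvgrPdist_lt /(_ 1 ltr01) N.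
move/nbhs_ballP: N => [r3 /= r30 B].
exists (`|partial o0 f p| + 1); exists (Num.min r2 r3); first by rewrite lt_min r20.
move=> v hv; have /andP[v0 vr] := hb_s p0 hv.
have IN (c : R) : 0 <= c <= 1 -> ball p (Num.min r2 r3) (pi0 v + (c * v 0 o0) *: ee o0).
  move=> /andP[c0 c1]; apply/ball_rVP; split; first by rewrite lt_min r20.
  move=> j; have [/ball_rVP [_ /(_ j) Bj] _] := hv.
  rewrite mxE pi0_coord !mxE; have [->|jn] := eqVneq j o0; rewrite /= ?(mulr0, mulr1, addr0) //.
  rewrite add0r p0 sub0r normrN normrM (ger0_norm c0) (gtr0_norm v0).
  by apply: le_lt_trans vr; rewrite ler_piMl // ltW.
have [c c01 E] : exists2 c : R, 0 <= c <= 1 & f (pi0 v + v 0 o0 *: ee o0) - f (pi0 v) =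
    v 0 o0 * 'D_(ee o0) f (pi0 v + (c * v 0 o0) *: ee o0).
  apply: line_MVT => c /IN h; apply: Ck_derivable (C2 1%N) _.
  by apply: le_ball h; exact: min_lel.
have <- : pi0 v + v 0 o0 *: ee o0 = v by rewrite /pi0 /upd scale0r addr0 subrK.
set z := (pi0 v + v 0 o0 *: ee o0).
have zv : z = v by rewrite /z /pi0 /upd scale0r addr0 subrK.
have pz : pi0 z = pi0 v by rewrite zv.
rewrite pz E zv powRr1 ?(ltW v0) // normrM (gtr0_norm v0) mulrC; apply: ler_wpM2r; first exact: ltW.
have Bz : ball p r3 (pi0 v + (c * v 0 o0) *: ee o0) by apply: le_ball (IN c c01); exact: min_ler.
have := B _ Bz; rewrite /= partialE => h.
have -> : 'D_(ee o0) f (pi0 v + (c * v 0 o0) *: ee o0) = 'D_(ee o0) f p -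
  ('D_(ee o0) f p - 'D_(ee o0) f (pi0 v + (c * v 0 o0) *: ee o0)) by ring.
apply: le_trans (ler_normB _ _) _; rewrite lerD2l.
by move: h; rewrite partialE => /ltW.
Qed.

Lemma smooth_pi0B f : smooth_at f p -> smooth_at (fun v => f v - f (pi0 v)) p.
Proof.
move=> Sf; have -> : (fun v => f v - f (pi0 v)) = (fun v => f v + (-1) * f (pi0 v)).
  by apply/funext => v; rewrite mulN1r.
by apply: smooth_atD => //; apply: smooth_atM; [exact: smooth_at_cst|exact: smooth_pi0].
Qed.

Lemma G_base r f : smooth_at f p -> G p r 1 (fun v => f v - f (pi0 v)).
Proof.
elim: r f => [|r IH] f Sf; split; try exact: smooth_at_sm (smooth_pi0B Sf).
  by split => //; exact: pi0_bO0.
split=> [|i]; first exact: pi0_bO0.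
have [_] := IH _ (smooth_at_partial (rr i) Sf); apply: bO_eq.
apply: ev_mono (ev_and (sm_deriv (rr i) (smooth_at_sm Sf)) (sm_deriv (rr i) (smooth_at_sm (smooth_pi0 Sf)))).
by move=> v _ [d1 d2]; rewrite {1}/px (partialB d1 d2) -/(px i (fun v => f (pi0 v)) v) px_pi0.
Qed.

Lemma pi0_upd v t : pi0 (upd v t) = pi0 v.
Proof.
apply/rowP => j; rewrite !pi0_coord; have [->|jn] := eqVneq j o0; first by rewrite !mulr0.
case: (@split_ordP 1 m j) jn => k ->; first by rewrite lshift1 eqxx.
by move=> _; rewrite updr.
Qed.

(** The Taylor coefficient of order [j] in [s], as a function of the tangential
    variables only. *)
Definition tc f j v := iter j (partial o0) f (pi0 v) / j`!%:R.

Lemma smooth_iter f j v : smooth_at f v -> smooth_at (iter j (partial o0) f) v.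
Proof. by move=> Sf; elim: j => //= j IH; exact: smooth_at_partial. Qed.

Lemma smooth_tc f j : smooth_at f p -> smooth_at (tc f j) p.
Proof.
by move=> Sf; apply: smooth_atM; [apply: smooth_pi0; exact: smooth_iter|exact: smooth_at_cst].
Qed.

Lemma tcS f j v : tc (partial o0 f) j v = j.+1%:R * tc f j.+1 v.
Proof.
rewrite /tc -iterSr factS natrM invfM.
by rewrite [RHS]mulrCA mulVKf // pnatr_eq0.
Qed.

Definition taylor_rem f J v := f v - \sum_(j < J) v 0 o0 ^+ j * tc f j v.

Lemma smooth_s v : smooth_at (fun v : pt => v 0 o0) v.
Proof. exact: smooth_at_coord. Qed.

Lemma smooth_sX j v : smooth_at (fun v : pt => v 0 o0 ^+ j) v.
Proof.
elim: j => [|j IH].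
  have -> : (fun v : pt => v 0 o0 ^+ 0) = fun=> 1 by apply/funext => w; rewrite expr0.
  exact: smooth_at_cst.
have -> : (fun v : pt => v 0 o0 ^+ j.+1) = (fun v : pt => v 0 o0 * v 0 o0 ^+ j).
  by apply/funext => w; rewrite exprS.
by apply: smooth_atM => //; exact: smooth_s.
Qed.

Lemma smooth_at_sum (I : Type) (l : seq I) (Q : pred I) (F : I -> pt -> R) v :
  (forall i, smooth_at (F i) v) -> smooth_at (fun w => \sum_(i <- l | Q i) F i w) v.
Proof.
move=> SF; apply: (@closed_sum _ _ (fun f => smooth_at f v)) => //.
- by move=> c; exact: smooth_at_cst.
- by move=> f g; exact: smooth_atD.
Qed.

Lemma smooth_atB f g v : smooth_at f v -> smooth_at g v -> smooth_at (fun w => f w - g w) v.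
Proof.
move=> Sf Sg; have -> : (fun v => f v - g v) = (fun v => f v + (-1) * g v).
  by apply/funext => w; rewrite mulN1r.
by apply: smooth_atD => //; apply: smooth_atM => //; exact: smooth_at_cst.
Qed.

Lemma smooth_taylor f J : smooth_at f p -> smooth_at (taylor_rem f J) p.
Proof.
move=> Sf; apply: smooth_atB => //; apply: smooth_at_sum => j.
by apply: smooth_atM; [exact: smooth_sX|exact: smooth_tc].
Qed.

Lemma th_sX j v : th (fun v : pt => v 0 o0 ^+ j) v = j%:R * v 0 o0 ^+ j.
Proof.
have /(_ v) D := fun v => @smooth_sX j v.
elim: j D => [|j IH] D.
  have -> : (fun v : pt => v 0 o0 ^+ 0) = fun=> 1 by apply/funext => w; rewrite expr0.
  by rewrite /th partial_cst !(mulr0, mul0r).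
have -> : (fun v : pt => v 0 o0 ^+ j.+1) = (fun v : pt => v 0 o0 * v 0 o0 ^+ j).
  by apply/funext => w; rewrite exprS.
have der (f : pt -> R) : smooth_at f v -> derivable f v (ee o0).
  by move=> [U [_ Uv C]]; exact: (Ck_derivable (C 1%N)).
rewrite /th (partialM (der _ (@smooth_s v)) (der _ (@smooth_sX j v))) partial_coord eqxx.
rewrite mulrDr mul1r mulrCA -[X in _ + _ * X]/(th (fun v : pt => v 0 o0 ^+ j) v).
by rewrite IH ?exprS -?natr1; [ring|exact: smooth_sX].
Qed.

(** By induction: [theta] of the remainder is [s] times the remainder of [partial o0
    f] of one order less, and it integrates from [s = 0] without loss. *)
Lemma taylor r f J : smooth_at f p -> G p r J%:R (taylor_rem f J).
Proof.
elim: J f => [|J IH] f Sf.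
  apply: G_eq (G_smooth r Sf); apply: ev_true => v _.
  by rewrite /taylor_rem big_ord0 subr0.
split; first exact: smooth_at_sm (smooth_taylor _ Sf).
apply: (INT0 p0 (a := J.+1%:R) (b := 1)); rewrite ?ltr01 ?ltr0n //.
- exact: smooth_at_sm (smooth_taylor _ Sf).
- have : G p r 1 (fun v => (f v - f (pi0 v)) - \sum_(j < J) v 0 o0 ^+ j.+1 * tc f j.+1 v).
    apply: (GB p0); first exact: G_base.
    apply: G_sum => j; have Gj := G_smooth r (smooth_tc j.+1 Sf).
    have := GM p0 (G_s p r) (GM p0 (G_smooth r (@smooth_sX j p)) Gj).
    rewrite !addr0; apply: G_eq; apply: ev_true => v _; by rewrite exprS; ring.
  case=> _; apply: bO_eq; apply: ev_true => v _.
  rewrite /taylor_rem big_ord_recl expr0 mul1r /tc /= divr1 opprD addrA; congr (_ - _).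
have := GM p0 (G_s p r) (IH _ (smooth_at_partial o0 Sf)).
have <- : J.+1%:R = 1 + J%:R :> R by rewrite -natr1 addrC.
case=> _; apply: bO_eq.
have dv (g : pt -> R) w : smooth_at g w -> derivable g w (ee o0).
  by move=> [U [_ Uw CU]]; exact: (Ck_derivable (CU 1%N)).
have df := sm_deriv o0 (smooth_at_sm Sf).
have dt (j : 'I_J.+1) := sm_deriv o0 (smooth_at_sm (smooth_tc j Sf)).
apply: ev_mono (ev_and df (ev_all dt)) => v _ [dfv dtv].
have dj (j : 'I_J.+1) : derivable (fun v : pt => v 0 o0 ^+ j * tc f j v) v (ee o0).
  by apply: derivableM; [exact: dv (@smooth_sX j v)|exact: dtv].
have pj (j : 'I_J.+1) : v 0 o0 * partial o0 (fun v : pt => v 0 o0 ^+ j * tc f j v) v =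
    j%:R * v 0 o0 ^+ j * tc f j v.
  rewrite (partialM (dv _ _ (@smooth_sX j v)) (dtv j)) mulrDr.
  have -> : v 0 o0 * (partial o0 (fun v : pt => v 0 o0 ^+ j) v * tc f j v) =
     th (fun v : pt => v 0 o0 ^+ j) v * tc f j v by rewrite /th mulrA.
  have z : th (tc f j) v = 0.
    rewrite /th (_ : tc f j = fun v => j`!%:R^-1 * iter j (partial o0) f (pi0 v)); last first.
      by apply/funext => w; rewrite mulrC.
    have := th_pi0 (fun w => j`!%:R^-1 * iter j (partial o0) f w) v.
    by rewrite /th.
  rewrite [X in _ + X]mulrCA -/(th (tc f j) v) z mulr0 addr0 th_sX //.
have dS : derivable (fun v : pt => \sum_(j < J.+1) v 0 o0 ^+ j * tc f j v) v (ee o0).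
  exact: derivable_sumf.
have pS : partial o0 (fun v : pt => \sum_(j < J.+1) v 0 o0 ^+ j * tc f j v) v =
    \sum_(j < J.+1) partial o0 (fun v : pt => v 0 o0 ^+ j * tc f j v) v.
  exact: partial_sum.
rewrite /taylor_rem /th (partialB dfv dS) pS.
rewrite !mulrBr; congr (_ - _).
rewrite !mulr_sumr big_ord_recl pj mul0r mul0r add0r.
apply: eq_bigr => j _; rewrite pj tcS exprS.
rewrite /lift /= /bump /=; ring.
Qed.

(** The Taylor coefficients of order below [k] form a polynomial in [s] that is too small
    not to vanish. *)
Lemma smooth_flat f k : smooth_at f p -> bO0 p (k%:R - 3/4) f ->
  forall r, G p r k%:R f /\ G p r k.+1%:R (fun v => f v - v 0 o0 ^+ k * tc f k v).
Proof.
move=> Sf Of.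
have Z : ev p (fun v => forall j, (j < k)%N -> tc f j v = 0).
  have [C H1] := Of; have [C' H2] := bO_0 (taylor 0 k Sf).2.
  have [q q0 H] := ev_and H1 H2; exists q => // v hv.
  have k1 : k%:R - 1 < k%:R - 3/4 :> R by rewrite ltrD2l; lra.
  apply: (@poly_vanish R k (fun j => tc f j v) (`|C| + `|C'|) _ (Num.min q 1) _ k1).
    by rewrite lt_min q0 ltr01.
  move=> s /andP[s0]; rewrite lt_min => /andP[sq s1].
  have [] := H (upd v s) (hb_upd p0 hv _); first by rewrite s0.
  rewrite upd0 => h1 h2.
  have -> : \sum_(j < k) s ^+ j * tc f j v = f (upd v s) - taylor_rem f k (upd v s).
    rewrite /taylor_rem subKr upd0; apply: eq_bigr => j _; by rewrite /tc pi0_upd.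
  apply: le_trans (ler_normB _ _) _; rewrite mulrDl; apply: lerD.
    by apply: le_trans h1 _; rewrite ler_wpM2r ?powR_ge0 // ler_norm.
  apply: le_trans h2 _; apply: (@le_trans _ _ (`|C'| * s `^ k%:R)).
    by rewrite ler_wpM2r ?powR_ge0 // ler_norm.
  apply: ler_wpM2l => //.
  by apply: ger_powR; rewrite ?s0 ?(ltW s1) // lerBlDr lerDl; lra.
move=> r; split.
  apply: G_eq (taylor r k Sf); apply: ev_mono Z => v _ Zv.
  rewrite /taylor_rem big1 ?subr0 // => j _; by rewrite Zv ?mulr0.
apply: G_eq (taylor r k.+1 Sf); apply: ev_mono Z => v _ Zv.
rewrite /taylor_rem big_ord_recr /= big1 ?add0r // => j _; by rewrite Zv ?mulr0.
Qed.

End Germ2.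

(** * Linearisation at the boundary and comparison of solutions *)

Section MatrixGerms.
Context {R : realType} {m : nat}.
Local Notation pt := 'rV[R]_(1 + m).
Variables (p : pt).
Hypothesis p0 : p 0 o0 = 0.

Definition mG r a k l (M : pt -> 'M[R]_(k, l)) := forall i j, G p r a (fun v => M v i j).

Lemma mG_eq r a k l (M N : pt -> 'M[R]_(k, l)) : ev p (fun v => M v = N v) -> mG r a M -> mG r a N.
Proof. by move=> E H i j; apply: G_eq (H i j); apply: ev_mono E => v _ ->. Qed.

Lemma mG_W r r' a b k l (M : pt -> 'M[R]_(k, l)) : (r' <= r)%N -> a <= b -> mG r b M -> mG r' a M.
Proof. by move=> rr' ab H i j; exact: G_W (H i j). Qed.

Lemma mGB r a k l (M N : pt -> 'M[R]_(k, l)) : mG r a M -> mG r a N -> mG r a (fun v => M v - N v).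
Proof.
move=> HM HN i j; apply: G_eq (GB p0 (HM i j) (HN i j)); apply: ev_true => v _.
by rewrite addmxE oppmxE.
Qed.

Lemma mGZ r a b k l f (M : pt -> 'M[R]_(k, l)) : G p r a f -> mG r b M -> mG r (a + b) (fun v => f v *: M v).
Proof. by move=> Hf HM i j; apply: G_eq (GM p0 Hf (HM i j)); apply: ev_true => v _; rewrite scalemxE. Qed.

Lemma mGM r a b k l n (M : pt -> 'M[R]_(k, l)) (N : pt -> 'M[R]_(l, n)) :
  mG r a M -> mG r b N -> mG r (a + b) (fun v => M v *m N v).
Proof.
move=> HM HN i j.
have := G_sum (index_enum _) predT (fun x => GM p0 (HM i x) (HN x j)).
by apply: G_eq; apply: ev_true => v _; rewrite mxE.
Qed.

Lemma mGtr r a n (M : pt -> 'M[R]_n) : mG r a M -> G p r a (fun v => \tr (M v)).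
Proof. by move=> HM; exact: (G_sum (index_enum _) predT (fun x => HM x x)). Qed.

(** Pairs of germs that are bounded and [O(s^a)]-close. Unlike [L0] and [L1] below, this
    relation is stable under tangential derivatives; it serves for the curvature terms,
    which need no linearisation because they carry a factor [s]. *)
Definition cmp r a (x y : pt -> R) := [/\ G p r 0 x, G p r 0 y & G p r a (fun v => x v - y v)].

Lemma cmp_eq r a x y x' y' : ev p (fun v => x v = x' v) -> ev p (fun v => y v = y' v) ->
  cmp r a x y -> cmp r a x' y'.
Proof.
move=> Ex Ey [h1 h2 h3]; split; [exact: G_eq h1|exact: G_eq h2|apply: G_eq h3].
by apply: ev_mono (ev_and Ex Ey) => v _ [-> ->].
Qed.

Lemma cmp_W r r' a x y : (r' <= r)%N -> cmp r a x y -> cmp r' a x y.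
Proof. by move=> rr' [h1 h2 h3]; split; [exact: G_W h1|exact: G_W h2|exact: G_W h3]. Qed.

Lemma cmp_cst r a c : cmp r a (fun=> c) (fun=> c).
Proof.
split; try exact: G_cst; apply: G_eq (G_cst0 p r a); apply: ev_true => v _; by rewrite subrr.
Qed.

Lemma cmpD r a x y x' y' : cmp r a x y -> cmp r a x' y' ->
  cmp r a (fun v => x v + x' v) (fun v => y v + y' v).
Proof.
move=> [h1 h2 h3] [h4 h5 h6]; split; try exact: GD; apply: G_eq (GD h3 h6).
by apply: ev_true => v _; ring.
Qed.

Lemma cmpM r a x y x' y' : cmp r a x y -> cmp r a x' y' ->
  cmp r a (fun v => x v * x' v) (fun v => y v * y' v).
Proof.
move=> [h1 h2 h3] [h4 h5 h6]; split.
- by have := GM p0 h1 h4; rewrite addr0.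
- by have := GM p0 h2 h5; rewrite addr0.
have := GM p0 h3 h4; have := GM p0 h2 h6; rewrite addr0 add0r => k1 k2.
by apply: G_eq (GD k1 k2); apply: ev_true => v _; ring.
Qed.

Lemma cmpN r a x y : cmp r a x y -> cmp r a (fun v => - x v) (fun v => - y v).
Proof.
move=> /(cmpM (cmp_cst r a (-1))); apply: cmp_eq; apply: ev_true => v _; exact: mulN1r.
Qed.

Lemma cmpB r a x y x' y' : cmp r a x y -> cmp r a x' y' ->
  cmp r a (fun v => x v - x' v) (fun v => y v - y' v).
Proof. by move=> h /cmpN; exact: cmpD. Qed.

Lemma cmp_px r a x y i : cmp r.+1 a x y -> cmp r a (px i x) (px i y).
Proof.
move=> [h1 h2 h3]; split; [exact: G_px|exact: G_px|apply: G_eq (G_px i h3)].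
by apply: ev_mono (ev_and (sm_deriv (rr i) h1.1) (sm_deriv (rr i) h2.1)) => v _ [d1 d2];
  rewrite /px partialB.
Qed.

Lemma cmpV r a x y c : 0 < c -> ev p (fun v => c <= `|x v|) -> ev p (fun v => c <= `|y v|) ->
  cmp r a x y -> cmp r a (fun v => (x v)^-1) (fun v => (y v)^-1).
Proof.
move=> c0 xc yc [h1 h2 h3].
have k1 := GV p0 c0 xc h1; have k2 := GV p0 c0 yc h2; split=> //.
have := GM p0 h3 (GM p0 k1 (GZ p0 (-1) k2)); rewrite !addr0; apply: G_eq.
apply: ev_mono (ev_and xc yc) => v _ [xv yv].
have x0 : x v != 0 by rewrite -normr_gt0; exact: lt_le_trans xv.
have y0 : y v != 0 by rewrite -normr_gt0; exact: lt_le_trans yv.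
have alg (s t : R) : s != 0 -> t != 0 -> (s - t) * (s^-1 * (-1 * t^-1)) = s^-1 - t^-1.
  by move=> s0 t0; field; rewrite s0 t0.
exact: alg.
Qed.

Lemma cmp_sum r a (I : Type) (l : seq I) (Q : pred I) (F F' : I -> pt -> R) :
  (forall i, cmp r a (F i) (F' i)) ->
  cmp r a (fun v => \sum_(i <- l | Q i) F i v) (fun v => \sum_(i <- l | Q i) F' i v).
Proof.
move=> H; apply: (@closed_sum _ (bool * pt)%type
  (fun f => cmp r a (fun v => f (true, v)) (fun v => f (false, v))) _ _ _ l Q
  (fun i z => if z.1 then F i z.2 else F' i z.2)) => //=.
- by move=> c; exact: cmp_cst.
- by move=> f g; exact: cmpD.
Qed.

Definition cmpm r a k l (X Y : pt -> 'M[R]_(k, l)) :=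
  forall i j, cmp r a (fun v => X v i j) (fun v => Y v i j).

Lemma cmpmM r a k l n (X Y : pt -> 'M[R]_(k, l)) (X' Y' : pt -> 'M[R]_(l, n)) :
  cmpm r a X Y -> cmpm r a X' Y' -> cmpm r a (fun v => X v *m X' v) (fun v => Y v *m Y' v).
Proof.
move=> H H' i j; apply: (@cmp_eq _ _ (fun v => \sum_l X v i l * X' v l j) (fun v => \sum_l Y v i l * Y' v l j)).
- by apply: ev_true => v _; rewrite mxE.
- by apply: ev_true => v _; rewrite mxE.
by apply: cmp_sum => x; exact: cmpM.
Qed.

Lemma cmp_det r a n (X Y : pt -> 'M[R]_n) : cmpm r a X Y ->
  cmp r a (fun v => \det (X v)) (fun v => \det (Y v)).
Proof.
move=> H; apply: (@closed_det _ (bool * pt)%type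
  (fun f => cmp r a (fun v => f (true, v)) (fun v => f (false, v))) _ _ _ n
  (fun z => if z.1 then X z.2 else Y z.2)) => //=.
- by move=> c; exact: cmp_cst.
- by move=> f g; exact: cmpD.
- by move=> f g; exact: cmpM.
Qed.

(** A lower bound on the determinant, uniform near [p], keeps inverse matrices in
    the classes [G]. *)
Definition nondeg n (X : pt -> 'M[R]_n) := exists2 c, 0 < c & ev p (fun v => c <= `|\det (X v)|).

Lemma nondeg_unit n (X : pt -> 'M[R]_n) : nondeg X -> ev p (fun v => X v \in unitmx).
Proof.
case=> c c0; apply: ev_mono => v _ h; rewrite unitmxE unitfE -normr_gt0; exact: lt_le_trans h.
Qed.

Lemma cmpm_inv r a n (X Y : pt -> 'M[R]_n) : nondeg X -> nondeg Y -> cmpm r a X Y ->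
  cmpm r a (fun v => invmx (X v)) (fun v => invmx (Y v)).
Proof.
move=> dX dY H i j; have uX := nondeg_unit dX; have uY := nondeg_unit dY.
have [c c0 X0] := dX; have [c' c'0 Y0] := dY.
apply: (@cmp_eq _ _ (fun v => (\det (X v))^-1 * (\adj (X v)) i j) (fun v => (\det (Y v))^-1 * (\adj (Y v)) i j)).
- by apply: ev_mono uX => v _ h; rewrite (invmxE h) scalemxE.
- by apply: ev_mono uY => v _ h; rewrite (invmxE h) scalemxE.
apply: cmpM.
  apply: (@cmpV _ _ _ _ (Num.min c c')); rewrite ?lt_min ?c0 //; last exact: cmp_det.
  - by apply: ev_mono X0 => v _; apply: le_trans; exact: min_lel.
  - by apply: ev_mono Y0 => v _; apply: le_trans; exact: min_ler.
apply: (@closed_adj _ (bool * pt)%type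
  (fun f => cmp r a (fun v => f (true, v)) (fun v => f (false, v))) _ _ _ n
  (fun z => if z.1 then X z.2 else Y z.2) i j) => //=.
- by move=> x; exact: cmp_cst.
- by move=> f g; exact: cmpD.
- by move=> f g; exact: cmpM.
Qed.

Lemma ev_small b c f : 0 < b -> 0 < c -> bO0 p b f -> ev p (fun v => `|f v| <= c).
Proof.
move=> b0 c0 [C [q q0 H]].
have e1 : 0 < c / (`|C| + 1) by rewrite divr_gt0 // ltr_wpDl.
exists (Num.min q ((c / (`|C| + 1)) `^ (b^-1))); first by rewrite lt_min q0 powR_gt0.
move=> v hv; have /andP[v0 vr] := hb_s p0 hv.
apply: le_trans (H v (hb_sub (min_lel _ _) hv)) _.
have sb : v 0 o0 `^ b <= c / (`|C| + 1).
  have -> : c / (`|C| + 1) = ((c / (`|C| + 1)) `^ (b^-1)) `^ b.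
    by rewrite -powRrM mulVf ?gt_eqF // powRr1 // ltW.
  apply: ge0_ler_powR; rewrite ?nnegrE ?powR_ge0 ?(ltW b0) ?(ltW v0) //.
  by apply: le_trans (ltW vr) (min_ler _ _).
apply: (@le_trans _ _ (`|C| * v 0 o0 `^ b)); first by rewrite ler_wpM2r ?powR_ge0 // ler_norm.
apply: (@le_trans _ _ (`|C| * (c / (`|C| + 1)))); first by rewrite ler_wpM2l.
by rewrite mulrCA ler_piMr ?(ltW c0) // ler_pdivrMr ?ltr_wpDl // mul1r lerDl.
Qed.

Lemma nondeg_smooth n (g : pt -> 'M[R]_n) : (forall i j, smooth_at (fun v => g v i j) p) ->
  g p \in unitmx -> nondeg g.
Proof.
move=> Sg; rewrite unitmxE unitfE => d0.
have Sd : smooth_at (fun v => \det (g v)) p.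
  apply: (@closed_det _ _ (fun f => smooth_at f p)) => //.
  - by move=> c; exact: smooth_at_cst.
  - by move=> f f'; exact: smooth_atD.
  - by move=> f f'; exact: smooth_atM.
have c0 : 0 < `|\det (g p)| / 2 by rewrite divr_gt0 // normr_gt0.
have := smooth_at_cont Sd => /cvgrPdist_lt /(_ _ c0) /nbhs_ballP [q q0 B].
exists (`|\det (g p)| / 2) => //; exists q => // v [/B /= h _].
have : `|\det (g p)| <= `|\det (g p) - \det (g v)| + `|\det (g v)|.
  by apply: le_trans (ler_normD _ _); rewrite subrK.
by move: h; lra.
Qed.

Lemma nondeg_close n b (g X : pt -> 'M[R]_n) : 0 < b -> nondeg g -> cmpm 0 b X g -> nondeg X.
Proof.
move=> b0 [c c0 gc] H; have [_ _ [_ D]] := cmp_det H.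
have c2 : 0 < c / 2 by rewrite divr_gt0.
exists (c / 2) => //; apply: ev_mono (ev_and gc (ev_small b0 c2 (bO_0 D))) => v _ [h1 h2].
have : `|\det (g v)| <= `|\det (X v)| + `|\det (X v) - \det (g v)|.
  by have := ler_normB (\det (X v)) (\det (X v) - \det (g v)); rewrite subKr.
by move: h1 h2; lra.
Qed.

Section CompareCurvature.
Variables (a : R) (H T : pt -> 'M[R]_m) (u w : pt -> R).
Hypotheses (dH : nondeg H) (dT : nondeg T).

Lemma cmp_chx r k i j : cmpm r.+1 a H T -> cmp r a (chx H k i j) (chx T k i j).
Proof.
move=> HT; apply: cmpM; first exact: cmp_cst.
apply: cmp_sum => l; apply: cmpM.
  by apply: cmpm_inv => // i' j'; exact: cmp_W (leqnSn r) (HT i' j').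
by apply: cmpB; [apply: cmpD|]; exact: cmp_px.
Qed.

Lemma cmp_Ricx r : cmpm r.+2 a H T -> cmpm r a (Ricx H) (Ricx T).
Proof.
move=> HT i j; have cx r' k a' b : (r' <= r.+1)%N -> cmp r' a (chx H k a' b) (chx T k a' b).
  by move=> rr'; apply: cmp_chx => i' j'; apply: cmp_W (HT i' j').
apply: (@cmp_eq _ _ (ricx H i j) (ricx T i j)); try by apply: ev_true => v _; rewrite mxE.
apply: cmp_sum => k; apply: cmpD; first by apply: cmpB; apply: cmp_px; exact: cx.
by apply: cmp_sum => l; apply: cmpB; apply: cmpM; apply: cx.
Qed.

Lemma cmp_Hessx r : cmpm r.+1 a H T -> cmp r.+2 a u w -> cmpm r a (Hessx H u) (Hessx T w).
Proof.
move=> HT Huw i j.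
apply: (@cmp_eq _ _ (hessx H u i j) (hessx T w i j)); try by apply: ev_true => v _; rewrite mxE.
apply: cmpB; first by do 2!apply: cmp_px.
apply: cmp_sum => k; apply: cmpM; first exact: cmp_chx.
by apply: cmp_px; exact: cmp_W Huw.
Qed.
End CompareCurvature.

Local Notation q := (4^-1 : R).
(** A calculus of dual numbers: up to errors a quarter order smaller, an [L0] pair
    is small with difference [d] and an [L1] pair is close to [c]. Sums and products
    follow the rules for first order terms. *)
Definition L0 r a (x y d : pt -> R) := [/\ G p r q x, G p r q y, G p r a (fun v => x v - y v) &
  G p r (a + q) (fun v => x v - y v - d v)].
Definition L1 r a (x y c : pt -> R) := [/\ G p r 0 c, G p r q (fun v => x v - c v),
  G p r q (fun v => y v - c v) & G p r a (fun v => x v - y v)].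

Lemma q0 : 0 < q. Proof. by rewrite invr_gt0. Qed.
Hint Resolve q0 : core.

Lemma L0_eq r a x y d x' y' d' : ev p (fun v => x v = x' v) -> ev p (fun v => y v = y' v) ->
  ev p (fun v => d v = d' v) -> L0 r a x y d -> L0 r a x' y' d'.
Proof.
move=> Ex Ey Ed [h1 h2 h3 h4]; split; [exact: G_eq h1|exact: G_eq h2|apply: G_eq h3|apply: G_eq h4].
  by apply: ev_mono (ev_and Ex Ey) => v _ [-> ->].
by apply: ev_mono (ev_and Ed (ev_and Ex Ey)) => v _ [-> [-> ->]].
Qed.

Lemma L0D r a x y d x' y' d' : L0 r a x y d -> L0 r a x' y' d' ->
  L0 r a (fun v => x v + x' v) (fun v => y v + y' v) (fun v => d v + d' v).
Proof.
move=> [h1 h2 h3 h4] [k1 k2 k3 k4]; split; try exact: GD.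
- by apply: G_eq (GD h3 k3); apply: ev_true => v _; ring.
- by apply: G_eq (GD h4 k4); apply: ev_true => v _; ring.
Qed.

Lemma L0Z r a c x y d : L0 r a x y d -> L0 r a (fun v => c * x v) (fun v => c * y v) (fun v => c * d v).
Proof.
move=> [h1 h2 h3 h4]; split; try exact: (GZ p0).
- by apply: G_eq (GZ p0 c h3); apply: ev_true => v _; ring.
- by apply: G_eq (GZ p0 c h4); apply: ev_true => v _; ring.
Qed.

Lemma L0N r a x y d : L0 r a x y d -> L0 r a (fun v => - x v) (fun v => - y v) (fun v => - d v).
Proof. by move=> /(L0Z (-1)); apply: L0_eq; apply: ev_true => v _; exact: mulN1r. Qed.

Lemma L0B r a x y d x' y' d' : L0 r a x y d -> L0 r a x' y' d' ->
  L0 r a (fun v => x v - x' v) (fun v => y v - y' v) (fun v => d v - d' v).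
Proof. by move=> h /L0N; exact: L0D. Qed.

Lemma L0_0 r a : L0 r a (fun=> 0) (fun=> 0) (fun=> 0).
Proof.
split; try exact: G_cst0.
  by apply: G_eq (G_cst0 p r a); apply: ev_true => v _; rewrite subrr.
by apply: G_eq (G_cst0 p r (a + q)); apply: ev_true => v _; rewrite !subr0.
Qed.

Lemma L0_sum r a (I : Type) (l : seq I) (F F' D : I -> pt -> R) :
  (forall i, L0 r a (F i) (F' i) (D i)) ->
  L0 r a (fun v => \sum_(i <- l) F i v) (fun v => \sum_(i <- l) F' i v) (fun v => \sum_(i <- l) D i v).
Proof.
move=> H; elim: l => [|i l IH].
  by apply: L0_eq (L0_0 r a); apply: ev_true => v _; rewrite big_nil.
by apply: L0_eq (L0D (H i) IH); apply: ev_true => v _; rewrite big_cons.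
Qed.

Lemma L1_G r a x y c : L1 r a x y c -> G p r 0 x /\ G p r 0 y.
Proof.
move=> [h0 h1 h2 _]; split.
  have k1 := G_W p0 (leqnn r) (ltW q0) h1.
  have k2 := GD k1 h0.
  apply: G_eq k2.
  by apply: ev_true => v _; rewrite subrK.
apply: G_eq (GD (G_W p0 (leqnn r) (ltW q0) h2) h0).
by apply: ev_true => v _; rewrite subrK.
Qed.

Lemma L10 r a x y c x' y' d : L1 r a x y c -> L0 r a x' y' d ->
  L0 r a (fun v => x v * x' v) (fun v => y v * y' v) (fun v => c v * d v).
Proof.
move=> h; have [hx hy] := L1_G h; case: h => h0 h1 h2 h3 [k1 k2 k3 k4]; split.
- by have := GM p0 hx k1; rewrite add0r.
- by have := GM p0 hy k2; rewrite add0r.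
- have := GD (GM p0 h3 (G_W p0 (leqnn r) (ltW q0) k1)).
  rewrite addr0; move=> /(_ (fun v => y v * (x' v - y' v))) H.
  have := GM p0 hy k3; rewrite add0r => /H; apply: G_eq; apply: ev_true => v _; ring.
have e1 := GM p0 h3 k1; have e2 := GM p0 h2 k3; have e3 := GM p0 h0 k4.
rewrite add0r in e3; rewrite addrC in e2.
by apply: G_eq (GD e1 (GD e2 e3)); apply: ev_true => v _; ring.
Qed.

Lemma L01 r a x y c x' y' d : L1 r a x y c -> L0 r a x' y' d ->
  L0 r a (fun v => x' v * x v) (fun v => y' v * y v) (fun v => d v * c v).
Proof. by move=> h k; apply: L0_eq (L10 h k); apply: ev_true => v _; rewrite mulrC. Qed.

Lemma L00 r a x y d x' y' d' : L0 r a x y d -> L0 r a x' y' d' ->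
  L0 r a (fun v => x v * x' v) (fun v => y v * y' v) (fun=> 0).
Proof.
move=> [h1 h2 h3 h4] [k1 k2 k3 k4].
have E : G p r (a + q) (fun v => x v * x' v - y v * y' v).
  have e1 := GM p0 h3 k1; have e2 := GM p0 h2 k3; rewrite addrC in e2.
  by apply: G_eq (GD e1 e2); apply: ev_true => v _; ring.
have qq : q <= q + q by rewrite lerDl ltW.
split.
- exact: (G_W p0 (leqnn r) qq (GM p0 h1 k1)).
- exact: (G_W p0 (leqnn r) qq (GM p0 h2 k2)).
- by apply: (G_W p0 (leqnn r) _ E); rewrite lerDl ltW.
by apply: G_eq E; apply: ev_true => v _; rewrite subr0.
Qed.

Lemma L0_s r a x y : cmp r a x y -> L0 r a (fun v => v 0 o0 * x v) (fun v => v 0 o0 * y v) (fun=> 0).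
Proof.
move=> [h1 h2 h3].
have q1 : q <= 1 by rewrite invf_le1 // ler1n.
have E : G p r (a + q) (fun v => v 0 o0 * x v - v 0 o0 * y v).
  have := GM p0 (G_s p r) h3; rewrite addrC => /(G_W p0 (leqnn r) (lerD (lexx a) q1)).
  by apply: G_eq; apply: ev_true => v _; ring.
split.
- by have := GM p0 (G_s p r) h1; rewrite addr0; exact: G_W.
- by have := GM p0 (G_s p r) h2; rewrite addr0; exact: G_W.
- by apply: (G_W p0 (leqnn r) _ E); rewrite lerDl ltW.
by apply: G_eq E; apply: ev_true => v _; rewrite subr0.
Qed.

Definition mL0 r a k l (X Y D : pt -> 'M[R]_(k, l)) :=
  forall i j, L0 r a (fun v => X v i j) (fun v => Y v i j) (fun v => D v i j).
Definition mL1 r a k l (X Y C : pt -> 'M[R]_(k, l)) :=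
  forall i j, L1 r a (fun v => X v i j) (fun v => Y v i j) (fun v => C v i j).

Lemma mL0D r a k l (X Y D X' Y' D' : pt -> 'M[R]_(k, l)) : mL0 r a X Y D -> mL0 r a X' Y' D' ->
  mL0 r a (fun v => X v + X' v) (fun v => Y v + Y' v) (fun v => D v + D' v).
Proof.
by move=> h k' i j; apply: L0_eq (L0D (h i j) (k' i j)); apply: ev_true => v _; rewrite addmxE.
Qed.

Lemma mL0N r a k l (X Y D : pt -> 'M[R]_(k, l)) : mL0 r a X Y D ->
  mL0 r a (fun v => - X v) (fun v => - Y v) (fun v => - D v).
Proof. by move=> h i j; apply: L0_eq (L0N (h i j)); apply: ev_true => v _; rewrite oppmxE. Qed.

Lemma mL0Z r a k l c (X Y D : pt -> 'M[R]_(k, l)) : mL0 r a X Y D ->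
  mL0 r a (fun v => c *: X v) (fun v => c *: Y v) (fun v => c *: D v).
Proof. by move=> h i j; apply: L0_eq (L0Z c (h i j)); apply: ev_true => v _; rewrite scalemxE. Qed.

Lemma mL10 r a k l n (X Y C : pt -> 'M[R]_(k, l)) (X' Y' D : pt -> 'M[R]_(l, n)) :
  mL1 r a X Y C -> mL0 r a X' Y' D ->
  mL0 r a (fun v => X v *m X' v) (fun v => Y v *m Y' v) (fun v => C v *m D v).
Proof.
move=> h k' i j; apply: L0_eq (L0_sum (index_enum _) (fun x => L10 (h i x) (k' x j)));
  by apply: ev_true => v _; rewrite mxE.
Qed.

Lemma mL00 r a k l n (X Y D : pt -> 'M[R]_(k, l)) (X' Y' D' : pt -> 'M[R]_(l, n)) :
  mL0 r a X Y D -> mL0 r a X' Y' D' ->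
  mL0 r a (fun v => X v *m X' v) (fun v => Y v *m Y' v) (fun=> 0).
Proof.
move=> h k' i j; apply: L0_eq (L0_sum (index_enum _) (fun x => L00 (h i x) (k' x j)));
  apply: ev_true => v _; rewrite mxE // big1 //.
Qed.

Lemma mL0_tr r a n (X Y D : pt -> 'M[R]_n) : mL0 r a X Y D ->
  L0 r a (fun v => \tr (X v)) (fun v => \tr (Y v)) (fun v => \tr (D v)).
Proof. by move=> h; exact: (L0_sum (index_enum _) (fun x => h x x)). Qed.

Lemma mL1Z r a k l x y c (X Y D : pt -> 'M[R]_(k, l)) : L1 r a x y c -> mL0 r a X Y D ->
  mL0 r a (fun v => x v *: X v) (fun v => y v *: Y v) (fun v => c v *: D v).
Proof. by move=> h k' i j; apply: L0_eq (L10 h (k' i j)); apply: ev_true => v _; rewrite scalemxE. Qed.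

Lemma mL0Zm1 r a k l x y d (X Y C : pt -> 'M[R]_(k, l)) : L0 r a x y d -> mL1 r a X Y C ->
  mL0 r a (fun v => x v *: X v) (fun v => y v *: Y v) (fun v => d v *: C v).
Proof. by move=> h k' i j; apply: L0_eq (L01 (k' i j) h); apply: ev_true => v _; rewrite scalemxE. Qed.

Lemma mL0Zm0 r a k l x y d (X Y D : pt -> 'M[R]_(k, l)) : L0 r a x y d -> mL0 r a X Y D ->
  mL0 r a (fun v => x v *: X v) (fun v => y v *: Y v) (fun=> 0).
Proof.
by move=> h k' i j; apply: L0_eq (L00 h (k' i j)); apply: ev_true => v _; rewrite ?scalemxE ?mxE.
Qed.

Lemma mL0_s r a k l (X Y : pt -> 'M[R]_(k, l)) : cmpm r a X Y ->
  mL0 r a (fun v => v 0 o0 *: X v) (fun v => v 0 o0 *: Y v) (fun=> 0).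
Proof. by move=> h i j; apply: L0_eq (L0_s (h i j)); apply: ev_true => v _; rewrite ?scalemxE ?mxE. Qed.

Lemma G_2 r a f : G p r.+2 a f -> G p r a f.
Proof. by apply: G_W; rewrite ?lexx // -addn2 leq_addr. Qed.

Section Linearisation.
Variables (r : nat) (a : R) (g H T : pt -> 'M[R]_m) (u w : pt -> R).
Hypothesis Sg : forall i j, smooth_at (fun v => g v i j) p.
Hypothesis gu : g p \in unitmx.
Hypotheses (hH : mL1 r.+2 a H T g) (hH1 : mL0 r a (Th H) (Th T) (fun v => Th H v - Th T v))
  (hH2 : mL0 r a (Th (Th H)) (Th (Th T)) (fun v => Th (Th H) v - Th (Th T) v)).
Hypotheses (hu : L1 r.+2 a u w (fun=> 1)) (hu1 : L0 r a (th u) (th w) (fun v => th u v - th w v)).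

Let cH : cmpm 0 q H g.
Proof.
move=> i j; have [h1 h2 h3 h4] := hH i j; have [h5 h6] := L1_G (hH i j).
by split; [exact: G_W h5|exact: G_W h1|exact: G_W h2].
Qed.

Let cT : cmpm 0 q T g.
Proof.
move=> i j; have [h1 h2 h3 h4] := hH i j; have [h5 h6] := L1_G (hH i j).
by split; [exact: G_W h6|exact: G_W h1|exact: G_W h3].
Qed.

Let dg : nondeg g. Proof. exact: nondeg_smooth. Qed.
Let dH : nondeg H. Proof. exact: nondeg_close dg cH. Qed.
Let dT : nondeg T. Proof. exact: nondeg_close dg cT. Qed.

Let HT : cmpm r.+2 a H T.
Proof.
by move=> i j; have [h1 h2 h3 h4] := hH i j; have [h5 h6] := L1_G (hH i j).
Qed.

Let uw : cmp r.+2 a u w.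
Proof. by have [h1 h2 h3 h4] := hu; have [h5 h6] := L1_G hu. Qed.

Let Hi : mL1 r a (fun v => invmx (H v)) (fun v => invmx (T v)) (fun v => invmx (g v)).
Proof.
have c1 : cmpm r q H g.
  move=> i j; have [h1 h2 h3 h4] := hH i j; have [h5 h6] := L1_G (hH i j).
  by split; [exact: G_2 h5|exact: G_2 h1|exact: G_2 h2].
have c2 : cmpm r q T g.
  move=> i j; have [h1 h2 h3 h4] := hH i j; have [h5 h6] := L1_G (hH i j).
  by split; [exact: G_2 h6|exact: G_2 h1|exact: G_2 h3].
have c3 : cmpm r a H T by move=> i j; apply: cmp_W (HT i j); rewrite -addn2 leq_addr.
move=> i j; have [k1 k2 k3] := cmpm_inv dH dg c1 i j.
have [k4 k5 k6] := cmpm_inv dT dg c2 i j; have [k7 k8 k9] := cmpm_inv dH dT c3 i j.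
by split.
Qed.

Local Notation gi v := (invmx (g v)).
Local Notation D1 v := (Th H v - Th T v).
Local Notation D2 v := (Th (Th H) v - Th (Th T) v).

Let P0 : mL0 r a (Pm H) (Pm T) (fun v => gi v *m D1 v).
Proof. exact: mL10. Qed.

(** The terms quadratic in [theta H] and the intrinsic curvature, which carries a
    factor [s], do not contribute at this order. *)
Lemma lin_NS : G p r (a + q) (fun v => NS H v - NS T v -
   (4 * \tr (gi v *m D2 v) - 2 * (m%:R + 1) * \tr (gi v *m D1 v))).
Proof.
have t2 := L0Z 4 (mL0_tr (mL10 Hi hH2)).
have t3 := L0Z 3 (mL0_tr (mL00 P0 P0)).
have t4 := L0Z (2 * (m%:R + 1)) (mL0_tr P0).
have t5 : L0 r a (fun v => v 0 o0 * \tr (invmx (H v) *m Ricx H v))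
   (fun v => v 0 o0 * \tr (invmx (T v) *m Ricx T v)) (fun=> 0).
  apply: L0_s; have RR := cmp_Ricx dH dT HT.
  have cI : cmpm r a (fun v => invmx (H v)) (fun v => invmx (T v)).
    by apply: cmpm_inv => // i j; apply: cmp_W (HT i j); rewrite -addn2 leq_addr.
  by apply: cmp_sum => i; exact: (cmpmM cI RR).
have t6 := L00 (mL0_tr P0) (mL0_tr P0).
have [_ _ _] := L0D (L0B (L0B (L0B t2 t3) t4) t5) t6.
apply: G_eq; apply: ev_true => v _; rewrite /NS linear0 mulr0 expr2.
have alg (x1 x2 x3 x4 x5 y1 y2 y3 y4 y5 z1 z2 : R) :
  x1 - x2 - x3 - x4 + x5 - (y1 - y2 - y3 - y4 + y5) - (z1 - 0 - z2 - 0 + 0) =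
  x1 - x2 - x3 - x4 + x5 - (y1 - y2 - y3 - y4 + y5) - (z1 - z2) by ring.
exact: alg.
Qed.

(** As for [lin_NS]; only the terms linear in the Euler derivatives of [H] and [u]
    survive. *)
Lemma lin_NE : mG r (a + q) (fun v => NE H u v - NE T w v -
   ((-2) *: D2 v + (m%:R + 1) *: D1 v + \tr (gi v *m D1 v) *: g v
    + (2 * (th u v - th w v)) *: g v)).
Proof.
have hH' : mL1 r a H T g.
  move=> i j; have [h1 h2 h3 h4] := hH i j.
  by split; [exact: G_2 h1|exact: G_2 h2|exact: G_2 h3|exact: G_2 h4].
have hu' : L1 r a u w (fun=> 1).
  have [h1 h2 h3 h4] := hu.
  by split; [exact: G_2 h1|exact: G_2 h2|exact: G_2 h3|exact: G_2 h4].
have t1 := mL0Z (-2) hH2.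
have t2 := mL0Z (m%:R + 1) hH1.
have t3 := mL0Z 2 (mL00 hH1 P0).
have t4 := mL0Zm1 (mL0_tr P0) hH'.
have t5 := mL0N (mL0Zm0 (mL0_tr P0) hH1).
have t6 := mL0_s (cmp_Ricx dH dT HT).
have t7 := mL1Z hu' (mL0D (mL0D (mL0D (mL0D (mL0D t1 t2) t3) t4) t5) t6).
have t8 := mL0Zm1 (L0Z 2 hu1) hH'.
have t9 := mL0N (mL0Zm0 (L0Z 2 hu1) hH1).
have HT1 : cmpm r.+1 a H T by move=> i j; exact: cmp_W (HT i j).
have t10 := mL0N (mL0_s (cmp_Hessx dH dT HT1 uw)).
move=> i j; have [_ _ _] := mL0D (mL0D (mL0D t7 t8) t9) t10 i j.
apply: G_eq; apply: ev_true => v _.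
have alg (A B C1 C2 C3 C4 : 'M[R]_m) : (A - B - (C1 + C2 + C3 + C4)) i j =
   (A i j - B i j - (1 *: (C1 + C2 + 2 *: 0 + C3 - 0 + 0) + C4 - 0 - 0) i j).
  by rewrite scaler0 oppr0 !addr0 scale1r addmxE oppmxE addmxE oppmxE.
by rewrite alg.
Qed.
End Linearisation.

Lemma th_eq f f' : ev p (fun v => f v = f' v) -> ev p (fun v => th f v = th f' v).
Proof. by move=> /(ev_partial o0); apply: ev_mono => v _; rewrite /th => ->. Qed.

Lemma thB f f' : sm p f -> sm p f' -> ev p (fun v => th (fun v => f v - f' v) v = th f v - th f' v).
Proof.
move=> sf sf'; apply: ev_mono (ev_and (sm_deriv o0 sf) (sm_deriv o0 sf')) => v _ [d d'].
by rewrite /th partialB // mulrBr.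
Qed.

Lemma thD f f' : sm p f -> sm p f' -> ev p (fun v => th (fun v => f v + f' v) v = th f v + th f' v).
Proof.
move=> sf sf'; apply: ev_mono (ev_and (sm_deriv o0 sf) (sm_deriv o0 sf')) => v _ [d d'].
by rewrite /th partialD // mulrDr.
Qed.

Lemma thM0 c f : sm p c -> sm p f -> ev p (fun v => th c v = 0) ->
  ev p (fun v => th (fun v => c v * f v) v = c v * th f v).
Proof.
move=> sc sf c0; apply: ev_mono (ev_and c0 (ev_and (sm_deriv o0 sc) (sm_deriv o0 sf))) => v _ [z [d d']].
rewrite /th (partialM d d') mulrDr mulrA -/(th c v) z mul0r add0r; ring.
Qed.

Lemma th_sumf (n : nat) (F : 'I_n -> pt -> R) : (forall i, sm p (F i)) ->
  ev p (fun v => th (fun v => \sum_i F i v) v = \sum_i th (F i) v).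
Proof.
move=> SF; apply: ev_mono (ev_all (fun i => sm_deriv o0 (SF i))) => v _ d.
have -> : \sum_i th (F i) v = v 0 o0 * \sum_i partial o0 (F i) v by rewrite mulr_sumr.
by rewrite /th; congr (_ * _); exact: partial_sum.
Qed.

Section Compare.
Variables (g : pt -> 'M[R]_m).
Hypothesis m0 : (0 < m)%N.
Hypothesis Sg : forall i j, smooth_at (fun v => g v i j) p.
Hypothesis gu : g p \in unitmx.
Hypothesis gx : forall v, g v = g (pi0 v).

(** [u/sqrt s] and [H/s] have the leading behaviour of an asymptotically hyperbolic end. *)
Definition asymp_data r (H : pt -> 'M[R]_m) (u : pt -> R) :=
  [/\ mG r q (fun v => H v - g v), mG r q (Th H), mG r q (Th (Th H)),
      G p r q (fun v => u v - 1) & G p r q (th u)].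

(** Closeness of two solutions, with the Euler derivatives that occur in the
    equations. *)
Definition contact r a (H T : pt -> 'M[R]_m) (u w : pt -> R) :=
  [/\ mG r a (fun v => H v - T v), mG r a (fun v => Th H v - Th T v),
      mG r a (fun v => Th (Th H) v - Th (Th T) v),
      G p r a (fun v => u v - w v) & G p r a (fun v => th u v - th w v)].

Let mu : R := (m%:R + 1) / 2.
Let top : R := (2 * m%:R + 1) / 4.

Lemma asymp_data_W r r' H u : (r' <= r)%N -> asymp_data r H u -> asymp_data r' H u.
Proof.
move=> rr' [h1 h2 h3 h4 h5].
by split; [exact: mG_W h1|exact: mG_W h2|exact: mG_W h3|exact: G_W h4|exact: G_W h5].
Qed.

Lemma asymp_data_close r H T u w : asymp_data r H u -> asymp_data r T w -> contact r q H T u w.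
Proof.
move=> [h1 h2 h3 h4 h5] [k1 k2 k3 k4 k5]; split; try exact: mGB; try exact: (GB p0).
  by apply: mG_eq (mGB h1 k1); apply: ev_true => v _; rewrite opprB addrA subrK.
by apply: G_eq (GB p0 h4 k4); apply: ev_true => v _; rewrite opprB addrA subrK.
Qed.

Lemma mL0_self r a k l (X Y : pt -> 'M[R]_(k, l)) : mG r q X -> mG r q Y -> mG r a (fun v => X v - Y v) ->
  mL0 r a X Y (fun v => X v - Y v).
Proof.
move=> hX hY hXY i j; split; [exact: hX|exact: hY| |].
  by apply: G_eq (hXY i j); apply: ev_true => v _; rewrite addmxE oppmxE.
by apply: G_eq (G_cst0 p r (a + q)); apply: ev_true => v _; rewrite addmxE oppmxE subrr.
Qed.

Lemma Gg r : mG r 0 g. Proof. by move=> i j; exact: G_smooth. Qed.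

Lemma sm_of r a f c : smooth_at c p -> G p r a (fun v => f v - c v) -> sm p f.
Proof.
move=> Sc [sf _]; apply: sm_eq (smD sf (smooth_at_sm Sc)).
by apply: ev_true => v _; rewrite subrK.
Qed.

Lemma sm_ThTh r H u : asymp_data r H u -> [/\ forall i j, sm p (fun v => H v i j),
  forall i j, sm p (fun v => Th H v i j) & sm p u].
Proof.
move=> [h1 h2 h3 h4 h5]; split=> [i j|i j|]; last exact: sm_of (smooth_at_cst _ _) h4.
  apply: (sm_of (Sg i j)); apply: G_eq (h1 i j).
  by apply: ev_true => v _; rewrite addmxE oppmxE.
by have [] := h2 i j.
Qed.

Lemma th_Th (M : pt -> 'M[R]_m) i j : th (fun v => M v i j) = (fun v => Th M v i j).
Proof. by apply/funext => v; rewrite mxE. Qed.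

Lemma gi_G r : mG r 0 (fun v => invmx (g v)).
Proof.
have dg : nondeg g by exact: nondeg_smooth.
have c : cmpm r 0 g g.
  move=> i j; have h := Gg r i j; split=> //; apply: G_eq (G_cst0 p r 0).
  by apply: ev_true => v _; rewrite subrr.
by move=> i j; have [] := cmpm_inv dg dg c i j.
Qed.

Lemma th_gi i j v : th (fun v => invmx (g v) i j) v = 0.
Proof.
have -> : (fun v => invmx (g v) i j) = (fun v => (fun v => invmx (g v) i j) (pi0 v)).
  by apply/funext => w; rewrite /= -gx.
exact: (th_pi0 (fun v => invmx (g v) i j)).
Qed.

Lemma lin_close r a H T u w :
  asymp_data r.+2 H u -> asymp_data r.+2 T w -> contact r.+2 a H T u w ->
  G p r (a + q) (fun v => NS H v - NS T v -
     (4 * \tr (invmx (g v) *m (Th (Th H) v - Th (Th T) v))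
      - 2 * (m%:R + 1) * \tr (invmx (g v) *m (Th H v - Th T v)))) /\
  mG r (a + q) (fun v => NE H u v - NE T w v -
   ((-2) *: (Th (Th H) v - Th (Th T) v) + (m%:R + 1) *: (Th H v - Th T v)
    + \tr (invmx (g v) *m (Th H v - Th T v)) *: g v + (2 * (th u v - th w v)) *: g v)).
Proof.
move=> [a1 a2 a3 a4 a5] [b1 b2 b3 b4 b5] [c1 c2 c3 c4 c5].
have W2 k l b (M : pt -> 'M[R]_(k, l)) : mG r.+2 b M -> mG r b M by move=> h i j; exact: G_2 (h i j).
have hH : mL1 r.+2 a H T g.
  move=> i j; split; [exact: Gg| | |].
  - by apply: G_eq (a1 i j); apply: ev_true => v _; rewrite addmxE oppmxE.
  - by apply: G_eq (b1 i j); apply: ev_true => v _; rewrite addmxE oppmxE.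
  - by apply: G_eq (c1 i j); apply: ev_true => v _; rewrite addmxE oppmxE.
have hH1 := mL0_self (W2 _ _ _ _ a2) (W2 _ _ _ _ b2) (W2 _ _ _ _ c2).
have hH2 := mL0_self (W2 _ _ _ _ a3) (W2 _ _ _ _ b3) (W2 _ _ _ _ c3).
have hu : L1 r.+2 a u w (fun=> 1) by split; [exact: G_cst|exact: a4|exact: b4|exact: c4].
have hu1 : L0 r a (th u) (th w) (fun v => th u v - th w v).
  split; [exact: G_2 a5|exact: G_2 b5|exact: G_2 c5|].
  by apply: G_eq (G_cst0 p r (a + q)); apply: ev_true => v _; rewrite subrr.
by split; [exact: (lin_NS Sg gu hH hH1 hH2)|exact: (lin_NE Sg gu hH hH1 hH2 hu hu1)].
Qed.

(** One quarter order is gained at the cost of two tangential derivatives, which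
    come from the intrinsic curvature. The unknown [Z] is treated first because its
    equation, the one from [NS], is decoupled from the others. *)
Lemma compare_step r a H T u w : 0 < a -> a + q <= top ->
  asymp_data r.+2 H u -> asymp_data r.+2 T w -> contact r.+2 a H T u w ->
  G p r top (fun v => NS H v - NS T v) -> mG r top (fun v => NE H u v - NE T w v) ->
  contact r (a + q) H T u w.
Proof.
move=> a0 atop AH AT [c1 c2 c3 c4 c5] RS RE.
have [sH sH1 su] := sm_ThTh AH; have [sT sT1 sw] := sm_ThTh AT.
have [LS LE] := lin_close AH AT (And5 c1 c2 c3 c4 c5).
pose D1 v := Th H v - Th T v; pose D2 v := Th (Th H) v - Th (Th T) v.
pose Z v := \tr (invmx (g v) *m D1 v).
pose Z2 v := \tr (invmx (g v) *m D2 v).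
have amu : a + q < mu.
  by apply: le_lt_trans atop _; rewrite /top /mu; lra.
have sD1 i j : sm p (fun v => D1 v i j).
  by have [] := c2 i j.
have sgi i j : sm p (fun v => invmx (g v) i j) by have [] := gi_G 0 i j.
have thD1 i j : ev p (fun v => th (fun v => D1 v i j) v = D2 v i j).
  have E : (fun v => D1 v i j) = (fun v => Th H v i j - Th T v i j).
    by apply/funext => v; rewrite addmxE oppmxE.
  rewrite E; apply: ev_mono (thB (sH1 i j) (sT1 i j)) => v _ ->.
  by rewrite !th_Th /D2 addmxE oppmxE.
have EZ : Z = (fun v => \sum_i \sum_j invmx (g v) i j * D1 v j i).
  by apply/funext => v; apply: eq_bigr => i _; rewrite mxE.
have sZ : sm p Z.
  by rewrite EZ; apply: sm_sum => i; apply: sm_sum => j; exact: smM.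
have thZ : ev p (fun v => th Z v = Z2 v).
  have e1 := th_sumf (fun i => sm_sum (index_enum _) predT (fun j => smM (sgi i j) (sD1 j i))).
  have e2 (i : 'I_m) := th_sumf (fun j => smM (sgi i j) (sD1 j i)).
  have e3 (i j : 'I_m) := thM0 (sgi i j) (sD1 j i) (ev_true p (fun v _ => th_gi i j v)).
  rewrite EZ; apply: ev_mono (ev_and e1 (ev_and (ev_all e2)
    (ev_all (fun i => ev_all (fun j => ev_and (e3 i j) (thD1 j i)))))) => v _ [-> [E2 E3]].
  rewrite /Z2 /mxtrace; apply: eq_bigr => i _; rewrite E2 mxE; apply: eq_bigr => j _.
  by have [-> ->] := E3 i j.
have GRS := G_W p0 (leqnn r) atop RS.
have GZ1 : G p r (a + q) (fun v => Z2 v - mu * Z v).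
  have alg (x y z2 z k : R) :
    4^-1 * (x - y - (x - y - (4 * z2 - 2 * (k + 1) * z))) = z2 - (k + 1) / 2 * z by field.
  have := GZ p0 (4^-1) (GB p0 GRS LS); apply: G_eq; apply: ev_true => v _; exact: alg.
have GZZ : G p r (a + q) Z.
  split; first exact: sZ.
  apply: (INTpos p0 amu sZ); case: GZ1 => _; apply: bO_eq.
  by apply: ev_mono thZ => v _ ->.
have GZ2 : G p r (a + q) Z2.
  have := GD GZ1 (GZ p0 mu GZZ); apply: G_eq; apply: ev_true => v _; exact: subrK.
have E0 : mG r (a + q) (fun v => (-2) *: D2 v + (m%:R + 1) *: D1 v + Z v *: g v
    + (2 * (th u v - th w v)) *: g v).
  have RE' : mG r (a + q) (fun v => NE H u v - NE T w v) by exact: mG_W RE.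
  have := mGB RE' LE; apply: mG_eq; apply: ev_true => v _; by rewrite subKr.
have dg : nondeg g by exact: nondeg_smooth.
have tE := mGtr (mGM (gi_G r) E0); rewrite add0r in tE.
have m1 : (m%:R : R) != 0 by rewrite pnatr_eq0 -lt0n.
have Gv1 : G p r (a + q) (fun v => th u v - th w v).
  have := GZ p0 ((2 * m%:R)^-1) (GD tE (GD (GZ p0 2 GZ2) (GZ p0 (- (2 * m%:R + 1)) GZZ))).
  apply: G_eq; apply: ev_mono (nondeg_unit dg) => v _ ug.
  have alg (A B C : 'M[R]_m) (z t k : R) : C \in unitmx -> z = \tr (invmx C *m B) -> k != 0 ->
    (m%:R = k) -> (2 * k)^-1 * (\tr (invmx C *m ((-2) *: A + (k + 1) *: B + z *: C + (2 * t) *: C))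
      + (2 * \tr (invmx C *m A) + - (2 * k + 1) * z)) = t.
    move=> uC zE k0 mk; rewrite !mulmxDr -!scalemxAr !(mulVmx uC) !mxtraceD !mxtraceZ mxtrace1 mk -zE.
    by field.
  exact: (alg (D2 v) (D1 v) (g v) (Z v) (th u v - th w v) m%:R ug erefl m1 erefl).
have Gv : G p r (a + q) (fun v => u v - w v).
  have sv : sm p (fun v => u v - w v) by have [] := c4.
  split; first exact: sv.
  apply: (INT0 p0 _ a0 sv); first by rewrite addr_gt0.
    by have [] := G_2 c4.
  case: Gv1 => _; apply: bO_eq; by apply: ev_mono (thB su sw) => v _ ->.
have E1 : mG r (a + q) (fun v => (-2) *: D2 v + (m%:R + 1) *: D1 v).
  have e1 := mGZ GZZ (Gg r); have e2 := mGZ (GZ p0 2 Gv1) (Gg r).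
  rewrite addr0 in e1 e2.
  have := mGB (mGB E0 e2) e1; apply: mG_eq; apply: ev_true => v _; by rewrite !addrK.
have GD1' i j : G p r (a + q) (fun v => D2 v i j - mu * D1 v i j).
  have alg (x y k : R) : - 2^-1 * ((-2) * x + (k + 1) * y) = x - (k + 1) / 2 * y by field.
  have := GZ p0 (- 2^-1) (E1 i j); apply: G_eq; apply: ev_true => v _.
  by rewrite addmxE !scalemxE alg.
have GD1 : mG r (a + q) D1.
  move=> i j; split; first exact: sD1.
  apply: (INTpos p0 amu (sD1 i j)); case: (GD1' i j) => _; apply: bO_eq.
  by apply: ev_mono (thD1 i j) => v _ ->.
have GD2 : mG r (a + q) D2.
  move=> i j; have := GD (GD1' i j) (GZ p0 mu (GD1 i j)); apply: G_eq; apply: ev_true => v _; exact: subrK.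
split; [|exact: GD1|exact: GD2|exact: Gv|exact: Gv1] => i j.
have sR : sm p (fun v => (H v - T v) i j) by have [] := c1 i j.
split; first exact: sR.
apply: (INT0 p0 _ a0 sR); first by rewrite addr_gt0.
  by have [] := G_2 (c1 i j).
have [_] := GD1 i j; apply: bO_eq.
have E : (fun v => (H v - T v) i j) = (fun v => H v i j - T v i j).
  by apply/funext => v; rewrite addmxE oppmxE.
rewrite E; apply: ev_mono (thB (sH i j) (sT i j)) => v _ ->.
by rewrite !th_Th /D1 addmxE oppmxE.
Qed.

(** Iterating: two solutions modulo [O(s^(m/2 + 1/4))] agree to that order, since
    no indicial exponent lies between [0] and [(m + 1)/2]. *)
Lemma compare H T u w : asymp_data (4 * m) H u -> asymp_data (4 * m) T w ->
  G p (4 * m) top (fun v => NS H v - NS T v) -> mG (4 * m) top (fun v => NE H u v - NE T w v) ->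
  contact 0 top H T u w.
Proof.
move=> AH AT RS RE.
have step n k : (n + k = 2 * m)%N -> contact (2 * k) (n.+1%:R / 4) H T u w.
  elim: n k => [|n IH] k nk.
    rewrite mul1r; apply: asymp_data_close; [apply: asymp_data_W AH|apply: asymp_data_W AT];
      lia.
  have -> : n.+2%:R / 4 = n.+1%:R / 4 + q :> R by rewrite -[n.+2%:R]natr1 mulrDl mul1r.
  have k2 : ((2 * k).+2 <= 4 * m)%N by lia.
  have k1 : (2 * k <= 4 * m)%N by lia.
  apply: compare_step; [by rewrite divr_gt0| | | | | |].
  - have h : (n.+2%:R : R) <= 2 * m%:R + 1.
      by rewrite -natrM natr1 ler_nat; lia.
    have -> : n.+1%:R / 4 + q = n.+2%:R / 4 :> R by rewrite -[n.+2%:R]natr1 mulrDl mul1r.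
    by rewrite /top ler_wpM2r // invr_ge0.
  - exact: asymp_data_W AH.
  - exact: asymp_data_W AT.
  - have -> : ((2 * k).+2 = 2 * k.+1)%N by lia.
    by apply: IH; lia.
  - exact: G_W RS.
  - exact: mG_W RE.
have := step (2 * m)%N 0%N; rewrite addn0 muln0 => /(_ erefl).
by rewrite -natr1 natrM.
Qed.
End Compare.
End MatrixGerms.

(** * The formal solution *)

Section Formal.
Context {R : realType} {m : nat}.
Local Notation pt := 'rV[R]_(1 + m).

Section SmoothOperators.
Variables (v : pt).

Lemma smooth_th f : smooth_at f v -> smooth_at (th f) v.
Proof. by move=> Sf; apply: smooth_atM; [exact: smooth_s|exact: smooth_at_partial]. Qed.

Definition mS k l (M : pt -> 'M[R]_(k, l)) := forall i j, smooth_at (fun w => M w i j) v.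

Lemma smooth_eq (f f' : pt -> R) : f =1 f' -> smooth_at f v -> smooth_at f' v.
Proof. by move=> /funext ->. Qed.

Lemma smooth_atN f : smooth_at f v -> smooth_at (fun w => - f w) v.
Proof.
move=> Sf; apply: (@smooth_eq (fun w => (-1) * f w)) => [w|]; first by rewrite mulN1r.
by apply: smooth_atM => //; exact: smooth_at_cst.
Qed.

Lemma mSD k l (M N : pt -> 'M[R]_(k, l)) : mS M -> mS N -> mS (fun w => M w + N w).
Proof. by move=> h h' i j; apply: smooth_eq (smooth_atD (h i j) (h' i j)) => w; rewrite addmxE. Qed.

Lemma mSN k l (M : pt -> 'M[R]_(k, l)) : mS M -> mS (fun w => - M w).
Proof. by move=> h i j; apply: smooth_eq (smooth_atN (h i j)) => w; rewrite oppmxE. Qed.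

Lemma mSZ k l f (M : pt -> 'M[R]_(k, l)) : smooth_at f v -> mS M -> mS (fun w => f w *: M w).
Proof. by move=> h h' i j; apply: smooth_eq (smooth_atM h (h' i j)) => w; rewrite scalemxE. Qed.

Lemma mSZc k l (c : R) (M : pt -> 'M[R]_(k, l)) : mS M -> mS (fun w => c *: M w).
Proof. by apply: mSZ; exact: smooth_at_cst. Qed.

Lemma mSM k l n (M : pt -> 'M[R]_(k, l)) (N : pt -> 'M[R]_(l, n)) : mS M -> mS N -> mS (fun w => M w *m N w).
Proof.
move=> h h' i j; apply: (@smooth_eq (fun w => \sum_x M w i x * N w x j)) => [w|]; first by rewrite mxE.
by apply: smooth_at_sum => x; exact: smooth_atM.
Qed.

Lemma mStr n (M : pt -> 'M[R]_n) : mS M -> smooth_at (fun w => \tr (M w)) v.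
Proof. by move=> h; exact: smooth_at_sum. Qed.

Lemma mSTh k l (M : pt -> 'M[R]_(k, l)) : mS M -> mS (Th M).
Proof. by move=> h i j; apply: smooth_eq (smooth_th (h i j)) => w; rewrite mxE. Qed.

(** Near a point where [M] is invertible the inverse is given by the adjugate. *)
Lemma mSinv n (M : pt -> 'M[R]_n) : mS M -> M v \in unitmx -> mS (fun w => invmx (M w)).
Proof.
move=> h; rewrite unitmxE unitfE => d0 i j.
have Sd : smooth_at (fun w => \det (M w)) v.
  apply: (@closed_det _ _ (fun f => smooth_at f v)) => //.
  - by move=> c; exact: smooth_at_cst.
  - by move=> f f'; exact: smooth_atD.
  - by move=> f f'; exact: smooth_atM.
have : smooth_at (fun w => (\det (M w))^-1 * (\adj (M w)) i j) v.
  apply: smooth_atM; first exact: smooth_atV.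
  apply: (@closed_adj _ _ (fun f => smooth_at f v)) => //.
  - by move=> c; exact: smooth_at_cst.
  - by move=> f f'; exact: smooth_atD.
  - by move=> f f'; exact: smooth_atM.
apply: smooth_at_near.
have c0 : 0 < `|\det (M v)| by rewrite normr_gt0.
have := smooth_at_cont Sd => /cvgrPdist_lt /(_ _ c0); apply: filterS => w /= hw.
have dw : \det (M w) != 0.
  by apply: contraTneq hw => ->; rewrite subr0 ltxx.
by rewrite (invmxE (A := M w)) ?scalemxE // unitmxE unitfE.
Qed.

Lemma mSRicx H : mS H -> H v \in unitmx -> mS (Ricx H).
Proof.
move=> SH uH i j.
have cx k a b : smooth_at (chx H k a b) v.
  apply: smooth_atM; first exact: smooth_at_cst.
  apply: smooth_at_sum => l; apply: smooth_atM; first exact: mSinv.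
  by apply: smooth_atB; [apply: smooth_atD|]; exact: smooth_at_partial.
apply: (@smooth_eq (ricx H i j)) => [w|]; first by rewrite mxE.
apply: smooth_at_sum => k; apply: smooth_atD; first by apply: smooth_atB; exact: smooth_at_partial.
by apply: smooth_at_sum => l; apply: smooth_atB; exact: smooth_atM.
Qed.

Lemma mSHessx H u : mS H -> H v \in unitmx -> smooth_at u v -> mS (Hessx H u).
Proof.
move=> SH uH Su i j.
have cx k a b : smooth_at (chx H k a b) v.
  apply: smooth_atM; first exact: smooth_at_cst.
  apply: smooth_at_sum => l; apply: smooth_atM; first exact: mSinv.
  by apply: smooth_atB; [apply: smooth_atD|]; exact: smooth_at_partial.
apply: (@smooth_eq (hessx H u i j)) => [w|]; first by rewrite mxE.
apply: smooth_atB; first by do 2!apply: smooth_at_partial.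
by apply: smooth_at_sum => k; apply: smooth_atM => //; exact: smooth_at_partial.
Qed.

Lemma smooth_NS H : mS H -> H v \in unitmx -> smooth_at (NS H) v.
Proof.
move=> SH uH; have Si := mSinv SH uH; have S1 := mSTh SH; have S2 := mSTh S1.
have SP : mS (Pm H) := mSM Si S1.
have Sc c f : smooth_at f v -> smooth_at (fun w => c * f w) v.
  by apply: smooth_atM; exact: smooth_at_cst.
apply: (@smooth_eq (fun w => 4 * \tr (invmx (H w) *m Th (Th H) w)
  - 3 * \tr (Pm H w *m Pm H w) - 2 * (m%:R + 1) * \tr (Pm H w)
  - w 0 o0 * \tr (invmx (H w) *m Ricx H w) + \tr (Pm H w) * \tr (Pm H w))).
  by move=> w; rewrite /NS expr2.
apply: smooth_atD; last by apply: smooth_atM; exact: mStr.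
apply: smooth_atB; [apply: smooth_atB; [apply: smooth_atB|]|].
- by apply: Sc; apply: mStr; exact: mSM.
- by apply: Sc; apply: mStr; exact: mSM.
- by apply: Sc; exact: mStr.
apply: smooth_atM; first exact: smooth_s.
by apply: mStr; apply: mSM => //; exact: mSRicx.
Qed.

Lemma smooth_NE H u : mS H -> H v \in unitmx -> smooth_at u v -> mS (NE H u).
Proof.
move=> SH uH Su; have Si := mSinv SH uH; have S1 := mSTh SH; have S2 := mSTh S1.
have SP : mS (Pm H) := mSM Si S1.
have Su1 : smooth_at (fun w => 2 * th u w) v.
  by apply: smooth_atM; [exact: smooth_at_cst|exact: smooth_th].
have StP := mStr SP.
apply: mSD; last by apply: mSN; apply: mSZ; [exact: smooth_s|exact: mSHessx].
apply: mSD; last by apply: mSN; exact: mSZ.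
apply: mSD; last exact: mSZ.
apply: mSZ => //.
apply: mSD; last by apply: mSZ; [exact: smooth_s|exact: mSRicx].
apply: mSD; last by apply: mSN; exact: mSZ.
apply: mSD; last exact: mSZ.
apply: mSD; last by apply: mSZc; exact: mSM.
by apply: mSD; exact: mSZc.
Qed.
End SmoothOperators.

Lemma pi0_s (v : pt) : pi0 v 0 o0 = 0.
Proof. by rewrite pi0_coord eqxx mulr0. Qed.

Lemma pi0K (v : pt) : pi0 (pi0 v) = pi0 v.
Proof. exact: pi0_upd. Qed.

Lemma Th_pi0 k l (M : pt -> 'M[R]_(k, l)) v : Th M (pi0 v) = 0.
Proof. by apply/matrixP => i j; rewrite !mxE /th pi0_s mul0r. Qed.

(** At [s = 0] all Euler derivatives vanish and the curvature terms have a factor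
    [s]; the same holds for [NE_pi0]. *)
Lemma NS_pi0 H (v : pt) : NS H (pi0 v) = 0.
Proof.
have P0 : Pm H (pi0 v) = 0 by rewrite /Pm Th_pi0 mulmx0.
by rewrite /NS P0 Th_pi0 pi0_s !mulmx0 linear0 expr2 !(mulr0, mul0r, subr0, addr0).
Qed.

Lemma NE_pi0 H u (v : pt) : NE H u (pi0 v) = 0.
Proof.
have P0 : Pm H (pi0 v) = 0 by rewrite /Pm Th_pi0 mulmx0.
have t0 : th u (pi0 v) = 0 by rewrite /th pi0_s mul0r.
rewrite /NE P0 !Th_pi0 t0 pi0_s mxtrace0 !(mulmx0, mulr0, scaler0, scale0r, subr0, addr0).
done.
Qed.

Definition cNE (T : pt -> 'M[R]_m) (W : pt -> R) k (v : pt) : 'M[R]_m :=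
  \matrix_(i, j) tc (fun v => NE T W v i j) k v.

Section Coefficients.
Variables (g T : pt -> 'M[R]_m) (W : pt -> R) (k : nat).
Local Notation cE := (cNE T W k).
Let e : R := (m%:R + 1) * k%:R - 2 * k%:R ^+ 2.
(** The order-[k] coefficients that cancel the order-[k] residual; [trco] is going
    to be the trace of the metric coefficient [dco] and is found first. *)
Definition trco v : R := (2 * e)^-1 * tc (NS T) k v.
Definition wco v : R := - ((2 * k%:R * m%:R)^-1 * (\tr (invmx (g v) *m cE v) + (e + k%:R * m%:R) * trco v)).
Definition dco v : 'M[R]_m := - (e^-1 *: (cE v + (k%:R * trco v + 2 * k%:R * wco v) *: g v)).

(** The constants are nonzero because [2 k] differs from [m + 1]. The trace equation
    comes from [NS] and determines [trco]; the trace of the tangential equation then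
    gives [wco], and the tangential equation itself gives [dco]. *)
Lemma dco_eqns v : g v \in unitmx -> (0 < k)%N -> (2 * k <= m)%N ->
  [/\ \tr (invmx (g v) *m dco v) = trco v,
      tc (NS T) k v + (4 * k%:R ^+ 2 - 2 * (m%:R + 1) * k%:R) * trco v = 0 &
      cE v + e *: dco v + (k%:R * trco v) *: g v + (2 * k%:R * wco v) *: g v = 0].
Proof.
move=> ug k0 km.
have kR : (k%:R : R) != 0 by rewrite pnatr_eq0 -lt0n.
have mR : (m%:R : R) != 0 by rewrite pnatr_eq0; lia.
have e0 : e != 0.
  have -> : e = k%:R * ((m%:R + 1) - 2 * k%:R) by rewrite /e; ring.
  rewrite mulf_neq0 // subr_eq0 -natrM natr1 eqr_nat; lia.
have alg1 (t z k' m' e' : R) : k' != 0 -> m' != 0 -> e' != 0 ->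
    - (e'^-1 * (t + (k' * z + 2 * k' * - ((2 * k' * m')^-1 * (t + (e' + k' * m') * z))) * m')) = z.
  by move=> h1 h2 h3; field; rewrite h1 h2 h3.
have alg2 (c e' k' m' : R) : e' != 0 -> e' = (m' + 1) * k' - 2 * k' ^+ 2 ->
    c + (4 * k' ^+ 2 - 2 * (m' + 1) * k') * ((2 * e')^-1 * c) = 0.
  by move=> h1 h2; have -> : 4 * k' ^+ 2 - 2 * (m' + 1) * k' = - (2 * e') by [rewrite h2; ring]; field.
have alg3 (A B : 'M[R]_m) (x y e' : R) : e' != 0 ->
    A + e' *: - (e'^-1 *: (A + (x + y) *: B)) + x *: B + y *: B = 0.
  by move=> h; rewrite scalerN scalerA mulfV // scale1r opprD addNKr -addrA -scalerDl addNr.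
split; [|exact: alg2|exact: alg3].
have -> : \tr (invmx (g v) *m dco v) =
   - (e^-1 * (\tr (invmx (g v) *m cE v) + (k%:R * trco v + 2 * k%:R * wco v) * m%:R)).
  by rewrite /dco mulmxN -scalemxAr mulmxDr -scalemxAr mulVmx // raddfN /= mxtraceZ mxtraceD mxtraceZ mxtrace1.
exact: alg1.
Qed.
End Coefficients.

(** Partial sums in [s] of the formal solution, together with those of the lapse. *)
Fixpoint formal (g : pt -> 'M[R]_m) (J : nat) : (pt -> 'M[R]_m) * (pt -> R) :=
  if J is k.+1 then
    let: (T, W) := formal g k in
    (fun v => T v + v 0 o0 ^+ k.+1 *: dco g T W k.+1 v, fun v => W v + v 0 o0 ^+ k.+1 * wco g T W k.+1 v)
  else (g, fun=> 1).

Section FormalSolution.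
Variables (g : pt -> 'M[R]_m) (p : pt).
Hypothesis p0 : p 0 o0 = 0.
Hypothesis m0 : (0 < m)%N.
Hypothesis Sg : mS p g.
Hypothesis gu : g p \in unitmx.
Hypothesis gx : forall v, g v = g (pi0 v).

Lemma tc_pi0 f k (v : pt) : tc f k (pi0 v) = tc f k v.
Proof. by rewrite /tc pi0K. Qed.

Section Step.
Variables (T : pt -> 'M[R]_m) (W : pt -> R) (k : nat).
Hypothesis k0 : (0 < k)%N.
Hypotheses (ST : mS p T) (SW : smooth_at W p).
Hypotheses (T0 : forall v, T (pi0 v) = g v) (W0 : forall v, W (pi0 v) = 1).

Lemma T_unit : T p \in unitmx. Proof. by rewrite -(pi0p p0) T0. Qed.

Lemma trco_pi0 v : trco T k (pi0 v) = trco T k v.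
Proof. by rewrite /trco tc_pi0. Qed.

Lemma cNE_pi0 v : cNE T W k (pi0 v) = cNE T W k v.
Proof. by apply/matrixP => i j; rewrite !mxE tc_pi0. Qed.

Lemma wco_pi0 v : wco g T W k (pi0 v) = wco g T W k v.
Proof. by rewrite /wco trco_pi0 cNE_pi0 -(gx v). Qed.

Lemma dco_pi0 v : dco g T W k (pi0 v) = dco g T W k v.
Proof. by rewrite /dco trco_pi0 wco_pi0 cNE_pi0 -(gx v). Qed.

Let ScE : mS p (cNE T W k).
Proof.
move=> i j; apply: (@smooth_eq _ (tc (fun v => NE T W v i j) k)) => [w|]; first by rewrite mxE.
by apply: (smooth_tc p0); exact: (smooth_NE ST T_unit SW).
Qed.

Lemma smooth_trco : smooth_at (trco T k) p.
Proof.
apply: smooth_atM; first exact: smooth_at_cst.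
by apply: (smooth_tc p0); exact: (smooth_NS ST T_unit).
Qed.

Lemma smooth_wco : smooth_at (wco g T W k) p.
Proof.
apply: smooth_atN; apply: smooth_atM; first exact: smooth_at_cst.
apply: smooth_atD; first by apply: mStr; apply: mSM => //; exact: mSinv.
by apply: smooth_atM; [exact: smooth_at_cst|exact: smooth_trco].
Qed.

Lemma smooth_dco : mS p (dco g T W k).
Proof.
apply: mSN; apply: mSZc; apply: mSD => //; apply: mSZ => //.
apply: smooth_atD; apply: smooth_atM; try exact: smooth_at_cst; [exact: smooth_trco|exact: smooth_wco].
Qed.

Let T' v := T v + v 0 o0 ^+ k *: dco g T W k v.
Let W' v := W v + v 0 o0 ^+ k * wco g T W k v.

Lemma smooth_T' : mS p T'.
Proof. by apply: mSD => //; apply: mSZ; [exact: smooth_sX|exact: smooth_dco]. Qed.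

Lemma smooth_W' : smooth_at W' p.
Proof. by apply: smooth_atD => //; apply: smooth_atM; [exact: smooth_sX|exact: smooth_wco]. Qed.

Lemma T'_pi0 v : T' (pi0 v) = g v.
Proof. by rewrite /T' T0 pi0_s expr0n eqn0Ngt k0 scale0r addr0. Qed.

Lemma W'_pi0 v : W' (pi0 v) = 1.
Proof. by rewrite /W' W0 pi0_s expr0n eqn0Ngt k0 mul0r addr0. Qed.
End Step.

Lemma formal_base J : let T := (formal g J).1 in let W := (formal g J).2 in
  [/\ mS p T, smooth_at W p, forall v, T (pi0 v) = g v & forall v, W (pi0 v) = 1].
Proof.
elim: J => [|k] /=; first by split=> //; exact: smooth_at_cst.
case: (formal g k) => T W /= [ST SW T0 W0]; split.
- exact: smooth_T'.
- exact: smooth_W'.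
- exact: T'_pi0.
- exact: W'_pi0.
Qed.

(** A smooth function equal to its boundary value, or a multiple of an Euler derivative,
    differs from it by [O(s)]. *)
Lemma smooth_asymp_data r T W : mS p T -> smooth_at W p -> (forall v, T (pi0 v) = g v) ->
  (forall v, W (pi0 v) = 1) -> asymp_data p g r T W.
Proof.
move=> ST SW T0 W0.
have q1 : (4^-1 : R) <= 1 by rewrite invf_le1 // ler1n.
have B f : smooth_at f p -> G p r 4^-1 (fun v => f v - f (pi0 v)).
  by move=> Sf; apply: (G_W p0 (leqnn r) q1); exact: G_base.
have Bth f : smooth_at f p -> G p r 4^-1 (th f).
  move=> Sf; have := B _ (smooth_th Sf); apply: G_eq; apply: ev_true => v _.
  by rewrite {2}/th pi0_s mul0r subr0.
have BTh k l (M : pt -> 'M[R]_(k, l)) : mS p M -> mG p r 4^-1 (Th M).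
  move=> SM i j; apply: G_eq (Bth _ (SM i j)); apply: ev_true => v _; by rewrite mxE.
split; [|exact: BTh|by apply: BTh; exact: mSTh| |exact: Bth].
  move=> i j; apply: G_eq (B _ (ST i j)); apply: ev_true => v _.
  by rewrite addmxE oppmxE T0.
by apply: G_eq (B _ SW); apply: ev_true => v _; rewrite W0.
Qed.

Lemma th_pi0E (f : pt -> R) (v : pt) : (forall v, f v = f (pi0 v)) -> th f v = 0.
Proof. by move=> H; have -> : f = (fun v => f (pi0 v)) by [apply/funext]; exact: th_pi0. Qed.

Lemma dv_at (f : pt -> R) (i : 'I_(1 + m)) (w : pt) : smooth_at f w -> derivable f w (ee i).
Proof. by move=> [U [_ Uw CU]]; exact: (Ck_derivable (CU 1%N)). Qed.

Lemma th_sXM (f : pt -> R) k : (forall v, f v = f (pi0 v)) -> smooth_at f p ->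
  ev p (fun v => th (fun v => v 0 o0 ^+ k * f v) v = k%:R * (v 0 o0 ^+ k * f v)).
Proof.
move=> fp Sf; apply: ev_mono (sm_deriv o0 (smooth_at_sm Sf)) => v _ d.
have dX := dv_at (i := o0) (smooth_sX k v).
rewrite /th (partialM dX d) mulrDr mulrA -/(th (fun v => v 0 o0 ^+ k) v) th_sX mulrA.
have := th_pi0E v fp; rewrite {1}/th => z.
by rewrite [X in _ + X]mulrAC z mul0r addr0 mulrA.
Qed.

Lemma G_sXM r (f : pt -> R) k : smooth_at f p -> G p r k%:R (fun v => v 0 o0 ^+ k * f v).
Proof.
move=> Sf; elim: k => [|k IH].
  by apply: G_eq (G_smooth r Sf); apply: ev_true => v _; rewrite expr0 mul1r.
have := GM p0 (G_s p r) IH; rewrite -natr1 addrC; apply: G_eq; apply: ev_true => v _.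
by rewrite exprS mulrA.
Qed.

Lemma Th_sub k l (M N : pt -> 'M[R]_(k, l)) (D : 'M[R]_(k, l)) (c x : R) (v : pt) :
  (forall i j, th (fun v => M v i j) v = th (fun v => N v i j) v + c * (x * D i j)) ->
  Th M v - Th N v = (c * x) *: D.
Proof.
move=> h; apply/matrixP => i j; rewrite addmxE oppmxE scalemxE [Th M v i j]mxE [Th N v i j]mxE h.
by rewrite addrAC subrr add0r mulrA.
Qed.

Lemma cNEij T W k (v : pt) i j : cNE T W k v i j = tc (fun v => NE T W v i j) k v.
Proof. by rewrite mxE. Qed.

Lemma residual_alg (n n' d G C : 'M[R]_m) (c K M x z w : R) i j :
  C + ((M + 1) * K - 2 * K ^+ 2) *: d + (K * z) *: G + (2 * K * w) *: G = 0 ->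
  C i j = c ->
  (n' - n - ((-2) *: ((K ^+ 2 * x) *: d) + (M + 1) *: ((K * x) *: d) + (K * x * z) *: G
       + (2 * (K * x * w)) *: G)) i j + (n i j - x * c) = n' i j.
Proof.
move=> /matrixP/(_ i j) h <-; rewrite !(addmxE, scalemxE) [RHS]mxE in h.
rewrite !(addmxE, oppmxE, scalemxE).
have -> : C i j = - (((M + 1) * K - 2 * K ^+ 2) * d i j + K * z * G i j + 2 * K * w * G i j).
  by apply: (addIr (((M + 1) * K - 2 * K ^+ 2) * d i j + K * z * G i j + 2 * K * w * G i j));
    rewrite addNr -[RHS]h !addrA.
ring.
Qed.

(** The linearisation with error [O(s^(k + 1/4))] suffices: the new residual is smooth, so
    that it gains the full power as soon as its coefficient of order [k] cancels. *)
Lemma residual_step T W k : (0 < k)%N -> (2 * k <= m)%N -> mS p T -> smooth_at W p ->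
  (forall v, T (pi0 v) = g v) -> (forall v, W (pi0 v) = 1) ->
  let T' v := T v + v 0 o0 ^+ k *: dco g T W k v in
  let W' v := W v + v 0 o0 ^+ k * wco g T W k v in
  G p 0 k%:R (NS T) -> mG p 0 k%:R (NE T W) ->
  forall r, G p r k.+1%:R (NS T') /\ mG p r k.+1%:R (NE T' W').
Proof.
move=> k0 km ST SW T0 W0 T' W' RS RE.
have kR : (1 : R) <= k%:R by rewrite ler1n.
have ST' : mS p T' by exact: smooth_T'.
have SW' : smooth_at W' p by exact: smooth_W'.
have T'0 v : T' (pi0 v) = g v by exact: T'_pi0.
have W'0 v : W' (pi0 v) = 1 by exact: W'_pi0.
have uT : T p \in unitmx by exact: T_unit.
have uT' : T' p \in unitmx by rewrite -(pi0p p0) T'0.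
have AT := smooth_asymp_data 2 ST SW T0 W0; have AT' := smooth_asymp_data 2 ST' SW' T'0 W'0.
have Sd := smooth_dco k ST SW T0; have Sw := smooth_wco k ST SW T0.
pose d := dco g T W k; pose w := wco g T W k.
have dp v : d v = d (pi0 v) by rewrite /d dco_pi0.
have wp v : w v = w (pi0 v) by rewrite /w wco_pi0.
have kk : (k%:R - 3/4 : R) <= k%:R by lra.
have kk1 : (k.+1%:R - 3/4 : R) <= k%:R + 4^-1 by rewrite -natr1; lra.
have E1 : ev p (fun v => Th T' v - Th T v = (k%:R * v 0 o0 ^+ k) *: d v).
  have e i j : ev p (fun v => th (fun v => T' v i j) v = th (fun v => T v i j) v +
     k%:R * (v 0 o0 ^+ k * d v i j)).
    have Sx : smooth_at (fun v => v 0 o0 ^+ k * d v i j) p.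
      by apply: smooth_atM; [exact: smooth_sX|exact: Sd].
    have e1 := thD (smooth_at_sm (ST i j)) (smooth_at_sm Sx).
    have dpij v : d v i j = d (pi0 v) i j by rewrite -dp.
    have e2 := th_sXM k dpij (Sd i j).
    apply: ev_mono (ev_and e1 e2) => v _ [h1 h2]; rewrite -h2 -h1.
    congr (th _ v); apply/funext => y; by rewrite /T' addmxE scalemxE.
  apply: ev_mono (ev_all (fun i => ev_all (e i))) => v _ h.
  exact: Th_sub.
have E2 : ev p (fun v => Th (Th T') v - Th (Th T) v = (k%:R ^+ 2 * v 0 o0 ^+ k) *: d v).
  have e i j : ev p (fun v => th (fun v => Th T' v i j) v = th (fun v => Th T v i j) v +
     k%:R ^+ 2 * (v 0 o0 ^+ k * d v i j)).
    have Sx : smooth_at (fun v => v 0 o0 ^+ k * (k%:R * d v i j)) p.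
      by apply: smooth_atM; [exact: smooth_sX|apply: smooth_atM; [exact: smooth_at_cst|exact: Sd]].
    have e1 := thD (smooth_at_sm (mSTh ST i j)) (smooth_at_sm Sx).
    have dpij v : k%:R * d v i j = k%:R * d (pi0 v) i j by rewrite -dp.
    have Skd : smooth_at (fun v => k%:R * d v i j) p.
      by apply: smooth_atM; [exact: smooth_at_cst|exact: Sd].
    have e2 := th_sXM k dpij Skd.
    have e3 : ev p (fun v => Th T' v i j = Th T v i j + v 0 o0 ^+ k * (k%:R * d v i j)).
      apply: ev_mono E1 => v _ h.
      have -> : Th T' v = Th T v + (Th T' v - Th T v) by rewrite addrC subrK.
      by rewrite h addmxE scalemxE mulrCA mulrA.
    have e4 := th_eq e3.
    apply: ev_mono (ev_and e1 (ev_and e2 e4)) => v _ [h1 [h2 h3]].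
    by rewrite h3 h1 h2 expr2 -[in RHS]mulrA [in RHS](mulrCA k%:R (_ ^+ _)).
  apply: ev_mono (ev_all (fun i => ev_all (e i))) => v _ h.
  exact: Th_sub.
have E3 : ev p (fun v => th W' v - th W v = (k%:R * v 0 o0 ^+ k) * w v).
  have Sx : smooth_at (fun v => v 0 o0 ^+ k * w v) p by apply: smooth_atM; [exact: smooth_sX|exact: Sw].
  apply: ev_mono (ev_and (thD (smooth_at_sm SW) (smooth_at_sm Sx)) (th_sXM k wp Sw)) => v _ [h1 h2].
  by rewrite /W' -/w h1 h2 addrAC subrr add0r mulrA.
have cl : contact p 2 k%:R T' T W' W.
  split.
  - move=> i j; apply: G_eq (G_sXM 2 k (Sd i j)); apply: ev_true => v _.
    by rewrite /T' addrAC subrr add0r scalemxE.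
  - move=> i j; apply: G_eq (GZ p0 k%:R (G_sXM 2 k (Sd i j))); apply: ev_mono E1 => v _ ->.
    by rewrite scalemxE mulrA.
  - move=> i j; apply: G_eq (GZ p0 (k%:R ^+ 2) (G_sXM 2 k (Sd i j))); apply: ev_mono E2 => v _ ->.
    by rewrite scalemxE mulrA.
  - by apply: G_eq (G_sXM 2 k Sw); apply: ev_true => v _; rewrite /W' addrAC subrr add0r.
  - by apply: G_eq (GZ p0 k%:R (G_sXM 2 k Sw)); apply: ev_mono E3 => v _ ->; rewrite mulrA.
have [LS LE] := lin_close p0 Sg gu AT' AT cl.
have ug : ev p (fun v => g v \in unitmx) by exact: (nondeg_unit (nondeg_smooth Sg gu)).
have SNS := smooth_NS ST uT; have SNE := smooth_NE ST uT SW.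
have NS1 : bO0 p (k.+1%:R - 3/4) (NS T').
  apply: (bO0_W p0 kk1); have [_ F] := smooth_flat p0 SNS (bO0_W p0 kk (bO_0 RS.2)) 0.
  have k14 : k%:R + 4^-1 <= k.+1%:R :> R by rewrite -[k.+1%:R]natr1; lra.
  have [_ /bO_0] := GD LS (G_W p0 (leqnn 0) k14 F); apply: bO0_eq.
  apply: ev_mono (ev_and ug (ev_and E1 E2)) => v _ [u1 [-> ->]].
  have [q1 q2 _] := dco_eqns T W u1 k0 km.
  rewrite -!scalemxAr !mxtraceZ q1.
  have alg (n n' c K M x z : R) : c + (4 * K ^+ 2 - 2 * (M + 1) * K) * z = 0 ->
     n' - n - (4 * (K ^+ 2 * x * z) - 2 * (M + 1) * (K * x * z)) + (n - x * c) = n'.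
    by move=> h; have -> : c = - ((4 * K ^+ 2 - 2 * (M + 1) * K) * z) by [apply: (addIr ((4 * K ^+ 2 - 2 * (M + 1) * K) * z)); rewrite h addNr]; ring.
  exact: alg.
have NE1 i j : bO0 p (k.+1%:R - 3/4) (fun v => NE T' W' v i j).
  apply: (bO0_W p0 kk1).
  have [_ F] := smooth_flat p0 (SNE i j) (bO0_W p0 kk (bO_0 (RE i j).2)) 0.
  have k14 : k%:R + 4^-1 <= k.+1%:R :> R by rewrite -[k.+1%:R]natr1; lra.
  have [_ /bO_0] := GD (LE i j) (G_W p0 (leqnn 0) k14 F); apply: bO0_eq.
  apply: ev_mono (ev_and ug (ev_and E1 (ev_and E2 E3))) => v _ [u1 [-> [-> ->]]].
  have [q1 q2 q3] := dco_eqns T W u1 k0 km.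
  rewrite -scalemxAr mxtraceZ q1.
  exact: (residual_alg _ _ _ q3 (cNEij T W k v i j)).
move=> r; split.
  by have [] := smooth_flat p0 (smooth_NS ST' uT') NS1 r.
by move=> i j; have [] := smooth_flat p0 (smooth_NE ST' uT' SW' i j) (NE1 i j) r.
Qed.

(** At order zero the residual is smooth and vanishes at [s = 0], hence is [O(s)].
    *)
Lemma formal_residual J : (2 * J <= m)%N -> forall r,
  G p r J.+1%:R (NS (formal g J).1) /\ mG p r J.+1%:R (NE (formal g J).1 (formal g J).2).
Proof.
elim: J => [|k IH] km r.
  have [ST SW T0 W0] := formal_base 0.
  have uT : (formal g 0).1 p \in unitmx by exact: gu.
  split.
    apply: G_eq (G_base p0 r (smooth_NS ST uT)); apply: ev_true => v _.
    by rewrite NS_pi0 subr0.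
  move=> i j; apply: G_eq (G_base p0 r (smooth_NE ST uT SW i j)); apply: ev_true => v _.
  by rewrite NE_pi0 [X in _ - X]mxE subr0.
have := IH _ 0%N; have := formal_base k => /=.
case: (formal g k) => T W /= [ST SW T0 W0] [|RS RE]; first by lia.
by apply: residual_step => //; lia.
Qed.

End FormalSolution.

(** The coefficient of [s^l]: it depends only on the partial sum of order [l - 1].
    *)
Definition aco (g : pt -> 'M[R]_m) l := dco g (formal g l.-1).1 (formal g l.-1).2 l.
Definition bco (g : pt -> 'M[R]_m) l := wco g (formal g l.-1).1 (formal g l.-1).2 l.

Lemma formalE g J v :
  (formal g J).1 v = g v + \sum_(1 <= l < J.+1) v 0 o0 ^+ l *: aco g l v /\
  (formal g J).2 v = 1 + \sum_(1 <= l < J.+1) v 0 o0 ^+ l * bco g l v.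
Proof.
elim: J => [|k [IH1 IH2]]; first by rewrite !big_geq // !addr0.
split; rewrite big_nat_recr //= addrA.
  by rewrite -IH1 /aco /=; case: (formal g k).
by rewrite -IH2 /bco /=; case: (formal g k).
Qed.

Section Solution.
Variables (g : pt -> 'M[R]_m) (p : pt).
Hypothesis p0 : p 0 o0 = 0.
Hypothesis m0 : (0 < m)%N.
Hypothesis Sg : mS p g.
Hypothesis gu : g p \in unitmx.
Hypothesis gx : forall v, g v = g (pi0 v).

Lemma aco_pi0 l v : aco g l (pi0 v) = aco g l v /\ bco g l (pi0 v) = bco g l v.
Proof. by split; [exact: dco_pi0|exact: wco_pi0]. Qed.

Lemma smooth_aco l : mS p (aco g l) /\ smooth_at (bco g l) p.
Proof.
have [ST SW T0 W0] := formal_base p0 Sg gu gx l.-1.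
by split; [exact: smooth_dco|exact: smooth_wco].
Qed.

Variables (H : pt -> 'M[R]_m) (u : pt -> R).
Hypothesis su : sm p u.

(** The lapse inherits its decay from the metric through the [00] equation: Gronwall
    bounds [u], the exponent-one ODE for [theta u] makes it decay, and then [u - 1] decays. *)
Lemma asymp_data_lapse r : mG p r.+1 4^-1 (fun v => H v - g v) -> mG p r.+1 4^-1 (Th H) ->
  mG p r.+1 4^-1 (Th (Th H)) -> ev p (fun v => N0 H u v = 0) ->
  vanish p (fun v => u v - 1) -> asymp_data p g r H u.
Proof.
move=> h1 h2 h3 N00 u1.
have q0 := q0 (R := R).
have cH : cmpm p 0 4^-1 H g.
  move=> i j; have Gh : G p 0 4^-1 (fun v => H v i j - g v i j).
    apply: (G_W p0 (leq0n r.+1) (lexx _)); apply: G_eq (h1 i j).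
    by apply: ev_true => v _; rewrite addmxE oppmxE.
  have Gg0 : G p 0 0 (fun v => g v i j) by exact: G_smooth.
  split=> //; apply: G_eq (GD (G_W p0 (leqnn 0) (ltW q0) Gh) Gg0).
  by apply: ev_true => v _; rewrite subrK.
have dg := nondeg_smooth Sg gu.
have dH := nondeg_close p0 q0 dg cH.
have GH : mG p r.+1 0 H.
  move=> i j; apply: G_eq (GD (G_W p0 (leqnn _) (ltW q0) (h1 i j)) (G_smooth r.+1 (Sg i j))).
  by apply: ev_true => v _; rewrite addmxE oppmxE subrK.
have cHH : cmpm p r.+1 0 H H.
  move=> i j; split; [exact: GH|exact: GH|].
  by apply: G_eq (G_cst0 p r.+1 0); apply: ev_true => v _; rewrite subrr.
have Hi : mG p r.+1 0 (fun v => invmx (H v)).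
  by move=> i j; have [] := cmpm_inv p0 dH dH cHH i j.
have GP : mG p r.+1 4^-1 (Pm H) by have := mGM p0 Hi h2; rewrite add0r.
pose Phi v := 2^-1 * \tr (Pm H v) + 4^-1 * \tr (Pm H v *m Pm H v)
           - 2^-1 * \tr (invmx (H v) *m Th (Th H) v).
have GPhi : G p r.+1 4^-1 Phi.
  apply: (GB p0); last by apply: (GZ p0); apply: mGtr; have := mGM p0 Hi h3; rewrite add0r.
  apply: GD; apply: (GZ p0); apply: mGtr => //.
  have qq : (4^-1 : R) <= 4^-1 + 4^-1 by rewrite lerDl ltW.
  exact: (mG_W p0 (leqnn _) qq (mGM p0 GP GP)).
have bu : bO p r.+1 0 u.
  apply: (gronwall p0 su GPhi); have [_] := G_cst0 p r.+1 (4^-1).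
  by apply: bO_eq; apply: ev_mono N00 => v _ <-; rewrite /N0 /Phi mulrC.
have Gu : G p r.+1 0 u by split.
have Gthu : G p r.+1 4^-1 (th u).
  split; first exact: sm_th.
  apply: (INTpos p0 (mu := 1)); [by rewrite invf_lt1 // ltr1n|exact: sm_th|].
  have := GM p0 Gu GPhi; rewrite add0r => -[_]; apply: bO_eq.
  by apply: ev_mono N00 => v _ /subr0_eq; rewrite mul1r /Phi => <-.
have su1 : sm p (fun v => u v - 1) by exact: smD su (sm_cst p (-1)).
have thu1 : ev p (fun v => th u v = th (fun v => u v - 1) v).
  apply: ev_mono (sm_deriv o0 su) => v _ d; rewrite /th; congr (_ * _).
  have dc : derivable (fun _ : pt => 1 : R) v (ee o0) by exact: derivable_cst.
  by rewrite (partialB d dc) partial_cst subr0.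
have Gu1 : G p r 4^-1 (fun v => u v - 1).
  split=> //; have [_ b1] := Gthu; apply: (bO_bootstrap p0 q0) => //.
  - apply: (INT0_bO0 p0 q0) => //; apply: bO0_eq (bO_0 b1); exact: thu1.
  - by have [] := GB p0 Gu (G_cst p r.+1 1).
  - by apply: bO_eq (bO_S b1); exact: thu1.
have W (k l : nat) (M : pt -> 'M[R]_(k, l)) : mG p r.+1 4^-1 M -> mG p r 4^-1 M.
  exact: (mG_W p0 (leqnSn r) (lexx _)).
split; [exact: W|exact: W|exact: W|exact: Gu1|exact: (G_W p0 (leqnSn r) (lexx _) Gthu)].
Qed.

(** Both the solution and the formal solution satisfy the equations up to the order
    allowed by [compare]. *)
Lemma static_expansion : let J := m./2 in
  mG p (4 * m).+1 4^-1 (fun v => H v - g v) -> mG p (4 * m).+1 4^-1 (Th H) ->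
  mG p (4 * m).+1 4^-1 (Th (Th H)) ->
  ev p (fun v => [/\ N0 H u v = 0, NS H v = 0 & NE H u v = 0]) ->
  vanish p (fun v => u v - 1) ->
  (forall i j, bO0 p ((2 * m%:R + 1) / 4) (fun v => H v i j - (formal g J).1 v i j)) /\
  bO0 p ((2 * m%:R + 1) / 4) (fun v => u v - (formal g J).2 v).
Proof.
move=> J h1 h2 h3 eqs u1.
have AH : asymp_data p g (4 * m) H u.
  by apply: asymp_data_lapse => //; apply: ev_mono eqs => v _ [].
have [ST SW T0 W0] := formal_base p0 Sg gu gx J.
have AT := smooth_asymp_data p0 (4 * m) ST SW T0 W0.
have J2 : (2 * J <= m)%N by rewrite /J; lia.
have [FS FE] := formal_residual p0 m0 Sg gu gx J2 (4 * m).
have top : (2 * m%:R + 1) / 4 <= J.+1%:R :> R.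
  rewrite ler_pdivrMr // -!natrM natr1 ler_nat /J; lia.
have [] := compare p0 m0 Sg gu gx AH AT.
- apply: (G_W p0 (leqnn _) top); apply: G_eq (GN p0 FS); apply: ev_mono eqs => v _ [_ -> _].
  by rewrite sub0r.
- move=> i j; apply: (G_W p0 (leqnn _) top); apply: G_eq (GN p0 (FE i j)).
  by apply: ev_mono eqs => v _ [_ _ ->]; rewrite sub0r oppmxE.
move=> c1 _ _ c4 _; split; last exact: bO_0 c4.2.
move=> i j; apply: bO0_eq (bO_0 (c1 i j).2); apply: ev_true => v _.
by rewrite addmxE oppmxE.
Qed.
End Solution.
End Formal.

(** * Expansions with logarithms *)

Lemma Ck_smooth_at (R : realType) n (U : set 'rV[R]_n) f k :
  (forall x, U x -> smooth_at f x) -> Ck k U f.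
Proof.
elim: k f => [|k IH] f Sf.
  by split=> // x; rewrite inE => /Sf; exact: smooth_at_cont.
split=> [x|i]; first by rewrite inE => /Sf; exact: smooth_at_cont.
split=> [x /Sf [V [_ Vx CV]]|]; first exact: (Ck_derivable (CV 1%N)).
by apply: IH => x /Sf; case=> V [oV Vx CV]; exists V; split=> // l; exact: Ck_partial (CV l.+1).
Qed.

Section CoordinateFunctions.
Context {R : realType} {m : nat}.
Local Notation pt := 'rV[R]_(1 + m).

Lemma is_derive_coord_fun (phi : R -> R) (d : R) (i : 'I_(1 + m)) (v : pt) :
  is_derive (v 0 o0) (1 : R) phi d ->
  is_derive v (ee i) (fun v : pt => phi (v 0 o0)) ((i == o0)%:R * d).
Proof.
move=> D; pose c : R := (i == o0)%:R.
have E : (fun h : R => phi ((h *: ee i + v) 0 o0)) = (fun h : R => phi (v 0 o0 + h * c)).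
  apply/funext => h; congr phi; rewrite !mxE eqxx /= addrC; congr (_ + _ * _).
  by rewrite /c eq_sym.
have D1 : is_derive (0 : R) (1 : R) (fun h : R => v 0 o0 + h * c) c.
  have d0 : is_derive (0 : R) (1 : R) (fun h : R => h * c) c.
    by split; [exact: derivableM|rewrite deriveM // derive_cst derive_id scaler0 add0r [_ *: _]mulr1].
  have := @is_deriveD R _ _ _ _ (0 : R) (1 : R) _ _ (is_derive_cst (v 0 o0) (0 : R) (1 : R)) d0.
  by rewrite add0r.
have D2 : is_derive (0 : R) (1 : R) (fun h : R => phi (v 0 o0 + h * c)) (d * c).
  have D' : is_derive (v 0 o0 + 0 * c) (1 : R) phi d by rewrite mul0r addr0.
  exact: (@is_derive1_comp R phi (fun h => v 0 o0 + h * c) 0 _ _ D' D1).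
split.
  by apply/derivable1P; rewrite E; have [] := D2.
by rewrite derive_line E mulrC; have [_ ->] := D2.
Qed.

Lemma coord_fun_cont (phi : R -> R) (d : R) (v : pt) : is_derive (v 0 o0) (1 : R) phi d ->
  {for v, continuous (fun v : pt => phi (v 0 o0))}.
Proof.
move=> [D _]; apply: (@continuous_comp _ _ _ (fun v : pt => v 0 o0) phi).
  exact: coord_continuous.
by apply: differentiable_continuous; apply/derivable1_diffP.
Qed.

Let pos : set pt := [set v | 0 < v 0 o0].

Lemma pos_open : open pos.
Proof.
have -> : pos = (fun v : pt => v 0 o0) @^-1` [set x : R | 0 < x] by [].
by apply: open_comp => [v _|]; [exact: coord_continuous|exact: open_gt].
Qed.

Lemma Ck_powR k (a : R) : Ck k pos (fun v : pt => v 0 o0 `^ a).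
Proof.
elim: k a => [|k IH] a.
  by split=> // v; rewrite inE => v0; exact: (coord_fun_cont (is_derive_powR a v0)).
split=> [v|i]; first by rewrite inE => v0; exact: (coord_fun_cont (is_derive_powR a v0)).
split=> [v v0|]; first by have [] := is_derive_coord_fun i (is_derive_powR a v0).
apply: (@Ck_ext _ _ _ _ (fun v : pt => ((i == o0)%:R * a) * v 0 o0 `^ (a - 1))).
- exact: pos_open.
- move=> v v0; have [_ e] := is_derive_coord_fun i (is_derive_powR a v0).
  by rewrite partialE e mulrA.
by apply: CkM; [exact: pos_open|exact: Ck_cst pos_open|exact: IH].
Qed.

Lemma Ck_ln k : Ck k pos (fun v : pt => ln (v 0 o0)).
Proof.
case: k => [|k].
  by split=> // v; rewrite inE => v0; exact: (coord_fun_cont (is_derive1_ln v0)).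
split=> [v|i]; first by rewrite inE => v0; exact: (coord_fun_cont (is_derive1_ln v0)).
split=> [v v0|]; first by have [] := is_derive_coord_fun i (is_derive1_ln v0).
apply: (@Ck_ext _ _ _ _ (fun v : pt => (i == o0)%:R * v 0 o0 `^ (-1))).
- exact: pos_open.
- move=> v v0; have [_ e] := is_derive_coord_fun i (is_derive1_ln v0).
  by rewrite partialE e powR_inv1 // ltW.
by apply: CkM; [exact: pos_open|exact: Ck_cst pos_open|exact: Ck_powR].
Qed.

Lemma smooth_powR (a : R) (v : pt) : 0 < v 0 o0 -> smooth_at (fun v : pt => v 0 o0 `^ a) v.
Proof. by move=> v0; exists pos; split=> // [|k]; [exact: pos_open|exact: Ck_powR]. Qed.

Lemma smooth_ln (v : pt) : 0 < v 0 o0 -> smooth_at (fun v : pt => ln (v 0 o0)) v.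
Proof. by move=> v0; exists pos; split=> // [|k]; [exact: pos_open|exact: Ck_ln]. Qed.

Variable p : pt.
Hypothesis p0 : p 0 o0 = 0.

Lemma sm_pos f : (forall v : pt, 0 < v 0 o0 -> smooth_at f v) -> sm p f.
Proof. by move=> Sf; exists 1 => // k; apply: Ck_smooth_at => v [_ /Sf]. Qed.

Lemma th_powR a (v : pt) : 0 < v 0 o0 -> th (fun v : pt => v 0 o0 `^ a) v = a * v 0 o0 `^ a.
Proof.
move=> v0; have [_ e] := is_derive_coord_fun o0 (is_derive_powR a v0).
rewrite /th partialE e eqxx mul1r powR_pred // mulrCA; congr (_ * _).
by rewrite mulrC mulfVK // gt_eqF.
Qed.

Lemma th_ln (v : pt) : 0 < v 0 o0 -> th (fun v : pt => ln (v 0 o0)) v = 1.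
Proof.
move=> v0; have [_ e] := is_derive_coord_fun o0 (is_derive1_ln v0).
by rewrite /th partialE e eqxx mul1r mulfV // gt_eqF.
Qed.

Lemma px_coord_fun (phi : R -> R) d i (v : pt) : is_derive (v 0 o0) (1 : R) phi d ->
  px i (fun v : pt => phi (v 0 o0)) v = 0.
Proof. by move=> /(is_derive_coord_fun (rr i)) [_ e]; rewrite /px partialE e mul0r. Qed.

Lemma x_ln_le (x : R) : 0 < x < 1 -> `|x * ln x| <= 1.
Proof.
move=> /andP[x0 x1]; rewrite normrM (gtr0_norm x0) ltr0_norm ?ln_lt0 ?x0 //.
rewrite -lnV ?posrE // -ler_pdivlMl // mulr1.
by apply: ltW; rewrite ln_sublinear // invr_gt0.
Qed.

Lemma powR_lnX_bounded (e : R) l : 0 < e ->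
  exists C : R, forall s : R, 0 < s < 1 -> `|s `^ e * ln s ^+ l| <= C.
Proof.
elim: l e => [|l IH] e e0.
  exists 1 => s /andP[s0 s1]; rewrite expr0 mulr1 ger0_norm ?powR_ge0 //.
  by rewrite -[leRHS](powRr0 s); apply: ger_powR; rewrite ?s0 ?(ltW s1) // ltW.
have e2 : 0 < e / 2 by rewrite divr_gt0.
have [C H] := IH _ e2; exists (C * (e / 2)^-1) => s /andP[s0 s1].
have -> : s `^ e * ln s ^+ l.+1 = (s `^ (e / 2) * ln s ^+ l) * ((e / 2)^-1 * (s `^ (e / 2) * ln (s `^ (e / 2)))).
  have -> : s `^ e = s `^ (e / 2) * s `^ (e / 2) by rewrite -powR_add // -splitr.
  have alg (x y z d : R) : d != 0 -> x * x * (y * z) = (x * z) * (d^-1 * (x * (d * y))).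
    by move=> d0; field.
  by rewrite ln_powR exprS; apply: alg; rewrite gt_eqF.
rewrite normrM; apply: ler_pM => //; first by apply: H; rewrite s0.
rewrite normrM gtr0_norm ?invr_gt0 // ler_piMr ?invr_ge0 ?(ltW e2) //.
have h : s `^ (e / 2) < 1 `^ (e / 2).
  by apply: gt0_ltr_powR => //; rewrite nnegrE ?ler01 // ltW.
rewrite powR1 in h; by apply: x_ln_le; rewrite powR_gt0.
Qed.

Lemma thM f g : sm p f -> sm p g ->
  ev p (fun v => th (fun v => f v * g v) v = th f v * g v + f v * th g v).
Proof.
move=> sf sg; apply: ev_mono (ev_and (sm_deriv o0 sf) (sm_deriv o0 sg)) => v _ [d d'].
rewrite /th (partialM d d'); ring.
Qed.

Lemma sm_lnX l : sm p (fun v : pt => ln (v 0 o0) ^+ l).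
Proof.
elim: l => [|l IH].
  by apply: sm_eq (sm_cst p 1); apply: ev_true => v _; rewrite expr0.
apply: sm_eq (smM (sm_pos (fun v => @smooth_ln v)) IH); apply: ev_true => v _; by rewrite exprS.
Qed.

Lemma sm_powR b : sm p (fun v : pt => v 0 o0 `^ b).
Proof. by apply: sm_pos => v; exact: smooth_powR. Qed.

Lemma th_lnX l : ev p (fun v : pt => th (fun v : pt => ln (v 0 o0) ^+ l) v = l%:R * ln (v 0 o0) ^+ l.-1).
Proof.
elim: l => [|l IH].
  apply: ev_true => v _; rewrite (_ : (fun v : pt => ln (v 0 o0) ^+ 0) = fun=> 1).
    by rewrite /th partial_cst mulr0 mul0r.
  by apply/funext => w; rewrite expr0.
have e := thM (sm_pos (fun v => @smooth_ln v)) (sm_lnX l).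
apply: ev_mono (ev_and e IH) => v v0 [h1 h2].
have -> : (fun v : pt => ln (v 0 o0) ^+ l.+1) = (fun v : pt => ln (v 0 o0) * ln (v 0 o0) ^+ l).
  by apply/funext => w; rewrite exprS.
rewrite h1 th_ln // h2 mul1r; case: l {IH e h1 h2} => [|l] /=; first by rewrite mul0r mulr0 addr0 expr0 mulr1.
by rewrite mulrCA -exprS -[l.+2%:R]natr1 mulrDl mul1r addrC.
Qed.

Lemma G_coord r a f : sm p f -> bO0 p a f -> ev p (fun v => forall i, px i f v = 0) -> G p r a f.
Proof.
move=> sf bf pf; split=> //; case: r => [|r]; split=> // i.
by have [_] := G_cst0 p r a; apply: bO_eq; apply: ev_mono pf => v _ ->.
Qed.

Lemma G_powR_lnX r b l : 2^-1 <= b -> G p r 4^-1 (fun v : pt => v 0 o0 `^ b * ln (v 0 o0) ^+ l).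
Proof.
move=> hb; have b4 : 0 < b - 4^-1 by lra.
apply: G_coord; first exact: smM (sm_powR b) (sm_lnX l).
  have [C H] := powR_lnX_bounded l b4; exists C; apply: ev_mono (ev_lt1 p0) => v v0 v1.
  have -> : v 0 o0 `^ b = v 0 o0 `^ (b - 4^-1) * v 0 o0 `^ 4^-1 by rewrite -powR_add // subrK.
  rewrite mulrAC normrM [X in _ * X <= _]ger0_norm ?powR_ge0 //.
  by rewrite ler_wpM2r ?powR_ge0 // H // v0.
apply: ev_true => v v0 i.
have d1 := is_derive_powR b v0; have d2 := is_derive1_ln v0.
have d3 : derivable (fun s : R => ln s ^+ l) (v 0 o0) 1.
  elim: l => [|l IH].
    by rewrite (_ : (fun s : R => ln s ^+ 0) = fun=> 1) //; apply/funext => w; rewrite expr0.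
  rewrite (_ : (fun s : R => ln s ^+ l.+1) = fun s : R => ln s * ln s ^+ l).
    by apply: derivableM; [case: d2|exact: IH].
  by apply/funext => w; rewrite exprS.
have d4 : derivable (fun s : R => s `^ b * ln s ^+ l) (v 0 o0) 1.
  by apply: derivableM; [case: d1|exact: d3].
exact: (px_coord_fun i (derivableP d4)).
Qed.

(** Finite sums of terms [s^b (ln s)^l a(x)] with [b >= 1/2]. The class is stable
    under [theta], which lowers the power of the logarithm or multiplies by [b]. *)
Inductive logc : (pt -> R) -> Prop :=
| logc_base b l a : 2^-1 <= b -> smooth_at a p -> (forall v, a v = a (pi0 v)) ->
    logc (fun v => v 0 o0 `^ b * ln (v 0 o0) ^+ l * a v)
| logc_add f g : logc f -> logc g -> logc (fun v => f v + g v)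
| logc_scale c f : logc f -> logc (fun v => c * f v)
| logc_eq f g : ev p (fun v => f v = g v) -> logc f -> logc g.

Lemma logc_G r f : logc f -> G p r 4^-1 f.
Proof.
elim=> [b l a hb Sa _|f' g _ h1 _ h2|c f' _ h|f' g e _ h].
- by have := GM p0 (G_powR_lnX r l hb) (G_smooth r Sa); rewrite addr0.
- exact: GD.
- exact: (GZ p0).
- exact: G_eq e h.
Qed.

Lemma logc_th f : logc f -> logc (th f).
Proof.
elim=> [b l a hb Sa ap|f' g l1 h1 l2 h2|c f' l1 h|f' g e _ h].
- have sa := smooth_at_sm Sa.
  have e1 := thM (smM (sm_powR b) (sm_lnX l)) sa.
  have e2 := thM (sm_powR b) (sm_lnX l).
  apply: (@logc_eq (fun v => b * (v 0 o0 `^ b * ln (v 0 o0) ^+ l * a v) +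
    l%:R * (v 0 o0 `^ b * ln (v 0 o0) ^+ l.-1 * a v))); last first.
    by apply: logc_add; apply: logc_scale; exact: logc_base.
  apply: ev_mono (ev_and e1 (ev_and e2 (th_lnX l))) => v v0 [-> [-> ->]].
  rewrite th_powR // (th_pi0E v ap) mulr0 addr0; ring.
- apply: logc_eq (logc_add h1 h2); have s1 := (logc_G 0 l1).1; have s2 := (logc_G 0 l2).1.
  by apply: ev_mono (thD s1 s2) => v _ ->.
- apply: logc_eq (logc_scale c h); have s1 := (logc_G 0 l1).1.
  apply: ev_mono (sm_deriv o0 s1) => v _ d; by rewrite /th (partialZ _ d) mulrCA.
- by apply: logc_eq h; exact: th_eq.
Qed.

Lemma logc0 : logc (fun=> 0).
Proof.
apply: (@logc_eq (fun v => 0 * (v 0 o0 `^ 1 * ln (v 0 o0) ^+ 0 * 1))).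
  by apply: ev_true => v _; rewrite mul0r.
apply: logc_scale; apply: (@logc_base _ _ (fun=> 1)) => //; first by lra.
exact: smooth_at_cst.
Qed.

Lemma logc_sum (I : Type) (s : seq I) (F : I -> pt -> R) : (forall i, logc (F i)) ->
  logc (fun v => \sum_(i <- s) F i v).
Proof.
move=> HF; elim: s => [|i s IH].
  by apply: logc_eq logc0; apply: ev_true => v _; rewrite big_nil.
by apply: logc_eq (logc_add (HF i) IH); apply: ev_true => v _; rewrite big_cons.
Qed.

Implicit Types (v : pt).

(** The square root of the transversal coordinate: the original boundary coordinate [t]. *)
Definition rt (v : pt) : R := v 0 o0 `^ 2^-1.
Definition tl (v : pt) : 'rV[R]_m := rsubmx v.

Lemma rt_gt0 v : 0 < v 0 o0 -> 0 < rt v. Proof. exact: powR_gt0. Qed.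

Lemma rt2 v : 0 <= v 0 o0 -> rt v ^+ 2 = v 0 o0.
Proof. by move=> v0; rewrite /rt -powR_mulrn ?powR_ge0 // -powRrM mulVf // powRr1. Qed.

Lemma tl_upd v t : tl (upd v t) = tl v.
Proof. by apply/rowP => i; rewrite [LHS]mxE [RHS]mxE; exact: updr. Qed.

Lemma tl_pi0 v : tl (pi0 v) = tl v. Proof. exact: tl_upd. Qed.

Lemma smooth_tl (f : 'rV[R]_m -> R) v : smooth_at f (tl v) -> smooth_at (fun v => f (tl v)) v.
Proof.
move=> Sf; apply: smooth_at_comp => // j.
have -> : (fun y => tl y 0 j) = (fun y : pt => y 0 (rr j)) by apply/funext => y; rewrite mxE.
exact: smooth_at_coord.
Qed.

Section ErrorTerm.
Variables (E : R -> 'rV[R]_m -> R) (D : set 'rV[R]_m) (K : nat) (rho : R).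
Hypotheses (rho0 : 0 < rho) (Drho : forall v, hb p rho v -> D (tl v)).
Hypothesis K0 : (0 < K)%N.
Hypothesis HE : forall j s, (j + size s <= K)%N -> exists2 eta : R, 0 < eta &
  forall t x, 0 < t < eta -> D x -> t ^+ j * `|derive1n j (fun u => partials s (E u) x) t| <= t ^+ K.

(** The tangential derivatives of the remainder of the expansion, along the boundary
    coordinate [t = sqrt s]. *)
Definition err s (v : pt) := partials s (E (rt v)) (tl v).
Hypothesis sE : sm p (err [::]).

Lemma px_err s i v : px i (err s) v = err (i :: s) v.
Proof.
have e : (fun h : R => err s (h *: ee (rr i) + v)) = (fun h : R => partials s (E (rt v)) (h *: ee i + tl v)).
  apply/funext => h; rewrite /err /rt; congr (partials s (E (_ `^ _)) _).
    by rewrite !mxE /= mulr0 add0r.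
  apply/rowP => j; rewrite !mxE eqxx /=; congr (_ * _ + _).
by rewrite /px partialE derive_line e /err /= partialE [RHS]derive_line.
Qed.

Lemma sm_err s : sm p (err s).
Proof. by elim: s => [//|i s IH]; have -> : err (i :: s) = px i (err s) by [apply/funext => v; rewrite px_err]; exact: sm_px. Qed.

Let F s v t := partials s (E t) (tl v).

Lemma err_bound j s : (j + size s <= K)%N ->
  ev p (fun v => rt v ^+ j * `|derive1n j (F s v) (rt v)| <= v 0 o0 `^ 4^-1).
Proof.
move=> /HE [eta eta0 H].
exists (Num.min rho (Num.min 1 (eta ^+ 2))); first by rewrite !lt_min rho0 ltr01 exprn_gt0.
move=> v hv; have /andP[v0] := hb_s p0 hv; rewrite !lt_min => /and3P[_ v1 ve].
have Dv : D (tl v) by apply: Drho; apply: hb_sub hv; exact: min_lel.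
have t0 := rt_gt0 v0.
have te : rt v < eta by move: ve; rewrite -(rt2 (ltW v0)) !expr2; nra.
have t1 : rt v <= 1 by have := rt2 (ltW v0); rewrite expr2; nra.
apply: le_trans (H _ _ _ Dv) _; first by rewrite t0.
apply: (@le_trans _ _ (rt v)).
  by case: K K0 => // k _; rewrite exprS ler_piMr ?(ltW t0) // exprn_ile1 // ltW.
apply: ger_powR; first by rewrite v0 ltW.
by lra.
Qed.

(** [t d/dt] is [2 theta], and [t^2 d^2/dt^2] is its square minus itself. *)
Lemma err_deriv s : ev p (fun v => 
   2 * th (err s) v = rt v * (F s v)^`()%classic (rt v) /\
   4 * th (th (err s)) v - 2 * th (err s) v = rt v ^+ 2 * derive1n 2 (F s v) (rt v)).
Proof.
have [q q0 Cq] := sm_err s; exists q => // v hv; have /andP[v0 vq] := hb_s p0 hv.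
pose b := q `^ 2^-1.
have sq x : 0 < x < b -> 0 < x ^+ 2 < q.
  move=> /andP[x0 xb]; rewrite exprn_gt0 //=.
  have <- : b ^+ 2 = q by rewrite /b -powR_mulrn ?powR_ge0 // -powRrM mulVf // powRr1 // ltW.
  by rewrite ltr_pXn2r // nnegrE ltW // powR_gt0.
have vb : 0 < rt v < b.
  by rewrite rt_gt0 //=; apply: gt0_ltr_powR; rewrite ?nnegrE ?invr_gt0 ?ltr0n ?(ltW v0) ?(ltW q0).
have d0 x : 0 < x < b -> is_derive (x ^+ 2) (1 : R) (fun y => err s (upd v y)) (partial o0 (err s) (upd v (x ^+ 2))).
  by move=> /sq xx; apply: is_derive_upd; apply: (Ck_derivable (Cq 1%N)); exact: hb_upd.
have d1 x : 0 < x < b -> is_derive (x ^+ 2) (1 : R) (fun y => partial o0 (err s) (upd v y))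
   (partial o0 (partial o0 (err s)) (upd v (x ^+ 2))).
  by move=> /sq xx; apply: is_derive_upd; apply: (Ck_derivable (Ck_partial o0 (Cq 2%N))); exact: hb_upd.
have dsq (x : R) : is_derive x (1 : R) (fun x : R => x ^+ 2) (2 * x).
  have := is_derive_mul (is_derive_id x (1 : R)) (is_derive_id x (1 : R)).
  have -> : (fun t : R => id t * id t) = (fun x : R => x ^+ 2) by apply/funext => y; rewrite expr2.
  by congr is_derive; rewrite /=; ring.
have FE x : 0 < x -> F s v x = err s (upd v (x ^+ 2)).
  move=> x0; rewrite /F /err tl_upd /rt upd0 -powR_mulrn ?ltW // -powRrM mulfV // powRr1 //.
  exact: ltW.
have NX x : 0 < x < b -> \forall y \near x, 0 < y < b.
  move=> xb; have xi : x \in `]0, b[ by rewrite in_itv.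
  by apply: filterS (near_in_itvoo xi) => y; rewrite in_itv.
have D1 x : 0 < x < b -> is_derive x (1 : R) (F s v) (2 * x * partial o0 (err s) (upd v (x ^+ 2))).
  move=> xb.
  have dd : is_derive x (1 : R) (fun x => err s (upd v (x ^+ 2))) (2 * x * partial o0 (err s) (upd v (x ^+ 2))).
    have := @is_derive1_comp R (fun y => err s (upd v y)) (fun x => x ^+ 2) x _ _ (d0 x xb) (dsq x).
    by congr is_derive; rewrite mulrC.
  apply: near_eq_is_derive dd; apply: filterS (NX x xb) => y /andP[y0 _]; by rewrite FE.
have D1' x : 0 < x < b -> (F s v)^`()%classic x = 2 * x * partial o0 (err s) (upd v (x ^+ 2)).
  by move=> /D1 [_ e]; rewrite derive1E.
have D2 x : 0 < x < b -> is_derive x (1 : R) ((F s v)^`()%classic)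
   (4 * x ^+ 2 * partial o0 (partial o0 (err s)) (upd v (x ^+ 2)) + 2 * partial o0 (err s) (upd v (x ^+ 2))).
  move=> xb.
  have k1 := @is_derive1_comp R (fun y => partial o0 (err s) (upd v y)) (fun x => x ^+ 2) x _ _ (d1 x xb) (dsq x).
  have k2 := is_derive_mul (is_derive_id x (1 : R)) k1.
  have dd : is_derive x (1 : R) (fun x => 2 * (x * partial o0 (err s) (upd v (x ^+ 2))))
    (4 * x ^+ 2 * partial o0 (partial o0 (err s)) (upd v (x ^+ 2)) + 2 * partial o0 (err s) (upd v (x ^+ 2))).
    by have := is_derive_scale 2 k2; congr is_derive; rewrite /=; ring.
  apply: near_eq_is_derive dd; apply: filterS (NX x xb) => y yb; by rewrite D1' // mulrA.
have vE : upd v (rt v ^+ 2) = v by rewrite rt2 ?upd_id // ltW.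
have r2 : rt v ^+ 2 = v 0 o0 by rewrite rt2 // ltW.
split.
  rewrite D1' // vE /th -r2; ring.
have -> : derive1n 2 (F s v) (rt v) = 4 * (rt v) ^+ 2 * partial o0 (partial o0 (err s)) v + 2 * partial o0 (err s) v.
  by have [_] := D2 _ vb; rewrite vE => <-; rewrite [LHS]derive1E.
have -> : th (th (err s)) v = v 0 o0 * partial o0 (err s) v + v 0 o0 ^+ 2 * partial o0 (partial o0 (err s)) v.
  have dp := Ck_derivable (i := o0) (Ck_partial o0 (Cq 2%N)) hv.
  have dc : derivable (fun v : pt => v 0 o0) v (ee o0) by exact: dv_at (smooth_s v).
  rewrite {1}/th (partialM dc dp) partial_coord eqxx mul1r mulrDr mulrA -expr2 //.
rewrite /th -r2; ring.
Qed.

Lemma bO_err r s : (r + size s + 2 <= K)%N ->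
  [/\ bO p r 4^-1 (err s), bO p r 4^-1 (th (err s)) & bO p r 4^-1 (th (th (err s)))].
Proof.
have base s' : (size s' + 2 <= K)%N ->
  [/\ bO0 p 4^-1 (err s'), bO0 p 4^-1 (th (err s')) & bO0 p 4^-1 (th (th (err s')))].
  move=> sK.
  have b0 := @err_bound 0 s' ltac:(lia); have b1 := @err_bound 1 s' ltac:(lia).
  have b2 := @err_bound 2 s' ltac:(lia); have dd := err_deriv s'.
  split.
  - exists 1; apply: ev_mono b0 => v v0; rewrite mul1r expr0 mul1r; exact.
  - exists 1; apply: ev_mono (ev_and b1 dd) => v v0 [h1 [h2 _]].
    have t0 := rt_gt0 v0.
    have : `|2 * th (err s') v| <= v 0 o0 `^ 4^-1.
      by rewrite h2 normrM (gtr0_norm t0); move: h1; rewrite expr1.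
    rewrite normrM ger0_norm // mul1r; have := normr_ge0 (th (err s') v); lra.
  exists 1; apply: ev_mono (ev_and b1 (ev_and b2 dd)) => v v0 [h1 [h2 [h3 h4]]].
  have t0 := rt_gt0 v0.
  have k1 : `|2 * th (err s') v| <= v 0 o0 `^ 4^-1.
    by rewrite h3 normrM (gtr0_norm t0); move: h1; rewrite expr1.
  have k2 : `|4 * th (th (err s')) v - 2 * th (err s') v| <= v 0 o0 `^ 4^-1.
    by rewrite h4 normrM [X in X * _]gtr0_norm ?exprn_gt0.
  have : `|4 * th (th (err s')) v| <= v 0 o0 `^ 4^-1 + v 0 o0 `^ 4^-1.
    rewrite -[X in `|X|](subrK (2 * th (err s') v)).
    by apply: le_trans (ler_normD _ _) _; exact: lerD.
  rewrite normrM ger0_norm // mul1r; have := normr_ge0 (th (th (err s')) v); lra.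
elim: r s => [|r IH] s sK; first by have [] := base s sK; split.
have [c1 c2 c3] := base s ltac:(lia).
have ih i : [/\ bO p r 4^-1 (err (i :: s)), bO p r 4^-1 (th (err (i :: s))) & bO p r 4^-1 (th (th (err (i :: s))))].
  by apply: IH => /=; lia.
have pe i : px i (err s) = err (i :: s) by apply/funext => v; rewrite px_err.
split; split=> // i; have [k1 k2 k3] := ih i.
- by rewrite pe.
- by apply: bO_eq k2; apply: ev_mono (ev_px_th i (sm_err s)) => v _ ->; rewrite pe.
apply: bO_eq k3.
have e1 := ev_px_th i (sm_th (sm_err s)); have e2 := th_eq (ev_px_th i (sm_err s)).
by apply: ev_mono (ev_and e1 e2) => v _ [-> ->]; rewrite pe.
Qed.
End ErrorTerm.
End CoordinateFunctions.

(** In the variable [s = -1/ln t] the sum is [s^(-P)] times a polynomial of degree [P].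
    It is bounded, which leaves only the top coefficient, the one without logarithm. *)
Lemma leading_coefficient (R : realType) P (h : R -> R) (a : nat -> R) (C eta g : R) : 0 < eta ->
  (forall t, 0 < t < eta -> `|h t - \sum_(l < P.+1) ln t ^+ l * a l| <= C * t `^ 2^-1) ->
  (forall e, 0 < e -> exists2 d : R, 0 < d & forall t, 0 < t < d -> `|h t - g| < e) ->
  a 0%N = g /\ forall l, (0 < l <= P)%N -> a l = 0.
Proof.
move=> eta0 H hg.
have a0 l : (0 < l <= P)%N -> a l = 0.
  have [d d0 Hd] := hg 1 ltr01.
  pose t0 := Num.min eta (Num.min d 2^-1).
  have t00 : 0 < t0 by rewrite !lt_min eta0 d0 invr_gt0 ltr0n.
  have t01 : t0 < 1.
    by apply: le_lt_trans (min_ler _ _) _; apply: le_lt_trans (min_ler _ _) _; rewrite invf_lt1 // ltr1n.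
  have L0 : 0 < - ln t0 by rewrite oppr_gt0 ln_lt0 // t00.
  pose B := `|C| + 1 + `|g|.
  have HB t : 0 < t < t0 -> `|\sum_(l < P.+1) ln t ^+ l * a l| <= B.
    move=> /andP[tp]; rewrite !lt_min => /and3P[te td th2].
    have h1 := H t; rewrite tp te in h1; have {}h1 := h1 isT.
    have h2 := Hd t; rewrite tp td in h2; have {}h2 := h2 isT.
    have t1 : t `^ 2^-1 <= 1.
      by rewrite -[leRHS](powRr0 t); apply: ger_powR; rewrite ?tp ?invr_ge0 //=; lra.
    have h3 : C * t `^ 2^-1 <= `|C|.
      apply: (@le_trans _ _ (`|C| * t `^ 2^-1)); first by rewrite ler_wpM2r ?powR_ge0 // ler_norm.
      by rewrite ler_piMr.
    set S := \sum_(l < P.+1) _ in h1 *.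
    have -> : S = - (h t - S) + (h t - g) + g by ring.
    apply: le_trans (ler_normD _ _) _; rewrite lerD2r.
    apply: le_trans (ler_normD _ _) _; rewrite normrN; apply: lerD; last exact: ltW.
    exact: le_trans h1 h3.
  pose c j := (-1) ^+ (P - j) * a (P - j)%N.
  have c0 j : (j < P)%N -> c j = 0.
    apply: (@poly_vanish R P c (B + `|a 0%N|) P%:R (- ln t0)^-1); rewrite ?invr_gt0 //; first by lra.
    move=> s /andP[s0 sd]; pose t := expR (- s^-1).
    have lt : ln t = - s^-1 by rewrite /t expRK.
    have tt : 0 < t < t0.
      rewrite expR_gt0 /= -[ltRHS](lnK (x := t0)) ?posrE // /t ltr_expR -ltrN2 opprK.
      by rewrite -(invrK (- ln t0)) ltf_pV2 ?posrE ?invr_gt0.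
    have -> : \sum_(j < P) s ^+ j * c j = s ^+ P * (\sum_(l < P.+1) ln t ^+ l * a l) - s ^+ P * a 0%N.
      have -> : s ^+ P * (\sum_(l < P.+1) ln t ^+ l * a l) = \sum_(j < P.+1) s ^+ j * c j.
        rewrite mulr_sumr (reindex_inj rev_ord_inj) /=; apply: eq_bigr => i _.
        rewrite lt subSS /c; have jP : (i <= P)%N by rewrite -ltnS.
        have -> : s ^+ P = s ^+ i * s ^+ (P - i) by rewrite -exprD subnKC.
        rewrite -(mulN1r s^-1) exprMn exprVn.
        have sn : s ^+ (P - i) != 0 by rewrite expf_neq0 // gt_eqF.
        have alg (x y z w : R) : y != 0 -> x * y * (z * y^-1 * w) = x * (z * w) by move=> y0; field.
        exact: alg.
      by rewrite big_ord_recr /= /c subnn expr0 mul1r addrK.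
    rewrite powR_mulrn ?(ltW s0) //.
    apply: le_trans (ler_normB _ _) _; rewrite !normrM !normrX (gtr0_norm s0) mulrDl.
    by apply: lerD; rewrite mulrC ler_wpM2r ?exprn_ge0 ?(ltW s0) // HB.
  move=> /andP[l0 lP]; have := c0 (P - l)%N; rewrite /c subKn // ltn_subrL l0 (leq_trans l0 lP).
  move=> /(_ isT) /eqP; rewrite mulf_eq0 signr_eq0 /= => /eqP //.
split=> //; apply/eqP; rewrite -subr_eq0 -normr_eq0 eq_le normr_ge0 andbT.
apply/ler_addgt0Pr => e e0; rewrite add0r -subr_le0.
have [d d0 Hd] := hg e e0.
apply: (@le0_of_powR _ _ C 2^-1 (Num.min d eta)); rewrite ?invr_gt0 // ?lt_min ?d0 //.
move=> t /andP[t0]; rewrite lt_min => /andP[td te].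
have h1 := H t; rewrite t0 te in h1; have {}h1 := h1 isT.
have h2 := Hd t; rewrite t0 td in h2; have {}h2 := h2 isT.
have E : \sum_(l < P.+1) ln t ^+ l * a l = a 0%N.
  rewrite big_ord_recl /= expr0 mul1r big1 ?addr0 // => l _.
  by rewrite a0 ?mulr0 // /lift /= /bump /= ltn_ord.
rewrite E in h1.
have h3 : `|a 0%N - g| <= `|h t - a 0%N| + `|h t - g|.
  have -> : a 0%N - g = - (h t - a 0%N) + (h t - g) by ring.
  by apply: le_trans (ler_normD _ _) _; rewrite normrN.
by lra.
Qed.

Section RegularData.
Context {R : realType} {m : nat}.
Local Notation pt := 'rV[R]_(1 + m).

Lemma closed_box (U : set 'rV[R]_m) (x : 'rV[R]_m) : open U -> U x ->
  exists2 r : R, 0 < r & exists D : set 'rV[R]_m,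
    [/\ compact D, D `<=` U & forall y : 'rV[R]_m, (forall i, `|x 0 i - y 0 i| < r) -> D y].
Proof.
move=> oU Ux; have /nbhs_ballP [r /= r0 B] := open_nbhs_nbhs (conj oU Ux).
exists (r / 2); first by rewrite divr_gt0.
exists [set y : 'rV[R]_m | forall i, `[x 0 i - r / 2, x 0 i + r / 2]%classic (y 0 i)]; split.
- apply: (@rV_compact R m (fun i => `[x 0 i - r / 2, x 0 i + r / 2]%classic)) => i.
  exact: segment_compact.
- move=> y Dy; apply: B; apply/ball_rVP; split=> // i; have := Dy i.
  rewrite /= in_itv /= => /andP[y1 y2]; rewrite ltr_norml; apply/andP; split; lra.
move=> y Hy i; have := Hy i; rewrite /= in_itv /= ltr_norml => /andP[y1 y2].
by apply/andP; split; lra.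
Qed.

Variables (p : pt) (h : R -> 'rV[R]_m -> R) (a : nat -> nat -> 'rV[R]_m -> R) (g : 'rV[R]_m -> R).
Variables (U : set 'rV[R]_m) (K P : nat).
Hypotheses (p0 : p 0 o0 = 0) (oU : open U) (Up : U (tl p)).
Hypothesis K0 : (0 < K)%N.
Hypothesis Sa : forall k l, smooth_at (a k l) (tl p).
Hypothesis Sg : smooth_at g (tl p).
Let S t x := \sum_(k < K.+1) \sum_(l < P.+1) t ^+ k * ln t ^+ l * a k l x.
Hypothesis hS : asymp K K U h S.
Hypothesis hg : forall x, U x -> forall e, 0 < e ->
  exists2 d : R, 0 < d & forall t, 0 < t < d -> `|h t x - g x| < e.
Hypothesis sh : sm p (fun v : pt => h (rt v) (tl v)).

(** The remainder and all terms of positive order are [O(t^(1/2))], so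
    [leading_coefficient] applies at each point. *)
Lemma leading_terms x : U x -> a 0%N 0%N x = g x /\ forall l, (0 < l <= P)%N -> a 0%N l x = 0.
Proof.
move=> Ux.
have H0 (kl : nat * nat) : exists C : R, forall t : R, 0 < t < 1 ->
    `|t ^+ kl.1.+1 * ln t ^+ kl.2| <= C * t `^ 2^-1.
  case: kl => k l /=.
  have k0 : 0 < k.+1%:R - 2^-1 :> R.
    have : (0 : R) <= k%:R by [].
    by rewrite -natr1; lra.
  have [C H] := powR_lnX_bounded l k0; exists C => t /andP[t0 t1].
  have -> : t ^+ k.+1 = t `^ (k.+1%:R - 2^-1) * t `^ 2^-1.
    by rewrite -powR_add // subrK powR_mulrn // ltW.
  rewrite mulrAC normrM [X in _ * X <= _]ger0_norm ?powR_ge0 //.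
  by rewrite ler_wpM2r ?powR_ge0 // H // t0.
have [C HC] := choice H0.
have cx : compact [set x] by exact: compact_set1.
have xU : [set x] `<=` U by move=> y ->.
have [eta eta0 He] := hS (j := 0) (s := [::]) (leq0n K) cx xU ltr01.
pose B := 1 + \sum_(k < K) \sum_(l < P.+1) C (k : nat, l : nat) * `|a k.+1 l x|.
apply: (@leading_coefficient R P (fun t => h t x) (fun l => a 0%N l x) B (Num.min eta 1)).
- by rewrite lt_min eta0 ltr01.
- move=> t /andP[t0]; rewrite lt_min => /andP[te t1].
  have h1 := He t x; rewrite t0 te in h1; have {}h1 := h1 isT erefl.
  rewrite expr0 mul1r mul1r derive1n0 /= in h1.
  have tt : 0 < t < 1 by rewrite t0.
  have th : t ^+ K <= t `^ 2^-1.
    rewrite -powR_mulrn ?(ltW t0) //; apply: ger_powR; first by rewrite t0 ltW.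
    have : (1 : R) <= K%:R by rewrite ler1n.
    lra.
  have -> : h t x - \sum_(l < P.+1) ln t ^+ l * a 0%N l x =
     (h t x - S t x) + \sum_(k < K) \sum_(l < P.+1) t ^+ k.+1 * ln t ^+ l * a k.+1 l x.
    have -> : S t x = \sum_(l < P.+1) ln t ^+ l * a 0%N l x +
        \sum_(k < K) \sum_(l < P.+1) t ^+ k.+1 * ln t ^+ l * a k.+1 l x.
      rewrite /S [LHS]big_ord_recl; congr (_ + _).
      by apply: eq_bigr => l _; rewrite expr0 mul1r.
    by rewrite opprD addrA subrK.
  apply: le_trans (ler_normD _ _) _; rewrite mulrDl mul1r; apply: lerD; first exact: le_trans h1 th.
  apply: le_trans (ler_norm_sum _ _ _) _; rewrite mulr_suml; apply: ler_sum => k _.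
  apply: le_trans (ler_norm_sum _ _ _) _; rewrite mulr_suml; apply: ler_sum => l _.
  rewrite normrM [leRHS]mulrAC; apply: ler_wpM2r => //; exact: (HC (k : nat, l : nat)).
exact: hg.
Qed.

(** The expansion splits into terms of class [logc] and a remainder that is [O(t^K)]
    with all derivatives that occur. *)
Lemma regular_G r : (r.+2 <= K)%N -> let f := fun v : pt => h (rt v) (tl v) - g (tl v) in
  [/\ G p r 4^-1 f, G p r 4^-1 (th f) & G p r 4^-1 (th (th f))].
Proof.
move=> rK f; have [rho rho0 [D [cD DU Dr]]] := closed_box oU Up.
have Drho (v : pt) : hb p rho v -> D (tl v).
  move=> [/ball_rVP [_ B] _]; apply: Dr => i; have := B (rr i); by rewrite !mxE.
pose E t y := h t y - S t y.
have HE j s : (j + size s <= K)%N -> exists2 eta : R, 0 < eta &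
  forall t x, 0 < t < eta -> D x -> t ^+ j * `|derive1n j (fun u => partials s (E u) x) t| <= t ^+ K.
  move=> js; have [eta eta0 H] := hS js cD DU ltr01; exists eta => // t x tt Dx.
  by have := H t x tt Dx; rewrite mul1r.
pose L (v : pt) := \sum_(k < K) \sum_(l < P.+1)
   (2^-1) ^+ l * (v 0 o0 `^ (2^-1 * k.+1%:R) * ln (v 0 o0) ^+ l * a k.+1 l (tl v)).
have cL : logc p L.
  apply: logc_sum => k; apply: logc_sum => l; apply: logc_scale; apply: (logc_base _ _ (a := fun v => a k.+1 l (tl v))).
  - by rewrite ler_peMr ?invr_ge0 // ler1n.
  - exact: smooth_tl.
  - by move=> v; rewrite tl_pi0.
have fE : ev p (fun v => f v = err E [::] v + L v).
  exists rho => // v hv; have /andP[v0 _] := hb_s p0 hv.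
  have [a0 al] := leading_terms (DU _ (Drho _ hv)).
  have -> : L v = \sum_(k < K) \sum_(l < P.+1) rt v ^+ k.+1 * ln (rt v) ^+ l * a k.+1 l (tl v).
    apply: eq_bigr => k _; apply: eq_bigr => l _.
    have -> : rt v ^+ k.+1 = v 0 o0 `^ (2^-1 * k.+1%:R).
      by rewrite -powR_mulrn ?powR_ge0 // /rt -powRrM.
    rewrite /rt ln_powR exprMn.
    have alg (x y z w : R) : x * (y * z * w) = y * (x * z) * w by ring.
    exact: alg.
  rewrite /f /err /= /E /S big_ord_recl /=.
  have -> : \sum_(l < P.+1) rt v ^+ 0 * ln (rt v) ^+ l * a 0%N l (tl v) = g (tl v).
    rewrite big_ord_recl /= big1 ?addr0 => [|l _]; first by rewrite !expr0 !mul1r.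
    by rewrite al ?mulr0 // /lift /= /bump /= ltn_ord.
  by rewrite opprD addrA subrK.
have sg := smooth_at_sm (smooth_tl Sg).
have sL := (logc_G p0 0 cL).1.
have sE : sm p (err E [::]).
  have s1 : sm p (fun v => f v + (-1) * L v).
    apply: smD; last exact: smM (sm_cst p (-1)) sL.
    apply: sm_eq (smD sh (smM (sm_cst p (-1)) sg)); apply: ev_true => v _; by rewrite mulN1r.
  apply: sm_eq s1; apply: ev_mono fE => v _ ->; by rewrite mulN1r addrK.
have rK' : (r + size (@nil 'I_m) + 2 <= K)%N by rewrite addn0 addn2.
have [b1 b2 b3] := bO_err p0 rho0 Drho K0 HE sE rK'.
have cL1 := logc_th p0 cL; have cL2 := logc_th p0 cL1.
have t1 : ev p (fun v => th f v = th (err E [::]) v + th L v).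
  by apply: ev_mono (ev_and (th_eq fE) (thD sE sL)) => v _ [-> ->].
have t2 : ev p (fun v => th (th f) v = th (th (err E [::])) v + th (th L) v).
  have sL1 := (logc_G p0 0 cL1).1.
  by apply: ev_mono (ev_and (th_eq t1) (thD (sm_th sE) sL1)) => v _ [-> ->].
split.
- apply: G_eq (GD (conj sE b1) (logc_G p0 r cL)); by apply: ev_mono fE => v _ ->.
- apply: G_eq (GD (conj (sm_th sE) b2) (logc_G p0 r cL1)); by apply: ev_mono t1 => v _ ->.
apply: G_eq (GD (conj (sm_th (sm_th sE)) b3) (logc_G p0 r cL2)); by apply: ev_mono t2 => v _ ->.
Qed.
End RegularData.

(** * From the charts of the manifold to the collar *)

Lemma posdef_unit (R : realType) n (G : 'M[R]_n) : posdef G -> G \in unitmx.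
Proof.
move=> [_ pos]; rewrite -row_free_unit -kermx_eq0; apply/rowV0P => v /sub_kermxP vG.
by apply/eqP; apply: contraT => /pos; rewrite vG mul0mx mxE ltxx.
Qed.

Lemma smooth_on_at (R : realType) n (A : set 'rV[R]_n) f x : smooth_on A f -> A x ->
  (\forall y \near x, A y) -> smooth_at f x.
Proof.
move=> Sf Ax nA; have [F [U [oU Ux CF FE]]] := Sf x Ax.
have SF : smooth_at F x by exists U.
apply: smooth_at_near SF.
by apply: filterS2 nA (open_nbhs_nbhs (conj oU Ux)) => y; exact: FE.
Qed.

Lemma smooth_pos (R : realType) n (f : 'rV[R]_n -> R) x : smooth_at f x -> 0 < f x ->
  \forall z \near x, 0 < f z.
Proof. by move=> /smooth_at_cont h f0; exact: (cvgr_gt _ h 0 f0). Qed.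

Lemma static_at_local (R : realType) n (g : 'rV[R]_n -> 'M[R]_n) f f' W x : open W -> W x ->
  (forall y, W y -> f y = f' y) -> static_at g f x -> static_at g f' x.
Proof.
move=> oW Wx E.
have P1 i y : W y -> partial i f y = partial i f' y.
  by move=> Wy; apply: partial_near; exact: open_eq_near oW Wy E.
have P2 i j : partial i (partial j f) x = partial i (partial j f') x.
  by apply: partial_near; apply: open_eq_near oW Wx _ => y; exact: P1.
have Hh i j : hessian g f i j x = hessian g f' i j x.
  by rewrite /hessian P2; congr (_ - _); apply: eq_bigr => k _; rewrite P1.
move=> [h1 h2]; split=> [i j|]; first by rewrite h1 (E x Wx) Hh.
rewrite -(E x Wx) -h2; apply: eq_bigr => i _; apply: eq_bigr => j _; by rewrite Hh.
Qed.

Lemma chart_image_open (R : realType) n (T : topologicalType) (c : chart R n T) :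
  is_chart setT c -> open (image_of setT c).
Proof. by move=> [_ [U oU E] _ _ _]; rewrite /image_of setIT E setIT. Qed.

(** The range of a chart is relatively open in the half-space, and a point with
    positive first coordinate is interior to the half-space. *)
Lemma chart_nbhd (R : realType) n (T : topologicalType) (C : chart R n.+1 T) (O : set T) q :
  is_chart (@half_space R n) C -> open O -> cdom C q -> O q -> 0 < cmap C q 0 0 ->
  \forall z \near cmap C q, (cmap C @` (cdom C `&` O)) z.
Proof.
move=> [oD [U oU E] inv _ cont] oO Dq Oq pos.
have Uq : U (cmap C q).
  by have : (U `&` half_space (n:=n)) (cmap C q) by [rewrite -E; exists q]; case.
have nP : \forall z \near cmap C q, 0 < (z : 'rV[R]_n.+1) 0 0.
  have Sc : smooth_at (fun z : 'rV[R]_n.+1 => z 0 0) (cmap C q) by exact: smooth_at_coord.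
  exact: smooth_pos Sc pos.
have nA : \forall z \near cmap C q, (cmap C @` cdom C) z.
  apply: filterS2 nP (open_nbhs_nbhs (conj oU Uq)) => z z0 Uz.
  by rewrite E; split=> //; rewrite /half_space /=; exact: ltW.
have Aq : (cmap C @` cdom C) (cmap C q) by exists q.
move/subspace_continuousP: cont => /(_ _ Aq) cont.
have oq : nbhs (cinv C (cmap C q)) O by rewrite inv //; exact: (open_nbhs_nbhs (conj oO Oq)).
have nO : \forall z \near cmap C q, (cmap C @` cdom C) z -> O (cinv C z).
  exact: (cont O oq).
apply: filterS2 nA nO => z [q' Dq' <-] /(_ (ex_intro2 _ _ q' Dq' erefl)).
by rewrite inv // => Oq'; exists q'.
Qed.

Lemma blk_unit (R : realType) m (a : R) (D : 'M[R]_m) : a != 0 -> D \in unitmx ->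
  (block_mx a%:M 0 0 D : 'M[R]_(1 + m)) \in unitmx.
Proof.
move=> a0 uD; have E : (block_mx a%:M 0 0 D : 'M[R]_(1 + m)) *m block_mx (a^-1)%:M 0 0 (invmx D) = 1%:M.
  rewrite mulmx_block !mulmx0 !mul0mx !addr0 !add0r -scalar_mxM mulfV // mulmxV //.
  by rewrite -scalar_mx_block.
by have [] := mulmx1_unit E.
Qed.

Lemma block_conj (R : comNzRingType) m (x y : R) (D : 'M[R]_m) :
  (block_mx x%:M 0 0 1%:M : 'M[R]_(1 + m)) *m (y *: block_mx 1%:M 0 0 D) *m (block_mx x%:M 0 0 1%:M)^T =
  block_mx (x * y * x)%:M 0 0 (y *: D).
Proof.
rewrite tr_block_mx !trmx0 !tr_scalar_mx scale_block_mx !scaler0 scale_scalar_mx mulr1 !mulmx_block.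
by rewrite !(mul0mx, mulmx0, addr0, add0r, mul1mx, mulmx1) -!scalar_mxM.
Qed.

Lemma mS_tr (R : realType) (m k l : nat) v (M : 'rV[R]_(1 + m) -> 'M[R]_(k, l)) :
  mS v M -> mS v (fun w => (M w)^T).
Proof. by move=> h i j; apply: smooth_eq (h j i) => w; rewrite mxE. Qed.

Section Collar.
Context {R : realType} {m : nat} {N : boundaryless R m} {M : with_boundary R m}.
Local Notation pt := 'rV[R]_(1 + m).
Variables (g : tensor2 M) (V : M -> R) (iota : N -> M) (ghat : tensor2 N) (delta : R)
  (Phi : R -> N -> M) (tau : M -> R) (pr : M -> N) (h : R -> tensor2 N).
Hypothesis HV : static_vacuum (minterior M) g V.
Hypothesis HS : special_defining_function g iota ghat delta Phi tau pr h.

Lemma tau_interior q : 0 < tau q -> minterior M q.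
Proof.
have [[_ _ t0 _] _ _ _ _] := HS.
by move=> tq; apply: contrapT => nq; have := t0 q nq => e; rewrite e ltxx in tq.
Qed.

Lemma interior_tau q : minterior M q -> 0 < tau q.
Proof. by have [[_ t0 _ _] _ _ _ _] := HS => /t0. Qed.

(** The definition of interior points refers to all charts; openness is read off
    from the positivity of the smooth function [tau]. *)
Lemma interior_image_open d : atlas M d -> open (image_of (minterior M) d).
Proof.
move=> Md; rewrite openE => z [q [Dq Iq] <-].
have [[St _ _ _] _ _ _ _] := HS.
have ch := atlas_chart Md.
have nA := chart_nbhd ch openT Dq I (Iq d Md Dq).
have [_ _ inv _ _] := ch.
have S : smooth_at (fun x => tau (cinv d x)) (cmap d q).
  by apply: smooth_on_at (St d Md) _ nA; exists q.
have tq : 0 < tau (cinv d (cmap d q)) by rewrite inv //; exact: interior_tau.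
have nT : \forall z \near cmap d q, 0 < tau (cinv d z).
  exact: smooth_pos S tq.
rewrite /interior /=; apply: filterS2 nA nT => z' [q' [Dq' _] <-].
by rewrite inv // => /tau_interior Iq'; exists q'.
Qed.

Variable (c : chart R m N).
Hypothesis Nc : atlas N c.
Local Notation C := (collar_chart delta Phi tau pr c).

(** The change of variables from [(s, x)] to the collar coordinates [(t, x)]. *)
Definition psi0 (v : pt) : pt := row_mx (const_mx (rt v)) (tl v).

Implicit Types v : pt.

Lemma psi0_0 v : psi0 v 0 o0 = rt v.
Proof. by rewrite /psi0 -(lshift1 m 0) row_mxEl mxE. Qed.

Lemma psi0_r v j : psi0 v 0 (rr j) = v 0 (rr j).
Proof. by rewrite /psi0 row_mxEr mxE. Qed.

(** On these open sets the coordinates [(s, x)] and a chart [d] of [M] can be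
    compared. *)
Definition cd (d : chart R m.+1 M) : set pt := [set v : pt | 0 < v 0 o0 /\
  exists y, [/\ cdom c y, cmap c y = tl v, rt v < delta & cdom d (Phi (rt v) y)]].

Lemma cd_point d v : cd d v -> let q := Phi (rt v) (cinv c (tl v)) in
  [/\ cdom C q, cdom d q, tau q = rt v, cmap C q = psi0 v & minterior M q].
Proof.
move=> [v0 [y [Dy Ey tv Dq]]] q.
have [_ _ inv _ _] := atlas_chart Nc.
have Eq : q = Phi (rt v) y by rewrite /q -Ey inv.
have [_ [d0 _ tp _] _ _ _] := HS.
have t0 := rt_gt0 v0.
have [tq pq] : tau q = rt v /\ pr q = y by rewrite Eq; apply: tp; rewrite ltW.
split=> //; first by exists (rt v), y; split=> //; rewrite ltW.
- by rewrite Eq.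
- by rewrite /= tq pq Ey.
- by apply: tau_interior; rewrite tq.
Qed.

Lemma collar_is_chart : is_chart (@half_space R m) C.
Proof. by have [_ [_ _ _ cc] _ _ _] := HS; have [] := cc c Nc. Qed.

Lemma smooth_psi0 v : 0 < v 0 o0 -> forall j, smooth_at (fun v => psi0 v 0 j) v.
Proof.
move=> v0 j; case: (@split_ordP 1 m j) => k ->.
  rewrite lshift1 (_ : (fun v => psi0 v 0 o0) = fun v => v 0 o0 `^ 2^-1); first exact: smooth_powR.
  by apply/funext => w; rewrite psi0_0.
rewrite (_ : (fun v => psi0 v 0 (rr k)) = fun v : pt => v 0 (rr k)); first exact: smooth_at_coord.
by apply/funext => w; rewrite psi0_r.
Qed.

Lemma psi0_cont v : 0 < v 0 o0 -> {for v, continuous psi0}.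
Proof. by move=> v0; apply: rv_continuous => j; apply: smooth_at_cont; exact: smooth_psi0. Qed.

Lemma cd_nbhd d v : atlas M d -> cd d v -> \forall z \near psi0 v, (cmap C @` (cdom C `&` cdom d)) z.
Proof.
move=> Md Rv; have [Cq Dq tq Eq _] := cd_point Rv; rewrite -Eq.
have [od _ _ _ _] := atlas_chart Md.
apply: chart_nbhd => //; first exact: collar_is_chart.
rewrite Eq; have -> : psi0 v 0 0 = rt v by exact: psi0_0.
by case: Rv => v0 _; exact: rt_gt0.
Qed.

Lemma cd_open d : atlas M d -> open (cd d).
Proof.
move=> Md; rewrite openE => v Rv; have v0 : 0 < v 0 o0 by case: Rv.
have n1 : \forall w \near v, (cmap C @` (cdom C `&` cdom d)) (psi0 w).
  exact: (psi0_cont v0 (cd_nbhd Md Rv)).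
have n2 : \forall w \near v, 0 < (w : pt) 0 o0.
  exact: smooth_pos (smooth_s v) v0.
rewrite /interior /=; apply: filterS2 n1 n2 => w [q [[t [y [td Dy Eq]]] Dq] Ew] w0.
have [_ [d0 _ tp _] _ _ _] := HS.
have [tq pq] := tp t y td; rewrite -Eq in tq pq.
have rw : rt w = t.
  by rewrite -psi0_0 -Ew /= -(lshift1 m 0) row_mxEl mxE.
split=> //; exists y; split=> //; last by rewrite rw -Eq.
  apply/rowP => j; have := psi0_r w j; rewrite -Ew /= row_mxEr pq => ->.
  by rewrite mxE.
by rewrite rw; case/andP: td.
Qed.

Lemma transition_smooth d v : atlas M d -> cd d v ->
  forall j, smooth_at (fun z => transition C d z 0 j) (psi0 v).
Proof.
move=> Md Rv j; have nb := cd_nbhd Md Rv.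
have [_ [_ _ _ cc] _ _ _] := HS; have [_ /(_ d Md) [comp _]] := cc c Nc.
exact: smooth_on_at (comp j) (nbhs_singleton nb) nb.
Qed.

Definition psi d (v : pt) : pt := transition C d (psi0 v).

Lemma cinv_psi0 v : cinv C (psi0 v) = Phi (rt v) (cinv c (tl v)).
Proof.
rewrite /= /psi0 row_mxKr; congr (Phi _ _).
exact: (psi0_0 v).
Qed.

Lemma cinv_psi d v : atlas M d -> cd d v -> cinv d (psi d v) = Phi (rt v) (cinv c (tl v)).
Proof.
move=> Md Rv; have [_ Dq _ _ _] := cd_point Rv; have [_ _ inv _ _] := atlas_chart Md.
by rewrite /psi /transition cinv_psi0 inv.
Qed.

Lemma psi_interior d v : atlas M d -> cd d v -> image_of (minterior M) d (psi d v).
Proof.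
move=> Md Rv; have [_ Dq _ _ Iq] := cd_point Rv.
by exists (Phi (rt v) (cinv c (tl v))); [split|rewrite /psi /transition cinv_psi0].
Qed.

Lemma smooth_psi d v : atlas M d -> cd d v -> forall j, smooth_at (fun v => psi d v 0 j) v.
Proof.
move=> Md Rv j; have v0 : 0 < v 0 o0 by case: Rv.
exact: (smooth_at_comp (transition_smooth Md Rv j) (smooth_psi0 v0)).
Qed.

Lemma jac_psi0 v : 0 < v 0 o0 -> jac psi0 v = block_mx ((2 * rt v)^-1)%:M 0 0 1%:M.
Proof.
move=> v0; have D := is_derive_powR 2^-1 v0.
have p0 i : partial i (fun y => psi0 y 0 o0) v = (i == o0)%:R * (2 * rt v)^-1.
  have -> : (fun y => psi0 y 0 o0) = (fun y : pt => y 0 o0 `^ 2^-1) by apply/funext => y; rewrite psi0_0.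
  have [_ e] := is_derive_coord_fun i D; rewrite partialE e; congr (_ * _).
  rewrite powR_pred // -/(rt v) -(rt2 (ltW v0)); have := rt_gt0 v0.
  by move=> t0; field; rewrite gt_eqF.
have pr' i k : partial i (fun y => psi0 y 0 (rr k)) v = (i == rr k)%:R.
  have -> : (fun y => psi0 y 0 (rr k)) = (fun y : pt => y 0 (rr k)) by apply/funext => y; rewrite psi0_r.
  by rewrite partial_coord.
apply/matrixP => i j; rewrite mxE.
case: (@split_ordP 1 m j) => j' ->; case: (@split_ordP 1 m i) => i' ->; rewrite ?lshift1.
- by rewrite p0 blk00 eqxx mul1r.
- by rewrite p0 blkr0 mul0r.
- by rewrite pr' blk0r.
by rewrite pr' blkrr mxE; congr (nat_of_bool _)%:R.
Qed.

Lemma jac_psi d v : atlas M d -> cd d v -> jac (psi d) v = jac psi0 v *m jac (transition C d) (psi0 v).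
Proof.
move=> Md Rv; have v0 : 0 < v 0 o0 by case: Rv.
apply/matrixP => i k; rewrite [LHS]mxE [RHS]mxE.
have [U [oU Uv CU]] := transition_smooth Md Rv k.
have dpsi j : derivable (fun y => psi0 y 0 j) v (ee i) by exact: dv_at (smooth_psi0 v0 j).
have [_ e] := chain oU (CU 1%N) Uv dpsi.
by rewrite partialE e; apply: eq_bigr => j _; rewrite mulrC ![jac _ _ _ _]mxE.
Qed.

Definition Hc (v : pt) : 'M[R]_m := h (rt v) c (tl v).
Definition gc (v : pt) : 'M[R]_(1 + m) :=
  block_mx ((4 * v 0 o0 ^+ 2)^-1)%:M 0 0 ((v 0 o0)^-1 *: Hc v).
(** The weight [s^(-1/2)], written so that it is nowhere zero and [V] is globally
    [wt * uc]. *)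
Definition wt (v : pt) : R := expR (- 2^-1 * ln (v 0 o0)).
Definition uc (v : pt) : R := (wt v)^-1 * V (Phi (rt v) (cinv c (tl v))).

Lemma Hc_posdef d v : cd d v -> posdef (Hc v).
Proof.
move=> [v0 [y [Dy Ey tv Dq]]]; have [_ _ hr _ _] := HS.
have tt : 0 <= rt v < delta by rewrite ltW ?rt_gt0.
have [_ pd] := hr _ tt; rewrite /Hc -Ey; apply: (pd c Nc).
by exists y.
Qed.

(** The metric identity of the special defining function, pulled back further by
    [psi0]. *)
Lemma gcE d v : atlas M d -> cd d v ->
  gc v = jac (psi d) v *m g d (psi d v) *m (jac (psi d) v)^T.
Proof.
move=> Md Rv; have [Cq Dq tq Eq Iq] := cd_point Rv.
have [_ _ _ _ met] := HS; have [v0 [y [Dy Ey tv Dq']]] := Rv.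
have t0 := rt_gt0 v0.
have tt : 0 < rt v < delta by rewrite t0.
have [_ _ inv _ _] := atlas_chart Nc.
have Eqy : Phi (rt v) (cinv c (tl v)) = Phi (rt v) y by rewrite -Ey inv.
have := met c d Nc Md (rt v) y tt Dy Dq'; cbv zeta; rewrite -Eqy Eq Ey.
set J := jac (transition C d) (psi0 v); set G := g d _ => mE.
have -> : g d (psi d v) = G by rewrite /G /psi /transition cinv_psi0.
rewrite (jac_psi Md Rv) -/J trmx_mul !mulmxA -(mulmxA _ J G) -(mulmxA _ (J *m G)) -mE jac_psi0 //.
apply: etrans (esym (block_conj _ _ _)).
rewrite /gc -(rt2 (ltW v0)) -/(Hc v); congr (block_mx (_%:M) 0 0 _).
by field; rewrite gt_eqF.
Qed.

Lemma gc_unit d v : cd d v -> gc v \in unitmx.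
Proof.
move=> Rv; have v0 : v 0 o0 != 0 by case: Rv => v0 _; rewrite gt_eqF.
apply: blk_unit; first by rewrite invr_neq0 // mulf_neq0 ?expf_neq0 ?pnatr_eq0.
by rewrite unitmxZ ?unitfE ?invr_neq0 //; exact: posdef_unit (Hc_posdef Rv).
Qed.

Lemma jac_psi_smooth d v : atlas M d -> cd d v -> mS v (jac (psi d)).
Proof.
move=> Md Rv i j; apply: (@smooth_eq _ _ v (partial i (fun y => psi d y 0 j))).
  by move=> w; rewrite mxE.
by apply: smooth_at_partial; exact: smooth_psi.
Qed.

Lemma g_smooth d z : atlas M d -> image_of (minterior M) d z -> forall i j, smooth_at (fun z => g d z i j) z.
Proof.
move=> Md Iz i j; have [[[_ Sg _] _] _ _ _] := HV.
exact: smooth_on_at (Sg d Md i j) Iz (open_nbhs_nbhs (conj (interior_image_open Md) Iz)).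
Qed.

Lemma V_smooth d z : atlas M d -> image_of (minterior M) d z -> smooth_at (fun z => V (cinv d z)) z.
Proof.
move=> Md Iz; have [_ SV _ _] := HV.
exact: smooth_on_at (SV d Md) Iz (open_nbhs_nbhs (conj (interior_image_open Md) Iz)).
Qed.

Lemma Hc_smooth d v : atlas M d -> cd d v -> mS v Hc.
Proof.
move=> Md Rv i j.
have SJ := jac_psi_smooth Md Rv.
have Sgp : mS v (fun w => g d (psi d w)).
  move=> a b; apply: (smooth_at_comp (f := fun z => g d z a b)); last exact: smooth_psi.
  by apply: g_smooth => //; exact: psi_interior.
have S := mSM (mSM SJ Sgp) (mS_tr SJ).
have := smooth_atM (smooth_s v) (S (rr i) (rr j)); apply: smooth_at_near.
apply: filterS (open_nbhs_nbhs (conj (cd_open Md) Rv)) => w Rw.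
have w0 : w 0 o0 != 0 by case: Rw => w0 _; rewrite gt_eqF.
by rewrite -(gcE Md Rw) /gc blkrr scalemxE mulVKf.
Qed.

Lemma wt_rt v : 0 < v 0 o0 -> (wt v)^-1 = rt v.
Proof. by move=> v0; rewrite /wt /rt /powR gt_eqF // -expRN mulNr opprK. Qed.

Lemma wt_pow v : 0 < v 0 o0 -> wt v = v 0 o0 `^ (- 2^-1).
Proof. by move=> v0; rewrite /wt /powR gt_eqF. Qed.

Lemma wt_smooth v : 0 < v 0 o0 -> smooth_at wt v.
Proof.
move=> v0; apply: smooth_at_near (smooth_powR (- 2^-1) v0).
by apply: filterS (smooth_pos (smooth_s v) v0) => w w0; rewrite wt_pow.
Qed.

Lemma wt_neq0 v : wt v != 0. Proof. by rewrite gt_eqF ?expR_gt0. Qed.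

Lemma uc_smooth d v : atlas M d -> cd d v -> smooth_at uc v.
Proof.
move=> Md Rv; have v0 : 0 < v 0 o0 by case: Rv.
apply: smooth_atM; first by apply: smooth_atV; [exact: wt_neq0|exact: wt_smooth].
have := smooth_at_comp (V_smooth Md (psi_interior Md Rv)) (smooth_psi Md Rv).
apply: smooth_at_near; apply: filterS (open_nbhs_nbhs (conj (cd_open Md) Rv)) => w Rw.
by rewrite cinv_psi.
Qed.

(** The static equations hold in any chart [d] of [M], are transported to the
    coordinates [(s, x)] by [static_gt], and are reduced there. *)
Lemma interior_static v : 0 < v 0 o0 -> rt v < delta -> image_of setT c (tl v) ->
  [/\ mS v Hc, smooth_at uc v & [/\ N0 Hc uc v = 0, NS Hc v = 0 & NE Hc uc v = 0]].
Proof.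
move=> v0 tv [y [Dy _] Ey].
have [d Md Dq] := atlas_cover (Phi (rt v) y).
have Rv : cd d v by split=> //; exists y.
split; [exact: Hc_smooth Rv|exact: uc_smooth Rv|].
have oU := interior_image_open Md; have oR := cd_open Md.
have [[[sg _ _] pd] _ Vpos eqs] := HV.
have CU k : Ck k (cd d) uc by apply: Ck_smooth_at => w; exact: uc_smooth.
have CH k : MC k (cd d) Hc by move=> i j; apply: Ck_smooth_at => w Rw; exact: Hc_smooth Rw i j.
have Cw k : Ck k (cd d) wt by apply: Ck_smooth_at => w [w0 _]; exact: wt_smooth.
have Cpsi k j : Ck k (cd d) (fun w => psi d w 0 j) by apply: Ck_smooth_at => w Rw; exact: smooth_psi.
have Cg k : MC k (image_of (minterior M) d) (g d).
  by move=> i j; apply: Ck_smooth_at => z Iz; exact: g_smooth.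
have CV k : Ck k (image_of (minterior M) d) (fun z => V (cinv d z)).
  by apply: Ck_smooth_at => z Iz; exact: V_smooth.
have Ju w : cd d w -> jac (psi d) w \in unitmx.
  by move=> Rw; have := gc_unit Rw; rewrite (gcE Md Rw) !unitmx_mul => /andP[/andP[]].
have st : static_at (g d) (fun z => V (cinv d z)) (psi d v) by exact: (eqs d Md _ (psi_interior Md Rv)).
have st2 := static_gt oU oR (fun w => psi_interior Md) Cpsi Cg (sg d Md)
  (fun z Iz => posdef_unit (pd d Md z Iz)) Ju (fun w => gcE Md) CV Rv st.
have st3 : static_at gc (fun w => wt w * uc w) v.
  apply: static_at_local oR Rv _ st2 => w Rw.
  by rewrite (cinv_psi Md Rw) /uc mulVKf // wt_neq0.
have pos w : cd d w -> 0 < w 0 o0 by case.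
have Hs w : cd d w -> (Hc w)^T = Hc w by move=> /Hc_posdef [].
have Hu w : cd d w -> Hc w \in unitmx by move=> /Hc_posdef /posdef_unit.
have u0 w : cd d w -> uc w != 0.
  move=> Rw; rewrite mulf_neq0 ?invr_neq0 ?wt_neq0 // gt_eqF //; apply: Vpos.
  by have [] := cd_point Rw.
have w0 w : cd d w -> wt w != 0 by move=> _; exact: wt_neq0.
have nw w : cd d w -> \forall y \near w, wt y = (y : pt) 0 o0 `^ (- 2^-1).
  by move=> /pos w1; apply: filterS (smooth_pos (smooth_s w) w1) => z; exact: wt_pow.
have w_0 w : cd d w -> partial o0 wt w = - (2^-1 * (w 0 o0)^-1 * wt w).
  move=> Rw; rewrite (partial_near o0 (nw w Rw)) partialE; have w1 := pos w Rw.
  have [_ ->] := is_derive_coord_fun o0 (is_derive_powR (- 2^-1) w1).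
  rewrite eqxx mul1r powR_pred // -(wt_pow w1); ring.
have w_r w i : cd d w -> partial (rr i) wt w = 0.
  move=> Rw; rewrite (partial_near (rr i) (nw w Rw)) partialE; have w1 := pos w Rw.
  have [_ ->] := is_derive_coord_fun (rr i) (is_derive_powR (- 2^-1) w1).
  by rewrite mul0r.
split.
- exact: (static_N0 oR pos CH Hs Hu (fun w _ => erefl) CU Cw u0 w0 w_0 Rv st3).
- exact: (static_NS oR pos CH Hs Hu (fun w _ => erefl) CU Cw u0 w0 w_0 Rv st3).
exact: (static_NE oR pos CH Hs Hu (fun w _ => erefl) CU Cw u0 w0 w_0 w_r Rv st3).
Qed.
End Collar.

(** * Expansion of the metric and of the potential *)

(** Local statements near the boundary hold uniformly over compact sets of boundary
    points. *)
Lemma compact_uniform (R : realType) m (D : set 'rV[R]_m) (P : R -> 'rV[R]_m -> Prop) :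
  compact D ->
  (forall x, D x -> exists2 r : R, 0 < r &
     forall (x' : 'rV[R]_m) t, (forall i, `|x 0 i - x' 0 i| < r) -> 0 < t < r -> P t x') ->
  exists2 eta : R, 0 < eta & forall t x, 0 < t < eta -> D x -> P t x.
Proof.
move=> /compact_near_coveringP cD H.
have : \forall t \near (0 : R)^'+, D `<=` P t.
  apply: cD => x /H [r r0 Hr].
  exists (ball x r, [set t | 0 < t < r]) => /=.
    split; first exact: nbhsx_ballx.
    apply/nbhs_ballP; exists r => //= t; rewrite /ball /= sub0r normrN => tr t0.
    by rewrite t0 /=; apply: le_lt_trans tr; exact: ler_norm.
  by move=> [x' t] /= [/ball_rVP [_ B] tr]; exact: Hr.
move=> /nbhs_ballP [eta /= eta0 B]; exists eta => // t x /andP[t0 te] Dx.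
by apply: (B t) => //; rewrite /ball /= sub0r normrN gtr0_norm.
Qed.

Section Emb.
Context {R : realType} {m : nat}.
Local Notation pt := 'rV[R]_(1 + m).

Definition emb (s : R) (x : 'rV[R]_m) : pt := row_mx (const_mx s) x.

Lemma emb0 s x : emb s x 0 o0 = s. Proof. by rewrite /emb -(lshift1 m 0) row_mxEl mxE. Qed.
Lemma embr s x j : emb s x 0 (rr j) = x 0 j. Proof. by rewrite /emb row_mxEr. Qed.
Lemma tl_emb s x : tl (emb s x) = x. Proof. exact: row_mxKr. Qed.
Lemma rt_emb t x : 0 < t -> rt (emb (t ^+ 2) x) = t.
Proof. by move=> t0; rewrite /rt emb0 -powR_mulrn ?(ltW t0) // -powRrM mulfV // powRr1 // ltW. Qed.

Lemma pi0_emb (v : pt) : pi0 v = emb 0 (tl v).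
Proof.
apply/rowP => j; rewrite pi0_coord; case: (@split_ordP 1 m j) => k ->.
  by rewrite lshift1 eqxx mulr0 emb0.
by rewrite embr mulr1 mxE.
Qed.

(** Expansions in even powers of [t]. Fixed linear combinations act on them, so that
    transformation laws pass from functions to coefficients. *)
Definition expo n (F : R -> R) (a : nat -> R) := exists C r : R, 0 < r /\
  forall t, 0 < t < r -> `|F t - \sum_(j < n) t ^+ (2 * j) * a j| <= C * (t ^+ m * t `^ 2^-1).

Lemma expoD n F F' a a' : expo n F a -> expo n F' a' -> expo n (fun t => F t + F' t) (fun j => a j + a' j).
Proof.
move=> [C [r [r0 H]]] [C' [r' [r'0 H']]]; exists (C + C'), (Num.min r r').
split=> [|t /andP[t0]]; first by rewrite lt_min r0.
rewrite lt_min => /andP[tr tr'].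
have -> : F t + F' t - \sum_(j < n) t ^+ (2 * j) * (a j + a' j) =
  (F t - \sum_(j < n) t ^+ (2 * j) * a j) + (F' t - \sum_(j < n) t ^+ (2 * j) * a' j).
  rewrite addrACA -opprD -big_split /=; congr (_ - _); apply: eq_bigr => j _; exact: mulrDr.
apply: le_trans (ler_normD _ _) _; rewrite mulrDl; apply: lerD; [apply: H|apply: H'];
  by rewrite t0.
Qed.

Lemma expoZ n c F a : expo n F a -> expo n (fun t => c * F t) (fun j => c * a j).
Proof.
move=> [C [r [r0 H]]]; exists (`|c| * C), r; split=> // t /H h.
have -> : c * F t - \sum_(j < n) t ^+ (2 * j) * (c * a j) = c * (F t - \sum_(j < n) t ^+ (2 * j) * a j).
  rewrite mulrBr mulr_sumr; congr (_ - _); apply: eq_bigr => j _; exact: mulrCA.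
by rewrite normrM -mulrA ler_wpM2l.
Qed.

Lemma expo_sum n (I : Type) (l : seq I) (F : I -> R -> R) (a : I -> nat -> R) :
  (forall i, expo n (F i) (a i)) ->
  expo n (fun t => \sum_(i <- l) F i t) (fun j => \sum_(i <- l) a i j).
Proof.
move=> H; elim: l => [|i l IH].
  exists 0, 1; split=> // t _; rewrite big_nil big1 ?subrr ?normr0 ?mul0r // => j _.
  by rewrite big_nil mulr0.
have [C [r [r0 HH]]] := expoD (H i) IH; exists C, r; split=> // t /HH.
rewrite big_cons; under [X in _ -> `|_ - X| <= _]eq_bigr do rewrite big_cons.
exact.
Qed.

(** The difference of two expansions is a polynomial of degree [n - 1] in [s = t^2]
    that is [O(s^(m/2 + 1/4))], and [n - 1 <= m/2]. *)
Lemma expo_inj n F F' a a' d : (2 * n <= m.+2)%N -> 0 < d -> (forall t, 0 < t < d -> F t = F' t) ->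
  expo n F a -> expo n F' a' -> forall j, (j < n)%N -> a j = a' j.
Proof.
move=> nm d0 FF' H /(expoZ (-1)) H'; have [C [r [r0 HH]]] := expoD H H'.
move=> j jn; apply/eqP; rewrite -subr_eq0; apply/eqP.
have top : n%:R - 1 < (2 * m%:R + 1) / 4 :> R.
  have : (2 * n)%:R <= m.+2%:R :> R by rewrite ler_nat.
  by rewrite natrM -[m.+2%:R]natr1 -[m.+1%:R]natr1; lra.
have r'0 : 0 < Num.min r d by rewrite lt_min r0.
apply: (@poly_vanish R n (fun j => a j - a' j) C _ (Num.min r d ^+ 2) _ top) jn; first by rewrite exprn_gt0.
move=> s /andP[s0 sr]; pose t := s `^ 2^-1.
have t0 : 0 < t by rewrite powR_gt0.
have ts : t ^+ 2 = s by rewrite /t -powR_mulrn ?powR_ge0 // -powRrM mulVf // powRr1 // ltW.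
have : t < Num.min r d by move: sr; rewrite -ts !expr2; nra.
rewrite lt_min => /andP[tr td].
have := HH t; rewrite t0 tr (FF' t) ?t0 // mulN1r addrN => /(_ isT).
rewrite sub0r normrN.
have -> : \sum_(j < n) t ^+ (2 * j) * (a j + -1 * a' j) = \sum_(j < n) s ^+ j * (a j - a' j).
  by apply: eq_bigr => i _; rewrite exprM ts mulN1r.
have -> // : t ^+ m * t `^ 2^-1 = s `^ ((2 * m%:R + 1) / 4).
rewrite -powR_mulrn ?(ltW t0) // -powR_add // /t -powRrM; congr (_ `^ _); lra.
Qed.

Lemma small_error (C e t : R) : 0 < e -> 0 < t < (e / (`|C| + 1)) ^+ 2 -> C * t `^ 2^-1 <= e.
Proof.
move=> e0 /andP[t0 te]; have c0 : 0 < `|C| + 1 by rewrite ltr_wpDl.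
have q0 : 0 < e / (`|C| + 1) by rewrite divr_gt0.
have h : t `^ 2^-1 <= e / (`|C| + 1).
  have := powR_gt0 2^-1 t0; have : (t `^ 2^-1) ^+ 2 = t.
    by rewrite -powR_mulrn ?powR_ge0 // -powRrM mulVf // powRr1 // ltW.
  by move: (t `^ 2^-1) (e / _) te q0 => x y; rewrite !expr2 => te q0 xt x0; nra.
apply: (@le_trans _ _ (`|C| * t `^ 2^-1)); first by rewrite ler_wpM2r ?powR_ge0 // ler_norm.
apply: (@le_trans _ _ (`|C| * (e / (`|C| + 1)))); first by rewrite ler_wpM2l.
by rewrite mulrCA ler_piMr ?(ltW e0) // ler_pdivrMr // mul1r lerDl.
Qed.

Lemma sum_shape (F : nat -> R) :
  F 0%N + \sum_(1 <= l < m.+1 | (2 * l <= m)%N) F l = \sum_(l < m./2.+1) F l.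
Proof.
rewrite big_ord_recl /=; congr (_ + _).
have -> : \sum_(1 <= l < m.+1 | (2 * l <= m)%N) F l = \sum_(1 <= l < m./2.+1) F l.
  rewrite (@big_nat_widen _ _ _ 1 m./2.+1 m.+1); last by lia.
  by apply: eq_bigl => l /=; lia.
by rewrite big_add1 big_mkord; apply: eq_bigr => i _; rewrite /bump /= add1n.
Qed.
End Emb.

Section Coefficients.
Context {R : realType} {m : nat} {N : boundaryless R m}.
Local Notation pt := 'rV[R]_(1 + m).
Variables (ghat : tensor2 N).
Hypothesis m0 : (0 < m)%N.
Hypothesis Hg : riemannian setT ghat.

Definition gh (c : chart R m N) (v : pt) : 'M[R]_m := ghat c (tl v).

(** The coefficient of [t^(2 j)] in a chart of [N]; it is an expression in [ghat]
    alone. *)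
Definition Acf (c : chart R m N) (j : nat) (x : 'rV[R]_m) : 'M[R]_m :=
  if j is 0 then ghat c x else aco (gh c) j (emb 0 x).
Definition Bcf (c : chart R m N) (j : nat) (x : 'rV[R]_m) : R :=
  if j is 0 then 1 else bco (gh c) j (emb 0 x).

Lemma gh_pi0 c v : gh c v = gh c (pi0 v).
Proof. by rewrite /gh tl_pi0. Qed.

Section Chart.
Variables (c : chart R m N) (x : 'rV[R]_m).
Hypotheses (Nc : atlas N c) (Ux : image_of setT c x).
Let p := emb 0 x.

Lemma image_open : open (image_of setT c).
Proof. exact: chart_image_open (atlas_chart Nc). Qed.

Lemma image_near : \forall y \near x, image_of setT c y.
Proof. exact: (open_nbhs_nbhs (conj image_open Ux)). Qed.

Lemma p_0 : p 0 o0 = 0. Proof. exact: emb0. Qed.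

Lemma gh_smooth : mS p (gh c).
Proof.
move=> i j; have [[_ Sg _] _] := Hg.
apply: (smooth_tl (f := fun x => ghat c x i j)); rewrite tl_emb.
exact: smooth_on_at (Sg c Nc i j) Ux image_near.
Qed.

Lemma gh_unit : gh c p \in unitmx.
Proof. by rewrite /gh tl_emb; apply: posdef_unit; apply: (proj2 Hg c Nc). Qed.

Lemma smooth_emb (f : pt -> R) : smooth_at f p -> smooth_at (fun x => f (emb 0 x)) x.
Proof.
move=> Sf; apply: smooth_at_comp => // j; case: (@split_ordP 1 m j) => k ->.
  rewrite lshift1 (_ : (fun y => emb 0 y 0 o0) = fun=> 0); first exact: smooth_at_cst.
  by apply/funext => y; rewrite emb0.
rewrite (_ : (fun y => emb 0 y 0 (rr k)) = fun y : 'rV[R]_m => y 0 k); first exact: smooth_at_coord.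
by apply/funext => y; rewrite embr.
Qed.

Lemma Acf_smooth j a b : smooth_at (fun x => Acf c j x a b) x.
Proof.
case: j => [|j] /=.
  by have [[_ Sg _] _] := Hg; exact: smooth_on_at (Sg c Nc a b) Ux image_near.
apply: (smooth_emb (f := fun v => aco (gh c) j.+1 v a b)).
by have [S _] := smooth_aco p_0 gh_smooth gh_unit (gh_pi0 c) j.+1.
Qed.

Lemma Bcf_smooth j : smooth_at (Bcf c j) x.
Proof.
case: j => [|j] /=; first exact: smooth_at_cst.
apply: (smooth_emb (f := bco (gh c) j.+1)).
by have [_ S] := smooth_aco p_0 gh_smooth gh_unit (gh_pi0 c) j.+1.
Qed.
End Chart.

Lemma formal_Acf c J t x : 
  (formal (gh c) J).1 (emb (t ^+ 2) x) = \sum_(j < J.+1) t ^+ (2 * j) *: Acf c j x /\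
  (formal (gh c) J).2 (emb (t ^+ 2) x) = \sum_(j < J.+1) t ^+ (2 * j) * Bcf c j x.
Proof.
have [-> ->] := formalE (gh c) J (emb (t ^+ 2) x).
have e (l : nat) : aco (gh c) l (emb (t ^+ 2) x) = aco (gh c) l (emb 0 x) /\
    bco (gh c) l (emb (t ^+ 2) x) = bco (gh c) l (emb 0 x).
  have [<- <-] := aco_pi0 (gh_pi0 c) l (emb (t ^+ 2) x).
  by rewrite pi0_emb tl_emb.
split; rewrite big_ord_recl /= muln0 expr0 ?scale1r ?mul1r.
  congr (_ + _); first by rewrite /gh tl_emb.
  rewrite big_add1 big_mkord; apply: eq_bigr => i _.
  by rewrite emb0 /bump /= add1n exprM (e i.+1).1.
congr (_ + _).
rewrite big_add1 big_mkord; apply: eq_bigr => i _.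
by rewrite emb0 /bump /= add1n exprM (e i.+1).2.
Qed.
End Coefficients.

Section Expansion.
Context {R : realType} {m : nat} {N : boundaryless R m}.
Local Notation pt := 'rV[R]_(1 + m).
Variables (ghat : tensor2 N).
Hypothesis m0 : (0 < m)%N.
Hypothesis Hg : riemannian setT ghat.
Let K := (4 * m + 3)%N.

(** The hypotheses on [(M, g, V)] near conformal infinity that determine the
    expansion. *)
Record static_end (M : with_boundary R m) (g : tensor2 M) (V : M -> R) (iota : N -> M)
  (delta : R) (Phi : R -> N -> M) (tau : M -> R) (pr : M -> N) (h : R -> tensor2 N) : Prop :=
  StaticEnd {
    end_static : static_vacuum (minterior M) g V;
    end_special : special_defining_function g iota ghat delta Phi tau pr h;
    end_growth : forall q, mboundary M q ->
       (fun p => tau p * V p) @ within (minterior M) (nbhs q) --> (1 : R);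
    end_regular : regular_at_infinity h K }.

Section Solution.
Context {M : with_boundary R m} {g : tensor2 M} {V : M -> R} {iota : N -> M}
  {delta : R} {Phi : R -> N -> M} {tau : M -> R} {pr : M -> N} {h : R -> tensor2 N}.
Hypothesis E : static_end g V iota delta Phi tau pr h.
Let HV := end_static E.
Let HS := end_special E.

Section InChart.
Variables (c : chart R m N).
Hypotheses (Nc : atlas N c).
Local Notation C := (collar_chart delta Phi tau pr c).

Lemma delta_gt0 : 0 < delta. Proof. by have [_ [d0 _ _ _] _ _ _] := HS. Qed.

Lemma h_limit x i j : image_of setT c x -> forall e, 0 < e ->
  exists2 d : R, 0 < d & forall t, 0 < t < d -> `|h t c x i j - ghat c x i j| < e.
Proof.
move=> Ux e e0; have [_ _ _ /(_ c Nc) [hc h0] _] := HS.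
have A0 : [set z : R * 'rV[R]_m | 0 <= z.1 < delta /\ image_of setT c z.2] (0, x).
  by split=> //=; rewrite lexx delta_gt0.
move/subspace_continuousP: hc => /(_ _ A0) cv.
have cvij : (fun z : R * 'rV[R]_m => h z.1 c z.2 i j) @ within
    [set z : R * 'rV[R]_m | 0 <= z.1 < delta /\ image_of setT c z.2] (nbhs (0, x)) --> h 0 c x i j.
  exact: (cvg_comp _ _ cv (@coord_continuous R m m i j (h 0 c x))).
move/cvgrPdist_lt: cvij => /(_ e e0) /nbhs_ballP [d /= d0 B].
exists (Num.min d delta); first by rewrite lt_min d0 delta_gt0.
move=> t /andP[t0]; rewrite lt_min => /andP[td tD].
rewrite -(h0 x Ux) distrC; apply: (B (t, x)).
  by split; [rewrite /ball /= sub0r normrN gtr0_norm|exact: ballxx].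
by split=> //=; rewrite ltW.
Qed.

(** As [t] tends to [0] the points [Phi t y] tend to a boundary point, where [tau V]
    has the limit [1]. *)
Lemma V_limit y : cdom c y -> forall e, 0 < e ->
  exists2 d : R, 0 < d & forall t, 0 < t < d -> `|t * V (Phi t y) - 1| < e.
Proof.
move=> Dy e e0; have [_ [d0 _ tp cc] _ _ _] := HS.
have tt0 : 0 <= (0 : R) < delta by rewrite lexx d0.
have [tau0 pr0] := tp 0 y tt0.
have bq : mboundary M (Phi 0 y).
  by move=> /(interior_tau HS); rewrite tau0 ltxx.
move/cvgrPdist_lt: (end_growth E bq) => /(_ e e0) nb.
have [ch _] := cc c Nc; have [_ _ inv _ cont] := ch.
have CD t : 0 <= t < delta -> cdom C (Phi t y) by move=> tt; exists t, y.
have Cm t : 0 <= t < delta -> cmap C (Phi t y) = emb t (cmap c y).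
  by move=> tt; have [e1 e2] := tp t y tt; rewrite /= e1 e2.
have A0 : (cmap C @` cdom C) (emb 0 (cmap c y)) by exists (Phi 0 y); [exact: CD|exact: Cm].
have e0q : cinv C (emb 0 (cmap c y)) = Phi 0 y by rewrite -(Cm 0 tt0) (inv _ (CD 0 tt0)).
rewrite -e0q in nb; move/subspace_continuousP: cont => /(_ _ A0) cont.
have /nbhs_ballP [d /= dp B] := cont _ nb.
exists (Num.min d delta); first by rewrite lt_min dp d0.
move=> t /andP[t0]; rewrite lt_min => /andP[td tD].
have tt : 0 <= t < delta by rewrite ltW.
have [taut prt] := tp t y tt.
have Pt : cinv C (emb t (cmap c y)) = Phi t y by rewrite -(Cm t tt) (inv _ (CD t tt)).
have B' : ball (emb 0 (cmap c y)) d (emb t (cmap c y)) -> (cmap C @` cdom C) (emb t (cmap c y)) ->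
  minterior M (cinv C (emb t (cmap c y))) ->
  `|1 - tau (cinv C (emb t (cmap c y))) * V (cinv C (emb t (cmap c y)))| < e := B (emb t (cmap c y)).
rewrite Pt taut distrC in B'; apply: B'.
- apply/ball_rVP; split=> // j; case: (@split_ordP 1 m j) => k ->.
    by rewrite lshift1 !emb0 sub0r normrN gtr0_norm.
  by rewrite !embr subrr normr0.
- by exists (Phi t y); [exact: CD|exact: Cm].
by apply: (tau_interior HS); rewrite taut.
Qed.

Variables (x : 'rV[R]_m).
Hypothesis Ux : image_of setT c x.
Let p := emb 0 x.
Let p0 : p 0 o0 = 0 := emb0 0 x.
Local Notation H := (Hc h c).
Local Notation u := (uc V Phi c).

Lemma interior_ev : ev p (fun v => rt v < delta /\ image_of setT c (tl v)).
Proof.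
have [r r0 [D [_ DU Dr]]] := closed_box (image_open Nc) Ux.
exists (Num.min r (delta ^+ 2)); first by rewrite lt_min r0 exprn_gt0 // delta_gt0.
move=> v hv; have /andP[v0] := hb_s p0 hv; rewrite lt_min => /andP[_ vd].
split.
  have t0 := rt_gt0 v0; have d0 := delta_gt0.
  by move: vd; rewrite -(rt2 (ltW v0)) !expr2; nra.
apply/DU/Dr => i; have [/ball_rVP [_ B] _] := hv; have := B (rr i).
rewrite /p embr [tl v 0 i]mxE => h1; apply: lt_le_trans h1 _; exact: min_lel.
Qed.

Lemma solution_eqs : [/\ forall i j, sm p (fun v => H v i j), sm p u &
  ev p (fun v => [/\ N0 H u v = 0, NS H v = 0 & NE H u v = 0])].
Proof.
have [r r0 I] := interior_ev.
have S v : hb p r v -> [/\ mS v H, smooth_at u v & [/\ N0 H u v = 0, NS H v = 0 & NE H u v = 0]].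
  move=> hv; have [td Uv] := I v hv; have /andP[v0 _] := hb_s p0 hv.
  exact: (interior_static HV HS Nc v0 td Uv).
split=> [i j||].
- by exists r => // k; apply: Ck_smooth_at => v /S [].
- by exists r => // k; apply: Ck_smooth_at => v /S [].
by exists r => // v /S [].
Qed.

(** Of the [4 m + 3] derivatives in the regularity assumption, [compare] consumes [4
    m], [asymp_data_lapse] one, and the Euler derivatives of the metric two. *)
Lemma chart_expansion :
  (forall i j, bO0 p ((2 * m%:R + 1) / 4) (fun v => H v i j - (formal (gh ghat c) m./2).1 v i j)) /\
  bO0 p ((2 * m%:R + 1) / 4) (fun v => u v - (formal (gh ghat c) m./2).2 v).
Proof.
have [sH su eqs] := solution_eqs.
have [P [a [Sa Ea]]] := end_regular E.
have Sg := gh_smooth Hg Nc Ux; have gu := gh_unit Hg Nc Ux.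
have reg i j := @regular_G R m p (fun t x => h t c x i j) (fun k l x => a k l c x i j)
  (fun x => ghat c x i j) (image_of setT c) K P p0 (image_open Nc).
have {}reg i j : [/\ G p (4 * m).+1 4^-1 (fun v => H v i j - gh ghat c v i j),
    G p (4 * m).+1 4^-1 (th (fun v => H v i j - gh ghat c v i j)) &
    G p (4 * m).+1 4^-1 (th (th (fun v => H v i j - gh ghat c v i j)))].
  have tlp : tl p = x := tl_emb 0 x.
  have Up : image_of setT c (tl p) by rewrite tlp.
  have K0 : (0 < K)%N by rewrite /K addn3.
  have Sa' k l : smooth_at (fun x => a k l c x i j) (tl p).
    by rewrite tlp; have [_ S _] := Sa k l; exact: smooth_on_at (S c Nc i j) Ux (image_near Nc Ux).
  have Sg' : smooth_at (fun x => ghat c x i j) (tl p).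
    by rewrite tlp; have [[_ S _] _] := Hg; exact: smooth_on_at (S c Nc i j) Ux (image_near Nc Ux).
  have rK : ((4 * m).+1.+2 <= K)%N by rewrite /K addn3.
  exact: (reg i j Up K0 Sa' Sg' (Ea c Nc i j) (fun y Uy => h_limit i j Uy) (sH i j) _ rK).
have thE i j : ev p (fun v => th (fun v => H v i j - gh ghat c v i j) v = Th H v i j).
  have sg := smooth_at_sm (Sg i j).
  apply: ev_mono (thB (sH i j) sg) => v _ ->.
  rewrite (th_pi0E (f := fun v => gh ghat c v i j)) ?subr0; first by rewrite mxE.
  by move=> w; rewrite -gh_pi0.
apply: (static_expansion p0 m0 Sg gu (gh_pi0 ghat c)) => //.
- move=> i j; have [h1 _ _] := reg i j; apply: G_eq h1.
  by apply: ev_true => v _; rewrite addmxE oppmxE.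
- by move=> i j; have [_ h1 _] := reg i j; apply: G_eq h1.
- move=> i j; have [_ _ h1] := reg i j; apply: G_eq h1.
  by apply: ev_mono (th_eq (thE i j)) => v _ ->; rewrite mxE.
have [r r0 I] := interior_ev.
exists r => // v hv e e0; have [_ [y [Dy _] Ey]] := I v hv.
have [d d0 Hd] := V_limit Dy e0.
exists (d ^+ 2); first by rewrite exprn_gt0.
move=> t /andP[t0 td].
have u0 : 0 < upd v t 0 o0 by rewrite upd0.
rewrite /uc tl_upd -Ey; have [_ _ inv _ _] := atlas_chart Nc; rewrite inv // wt_rt //.
apply: Hd; rewrite rt_gt0 //=.
have := rt2 (ltW u0); rewrite upd0; have := rt_gt0 u0; move: (rt (upd v t)) td => q.
by rewrite !expr2 => td q0 qt; nra.
Qed.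

Local Notation n := (m./2.+1).

Lemma local_expansion : exists C r : R, 0 < r /\
  forall (x' : 'rV[R]_m) t, (forall i, `|x 0 i - x' 0 i| < r) -> 0 < t < r ->
  (forall i j, `|h t c x' i j - \sum_(l < n) t ^+ (2 * l) * Acf ghat c l x' i j| <= C * (t ^+ m * t `^ 2^-1)) /\
  `|t * V (Phi t (cinv c x')) - \sum_(l < n) t ^+ (2 * l) * Bcf ghat c l x'| <= C * (t ^+ m * t `^ 2^-1).
Proof.
have [hH [Cu Hu]] := chart_expansion.
have [CH HH] := choice (fun ij : 'I_m * 'I_m => hH ij.1 ij.2).
have [r r0 HB] := ev_and (ev_all HH) Hu.
pose C0 := `|Cu| + \sum_ij `|CH ij|.
exists C0, (Num.min r 1); split; first by rewrite lt_min r0 ltr01.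
move=> x' t xx /andP[t0]; rewrite lt_min => /andP[tr t1].
have hv : hb p r (emb (t ^+ 2) x').
  apply: (ball_hb p0).
    by move=> i; rewrite !embr; apply: lt_le_trans (xx i) _; exact: min_lel.
  by rewrite emb0 exprn_gt0 //=; apply: le_lt_trans tr; rewrite expr2 ler_piMl // ltW.
have [B1 B2] := HB _ hv; have [F1 F2] := formal_Acf ghat c m./2 t x'.
have ts : (emb (t ^+ 2) x') 0 o0 `^ ((2 * m%:R + 1) / 4) = t ^+ m * t `^ 2^-1.
  rewrite emb0 -!powR_mulrn ?(ltW t0) // -powRrM -powR_add //; congr (_ `^ _); lra.
have e0 : 0 <= t ^+ m * t `^ 2^-1 by rewrite mulr_ge0 ?exprn_ge0 ?powR_ge0 // ltW.
split=> [i j|].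
  have := B1 (i, j); rewrite /= F1 ts /Hc rt_emb // tl_emb summxE => h1.
  under eq_bigr do rewrite -scalemxE.
  apply: le_trans h1 _; apply: ler_wpM2r => //; apply: le_trans (ler_norm _) _.
  apply: le_trans (_ : \sum_ij `|CH ij| <= _); last by rewrite lerDr.
  by rewrite (bigD1 (i, j)) //= lerDl sumr_ge0.
move: B2; rewrite F2 ts /uc wt_rt ?emb0 ?exprn_gt0 // rt_emb // tl_emb => h1.
apply: le_trans h1 _; apply: ler_wpM2r => //; apply: le_trans (ler_norm _) _.
by rewrite lerDl sumr_ge0.
Qed.

End InChart.

Local Notation n := (m./2.+1).

Lemma n_m : (2 * n <= m.+2)%N. Proof. by lia. Qed.

Lemma h_expo c x i j : atlas N c -> image_of setT c x ->
  expo (m := m) n (fun t => h t c x i j) (fun l => Acf ghat c l x i j).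
Proof.
move=> Nc Ux; have [C [r [r0 H]]] := local_expansion Nc Ux; exists C, r; split=> // t tt.
by have [|h1 _] := H x t _ tt; [move=> k; rewrite subrr normr0|exact: h1].
Qed.

Lemma V_expo c y : atlas N c -> cdom c y ->
  expo (m := m) n (fun t => t * V (Phi t y)) (fun l => Bcf ghat c l (cmap c y)).
Proof.
move=> Nc Dy; have Ux : image_of setT c (cmap c y) by exists y.
have [_ _ inv _ _] := atlas_chart Nc.
have [C [r [r0 H]]] := local_expansion Nc Ux; exists C, r; split=> // t tt.
by have [|_] := H (cmap c y) t _ tt; [move=> k; rewrite subrr normr0|rewrite inv].
Qed.

Lemma h_riem t : 0 < t < delta -> riemannian setT (h t).
Proof. by move=> /andP[t0 td]; have [_ _ hr _ _] := HS; apply: hr; rewrite ltW. Qed.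

Lemma Acf_sym c x l : atlas N c -> image_of setT c x -> (l < n)%N ->
  (Acf ghat c l x)^T = Acf ghat c l x.
Proof.
move=> Nc Ux ln; apply/matrixP => i j; rewrite mxE.
apply: (expo_inj n_m delta_gt0 _ (h_expo j i Nc Ux) (h_expo i j Nc Ux)) => // t /h_riem [[hs _ _] _].
by rewrite -[in LHS](hs c Nc x Ux) mxE.
Qed.

(** The metrics [h_t] satisfy this transformation law for all [t > 0], and so do the
    coefficients of their expansion. *)
Lemma Acf_tensor c d y l : atlas N c -> atlas N d -> cdom c y -> cdom d y -> (l < n)%N ->
  let J := jac (transition c d) (cmap c y) in
  Acf ghat c l (cmap c y) = J *m Acf ghat d l (cmap d y) *m J^T.
Proof.
move=> Nc Nd Dc Dd ln J.
have Uc : image_of setT c (cmap c y) by exists y.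
have Ud : image_of setT d (cmap d y) by exists y.
apply/matrixP => i k.
have e := expo_sum (index_enum _) (fun b => expoZ (J k b) (expo_sum (index_enum _)
  (fun a => expoZ (J i a) (h_expo a b Nd Ud)))).
have F (X : 'M[R]_m) : (J *m X *m J^T) i k = \sum_b J k b * \sum_a J i a * X a b.
  by rewrite mxE; apply: eq_bigr => b _; rewrite [J^T _ _]mxE mulrC; congr (_ * _); rewrite mxE.
rewrite F; apply: (expo_inj n_m delta_gt0 _ (h_expo i k Nc Uc) e) => // t /h_riem [[_ _ ht] _].
by rewrite -F (ht c d Nc Nd y I Dc Dd).
Qed.

Lemma Bcf_chart c d y l : atlas N c -> atlas N d -> cdom c y -> cdom d y -> (l < n)%N ->
  Bcf ghat c l (cmap c y) = Bcf ghat d l (cmap d y).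
Proof.
by move=> Nc Nd Dc Dd; apply: (expo_inj n_m delta_gt0 _ (V_expo Nc Dc) (V_expo Nd Dd)).
Qed.

Lemma h_asymp c i j : atlas N c ->
  asymp m 0 (image_of setT c) (fun t x => h t c x i j)
    (fun t x => \sum_(l < n) t ^+ (2 * l) * Acf ghat c l x i j).
Proof.
move=> Nc [|j'] [|i' s] // _ D cD DU e e0.
apply: (compact_uniform cD) => x /DU Ux.
have [C [r [r0 H]]] := local_expansion Nc Ux.
exists (Num.min r ((e / (`|C| + 1)) ^+ 2)).
  by rewrite lt_min r0 exprn_gt0 // divr_gt0 // ltr_wpDl.
move=> x' t xx /andP[t0]; rewrite lt_min => /andP[tr te].
have tt : 0 < t < r by rewrite t0.
have [|h1 _] := H x' t _ tt; first by move=> k; apply: lt_le_trans (xx k) (min_lel _ _).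
rewrite expr0 mul1r derive1n0 /=; apply: le_trans (h1 i j) _.
rewrite mulrCA mulrC ler_wpM2r ?exprn_ge0 ?(ltW t0) //.
by apply: small_error; rewrite ?t0.
Qed.

Lemma V_asymp c : (0 < m)%N -> atlas N c ->
  asymp m.-1 0 (image_of setT c) (fun t x => V (Phi t (cinv c x)))
    (fun t x => t^-1 * \sum_(l < n) t ^+ (2 * l) * Bcf ghat c l x).
Proof.
move=> mm Nc [|j'] [|i' s] // _ D cD DU e e0.
apply: (compact_uniform cD) => x /DU Ux.
have [C [r [r0 H]]] := local_expansion Nc Ux.
exists (Num.min r ((e / (`|C| + 1)) ^+ 2)).
  by rewrite lt_min r0 exprn_gt0 // divr_gt0 // ltr_wpDl.
move=> x' t xx /andP[t0]; rewrite lt_min => /andP[tr te].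
have tt : 0 < t < r by rewrite t0.
have [|_ h1] := H x' t _ tt; first by move=> k; apply: lt_le_trans (xx k) (min_lel _ _).
rewrite expr0 mul1r derive1n0 /=.
have tn : t != 0 by rewrite gt_eqF.
have -> : V (Phi t (cinv c x')) - t^-1 * \sum_(l < n) t ^+ (2 * l) * Bcf ghat c l x' =
  t^-1 * (t * V (Phi t (cinv c x')) - \sum_(l < n) t ^+ (2 * l) * Bcf ghat c l x').
  by rewrite mulrBr mulKf.
rewrite normrM gtr0_norm ?invr_gt0 // ler_pdivrMl //; apply: le_trans h1 _.
have -> : t * (e * t ^+ m.-1) = e * t ^+ m by rewrite mulrCA -exprS prednK.
rewrite mulrCA mulrC ler_wpM2r ?exprn_ge0 ?(ltW t0) //.
by apply: small_error; rewrite ?t0.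
Qed.
End Solution.
End Expansion.

Lemma smooth_at_on (R : realType) n (A : set 'rV[R]_n) f :
  (forall x, A x -> smooth_at f x) -> smooth_on A f.
Proof. by move=> Sf x /Sf [U [oU Ux CU]]; exists f, U. Qed.

Lemma smooth_on_ext (R : realType) n (A : set 'rV[R]_n) f f' :
  (forall x, A x -> f x = f' x) -> smooth_on A f -> smooth_on A f'.
Proof.
move=> E Sf x /Sf [F [U [oU Ux CU FE]]]; exists F, U; split=> // y Ay Uy.
by rewrite FE // E.
Qed.

Lemma sym_tensor0 (R : realType) m (N : boundaryless R m) S :
  sym_tensor S ((fun _ _ => 0) : tensor2 N).
Proof.
split=> [c _ x _|c _ i j|c d _ _ p _ _ _ J]; first by rewrite trmx0.
  apply: (@smooth_on_ext _ _ _ (fun=> 0)) => [x _|]; first by rewrite mxE.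
  by apply: smooth_at_on => x _; exact: smooth_at_cst.
by rewrite mulmx0 mul0mx.
Qed.

Theorem theorem1p11 (R : realType) (m : nat) (hm : (3 <= m.+1)%N) :
  exists K : nat,
  forall (N : boundaryless R m) (ghat : tensor2 N),
    compact [set: N] -> riemannian setT ghat ->
  exists (g2 : nat -> tensor2 N) (V1 : nat -> N -> R),
    (forall l, sym_tensor setT (g2 l)) /\
    (forall l, smooth_fun setT (V1 l)) /\
  forall (M : with_boundary R m) (g : tensor2 M) (V : M -> R)
    (iota : N -> M) (delta : R) (Phi : R -> N -> M)
    (tau : M -> R) (pr : M -> N) (h : R -> tensor2 N),
    static_vacuum (minterior M) g V ->
    asymptotically_hyperbolic (minterior M) g ->
    conformally_compact g ->
    conformal_infinity g iota ghat ->
    special_defining_function g iota ghat delta Phi tau pr h ->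
    (forall q, mboundary M q ->
       (fun p => tau p * V p) @ within (minterior M) (nbhs q) --> (1 : R)) ->
    regular_at_infinity h K ->
  (forall c, atlas N c -> forall i j : 'I_m,
     asymp m 0 (image_of setT c) (fun t x => h t c x i j)
       (fun t x => ghat c x i j +
          \sum_(1 <= l < m.+1 | (2 * l <= m)%N) t ^+ (2 * l) * g2 l c x i j)) /\
  (forall c, atlas N c ->
     asymp m.-1 0 (image_of setT c) (fun t x => V (Phi t (cinv c x)))
       (fun t x => t^-1 +
          \sum_(1 <= l < m.+1 | (2 * l <= m)%N)
             t ^+ (2 * l - 1) * V1 l (cinv c x))).
Proof.
have m0 : (0 < m)%N by lia.
exists (4 * m + 3)%N => N ghat _ Hg.
(* The local coefficients are expressions in [ghat], but that they fit together on [N] is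
   seen through a solution; if there is none, any coefficients will do. *)
have [[M0 [g0 [V0 [iota0 [delta0 [Phi0 [tau0 [pr0 [h0 E0]]]]]]]]]|none] :=
  pselect (exists (M : with_boundary R m) (g : tensor2 M) (V : M -> R)
    (iota : N -> M) (delta : R) (Phi : R -> N -> M)
    (tau : M -> R) (pr : M -> N) (h : R -> tensor2 N), static_end ghat g V iota delta Phi tau pr h);
  last first.
  exists (fun _ _ _ => 0), (fun _ _ => 0); split.
    by move=> l; exact: sym_tensor0.
  split=> [l c _|]; first by apply: smooth_at_on => x _; exact: smooth_at_cst.
  move=> M g V iota delta Phi tau pr h h1 _ _ _ h2 h3 h4; exfalso; apply: none.
  by exists M, g, V, iota, delta, Phi, tau, pr, h.
pose g2 l : tensor2 N := if (0 < l < m./2.+1)%N then (fun c x => Acf ghat c l x) else (fun _ _ => 0).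
have charts (y : N) : exists c : chart R m N, atlas N c /\ cdom c y.
  by have [c h1 h2] := atlas_cover y; exists c.
have [cc Hcc] := choice charts.
pose V1 l (y : N) := if (0 < l < m./2.+1)%N then Bcf ghat (cc y) l (cmap (cc y) y) else 0.
have V1E l c y : (0 < l < m./2.+1)%N -> atlas N c -> cdom c y -> V1 l y = Bcf ghat c l (cmap c y).
  move=> /[dup] ll /andP[l0 ln] Nc Dy; rewrite /V1 ll; have [h1 h2] := Hcc y.
  exact: (Bcf_chart m0 Hg E0 h1 Nc h2 Dy ln).
exists g2, V1; split.
  move=> l; rewrite /g2; case: ifP => [/andP[l0 ln]|_]; last exact: sym_tensor0.
  split=> [c Nc x Ux|c Nc i j|c d Nc Nd p _ Dc Dd J].
  - exact: (Acf_sym m0 Hg E0).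
  - by apply: smooth_at_on => x Ux; exact: (Acf_smooth Hg Nc Ux).
  exact: (Acf_tensor m0 Hg E0).
split=> [l c Nc|].
  have [_ _ inv _ _] := atlas_chart Nc.
  case ll : (0 < l < m./2.+1)%N; last first.
    apply: smooth_at_on => x _; rewrite /V1 ll; exact: smooth_at_cst.
  apply: (@smooth_on_ext _ _ _ (Bcf ghat c l)) => [x [y [Dy _] <-]|].
    by rewrite inv // (V1E l c).
  by apply: smooth_at_on => x Ux; exact: (Bcf_smooth Hg Nc Ux).
move=> M g V iota delta Phi tau pr h h1 _ _ _ h2 h3 h4.
have E : static_end ghat g V iota delta Phi tau pr h by [].
have ext q (U : set 'rV[R]_m) (f S S' : R -> 'rV[R]_m -> R) : (forall t x, 0 < t -> U x -> S t x = S' t x) ->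
    asymp q 0 U f S -> asymp q 0 U f S'.
  move=> SS H [|j'] [|i' s] // _ D cD DU e e0.
  have [eta eta0 He] := H 0%N [::] isT D cD DU e e0; exists eta => // t x /[dup] tt /andP[t0 _] Dx.
  by have := He t x tt Dx; rewrite !derive1n0 /= SS //; exact: DU.
split=> c Nc.
  move=> i j; apply: ext (h_asymp m0 Hg E i j Nc) => t x t0 Ux.
  rewrite -(sum_shape (fun l => t ^+ (2 * l) * Acf ghat c l x i j)) muln0 expr0 mul1r; congr (_ + _).
  rewrite big_nat_cond [RHS]big_nat_cond; apply: eq_bigr => l /andP[/andP[l0 _] lm].
  by rewrite /g2 l0 /= ifT //; lia.
apply: ext (V_asymp m0 Hg E m0 Nc) => t x t0 [y [Dy _] <-].
have [_ _ inv _ _] := atlas_chart Nc; rewrite inv //.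
rewrite -(sum_shape (fun l => t ^+ (2 * l) * Bcf ghat c l (cmap c y))) muln0 expr0 mul1r mulrDr mulr1.
congr (_ + _); rewrite mulr_sumr big_nat_cond [RHS]big_nat_cond; apply: eq_bigr => l /andP[/andP[l0 _] lm].
rewrite (V1E l c) //; last by rewrite l0 /=; lia.
have -> : (2 * l = (2 * l - 1).+1)%N by lia.
by rewrite exprS subSS subn0 mulrA mulKf // gt_eqF.
Qed.
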